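(* Let $X:\Omega\times\mathbb{R}^d\to\mathbb{R}$ be a centered, stationary Gaussian random field with variance $1$ and continuous sample paths. Let $u\in\mathbb{R}$, let $K\subset\mathbb{R}^d$ be a compact set, and let $C_{u,K}:=\{t\in K: X(t)=u\}$. Then the following are equivalent: (a) $\mathbb{E}\big(\mathcal{I}_{d-1}(C_{u,K})\big)<\infty$; (b) the second spectral moment matrix $\Lambda_2$ of $X$ is finite. In such a case, $$\mathbb{E}\big(\mathcal{I}_{d-1}(C_{u,K})\big)=\mathcal{L}_d(K)\,\mathcal{F}(\Lambda_2)\,e^{-u^2/2}.$$
   Context: $\mathcal{L}_d$ is Lebesgue measure on $\mathbb{R}^d$ and $\mathcal{H}_k$ is $k$-dimensional Hausdorff measure. Integral geometric measure: for a Borel set $B\subset\mathbb{R}^d$, $$\mathcal{I}_{d-1}(B):=c_{d-1}\int_{v\in S^{d-1}}\left(\int_{y\in v^\perp}\#\{B\cap \ell_{v,y}\}\,d\mathcal{H}_{d-1}(y)\right)dS^{d-1}(v)\in[0,+\infty],$$ where $S^{d-1}$ is the unit sphere of $\mathbb{R}^d$ and $dS^{d-1}$ is its induced Riemannian measure (counting measure on $\{-1,1\}$ if $d=1$), $v^\perp$ is the hyperplane orthogonal to $v$, $\ell_{v,y}:=\{y+tv: t\in\mathbb{R}\}$, $\#$ denotes the number of points (possibly $+\infty$), and $$c_{d-1}=\frac{\Gamma\left(\frac{d+1}{2}\right)}{2\pi^{(d-1)/2}}.$$ Spectral measure: $F$ is the symmetric probability measure on $\mathbb{R}^d$ such that $\mathbb{E}(X(s)X(t))=\int_{\mathbb{R}^d}\cos\langle\lambda,s-t\rangle\,dF(\lambda)$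 for all $s,t\in\mathbb{R}^d$. The second spectral moment matrix $\Lambda_2$ is defined by $(\Lambda_2)_{ij}:=\int_{\mathbb{R}^d}\lambda_i\lambda_j\,dF(\lambda)$. It may be finite or infinite: by convention it is called infinite if at least one entry is infinite, so that $\Lambda_2$ is finite exactly when $\int_{\mathbb{R}^d}\|\lambda\|^2\,dF(\lambda)<\infty$. When $\Lambda_2$ is finite, $$\mathcal{F}(\Lambda_2):=\frac{1}{(2\pi)^{(d+1)/2}}\int_{z\in\mathbb{R}^d}(z^\top\Lambda_2 z)^{1/2}e^{-\|z\|^2/2}\,d\mathcal{L}_d(z);$$ when $\Lambda_2$ is infinite, $\mathcal{F}(\Lambda_2):=+\infty$.
   Formalization: The implication from (a) to (b) is stated only for compact K of positive Lebesgue measure, since it fails for instance for empty K with infinite second spectral moment; (b) implies (a) and the formula are stated for every compact K. *)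

(* Defs.v *)
From HB Require Import structures.
From mathcomp Require Import all_boot all_order all_algebra.
From mathcomp Require Import all_classical all_reals all_analysis.

Set Implicit Arguments.
Unset Strict Implicit.
Unset Printing Implicit Defensive.

Import Order.TTheory GRing.Theory Num.Theory.
Import numFieldNormedType.Exports.

Local Open Scope classical_set_scope.
Local Open Scope ring_scope.

(* R^n is 'rV[R]_n with its Borel sigma-algebra.  The library topology on
   matrices comes from the sup norm; it is the Euclidean topology. *)
HB.instance Definition _ (R : realType) (m n : nat) :=
  @isMeasurable.Build (sigma_display (@open 'M[R]_(m, n))) 'M[R]_(m, n)
    <<s @open 'M[R]_(m, n) >> (@sigma_algebra0 _ setT _)
    (@sigma_algebraC _ _) (@sigma_algebra_bigcup _ setT _).

Section euclidean.
Context {R : realType} {n : nat}.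
Implicit Types x y : 'rV[R]_n.

Definition dot x y : R := \sum_i x 0 i * y 0 i.

(* `|x| is the sup norm in the library, hence a separate Euclidean norm. *)
Definition enorm x : R := Num.sqrt (dot x x).

End euclidean.

(* Lebesgue measure on R^n: the n-fold product of the one-dimensional Lebesgue
   measure, computed on Borel sets by iterated integration of sections; on
   R^0 it is the unit mass at the only point. *)
Fixpoint lebesgue_rV {R : realType} (n : nat) : set 'rV[R]_n -> \bar R :=
  match n with
  | 0 => fun A => \d_(0 : 'rV[R]_0) A
  | m.+1 => fun A : set 'rV[R]_(1 + m) =>
      (\int[lebesgue_measure]_(x in [set: R])
         lebesgue_rV [set y : 'rV[R]_m | A (row_mx x%:M y)])%E
  end.
Arguments lebesgue_rV {R} n _.

Section hausdorff.
Context {R : realType}.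
Local Open Scope ereal_scope.

Definition diam n (A : set 'rV[R]_n) : \bar R :=
  ereal_sup [set (enorm (x - y))%:E | x in A & y in A].

(* diam(A)^k, with value 0 for the empty set (also when k = 0) and
   diam(A)^0 = 1 for nonempty A, so that dimension 0 counts points. *)
Definition diam_pow k n (A : set 'rV[R]_n) : \bar R :=
  if A == set0 then 0 else diam A ^+ k.

Definition hausdorff_delta k (delta : R) n (A : set 'rV[R]_n) : \bar R :=
  ereal_inf [set \sum_(0 <= i <oo) diam_pow k (U i) |
    U in [set U : (set 'rV[R]_n)^nat |
            A `<=` \bigcup_i U i /\ forall i, diam (U i) <= delta%:E]].

Definition hausdorff_raw k n (A : set 'rV[R]_n) : \bar R :=
  ereal_sup [set hausdorff_delta k delta A |
    delta in [set delta : R | (0 < delta)%R]].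

Definition unit_cube k : set 'rV[R]_k :=
  [set x | forall i, (0 <= x ord0 i <= 1)%R].

(* k-dimensional Hausdorff measure in R^n, normalized in the usual way, i.e.
   so as to coincide with Lebesgue measure on R^k: the normalizing constant is
   fixed by giving measure 1 to the unit cube of R^k (whose unnormalized
   measure is positive and finite).  For k = 0 it is the counting measure. *)
Definition hausdorff k n (A : set 'rV[R]_n) : \bar R :=
  ((fine (hausdorff_raw k (@unit_cube k)))^-1)%:E * hausdorff_raw k A.

End hausdorff.

Section sphere.
Context {R : realType} {n : nat}.

Definition sphere : set 'rV[R]_n.+1 := [set v | enorm v = 1].

(* For s = 1 and s = -1, the parametrizations of the two open hemispheres of
   S^n in R^(n+1) as graphs over the open unit ball of R^n. *)
Definition sphere_chart (s : R) (y : 'rV[R]_n) : 'rV[R]_n.+1 :=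
  (row_mx (s * Num.sqrt (1 - dot y y))%:M y : 'rV[R]_(1 + n)).

Definition chart_partial (s : R) (y : 'rV[R]_n) (i : 'I_n) : 'rV[R]_n.+1 :=
  \row_j derive1 (fun t : R => sphere_chart s (y + t *: delta_mx 0 i) 0 j) 0.

(* The Riemannian metric induced by R^(n+1), in the chart. *)
Definition chart_metric (s : R) (y : 'rV[R]_n) : 'M[R]_n :=
  \matrix_(i, j) dot (chart_partial s y i) (chart_partial s y j).

(* The Riemannian measure of S^n, extended by 0 outside of S^n: the integral
   of the volume density sqrt(det g) in the two hemisphere charts, which cover
   S^n up to the equator, a null set.  For n = 0 the charts map the one-point
   space R^0 to 1 and to -1, with density 1: this is the counting measure. *)
Definition sphere_measure (A : set 'rV[R]_n.+1) : \bar R :=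
  (\sum_(s <- [:: 1%R; (-1)%R])
     \int[lebesgue_rV n]_(y in [set y | (enorm y < 1)%R /\
                                        A (sphere_chart s y)])
       (Num.sqrt (\det (chart_metric s y)))%:E)%E.

End sphere.

Definition Gamma {R : realType} (a : R) : R :=
  \int[lebesgue_measure]_(t in `]0, +oo[) (t `^ (a - 1) * expR (- t)).

(* c_(d-1) *)
Definition igm_const {R : realType} (d : nat) : R :=
  Gamma (d.+1%:R / 2) / (2 * pi `^ (d.-1%:R / 2)).

Section integral_geometric.
Context {R : realType} {n : nat}.

Definition orth_hyperplane (v : 'rV[R]_n.+1) : set 'rV[R]_n.+1 :=
  [set y | dot v y = 0].

Definition line (v y : 'rV[R]_n.+1) : set 'rV[R]_n.+1 :=
  [set y + t *: v | t in [set: R]].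

(* Integral geometric measure I_(d-1) in R^d, with d = n + 1. *)
Definition integral_geometric_measure (B : set 'rV[R]_n.+1) : \bar R :=
  ((igm_const n.+1)%:E *
   \int[sphere_measure]_(v in sphere)
     \int[hausdorff n (n := n.+1)]_(y in orth_hyperplane v)
       counting (B `&` line v y))%E.

End integral_geometric.

Section random_field.
Context {R : realType} {n : nat} {dO : measure_display}
  {Omega : measurableType dO} {P : probability Omega R}.
Implicit Types X : 'rV[R]_n -> {RV P >-> R}.

(* Degenerate laws are Gaussian; they are treated apart because the library's
   normal_prob m 0 is not the point mass at m. *)
Definition gaussian_law (mu : set R -> \bar R) : Prop :=
  exists m s : R,
    forall A, measurable A ->
      mu A = if s == 0 then \d_m A else normal_prob m s A.

Definition gaussian_field X : Prop :=
  forall (k : nat) (t : 'I_k -> 'rV[R]_n) (a : 'I_k -> R),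
    gaussian_law (pushforward P (fun w => \sum_i a i * X (t i) w)).

Definition centered_field X : Prop := forall t, ('E_P[X t] = 0)%E.

Definition unit_variance X : Prop := forall t, ('V_P[X t] = 1)%E.

Definition stationary_field X : Prop :=
  forall (k : nat) (t : 'I_k -> 'rV[R]_n) (h : 'rV[R]_n) (A : set 'rV[R]_k),
    measurable A ->
    P [set w | A (\row_i X (t i + h) w)] = P [set w | A (\row_i X (t i) w)].

Definition continuous_paths X : Prop := forall w, continuous (X ^~ w).

Definition spectral_measure X (F : probability 'rV[R]_n R) : Prop :=
  (forall A : set 'rV[R]_n, measurable A -> F [set l | A (- l)] = F A) /\
  forall s t, ('E_P[fun w => X s w * X t w]%R =
    \int[F]_l (cos (dot l (s - t)))%:E)%E.

Definition level_set X (u : R) (K : set 'rV[R]_n) (w : Omega) : set 'rV[R]_n :=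
  [set t | K t /\ X t w = u].

End random_field.

Section spectral_moment.
Context {R : realType} {n : nat}.

(* The entries may be infinite.  An off-diagonal integral can be undefined (it
   then has a conventional infinite value), but only if a diagonal entry is
   infinite. *)
Definition spectral_moment2 (F : probability 'rV[R]_n R) : 'M[\bar R]_n :=
  \matrix_(i, j) (\int[F]_l (l 0 i * l 0 j)%:E)%E.

Definition finite_mx (L : 'M[\bar R]_n) : bool :=
  [forall i, forall j, L i j \is a fin_num].

Definition calF (L : 'M[\bar R]_n) : \bar R :=
  (if finite_mx L then
     ((2 * pi) `^ (- (n.+1%:R / 2)))%:E *
     \int[lebesgue_rV n]_z
       (Num.sqrt ((z *m map_mx fine L *m z^T) 0 0) *
        expR (- (enorm z ^+ 2 / 2)))%:E
   else +oo)%E.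

End spectral_moment.

(* Main.v *)
(** For a unit vector [v], Rice's formula on a line of direction [v] gives
    [sqrt(l2(v)) / pi * exp(-u^2/2)] zeros of [X - u] per unit length, where
    [l2(v)] is the integral of [<l, v>^2] against [F].  Integrating over the
    parallel lines and over [v], and writing the integral of [sqrt(l2)] over the
    sphere in polar coordinates, yields the formula.

    No smoothness is assumed, so Rice's formula is obtained from dyadic
    discretizations: the number of sign changes of [X - a] along the dyadic
    points of level [m] increases with [m], and its mean is [2^m] times the
    probability that [X - a] has opposite signs at two points at distance
    [2^-m].  That probability is explicit, the sum and the difference of the two
    values being independent Gaussian variables, and the mean converges to the
    rate, finite or not.  Sign changes at level [u] bound the number of zeros
    from below; sign changes at the levels [u - e] and [u + e] together bound it
    twice from above, in the limit [e -> 0].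

    When the second moments are infinite, [l2] is infinite off a proper subspace,
    and the lower bound on each line forces an infinite mean. *)

Require Import Defs.
From HB Require Import structures.
From mathcomp Require Import all_boot all_order all_algebra.
From mathcomp Require Import all_classical all_reals all_analysis.
From mathcomp Require Import measurable_realfun.
From mathcomp Require Import ring lra.

Set Implicit Arguments.
Unset Strict Implicit.
Unset Printing Implicit Defensive.

Import Order.TTheory GRing.Theory Num.Theory.
Import numFieldNormedType.Exports.

Local Open Scope classical_set_scope.
Local Open Scope ring_scope.

(** * Lebesgue measure on Euclidean space *)

Section borel_rV.
Context {R : realType}.

(** Three obstacles shape the proof. [hausdorff] and [sphere_measure] are bare set functions, so
    integrals against them must be turned into integrals against the product measure [leb]: the
    full-dimensional Hausdorff measure is compared with [leb] on dyadic cubes, and its invariance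
    under isometries carries the result to every hyperplane, through a reflection that depends
    measurably on [v]. The crossing probability involves the joint law of two values of [X], while
    Gaussianity is given for real linear combinations only: a Cramer-Wold argument is carried out by
    hand, with integrals of [1 + cos] in place of characteristic functions and a Gaussian smoothing
    to invert them. Finally, a line meets [K] in an arbitrary compact set of times, on which dyadic
    points say nothing: zeros at such times are compared with zeros in an interval by averaging over
    shifts, which stationarity allows. The constant [igm_const] fits because [calF] is a Gaussian
    integral of a function homogeneous of degree one, whose radial part is a value of [Gamma]. *)

Lemma open_measurable_rV m n (U : set 'M[R]_(m, n)) : open U -> measurable U.
Proof. by move=> oU; apply: sub_sigma_algebra. Qed.

Lemma continuous_measurable_M m n (f : 'M[R]_(m, n) -> R) :
  continuous f -> measurable_fun setT f.
Proof.
move=> /continuousP cf; apply: (measurability _ (RGenOpens.measurableE R)).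
move=> _ [_ [a [b ->] <-]]; rewrite setTI; apply: open_measurable_rV.
exact/cf/interval_open.
Qed.

Lemma measurable_rV_coord n (i : 'I_n) :
  measurable_fun setT (fun x : 'rV[R]_n => x 0 i).
Proof. by apply: continuous_measurable_M => x; exact: coord_continuous. Qed.

Definition rat_box n (p : 'rV[rat]_n * nat) : set 'rV[R]_n :=
  [set x | forall i, `|x 0 i - ratr (p.1 0 i)| < p.2.+1%:R^-1].

(** The boxes are indexed by a countable type, so that measurability of a map into R^n can be tested
    on boxes, that is, on coordinates. *)
Lemma open_bigcup_rat_box n (U : set 'rV[R]_n) : open U ->
  U = \bigcup_(p in [set p | rat_box p `<=` U]) rat_box p.
Proof.
move=> oU; apply/seteqP; split; last by move=> x [p /= pU px]; exact: pU.
move=> x Ux.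
have /nbhs_ballP[e/= e0 xeU] : nbhs x U by exact: open_nbhs_nbhs.
(* Half of [e], because both [x] and the points [y] of the box are only known to be within
   [k.+1%:R^-1] of its centre. *)
have [k ke] : exists k, k.+1%:R^-1 < e / 2 :> R.
  exists (Num.truncn (e / 2)^-1).
  rewrite invf_plt ?posrE ?divr_gt0//.
  by rewrite -truncn_lt_nat ?ltnS// invr_ge0 divr_ge0// ltW.
have qP i : exists q : rat, `|x 0 i - ratr q| < k.+1%:R^-1.
  have /rat_in_itvoo[q] : x 0 i - k.+1%:R^-1 < x 0 i + k.+1%:R^-1.
    by rewrite ltrBlDr -addrA ltrDl addr_gt0.
  rewrite in_itv/= => /andP[q1 q2]; exists q.
  move: (ratr q : R) (x 0 i) (k.+1%:R^-1 : R) q1 q2 => a b c q1 q2.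
  by rewrite ltr_norml; apply/andP; split; lra.
exists (\row_i sval (cid (qP i)), k) => /=; last first.
  by move=> i; rewrite mxE; case: cid.
move=> y xy; apply: xeU; split => // i j; rewrite ord1 /ball/=.
have := xy j; rewrite mxE; case: cid => q/= qx yq.
rewrite (_ : x 0 j - y 0 j = (x 0 j - ratr q) - (y 0 j - ratr q)); last by ring.
rewrite (le_lt_trans (ler_normB _ _))//.
by rewrite (lt_trans (ltrD qx yq))// [ltRHS](splitr e) ltrD.
Qed.

Lemma measurable_fun_rV d (T : measurableType d) (D : set T) n
    (f : T -> 'rV[R]_n) :
  (forall i, measurable_fun D (fun t => f t 0 i)) -> measurable_fun D f.
Proof.
move=> mf mD; apply: (@measurability _ _ _ _ D f (@open 'rV[R]_n)) => //.
move=> _ [U oU <-]; rewrite (open_bigcup_rat_box oU) preimage_bigcup.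
rewrite setI_bigcupr bigcup_mkcond.
apply: countable_bigcupT_measurable; first exact: countableP.
move=> p; case: ifPn => // _.
have -> : D `&` f @^-1` rat_box p =
    D `&` \bigcap_(i in [set: 'I_n])
      (D `&` (fun t => f t 0 i) @^-1` [set y | `|y - ratr (p.1 0 i)| < p.2.+1%:R^-1]).
  apply/seteqP; split => [t [Dt fp]|t [Dt fp]]; split => // i.
    by move=> _; split => //; exact: fp.
  by have [] := fp i Logic.I.
apply: measurableI => //; apply: fin_bigcap_measurable => // i _.
apply: mf => //; apply: open_measurable.
rewrite (_ : [set _ | _] = ball (ratr (p.1 0 i) : R) (p.2.+1%:R^-1)).
  exact: ball_open.
by apply/seteqP; split => y; rewrite /ball/= distrC.
Qed.

Lemma measurable_row_mx n :
  measurable_fun setT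
    (fun p : measurableTypeR R * 'rV[R]_n => row_mx p.1%:M p.2 : 'rV[R]_(1 + n)).
Proof.
apply: measurable_fun_rV => i; rewrite -(splitK i).
case: (fintype.split i) => j /=.
  rewrite (_ : (fun _ => _) = fst)//; apply/funext => p.
  by rewrite row_mxEl mxE !ord1 eqxx mulr1n.
under eq_fun do rewrite row_mxEr.
exact: (measurableT_comp (measurable_rV_coord j) measurable_snd).
Qed.

End borel_rV.

Section mpush.
Context d d' (T1 : measurableType d) (T2 : measurableType d') (R : realType).
Variables (m : {measure set T1 -> \bar R}) (f : T1 -> T2).
Hypothesis mf : measurable_fun [set: T1] f.

Definition mpush : {measure set T2 -> \bar R} :=
  measure_function_pushforward__canonical__measure_function_Measure m mf.

Lemma mpushE A : mpush A = m (f @^-1` A). Proof. by []. Qed.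

Lemma ge0_integral_mpush (h : T2 -> \bar R) :
  measurable_fun [set: T2] h -> (forall y, (0 <= h y)%E) ->
  (\int[mpush]_y h y = \int[m]_x h (f x))%E.
Proof. by move=> mh h0; rewrite (ge0_integral_pushforward mf). Qed.

End mpush.

Section product_sigma_finite.
Context d d' (T1 : measurableType d) (T2 : measurableType d') (R : realType).
Variables (m1 : {sigma_finite_measure set T1 -> \bar R})
  (m2 : {sigma_finite_measure set T2 -> \bar R}).

(** A named copy of the product measure, made to carry the sigma-finite structure, so that Fubini's
    theorem applies again to products with it. *)
Definition prodm : set (T1 * T2) -> \bar R := (m1 \x m2)%E.
HB.instance Definition _ := Measure.on prodm.

Lemma prodm_sigma_finite : sigma_finite setT prodm.
Proof.
have /sigma_finiteP[F [FT ndF mF]] := sigma_finiteT m1.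
have /sigma_finiteP[G [GT ndG mG]] := sigma_finiteT m2.
exists (fun n => F n `*` G n); last first.
  move=> i; have [[mFi Fi] [mGi Gi]] := (mF i, mG i).
  split; first exact: measurableX.
  by rewrite /prodm product_measure1E// lte_mul_pinfty// ge0_fin_numE.
apply/esym/seteqP; split => // -[x y] _.
have [i _ Fx] : (\bigcup_i F i) x by rewrite -FT.
have [j _ Gy] : (\bigcup_i G i) y by rewrite -GT.
exists (maxn i j) => //; split => /=.
  by apply: (subsetPset _ _ (ndF _ _ (leq_maxl i j))).
by apply: (subsetPset _ _ (ndG _ _ (leq_maxr i j))).
Qed.

HB.instance Definition _ :=
  @Measure_isSigmaFinite.Build _ _ _ prodm prodm_sigma_finite.

End product_sigma_finite.

Section lebesgue_cons.
Context {R : realType} {n : nat}.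

Definition rV_cons (p : measurableTypeR R * 'rV[R]_n) : 'rV[R]_(1 + n) :=
  row_mx p.1%:M p.2.

Variable m : {sigma_finite_measure set 'rV[R]_n -> \bar R}.

(** Image of the product measure under prepending a coordinate. Sigma-finiteness is carried along
    since each step of the recursion on the dimension needs it. *)
Definition cons_measure : set 'rV[R]_(1 + n) -> \bar R :=
  mpush (lebesgue_measure \x m)%E (@measurable_row_mx R n).
HB.instance Definition _ := Measure.on cons_measure.

Lemma cons_measure_sigma_finite : sigma_finite setT cons_measure.
Proof.
have [F FT mF] := prodm_sigma_finite (@lebesgue_measure R) m.
pose g (y : 'rV[R]_(1 + n)) : measurableTypeR R * 'rV[R]_n := (y 0 (lshift n 0), rsubmx y).
have mg : measurable_fun [set: 'rV[R]_(1 + n)] g.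
  apply/measurable_fun_pairP; split.
    exact: measurable_rV_coord.
  apply: measurable_fun_rV => i.
  under eq_fun do rewrite /= mxE.
  exact: measurable_rV_coord.
exists (fun i => g @^-1` F i); first by rewrite -preimage_bigcup -FT preimage_setT.
move=> i; split; first by rewrite -[X in measurable X]setTI; apply: mg => //; have [] := mF i.
rewrite /cons_measure mpushE.
rewrite (_ : _ @^-1` _ = F i); first by have [] := mF i.
apply/seteqP; split => -[x y]; rewrite /preimage/= /g row_mxEl row_mxKr mxE eqxx mulr1n//.
Qed.

HB.instance Definition _ := @Measure_isSigmaFinite.Build _ _ _ cons_measure cons_measure_sigma_finite.

Definition cons_leb : {sigma_finite_measure set 'rV[R]_(1 + n) -> \bar R} := cons_measure.
End lebesgue_cons.

Section lebesgue_measure_rV.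
Context {R : realType}.

(** The bundled measure behind the set function [lebesgue_rV]; [lebesgue_rVE] identifies the two on
    Borel sets, which is all that an integral sees. *)
Fixpoint leb n : {sigma_finite_measure set 'rV[R]_n -> \bar R} :=
  match n with
  | 0 => \d_(0 : 'rV[R]_0)
  | m.+1 => cons_leb (leb m)
  end.

Lemma lebesgue_rVE n (A : set 'rV[R]_n) : measurable A ->
  lebesgue_rV n A = leb n A.
Proof.
elim: n A => [//|n ih] A mA /=.
apply: eq_integral => x _; rewrite ih//=.
  by congr (leb n _); apply/funext => y; rewrite /xsection/= inE.
rewrite (_ : [set y | _] = xsection (@rV_cons R n @^-1` A) x); last first.
  by apply/seteqP; split => y; rewrite /xsection/= inE.
apply: measurable_xsection; rewrite -[X in measurable X]setTI.
exact: measurable_row_mx.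
Qed.

(** The space has a single point: every preimage is empty or full, hence measurable, and [f] can be
    arbitrary. *)
Lemma integral_leb0 (f : 'rV[R]_0 -> \bar R) :
  (\int[leb 0]_x f x)%E = f 0.
Proof.
rewrite integral_dirac// ?diracT ?mul1e//.
move=> _ B mB; rewrite setTI.
have [f0|f0] := pselect (B (f 0)).
  rewrite (_ : _ @^-1` _ = setT)//; apply/seteqP; split => // x _ /=.
  by rewrite (_ : x = 0)//; apply/matrixP => i [].
rewrite (_ : _ @^-1` _ = set0)//; apply/seteqP; split => // x /= .
by rewrite (_ : x = 0)//; apply/matrixP => i [].
Qed.

Lemma integral_lebS n (f : 'rV[R]_(1 + n) -> \bar R) :
  measurable_fun [set: 'rV[R]_(1 + n)] f -> (forall y, (0 <= f y)%E) ->
  (\int[leb n.+1]_x f x =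
   \int[lebesgue_measure]_x \int[leb n]_y f (row_mx x%:M y : 'rV[R]_(1 + n)))%E.
Proof.
move=> mf f0; rewrite [LHS]ge0_integral_mpush//; last exact: measurable_row_mx.
rewrite (fubini_tonelli1 (fun p : measurableTypeR R * 'rV[R]_n => f (row_mx p.1%:M p.2)))//.
exact: (measurableT_comp mf (@measurable_row_mx R n)).
Qed.

End lebesgue_measure_rV.

Section eq_set_function_integral.
Context d (T : measurableType d) (R : realType).
Local Open Scope ereal_scope.
Import HBNNSimple.

(* Unlike [eq_measure_integral], the set functions need not be measures: the
   integral only evaluates them on the level sets of simple functions. *)
Lemma eq_set_function_integral (m1 m2 : set T -> \bar R) D (f : T -> \bar R) :
  (forall A, measurable A -> A `<=` D -> m1 A = m2 A) ->
  \int[m1]_(x in D) f x = \int[m2]_(x in D) f x.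
Proof.
move=> m12; rewrite /integral funepos_restrict funeneg_restrict.
have E (g : T -> \bar R) (h : {nnsfun T >-> R}) :
    (forall x, (h x)%:E <= (g \_ D) x) -> sintegral m1 h = sintegral m2 h.
  move=> hg; apply: eq_fsbigr => r _.
  have [->|r0] := eqVneq r 0%R; first by rewrite !mul0e.
  rewrite m12// => x /= hx; apply: contrapT => Dx.
  have := hg x; rewrite /patch memNset// hx lee_fin => r_le0.
  by move: r0; rewrite eq_le r_le0 -hx fun_ge0.
by congr (ereal_sup _ - ereal_sup _); apply: eq_imagel => h; exact: E.
Qed.

End eq_set_function_integral.

Lemma integral_lebesgue_rV (R : realType) n D (f : 'rV[R]_n -> \bar R) :
  (\int[lebesgue_rV n]_(x in D) f x = \int[leb n]_(x in D) f x)%E.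
Proof. by apply: eq_set_function_integral => A mA _; exact: lebesgue_rVE. Qed.

Opaque leb.

Section lebesgue_affine.
Context {R : realType}.
Local Notation mu := (@lebesgue_measure R).

Lemma lebesgue_measure_oc (a b : R) :
  mu `]a, b]%classic = if a < b then (b - a)%:E else 0%E.
Proof. by rewrite lebesgue_measure_itv/= lte_fin EFinB. Qed.

(** The image of [mu] gives half-open intervals their length, which characterizes Lebesgue measure.
    Dilations and the reflection are treated in the same way. *)
Lemma ge0_integral_shift1 (a : R) (f : R -> \bar R) :
  measurable_fun [set: R] f -> (forall x, (0 <= f x)%E) ->
  (\int[mu]_x f (x + a)%R = \int[mu]_x f x)%E.
Proof.
move=> mf f0.
have ma : measurable_fun [set: measurableTypeR R] (fun x : measurableTypeR R => (x + a)%R : measurableTypeR R).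
  exact: measurable_funD.
rewrite -(ge0_integral_mpush _ ma)//.
apply: eq_measure_integral => A mA _; apply/esym.
apply: (lebesgue_measure_unique (mu := mpush mu ma)) => // _ [[b c] _ <-].
have -> : mpush mu ma `](b, c).1, (b, c).2]%classic = mu `]b - a, c - a]%classic.
  rewrite mpushE; congr (mu _).
  by apply/seteqP; split => x /=; rewrite !in_itv/= ltrBlDr lerBrDr.
rewrite !lebesgue_measure_oc ltrD2r.
by rewrite (_ : c - a - (b - a) = c - b)//; ring.
Qed.

Lemma ge0_integral_scale1 (r : R) (f : R -> \bar R) : 0 < r ->
  measurable_fun [set: R] f -> (forall x, (0 <= f x)%E) ->
  (\int[mu]_x f (r * x)%R = (r^-1)%:E * \int[mu]_x f x)%E.
Proof.
move=> r0 mf f0.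
have ma : measurable_fun [set: measurableTypeR R] (fun x : measurableTypeR R => (r * x)%R : measurableTypeR R).
  exact: measurable_funM.
have E : (\int[mu]_x f x = r%:E * \int[mpush mu ma]_x f x)%E.
  rewrite -(ge0_integral_mscale _ measurableT (NngNum (ltW r0)))//.
  apply: eq_measure_integral => A mA _.
  apply: (lebesgue_measure_unique (mu := mscale (NngNum (ltW r0)) (mpush mu ma))) => // _ [[b c] _ <-].
  change (mu `]b, c]%classic = r%:E * mpush mu ma `](b, c).1, (b, c).2]%classic)%E.
  have -> : mpush mu ma `](b, c).1, (b, c).2]%classic = mu `]b / r, c / r]%classic.
    rewrite mpushE; congr (mu _).
    by apply/seteqP; split => x /=; rewrite !in_itv/= ltr_pdivrMr// ler_pdivlMr// [x * r]mulrC.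
  rewrite !lebesgue_measure_oc ltr_pM2r ?invr_gt0//.
  case: ifPn => _; last by rewrite mule0.
  by rewrite -EFinM; congr EFin; field; rewrite gt_eqF.
by rewrite E muleA -EFinM mulVf ?gt_eqF// mul1e ge0_integral_mpush.
Qed.

Lemma measurable_row_mxr n (x : R) : measurable_fun [set: 'rV[R]_n] (fun y : 'rV[R]_n => row_mx x%:M y : 'rV[R]_(1 + n)).
Proof.
apply: (measurableT_comp (@measurable_row_mx R n) (g := fun y => (x, y))).
exact: measurable_pair1.
Qed.

Lemma measurable_shift n (a : 'rV[R]_n) : measurable_fun [set: 'rV[R]_n] (fun x => x + a).
Proof.
apply: measurable_fun_rV => i; under eq_fun do rewrite mxE.
by apply: measurable_funD => //; exact: measurable_rV_coord.
Qed.

Lemma measurable_scale n (r : R) : measurable_fun [set: 'rV[R]_n] (fun x => r *: x).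
Proof.
apply: measurable_fun_rV => i; under eq_fun do rewrite mxE.
by apply: measurable_funM => //; exact: measurable_rV_coord.
Qed.

Lemma rV_decomp n (a : 'rV[R]_(1 + n)) : a = row_mx (a 0 0)%:M (rsubmx a).
Proof. by rewrite -[LHS]hsubmxK [lsubmx a]mx11_scalar mxE (_ : lshift n 0 = 0)//; apply/val_inj. Qed.

Lemma measurable_int_row n (f : 'rV[R]_(1 + n) -> \bar R) :
  measurable_fun [set: 'rV[R]_(1 + n)] f -> (forall y, (0 <= f y)%E) ->
  measurable_fun [set: R] (fun x : R => \int[leb n]_y f (row_mx x%:M y : 'rV[R]_(1 + n)))%E.
Proof.
move=> mf f0.
apply: (@measurable_fun_fubini_tonelli_F _ _ (measurableTypeR R) _ R (leb n)
  (fun p : measurableTypeR R * 'rV[R]_n => f (row_mx p.1%:M p.2 : 'rV[R]_(1 + n)))) => //.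
exact: (measurableT_comp mf (@measurable_row_mx R n)).
Qed.

Lemma ge0_integral_shift n (a : 'rV[R]_n) (f : 'rV[R]_n -> \bar R) :
  measurable_fun [set: 'rV[R]_n] f -> (forall x, (0 <= f x)%E) ->
  (\int[leb n]_x f (x + a)%R = \int[leb n]_x f x)%E.
Proof.
elim: n a f => [a f mf f0|n ih].
  by rewrite !integral_leb0; congr f; apply/matrixP => i [].
(* Restated with the convertible dimension [1 + n], the form in which [row_mx] splits off the first
   coordinate. *)
change (forall (a : 'rV[R]_(1 + n)) (f : 'rV[R]_(1 + n) -> \bar R),
  measurable_fun [set: 'rV[R]_(1 + n)] f -> (forall x, (0 <= f x)%E) ->
  (\int[leb n.+1]_x f (x + a)%R = \int[leb n.+1]_x f x)%E).
move=> a f mf f0; rewrite (integral_lebS mf f0).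
rewrite (@integral_lebS _ n (fun x => f (x + a)) (measurableT_comp mf (measurable_shift _)) (fun x => f0 (x + a))).
pose g (x : R) := (\int[leb n]_y f (row_mx x%:M y : 'rV[R]_(1 + n)))%E.
rewrite -[RHS](@ge0_integral_shift1 (a 0 0) g); first last.
  by move=> x; apply: integral_ge0.
  exact: measurable_int_row.
apply: eq_integral => x _; rewrite /g.
rewrite -(ih (rsubmx a) (fun y => f (row_mx (x + a 0 0)%:M y : 'rV[R]_(1 + n)))) //; last first.
  exact: (measurableT_comp mf (@measurable_row_mxr n _)).
by apply: eq_integral => y _; rewrite {1}(rV_decomp a) add_row_mx -raddfD.
Qed.

Lemma ge0_integral_scale n (r : R) (f : 'rV[R]_n -> \bar R) : 0 < r ->
  measurable_fun [set: 'rV[R]_n] f -> (forall x, (0 <= f x)%E) ->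
  (\int[leb n]_x f (r *: x)%R = (r ^- n)%:E * \int[leb n]_x f x)%E.
Proof.
move=> r0; elim: n f => [f mf f0|n ih].
  by rewrite !integral_leb0 expr0 invr1 mul1e; congr f; apply/matrixP => i [].
change (forall (f : 'rV[R]_(1 + n) -> \bar R),
  measurable_fun [set: 'rV[R]_(1 + n)] f -> (forall x, (0 <= f x)%E) ->
  (\int[leb n.+1]_x f (r *: x)%R = (r ^- n.+1)%:E * \int[leb n.+1]_x f x)%E).
move=> f mf f0; rewrite (integral_lebS mf f0).
rewrite (@integral_lebS _ n (fun x => f (r *: x)) (measurableT_comp mf (measurable_scale _)) (fun x => f0 (r *: x))).
pose g (x : R) := (\int[leb n]_y f (row_mx x%:M y : 'rV[R]_(1 + n)))%E.
have g0 x : (0 <= g x)%E by exact: integral_ge0.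
have mg : measurable_fun [set: R] g by exact: measurable_int_row.
transitivity (\int[mu]_x ((r ^- n)%:E * g (r * x)%R))%E.
  apply: eq_integral => x _; rewrite /g -ih //; last first.
    exact: (measurableT_comp mf (@measurable_row_mxr n _)).
  by apply: eq_integral => y _; rewrite scale_row_mx scale_scalar_mx.
have mgr : measurable_fun [set: R] (fun x => g (r * x)).
  by apply: (measurableT_comp mg); exact: measurable_funM.
have rn0 : (0 <= (r ^- n)%:E)%E by rewrite lee_fin invr_ge0 exprn_ge0// ltW.
rewrite (ge0_integralZl mu measurableT mgr (fun x _ => g0 (r * x)) rn0).
rewrite (ge0_integral_scale1 r0 mg g0) muleA -EFinM -invfM -exprSr.
by [].
Qed.

Lemma leb_shift n (a : 'rV[R]_n) (A : set 'rV[R]_n) : measurable A ->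
  leb n ((fun x => x + a) @^-1` A) = leb n A.
Proof.
move=> mA; have mAa : measurable ((fun x : 'rV[R]_n => x + a) @^-1` A).
  by rewrite -[X in measurable X]setTI; exact: measurable_shift.
rewrite -[in LHS](setIT (_ @^-1` _)) -[A in RHS]setIT -!integral_indic//.
by rewrite -(@ge0_integral_shift _ a (EFin \o \1_A))// => [|x]; rewrite /= ?lee_fin//; exact/measurable_EFinP.
Qed.

End lebesgue_affine.

(** * Hausdorff measure and Lebesgue measure *)

Section enorm_theory.
Context {R : realType} {n : nat}.
Implicit Types x y : 'rV[R]_n.

Lemma dotC x y : dot x y = dot y x.
Proof. by apply: eq_bigr => i _; rewrite mulrC. Qed.

Lemma dotDl x y z : dot (x + y) z = dot x z + dot y z.
Proof. by rewrite /dot -big_split; apply: eq_bigr => i _; rewrite mxE mulrDl. Qed.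

Lemma dotZl r x y : dot (r *: x) y = r * dot x y.
Proof. by rewrite /dot mulr_sumr; apply: eq_bigr => i _; rewrite mxE mulrA. Qed.

Lemma dotDr x y z : dot x (y + z) = dot x y + dot x z.
Proof. by rewrite dotC dotDl ![dot _ x]dotC. Qed.

Lemma dotZr r x y : dot x (r *: y) = r * dot x y.
Proof. by rewrite dotC dotZl dotC. Qed.

Lemma dotNl x y : dot (- x) y = - dot x y.
Proof. by rewrite -scaleN1r dotZl mulN1r. Qed.

Lemma dotNr x y : dot x (- y) = - dot x y.
Proof. by rewrite dotC dotNl dotC. Qed.

Lemma dotBl x y z : dot (x - y) z = dot x z - dot y z.
Proof. by rewrite dotDl dotNl. Qed.

Lemma dotBr x y z : dot x (y - z) = dot x y - dot x z.
Proof. by rewrite dotDr dotNr. Qed.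

Lemma dot_ge0 x : 0 <= dot x x.
Proof. by apply: sumr_ge0 => i _; rewrite -expr2 sqr_ge0. Qed.

Lemma enorm_ge0 x : 0 <= enorm x. Proof. exact: sqrtr_ge0. Qed.

Lemma sqr_enorm x : enorm x ^+ 2 = dot x x.
Proof. by rewrite sqr_sqrtr// dot_ge0. Qed.

Lemma enormZ r x : enorm (r *: x) = `|r| * enorm x.
Proof.
by rewrite /enorm dotZl dotZr mulrA -expr2 sqrtrM ?sqr_ge0// sqrtr_sqr.
Qed.

Lemma coord_le_enorm x i : `|x 0 i| <= enorm x.
Proof.
rewrite -[leLHS]sqrtr_sqr ler_wsqrtr// /dot (bigD1 i)//= -expr2 lerDl.
by apply: sumr_ge0 => j _; rewrite -expr2 sqr_ge0.
Qed.

Lemma enorm_le_sum x (e : R) : (forall i, `|x 0 i| <= e) -> enorm x <= n%:R * e.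
Proof.
case: (posnP n) => [n0 _|n0 xe].
  rewrite /enorm /dot big1 ?sqrtr0 ?n0 ?mul0r// => i.
  by case: i => i i_n; exfalso; move: i_n; rewrite [in X in (_ < X)%N]n0.
have e0 : 0 <= e by exact: le_trans (normr_ge0 _) (xe (Ordinal n0)).
rewrite -(ler_pXn2r (_ : 0 < 2)%N) ?nnegrE ?enorm_ge0 ?mulr_ge0//.
rewrite sqr_enorm /dot (@le_trans _ _ (\sum_(i < n) e ^+ 2))//.
  by apply: ler_sum => i _; rewrite -expr2 -real_normK ?num_real// lerXn2r ?nnegrE.
rewrite sumr_const card_ord -(mulr_natl (e ^+ 2)) exprMn ler_wpM2r ?sqr_ge0// -natrX ler_nat.
by rewrite -{1}(expn1 n) leq_pexp2l.
Qed.

End enorm_theory.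

Section diam_theory.
Context {R : realType}.
Local Open Scope ereal_scope.

(** A supremum over no pair. This is why [diam_pow] treats the empty set apart, and why empty sets
    satisfy every bound on diameters in a cover. *)
Lemma diam_set0 n : diam (@set0 'rV[R]_n) = -oo.
Proof.
apply/eqP; rewrite eq_le leNye andbT; apply: ge_ereal_sup => _ [x []].
Qed.

Lemma enorm_le_diam n (A : set 'rV[R]_n) x y : A x -> A y ->
  (enorm (x - y))%:E <= diam A.
Proof. by move=> Ax Ay; apply: ereal_sup_ubound; exists x => //; exists y. Qed.

Lemma diam_ge0 n (A : set 'rV[R]_n) : A !=set0 -> 0 <= diam A.
Proof.
by move=> [x Ax]; apply: le_trans (enorm_le_diam Ax Ax); rewrite lee_fin enorm_ge0.
Qed.

Lemma diam_pow_ge0 k n (A : set 'rV[R]_n) : 0 <= diam_pow k A.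
Proof.
rewrite /diam_pow; case: ifPn => // /set0P A0; apply: expe_ge0; exact: diam_ge0.
Qed.

Lemma diam_pow_le k n (A : set 'rV[R]_n) (e : R) :
  (0 <= e)%R -> diam A <= e%:E -> diam_pow k A <= (e ^+ k)%:E.
Proof.
rewrite /diam_pow => e0 Ae; case: ifPn => [_|/set0P A0]; first by rewrite lee_fin exprn_ge0.
have := diam_ge0 A0; case: (diam A) Ae => // r; rewrite !lee_fin => re r0.
by rewrite -EFin_expe lee_fin lerXn2r ?nnegrE.
Qed.

Lemma diam_lipschitz n m (g : 'rV[R]_n -> 'rV[R]_m) (A : set 'rV[R]_n) (c : R) :
  (0 < c)%R ->
  (forall x y, A x -> A y -> (enorm (g x - g y) <= c * enorm (x - y))%R) ->
  A !=set0 -> diam (g @` A) <= c%:E * diam A.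
Proof.
move=> c0 gA A0; apply: ge_ereal_sup => _ [_ [x Ax <-]] [_ [y Ay <-] <-].
apply: (@le_trans _ _ (c%:E * (enorm (x - y))%:E)).
  by rewrite -EFinM lee_fin gA.
by rewrite lee_pmul2l// enorm_le_diam.
Qed.

End diam_theory.

Section hausdorff_outer.
Context {R : realType} {n : nat}.
Local Open Scope ereal_scope.
Variable k : nat.

(** Hausdorff covers use arbitrary sets, whereas [mu_ext] covers by measurable ones: under the
    discrete sigma-algebra the two notions coincide. *)
Definition discrete_rV := 'rV[R]_n.
HB.instance Definition _ := Pointed.on discrete_rV.
HB.instance Definition _ := @isMeasurable.Build default_measure_display
  discrete_rV discrete_measurable (@discrete_measurable0 _)
  (@discrete_measurableC _) (@discrete_measurableU _).

(* Pays [diam_pow k] for a set of diameter at most [delta], and an infinite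
   price for larger sets, so that [hausdorff_delta] is an instance of the
   outer measures [mu_ext] of the library. *)
Definition small_diam_pow (delta : R) (U : set discrete_rV) : \bar R :=
  if diam (U : set 'rV[R]_n) <= delta%:E then diam_pow k (U : set 'rV[R]_n) else +oo.

Lemma small_diam_pow_ge0 delta U : 0 <= small_diam_pow delta U.
Proof. by rewrite /small_diam_pow; case: ifP => // _; exact: diam_pow_ge0. Qed.

Lemma hausdorff_delta_mu_ext delta (A : set 'rV[R]_n) :
  hausdorff_delta k delta A = mu_ext (small_diam_pow delta) (A : set discrete_rV).
Proof.
apply/eqP; rewrite eq_le; apply/andP; split; apply: le_ereal_inf_tmp.
  move=> _ [U [_ AU] <-].
  have [Usmall|/existsNP[i /negP Ui]] := pselect (forall i, diam (U i : set 'rV[R]_n) <= delta%:E).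
    apply: ereal_inf_lbound; exists U => //.
    by apply: eq_eseriesr => i _; rewrite /small_diam_pow Usmall.
  rewrite (eseries_pinfty (k := i)) ?leey//; last by rewrite /small_diam_pow (negbTE Ui).
  by move=> j _; rewrite gt_eqF// (lt_le_trans _ (small_diam_pow_ge0 _ _)).
move=> _ [U [AU Usmall] <-]; apply: ereal_inf_lbound; exists U; first by split.
by apply: eq_eseriesr => i _; rewrite /small_diam_pow Usmall.
Qed.

Lemma hausdorff_delta_ge0 delta (A : set 'rV[R]_n) : 0 <= hausdorff_delta k delta A.
Proof.
by rewrite hausdorff_delta_mu_ext; apply: mu_ext_ge0 => U; exact: small_diam_pow_ge0.
Qed.

Lemma le_hausdorff_delta delta (A B : set 'rV[R]_n) : A `<=` B ->
  hausdorff_delta k delta A <= hausdorff_delta k delta B.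
Proof. by move=> AB; rewrite !hausdorff_delta_mu_ext; exact: le_mu_ext. Qed.

Lemma hausdorff_delta_subadd delta (A : (set 'rV[R]_n)^nat) :
  hausdorff_delta k delta (\bigcup_i A i) <=
  \sum_(i <oo) hausdorff_delta k delta (A i).
Proof.
rewrite hausdorff_delta_mu_ext.
under eq_eseriesr do rewrite hausdorff_delta_mu_ext.
by apply: mu_ext_sigma_subadditive => U; exact: small_diam_pow_ge0.
Qed.

Lemma hausdorff_delta_diam delta (A : set 'rV[R]_n) : diam A <= delta%:E ->
  hausdorff_delta k delta A <= diam_pow k A.
Proof.
move=> Ad; apply: ereal_inf_lbound.
exists (fun i : nat => if i == 0%N then A else set0).
  by split=> [x Ax|[|i]//]; [exists 0%N|rewrite /= diam_set0 leNye].
rewrite (nneseries_recl (P := xpredT)) => [|i _|//]; last exact: diam_pow_ge0.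
by rewrite eseries0 ?adde0// => i i0 _; case: i i0 => //= i _; rewrite /diam_pow eqxx.
Qed.

Lemma hausdorff_delta_le_raw delta (A : set 'rV[R]_n) : (0 < delta)%R ->
  hausdorff_delta k delta A <= hausdorff_raw k A.
Proof. by move=> d0; apply: ereal_sup_ubound; exists delta. Qed.

Lemma hausdorff_raw_ge0 (A : set 'rV[R]_n) : 0 <= hausdorff_raw k A.
Proof.
apply: le_trans (hausdorff_delta_le_raw A (@ltr01 R)); exact: hausdorff_delta_ge0.
Qed.

Lemma le_hausdorff_raw (A B : set 'rV[R]_n) : A `<=` B ->
  hausdorff_raw k A <= hausdorff_raw k B.
Proof.
move=> AB; apply: ge_ereal_sup => _ [d d0 <-].
by apply: le_trans (hausdorff_delta_le_raw B d0); exact: le_hausdorff_delta.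
Qed.

Lemma hausdorff_raw_subadd (A : (set 'rV[R]_n)^nat) :
  hausdorff_raw k (\bigcup_i A i) <= \sum_(i <oo) hausdorff_raw k (A i).
Proof.
apply: ge_ereal_sup => _ [d d0 <-]; apply: le_trans (hausdorff_delta_subadd _ _) _.
apply: lee_nneseries => i *; first exact: hausdorff_delta_ge0.
exact: hausdorff_delta_le_raw.
Qed.

End hausdorff_outer.

(** A cover of [A] by sets of diameter at most [d / c] is intersected with [A], where the Lipschitz
    bound holds, and then mapped to a cover of the image by sets of diameter at most [d]. *)
Lemma hausdorff_raw_lipschitz {R : realType} k n m (g : 'rV[R]_n -> 'rV[R]_m)
    (A : set 'rV[R]_n) (c : R) : 0 < c ->
  (forall x y, A x -> A y -> enorm (g x - g y) <= c * enorm (x - y)) ->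
  (hausdorff_raw k (g @` A) <= (c ^+ k)%:E * hausdorff_raw k A)%E.
Proof.
move=> c0 gA; apply: ge_ereal_sup => _ [d d0 <-].
have dc0 : (0 < d / c) by rewrite divr_gt0.
have ck0 : (0 < c ^+ k) by rewrite exprn_gt0.
apply: (@le_trans _ _ ((c ^+ k)%:E * hausdorff_delta k (d / c) A)%E); last first.
  by rewrite lee_pmul2l// hausdorff_delta_le_raw.
rewrite -lee_pdivrMl//; apply: le_ereal_inf_tmp => _ [U [AU Ud] <-].
rewrite lee_pdivrMl// -nneseriesZl; last by move=> i _; exact: diam_pow_ge0.
have UA_le i : (diam (U i `&` A) <= diam (U i))%E.
  by apply: le_ereal_sup => _ [x [Ux _]] [y [Uy _] <-]; exists x => //; exists y.
have gUA i : U i `&` A !=set0 -> (diam (g @` (U i `&` A)) <= c%:E * diam (U i `&` A))%E.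
  by apply: diam_lipschitz => //; move=> x y [_ Ax] [_ Ay]; exact: gA.
apply: (@le_trans _ _ (\sum_(i <oo) diam_pow k (g @` (U i `&` A)))%E).
  apply: ereal_inf_lbound; exists (fun i => g @` (U i `&` A)) => //; split.
    by move=> _ [x Ax <-]; have [i _ Uix] := AU _ Ax; exists i => //; exists x.
  move=> i; have [->|/set0P UAi0] := eqVneq (U i `&` A) set0.
    by rewrite image_set0 diam_set0 leNye.
  apply: le_trans (gUA i UAi0) _.
  rewrite (_ : d%:E = (c%:E * (d / c)%:E)%E); last by rewrite -EFinM mulrC divfK ?gt_eqF.
  by rewrite lee_pmul2l//; apply: le_trans (UA_le i) (Ud i).
apply: lee_nneseries => i *; first exact: diam_pow_ge0.
have [->|/set0P UAi0] := eqVneq (U i `&` A) set0.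
  by rewrite image_set0 {1}/diam_pow eqxx mule_ge0 ?diam_pow_ge0// lee_fin ltW.
have Ui0 : U i != set0 by apply/set0P; case: UAi0 => x [Ux _]; exists x.
have := UA_le i; have := Ud i; have := gUA i UAi0.
have /set0P/diam_ge0 := Ui0.
rewrite [in X in _ -> _ -> _ -> _ -> X]/diam_pow (negbTE Ui0) -/(diam_pow k (g @` (U i `&` A))).
case: (diam (U i)) => // r r0 gr _ UAr.
rewrite -EFin_expe -EFinM -exprMn; apply: diam_pow_le; first by rewrite mulr_ge0// ltW.
by apply: le_trans gr _; rewrite EFinM lee_pmul2l.
Qed.

Lemma hausdorff_delta0 {R : realType} n k delta : hausdorff_delta k delta (@set0 'rV[R]_n) = 0%E.
Proof.
apply/eqP; rewrite eq_le hausdorff_delta_ge0 andbT.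
apply: le_trans (hausdorff_delta_diam _ _) _; first by rewrite diam_set0 leNye.
by rewrite /diam_pow eqxx.
Qed.

Lemma hausdorff_raw0 {R : realType} n k : hausdorff_raw k (@set0 'rV[R]_n) = 0%E.
Proof.
apply/eqP; rewrite eq_le hausdorff_raw_ge0 andbT.
by apply: ge_ereal_sup => _ [d d0 <-]; rewrite hausdorff_delta0.
Qed.

Lemma hausdorff_rawU {R : realType} n k (A B : set 'rV[R]_n) C :
  C `<=` A `|` B -> (hausdorff_raw k C <= hausdorff_raw k A + hausdorff_raw k B)%E.
Proof.
move=> CAB; apply: le_trans (le_hausdorff_raw _ (_ : C `<=` \bigcup_i bigcup2 A B i)) _.
  by rewrite bigcup2E.
apply: le_trans (hausdorff_raw_subadd _ _) _.
rewrite (nneseries_split_cond 0 2)//=; last by move=> i _; exact: hausdorff_raw_ge0.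
rewrite eseries0; last by case=> [//|[//|i]] _ _; rewrite hausdorff_raw0.
by rewrite adde0 add0n big_mkord big_ord_recl big_ord1.
Qed.

(** * Dyadic cubes, and outer measures compared with Lebesgue measure *)

Section cubes.
Context {R : realType} {n : nat}.
Local Notation mu := (@lebesgue_measure R).

Lemma measurable_box (I : 'I_n -> set R) : (forall i, measurable (I i)) ->
  measurable [set x : 'rV[R]_n | forall i, I i (x 0 i)].
Proof.
move=> mI; rewrite (_ : [set _ | _] =
    \bigcap_(i in [set: 'I_n]) ((fun x : 'rV[R]_n => x 0 i) @^-1` I i)).
  apply: fin_bigcap_measurable => // i _.
  by rewrite -[X in measurable X]setTI; exact: measurable_rV_coord.
by apply/seteqP; split => [x xI i _|x xI i]; [exact: xI|exact: (xI i Logic.I)].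
Qed.

End cubes.

Lemma row_mx_ord0 (R : realType) n (x : R) (y : 'rV[R]_n) :
  (row_mx x%:M y : 'rV[R]_(1 + n)) 0 0 = x.
Proof.
by rewrite mxE; case: splitP => // j _; rewrite ord1 mxE eqxx mulr1n.
Qed.

Lemma row_mx_lift0 (R : realType) n (x : R) (y : 'rV[R]_n) (j : 'I_n) :
  (row_mx x%:M y : 'rV[R]_(1 + n)) 0 (lift 0 j) = y 0 j.
Proof. by rewrite (_ : lift 0 j = rshift 1 j) ?row_mxEr//; exact/val_inj. Qed.

Lemma leb_cube (R : realType) n (I : 'I_n -> set R) (l : R) :
  (forall i, measurable (I i)) -> (forall i, lebesgue_measure (I i) = l%:E) ->
  leb n [set x : 'rV[R]_n | forall i, I i (x 0 i)] = (l ^+ n)%:E.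
Proof.
elim: n I => [|n ih] I mI Il.
  rewrite -[X in leb 0 X]setIT -integral_indic ?integral_leb0; last exact: measurable_box.
    by rewrite indicE mem_set ?expr0// => -[].
  by [].
have mB := measurable_box mI.
rewrite -[X in leb _ X]setIT -integral_indic//.
have mf : measurable_fun [set: 'rV[R]_(1 + n)]
    (fun x => (\1_[set x : 'rV[R]_(1 + n) | forall i, I i (x 0 i)] x)%:E : \bar R).
  by apply/measurable_EFinP; exact: measurable_indic.
rewrite (integral_lebS mf); last by move=> y; rewrite lee_fin.
have mB' : measurable [set y : 'rV[R]_n | forall i, I (lift 0 i) (y 0 i)].
  by apply: (@measurable_box _ _ (fun i => I (lift 0 i))) => i; exact: mI.
transitivity (\int[lebesgue_measure]_x ((l ^+ n)%:E * (\1_(I 0) x)%:E))%E.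
  apply: eq_integral => x _.
  rewrite -(ih _ (fun i => mI (lift 0 i)) (fun i => Il (lift 0 i))).
  rewrite -[X in leb _ X]setIT -integral_indic// -ge0_integralZr//=; last first.
    by apply/measurable_EFinP; exact: measurable_indic.
  apply: eq_integral => y _; rewrite -EFinM !indicE -natrM mulnb; congr (_%:R%:E).
  congr nat_of_bool; apply/idP/andP; rewrite !inE /=.
    move=> xy; split; last by have := xy 0; rewrite row_mx_ord0.
    by move=> i; have := xy (lift 0 i); rewrite row_mx_lift0.
  move=> [/= Iy Ix] i.
  case: (unliftP 0 i) => [j ->|->]; last by rewrite row_mx_ord0.
  by rewrite row_mx_lift0; exact: Iy.
have mI0 : measurable_fun [set: R] (fun x : R => (\1_(I 0) x : R)%:E).
  by apply/measurable_EFinP; exact: measurable_indic.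
have ln0 : (0 <= (l ^+ n)%:E)%E.
  rewrite lee_fin exprn_ge0//.
  by rewrite -lee_fin -(Il 0) measure_ge0.
have I00 (x : R) : [set: R] x -> (0 <= (\1_(I 0) x : R)%:E)%E by rewrite lee_fin.
rewrite (ge0_integralZl lebesgue_measure measurableT mI0 I00 ln0).
rewrite (integral_indic lebesgue_measure measurableT (mI 0)) setIT.
by rewrite exprSr EFinM; congr (_ * _)%E; exact: Il.
Qed.

Lemma exists_exp2_lt (R : realType) (e : R) : 0 < e -> exists m, (2 ^+ m)^-1 < e.
Proof.
move=> e0; exists (Num.truncn e^-1).+1.
rewrite invf_plt ?posrE ?exprn_gt0//.
have /andP[_ /lt_trans] : (Num.truncn e^-1)%:R <= e^-1 < (Num.truncn e^-1).+1%:R.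
  by apply: truncn_itv; rewrite invr_ge0 ltW.
by apply; rewrite -natrX ltr_nat ltn_expl.
Qed.

Section dyadic.
Context {R : realType} {n : nat}.
Implicit Types (x : 'rV[R]_n) (z : 'rV[int]_n).

Definition dyadic_cube (m : nat) z : set 'rV[R]_n :=
  [set x | forall i, `[(z 0 i)%:~R / 2 ^+ m, ((z 0 i)%:~R + 1) / 2 ^+ m[%classic (x 0 i)].

Definition dyadic_floor (m : nat) x : 'rV[int]_n :=
  \row_i Num.floor (x 0 i * 2 ^+ m).

Lemma dyadic_cubeP m z x : dyadic_cube m z x <-> dyadic_floor m x = z.
Proof.
have p0 : 0 < 2 ^+ m :> R by rewrite exprn_gt0.
split=> [xz|<- i /=].
  apply/rowP => i; have := xz i; rewrite mxE /= in_itv/= ler_pdivrMr// ltr_pdivlMr//.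
  move=> /andP[x1 x2]; apply: Num.Theory.floor_def; rewrite x1/=.
  by rewrite intrD.
rewrite mxE in_itv/= ler_pdivrMr// ltr_pdivlMr// floor_le_tmp/=.
by have := floorD1_gt (x 0 i * 2 ^+ m); rewrite intrD.
Qed.

Lemma measurable_dyadic_cube m z : measurable (dyadic_cube m z).
Proof. by apply: (@measurable_box R n (fun i => `[_, _[%classic)) => i; exact: measurable_itv. Qed.

Lemma leb_dyadic_cube m z : leb n (dyadic_cube m z) = (2 ^- m ^+ n)%:E.
Proof.
apply: (@leb_cube R n (fun i => `[(z 0 i)%:~R / 2 ^+ m, ((z 0 i)%:~R + 1) / 2 ^+ m[%classic)) => i.
  exact: measurable_itv.
rewrite lebesgue_measure_itv/= lte_fin ltr_pM2r ?invr_gt0 ?exprn_gt0// ltrDl ltr01.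
by rewrite -EFinB -mulrBl addrC addKr mul1r.
Qed.

Definition dyadic_union m (W : set 'rV[R]_n) :=
  forall x y, dyadic_floor m x = dyadic_floor m y -> W x -> W y.

(** The cubes of level [m] are numbered by [pickle] of their integer corner; every other number
    yields an empty piece. *)
Let piece m W k : set 'rV[R]_n := [set x | W x /\ pickle (dyadic_floor m x) = k].

Let bigcup_piece m W : \bigcup_k piece m W k = W.
Proof. by apply/seteqP; split=> [x [k _ []]//|x Wx]; exists (pickle (dyadic_floor m x)). Qed.

Let pieceP m W k : dyadic_union m W ->
  piece m W k = set0 \/ exists z, piece m W k = dyadic_cube m z.
Proof.
move=> mW; have [->|/set0P[x [Wx xk]]] := eqVneq (piece m W k) set0; first by left.
right; exists (dyadic_floor m x); apply/seteqP; split => y.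
  by move=> [Wy yk]; apply/dyadic_cubeP/(pcan_inj pickleK); rewrite yk xk.
by move=> /dyadic_cubeP yx; split; [exact: mW Wx|rewrite yx].
Qed.

Let measurable_piece m W k : dyadic_union m W -> measurable (piece m W k).
Proof.
by move=> /(@pieceP m W k)[->//|[z ->]]; exact: measurable_dyadic_cube.
Qed.

Let trivIset_piece m W : trivIset setT (piece m W).
Proof. by apply/trivIsetP => i j _ _ /eqP ij; rewrite -subset0 => x [[_ xi] [_ xj]]; apply: ij; rewrite -xi -xj. Qed.

Lemma measurable_dyadic_union m W : dyadic_union m W -> measurable W.
Proof.
by move=> mW; rewrite -(bigcup_piece m W); apply: bigcupT_measurable => k; exact: measurable_piece.
Qed.

Lemma dyadic_floorS m x y : dyadic_floor m.+1 x = dyadic_floor m.+1 y ->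
  dyadic_floor m x = dyadic_floor m y.
Proof.
move=> xy; apply/rowP => i; have := congr1 (fun z : 'rV[int]_n => z 0 i) xy.
rewrite !mxE exprSr !mulrA.
move: (x 0 i * 2 ^+ m) (y 0 i * 2 ^+ m) => a b ab.
apply/esym/Num.Theory.floor_def; apply/andP; split.
  have : Num.floor a * 2 <= Num.floor (b * 2).
    by rewrite -ab floor_ge_int intrM ler_pM2r// floor_le.
  by rewrite floor_ge_int intrM ler_pM2r.
have : Num.floor (b * 2) < (Num.floor a + 1) * 2.
  by rewrite -ab floor_lt_int intrM ltr_pM2r// floorD1_gt.
by rewrite floor_lt_int intrM ltr_pM2r.
Qed.

Lemma dyadic_floor_le j m x y : (j <= m)%N -> dyadic_floor m x = dyadic_floor m y ->
  dyadic_floor j x = dyadic_floor j y.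
Proof.
move=> /subnK <-; elim: (m - j)%N => [//|k ih].
by rewrite addSn => /dyadic_floorS; exact: ih.
Qed.

Section outer_le.
Variables (theta : set 'rV[R]_n -> \bar R) (c : R).
Hypothesis c0 : 0 <= c.
Hypothesis theta_ge0 : forall A, (0 <= theta A)%E.
Hypothesis theta0 : theta set0 = 0%E.
Hypothesis theta_subadd : forall A : (set 'rV[R]_n)^nat,
  (theta (\bigcup_i A i) <= \sum_(i <oo) theta (A i))%E.

(** [theta] stays abstract because two outer measures are needed: [hausdorff_delta] at a fixed
    scale, to bound the normalizing constant, and [hausdorff_raw], for open sets. *)
Lemma outer_le_dyadic_union m W : dyadic_union m W ->
  (forall z, (theta (dyadic_cube m z) <= c%:E * leb n (dyadic_cube m z))%E) ->
  (theta W <= c%:E * leb n W)%E.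
Proof.
move=> mW cW; rewrite -[X in theta X](bigcup_piece m W).
apply: le_trans (theta_subadd _) _.
have -> : leb n W = (\sum_(k <oo) leb n (piece m W k))%E.
  rewrite -[in LHS](bigcup_piece m W) measure_bigcup//; last first.
    by move=> k _; exact: measurable_piece.
  by apply: eq_eseriesl => k; rewrite in_setT.
rewrite -nneseriesZl//; apply: lee_nneseries => [//|k _].
by case: (pieceP k mW) => [->|[z ->]]; rewrite ?theta0 ?measure0 ?mule0.
Qed.

Let inside U m : set 'rV[R]_n :=
  [set x | forall y, dyadic_floor m x = dyadic_floor m y -> U y].

(** Union of the cubes of level [m] contained in [U] and in no larger such cube: over all [m] these
    maximal cubes partition an open set. *)
Let first_inside U m : set 'rV[R]_n :=
  inside U m `&` [set x | forall j, (j < m)%N -> ~ inside U j x].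

Let dyadic_first_inside U m : dyadic_union m (first_inside U m).
Proof.
move=> x y xy [xU xj]; split=> [z yz|j jm yj]; first by apply: xU; rewrite xy.
apply: (xj _ jm) => z xz; apply: yj; rewrite -xz.
by apply: (dyadic_floor_le (ltnW jm)); rewrite xy.
Qed.

Let dyadic_floor_close m x y i : dyadic_floor m x = dyadic_floor m y ->
  `|x 0 i - y 0 i| < (2 ^+ m)^-1.
Proof.
move=> xy; have := congr1 (fun z : 'rV[int]_n => z 0 i) xy; rewrite !mxE => zi.
have p0 : 0 < 2 ^+ m :> R by rewrite exprn_gt0.
rewrite -(ltr_pM2r p0) mulVf ?gt_eqF// -{1}(gtr0_norm p0) -normrM mulrBl.
have := floor_itv (x 0 i * 2 ^+ m); have := floor_itv (y 0 i * 2 ^+ m).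
rewrite -zi intrD; move: (x 0 i * _) (y 0 i * _) (_%:~R : R) => a b k.
by move=> /andP[? ?] /andP[? ?]; rewrite ltr_norml; apply/andP; split; lra.
Qed.

Let bigcup_first_inside U : open U -> \bigcup_m first_inside U m = U.
Proof.
move=> oU; apply/seteqP; split=> [x [m _ [xU _]]|x Ux]; first exact: xU.
have /nbhs_ballP[e/= e0 xeU] : nbhs x U by exact: open_nbhs_nbhs.
have ex : exists m, `[< inside U m x >].
  have [m me] := exists_exp2_lt e0.
  exists m; apply/asboolP => y xy; apply: xeU; split=> // i j; rewrite ord1 /ball/=.
  exact: lt_trans (dyadic_floor_close _ xy) me.
exists (ex_minn ex) => //; case: ex_minnP => m /asboolP xm mmin; split=> // j jm /asboolP xj.
by have := mmin j xj; rewrite leqNgt jm.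
Qed.

Let trivIset_first_inside U : trivIset setT (first_inside U).
Proof.
apply/trivIsetP => i j _ _ ij; rewrite -subset0 => x [[xi xi'] [xj xj']].
by move: ij; rewrite neq_ltn => /orP[/xj'|/xi'].
Qed.

Hypothesis theta_cube : forall m z,
  (theta (dyadic_cube m z) <= c%:E * leb n (dyadic_cube m z))%E.

Lemma outer_le_open U : open U -> (theta U <= c%:E * leb n U)%E.
Proof.
move=> oU; have mF m := measurable_dyadic_union (@dyadic_first_inside U m).
have -> : leb n U = (\sum_(k <oo) leb n (first_inside U k))%E.
  rewrite -[in LHS](bigcup_first_inside oU) measure_bigcup//.
  by apply: eq_eseriesl => k; rewrite in_setT.
rewrite -[X in theta X](bigcup_first_inside oU).
apply: le_trans (theta_subadd _) _.
rewrite -nneseriesZl//; apply: lee_nneseries => [//|k _].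
exact: (@outer_le_dyadic_union k).
Qed.

End outer_le.
End dyadic.

Lemma ereal_cvg_lt_ex (R : realType) (u : nat -> \bar R) (l e : \bar R) :
  u @ \oo --> l -> (l < e)%E -> exists N, (u N < e)%E.
Proof.
move=> ul le; have : nbhs l [set x | (x < e)%E].
  by apply: open_nbhs_nbhs; split => //; exact: open_ereal_lt_ereal.
by move=> /ul[N _ /(_ N (leqnn N))]; exists N.
Qed.

Lemma ereal_cvg_le (R : realType) (u : nat -> \bar R) (l e : \bar R) :
  u @ \oo --> l -> (forall N, (u N <= e)%E) -> (l <= e)%E.
Proof.
move=> ul ue; rewrite -(cvg_lim _ ul)//; apply: lime_le; first by apply/cvg_ex; exists l.
exact: nearW.
Qed.

(** * Regularity of finite Borel measures *)

Section regularity.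
Context {R : realType} {n : nat} (nu : {finite_measure set 'rV[R]_n -> \bar R}).
Local Open Scope ereal_scope.

Definition regular (A : set 'rV[R]_n) := measurable A /\
  forall e : R, (0 < e)%R -> exists C U,
    [/\ closed C, open U, C `<=` A, A `<=` U & nu (U `\` C) < e%:E].

Lemma regularC A : regular A -> regular (~` A).
Proof.
move=> [mA rA]; split; first exact: measurableC.
move=> e /rA[C [U [cC oU CA AU UCe]]]; exists (~` U), (~` C); split.
- exact: open_closedC.
- exact: closed_openC.
- exact: subsetC.
- exact: subsetC.
- by rewrite setDE setCK setIC -setDE.
Qed.

Lemma closed_measurable_rV (C : set 'rV[R]_n) : closed C -> measurable C.
Proof.
by move=> cC; rewrite -[C]setCK; apply: measurableC; apply: open_measurable_rV; exact: closed_openC.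
Qed.

(** A closed set is the decreasing intersection of its open neighbourhoods of radius [k.+1%:R^-1],
    and a finite measure is continuous along decreasing sequences. *)
Lemma regular_closed C : closed C -> regular C.
Proof.
move=> cC; split=> [|e e0]; first exact: closed_measurable_rV.
pose U k : set 'rV[R]_n := \bigcup_(y in C) ball y (k.+1%:R^-1 : R).
have oU k : open (U k) by apply: bigcup_open => y _; exact: ball_open.
have CU k : C `<=` U k by move=> x Cx; exists x => //; exact: ballxx.
have CE : \bigcap_k U k = C.
  apply/seteqP; split=> [x xU|x Cx k _]; last exact: CU.
  rewrite (closure_id C).1// => B /nbhs_ballP[d/= d0 dB].
  have [k kd] : exists k, (k.+1%:R^-1 < d)%R.
    exists (Num.truncn d^-1); rewrite invf_plt ?posrE//.
    by have /andP[] := @truncn_itv R d^-1 (ltW (etrans (invr_gt0 _) d0)).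
  have [y Cy yx] := xU k Logic.I; exists y; split=> //; apply: dB.
  by apply/ball_sym; apply: le_ball yx; exact: ltW.
have niU : nonincreasing_seq (fun k => U k `\` C).
  move=> i j ij; apply/subsetPset => x [[y Cy yx] Cx]; split=> //; exists y => //.
  by apply: le_ball yx; rewrite lef_pV2 ?posrE// ler_nat.
have mUC k : measurable (U k `\` C).
  by apply: measurableD; [exact: open_measurable_rV|exact: closed_measurable_rV].
have bigUC : \bigcap_k (U k `\` C) = set0.
  rewrite -subset0 => x xUC; have [_ Cx] := xUC 0%N Logic.I; apply: Cx.
  by rewrite -CE => k _; have [] := xUC k Logic.I.
have : nu \o (fun k => U k `\` C) @ \oo --> nu (\bigcap_k (U k `\` C)).
  apply: nonincreasing_cvg_mu => //; last by rewrite bigUC.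
  by rewrite -ge0_fin_numE// fin_num_measure.
rewrite bigUC measure0 => /ereal_cvg_lt_ex -/(_ e%:E); rewrite lte_fin => /(_ e0)[k /= Ue].
by exists C, (U k); split.
Qed.

Lemma regular_bigcup (A : (set 'rV[R]_n)^nat) :
  (forall i, regular (A i)) -> regular (\bigcup_i A i).
Proof.
move=> rA; have mA i : measurable (A i) by have [] := rA i.
split=> [|e e0]; first exact: bigcupT_measurable.
(* One half of [e] is spread over the sets [A i] as a geometric series. The other half pays for
   replacing the union of the closed sets, which need not be closed, by a finite union. *)
have e2 : (0 < e / 2)%R by rewrite divr_gt0.
have ei i : (0 < e / 2 / (2 ^ i.+1)%:R)%R by rewrite divr_gt0// ltr0n expn_gt0.
have /choice[CU CUP] i : exists p : set 'rV[R]_n * set 'rV[R]_n,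
    [/\ closed p.1, open p.2, p.1 `<=` A i, A i `<=` p.2 &
      nu (p.2 `\` p.1) < (e / 2 / (2 ^ i.+1)%:R)%:E].
  by have [_ /(_ _ (ei i))[C [U ?]]] := rA i; exists (C, U).
pose C i := (CU i).1; pose U i := (CU i).2.
have cC i : closed (C i) by have [] := CUP i.
have oU i : open (U i) by have [] := CUP i.
have mC i := closed_measurable_rV (cC i).
have mU i := open_measurable_rV (oU i).
pose CN N := \big[setU/set0]_(i < N) C i.
have mCN N : measurable (CN N) by exact: bigsetU_measurable.
have mUU : measurable (\bigcup_i U i) by exact: bigcupT_measurable.
have mCC : measurable (\bigcup_i C i) by exact: bigcupT_measurable.
pose D N := \bigcup_i U i `\` CN N.
have bigD : \bigcap_N D N = \bigcup_i U i `\` \bigcup_i C i.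
  apply/seteqP; split=> [x xD|x [Ux Cx] N _].
    split; first by have [] := xD 0%N Logic.I.
    move=> [i _ Cix]; have [_ []] := xD i.+1 Logic.I.
    by rewrite /CN big_ord_recr/=; right.
  by split=> //; rewrite /CN -bigcup_mkord => -[i _ Cix]; apply: Cx; exists i.
have limD : nu (\bigcap_N D N) <= (e / 2)%:E.
  rewrite bigD; apply: (@le_trans _ _ (nu (\bigcup_i (U i `\` C i)))).
    apply: le_measure; rewrite ?inE.
    - exact: measurableD.
    - by apply: bigcupT_measurable => i; exact: measurableD.
    - by move=> x [[i _ Uix] Cx]; exists i => //; split=> // Cix; apply: Cx; exists i.
  have mUC i : measurable (U i `\` C i) by exact: measurableD.
  apply: le_trans (measure_sigma_subadditive _ mUC (bigcupT_measurable _ mUC) (@subset_refl _ _)) _.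
  apply: le_trans _ (epsilon_trick0 xpredT (ltW e2)).
  by apply: lee_nneseries => // i _; have [_ _ _ _ /ltW] := CUP i.
have : nu \o D @ \oo --> nu (\bigcap_N D N).
  apply: nonincreasing_cvg_mu.
  - by rewrite -ge0_fin_numE// fin_num_measure//; exact: measurableD.
  - by move=> N; exact: measurableD.
  - by rewrite bigD; exact: measurableD.
  - move=> i j ij; apply/subsetPset; apply: setDS.
    by rewrite /CN -!bigcup_mkord => x [k /= ki Ckx]; exists k => //=; exact: leq_trans ij.
have De : nu (\bigcap_N D N) < e%:E.
  by apply: le_lt_trans limD _; rewrite lte_fin ltr_pdivrMr// ltr_pMr// ltr1n.
move=> /ereal_cvg_lt_ex -/(_ _ De)[N /= DNe].
exists (CN N), (\bigcup_i U i); split => //.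
- rewrite /CN -bigcup_mkord; apply: closed_bigcup => //.
- by apply: bigcup_open => i _.
- by rewrite /CN -bigcup_mkord => x [i _ Cix]; exists i => //; have [_ _ CA _ _] := CUP i; exact: CA.
- by move=> x [i _ Aix]; exists i => //; have [_ _ _ AU _] := CUP i; exact: AU.
Qed.

(** The regular sets form a sigma-algebra that contains the closed sets, hence the open ones. *)
Lemma borel_regular A : measurable A -> regular A.
Proof.
move: A; apply: smallest_sub; last first.
  by move=> U oU; rewrite -[U]setCK; apply/regularC/regular_closed/open_closedC.
split.
- by apply: regular_closed; exact: closed0.
- by move=> A rA; rewrite setTD; exact: regularC.
- exact: regular_bigcup.
Qed.

End regularity.

(** * Hausdorff measure of full dimension is Lebesgue measure *)

Lemma dyadic_cube_scale (R : realType) n m (z : 'rV[int]_n) :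
  @dyadic_cube R n m z =
  (fun x => (2 ^+ m)^-1 *: x + \row_i ((z 0 i)%:~R / 2 ^+ m)) @` dyadic_cube 0 0.
Proof.
have p0 : 0 < 2 ^+ m :> R by rewrite exprn_gt0.
apply/seteqP; split=> [x xz|_ [x x0 <-] i /=].
  exists (2 ^+ m *: (x - \row_i ((z 0 i)%:~R / 2 ^+ m))); last first.
    by rewrite scalerA mulVf ?gt_eqF// scale1r subrK.
  move=> i; have := xz i; rewrite /= !mxE !in_itv/= expr0 !divr1 add0r.
  rewrite ler_pdivrMr// ltr_pdivlMr// mulrBr [_ * (_ / _)]mulrC divfK ?gt_eqF//.
  by move=> /andP[? ?]; apply/andP; split; lra.
have := x0 i; rewrite /= !mxE !in_itv/= expr0 !divr1 add0r.
rewrite ler_pdivrMr// ltr_pdivlMr// mulrDl mulrAC mulVf ?gt_eqF// mul1r divfK ?gt_eqF//.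
by move=> /andP[? ?]; apply/andP; split; lra.
Qed.

Section hausdorff_lebesgue.
Context {R : realType} {n : nat}.
Local Open Scope ereal_scope.
Implicit Types A : set 'rV[R]_n.
Local Notation H := (@hausdorff_raw R n n).
Local Notation kappa := (H (dyadic_cube 0 0)).

(** A cube is the image of the unit cube under a similarity of ratio [2 ^- m], which multiplies [H]
    by at most [2 ^- m ^+ n], its volume. *)
Lemma hausdorff_dyadic_cube_le m z :
  H (dyadic_cube m z) <= kappa * leb n (dyadic_cube m z).
Proof.
rewrite leb_dyadic_cube dyadic_cube_scale muleC exprVn.
rewrite -[X in (X%:E * _)%E]exprVn; apply: hausdorff_raw_lipschitz => [|x y _ _].
  by rewrite invr_gt0 exprn_gt0.
rewrite opprD addrACA subrr addr0 -scalerBr enormZ ger0_norm// invr_ge0 exprn_ge0//.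
Qed.

Lemma diam_dyadic_cube_le m z : diam (@dyadic_cube R n m z) <= (n%:R * (2 ^+ m)^-1)%:E.
Proof.
apply: ge_ereal_sup => _ [x xz] [y yz <-]; rewrite lee_fin.
apply: enorm_le_sum => i; rewrite !mxE.
have := xz i; have := yz i; rewrite /= !in_itv/=.
rewrite !mulrDl mul1r; move: (((z 0%R i)%:~R : R) / 2 ^+ m)%R ((2 ^+ m)^-1 : R)%R (x 0%R i) (y 0%R i) => a b c d.
by move=> /andP[? ?] /andP[? ?]; rewrite ler_norml; apply/andP; split; lra.
Qed.

(** A dyadic cube has diameter at most [n] times its side, so covering by small dyadic cubes costs
    at most [n ^ n] per unit of volume, uniformly in the scale [d]. *)
Lemma kappa_lty : kappa < +oo.
Proof.
apply: (@le_lt_trans _ _ (n%:R ^+ n)%:E); last exact: ltry.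
apply: ge_ereal_sup => _ [d /= d0 <-].
(* The divisor [n.+1] rather than [n] is positive in dimension 0 as well. *)
have [m md] : exists m, ((2 ^+ m)^-1 < d / n.+1%:R :> R)%R.
  by apply: exists_exp2_lt; rewrite divr_gt0.
have md' : (n%:R * (2 ^+ m)^-1 <= d)%R.
  rewrite ltr_pdivlMr// mulrC in md; apply: le_trans (ltW md).
  by rewrite ler_wpM2r ?invr_ge0 ?exprn_ge0// ler_nat.
apply: (@le_trans _ _ ((n%:R ^+ n)%:E * leb n (dyadic_cube 0 0))); last first.
  by rewrite leb_dyadic_cube expr0 invr1 expr1n mule1.
apply: (@outer_le_dyadic_union _ _ (@hausdorff_delta R n d n) (n%:R ^+ n)%R _ _ _ m).
- by move=> A; exact: hausdorff_delta_ge0.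
- exact: hausdorff_delta0.
- by move=> A; exact: hausdorff_delta_subadd.
- move=> x y xy /dyadic_cubeP x0; apply/dyadic_cubeP; rewrite -x0.
  by apply/esym; exact: dyadic_floor_le xy.
- move=> z; rewrite leb_dyadic_cube -EFinM -exprMn.
  apply: le_trans (hausdorff_delta_diam _ _) _.
    by apply: le_trans (diam_dyadic_cube_le _ _) _; rewrite lee_fin.
  apply: diam_pow_le; last exact: diam_dyadic_cube_le.
  by rewrite mulr_ge0// invr_ge0 exprn_ge0.
Qed.

(** A set of the cover lies in the box of half-side its diameter around one of its points, so its
    cost is at least [2 ^- n] times the volume of that box; the boxes cover the unit cube. *)
Lemma kappa_gt0 : 0 < kappa.
Proof.
apply: (@lt_le_trans _ _ ((2 ^+ n)^-1)%:E); first by rewrite lte_fin invr_gt0 exprn_gt0.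
(* The single scale 1 suffices for a lower bound, as [hausdorff_raw] is a supremum over scales. *)
apply: le_trans (hausdorff_delta_le_raw _ _ (@ltr01 R)).
apply: le_ereal_inf_tmp => _ [U [cU Ud] <-].
pose d i := fine (diam (U i)).
have Uid i : U i !=set0 -> (diam (U i) = (d i)%:E) /\ (0 <= d i)%R.
  move=> U0; have := Ud i; have := diam_ge0 U0; rewrite /d.
  by case: (diam (U i)) => // r; rewrite lee_fin.
pose w i : 'rV[R]_n := xget (0 : 'rV[R]_n)%R (U i).
pose B i : set 'rV[R]_n := if U i == set0 then set0 else
  [set x | forall j, `[(w i 0%R j - d i)%R, (w i 0%R j + d i)%R]%classic (x 0%R j)].
have mB i : measurable (B i).
  rewrite /B; case: ifP => _; first exact: measurable0.
  apply: (@measurable_box R n (fun j => `[(w i 0%R j - d i)%R, (w i 0%R j + d i)%R]%classic)) => j.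
  exact: measurable_itv.
have UB i : U i `<=` B i.
  move=> x Ux; rewrite /B ifF; last by apply/negbTE/set0P; exists x.
  have U0 : U i !=set0 by exists x.
  have Uy : U i (w i) by exact: xgetPex.
  move=> j /=.
  have := enorm_le_diam Ux Uy; rewrite (Uid _ U0).1 lee_fin => /(le_trans (coord_le_enorm _ j)).
  rewrite !mxE in_itv/= ler_norml; move: (x 0%R j) (w i 0%R j) (d i) => a b c.
  by move=> /andP[? ?]; apply/andP; split; lra.
have LB i : leb n (B i) <= (2 ^+ n)%:E * diam_pow n (U i).
  rewrite /B /diam_pow; case: ifPn => [_|/set0P U0]; first by rewrite measure0 mule0.
  have [-> d0] := Uid _ U0.
  rewrite -EFin_expe -EFinM -exprMn.
  rewrite (@leb_cube R n (fun j => `[(w i 0%R j - d i)%R, (w i 0%R j + d i)%R]%classic) (2 * d i)%R)//.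
  move=> j; rewrite lebesgue_measure_itv/= lte_fin.
  case: ltP => [_|]; first by rewrite -EFinB; congr EFin; ring.
  by move=> h; congr EFin; apply/eqP; rewrite eq_le; apply/andP; split; lra.
have : leb n (dyadic_cube 0 0) <= \sum_(i <oo) leb n (B i).
  apply: (measure_sigma_subadditive _ mB (measurable_dyadic_cube _ _)).
  by move=> x /cU[i _ /UB]; exists i.
rewrite leb_dyadic_cube expr0 invr1 expr1n => L1.
rewrite -[(2 ^- n)%:E]mule1 lee_pdivrMl ?exprn_gt0//.
apply: le_trans L1 _; rewrite -nneseriesZl; last by move=> i _; exact: diam_pow_ge0.
by apply: lee_nneseries => // i _.
Qed.

Lemma kappaE : exists2 k : R, (0 < k)%R & kappa = k%:E.
Proof.
have kfin : kappa \is a fin_num by rewrite ge0_fin_numE ?hausdorff_raw_ge0// kappa_lty.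
exists (fine kappa); last by rewrite fineK.
by rewrite fine_gt0// kappa_gt0 kappa_lty.
Qed.

Lemma hausdorff_open_le U : open U -> H U <= kappa * leb n U.
Proof.
have [k k0 kE] := kappaE.
move=> oU; rewrite kE; apply: outer_le_open => //.
- by move=> A; exact: hausdorff_raw_ge0.
- exact: hausdorff_raw0.
- by move=> A; exact: hausdorff_raw_subadd.
- by move=> m z; rewrite -kE; exact: hausdorff_dyadic_cube_le.
Qed.

Definition centered_cube N : set 'rV[R]_n :=
  [set x | forall i, `[(- 2 ^+ N)%R, (2 ^+ N)%R[%classic (x 0%R i)].

Lemma measurable_centered_cube N : measurable (centered_cube N).
Proof.
apply: (@measurable_box R n (fun=> `[(- 2 ^+ N)%R, (2 ^+ N)%R[%classic)) => i.
exact: measurable_itv.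
Qed.

Lemma leb_centered_cube N : leb n (centered_cube N) = ((2 ^+ N.+1) ^+ n)%:E.
Proof.
apply: (@leb_cube R n (fun=> `[(- 2 ^+ N)%R, (2 ^+ N)%R[%classic)) => i.
  exact: measurable_itv.
rewrite lebesgue_measure_itv/= lte_fin gtrN ?exprn_gt0//.
by rewrite -EFinD opprK exprS; congr EFin; ring.
Qed.

Lemma le_centered_cube i j : (i <= j)%N -> centered_cube i `<=` centered_cube j.
Proof.
move=> ij x xi k; have := xi k; rewrite /= !in_itv/=.
have : (2 ^+ i <= 2 ^+ j :> R)%R by rewrite ler_eXn2l// ltr1n.
move: (x 0%R k) (2 ^+ i : R)%R (2 ^+ j : R)%R => a b c ? /andP[? ?].
by apply/andP; split; lra.
Qed.

Lemma bigcup_centered_cube : \bigcup_N centered_cube N = setT.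
Proof.
apply/seteqP; split=> // x _.
have [N xN] : exists N, (enorm x < 2 ^+ N)%R.
  have [m] := @exists_exp2_lt R (enorm x + 1)^-1 (ltac:(by rewrite invr_gt0 ltr_wpDl ?enorm_ge0)).
  rewrite ltf_pV2 ?posrE ?exprn_gt0 ?ltr_wpDl ?enorm_ge0// => xm.
  by exists m; apply: lt_trans xm; rewrite ltrDl.
exists N => // i; have := le_lt_trans (coord_le_enorm x i) xN.
by rewrite /= in_itv/= ltr_norml => /andP[/ltW -> ->].
Qed.

(** The scaling bound read backwards: a contraction of ratio [(2 ^+ N.+1)^-1] maps the large cube
    over the unit cube. *)
Lemma hausdorff_centered_cube_ge N : kappa * leb n (centered_cube N) <= H (centered_cube N).
Proof.
have p0 : (0 < 2 ^+ N.+1 :> R)%R by rewrite exprn_gt0.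
rewrite leb_centered_cube.
pose g (x : 'rV[R]_n) := ((2 ^+ N.+1)^-1 *: (x + \row_i 2 ^+ N))%R.
have gQ : dyadic_cube 0 0 `<=` g @` centered_cube N.
  move=> x x0; exists (2 ^+ N.+1 *: x - \row_i 2 ^+ N)%R; last first.
    by rewrite /g subrK scalerA mulVf ?gt_eqF// scale1r.
  move=> i; have := x0 i; rewrite /= !mxE !in_itv/= expr0 !divr1 add0r.
  rewrite exprS; have : (0 < 2 ^+ N :> R)%R by rewrite exprn_gt0.
  move: (x 0%R i) (2 ^+ N : R)%R => a b b0 /andP[a0 a1].
  by apply/andP; split; nra.
have : kappa <= (((2 ^+ N.+1)^-1) ^+ n)%:E * H (centered_cube N).
  apply: le_trans (le_hausdorff_raw _ gQ) _.
  apply: hausdorff_raw_lipschitz => [|x y _ _]; first by rewrite invr_gt0.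
  rewrite /g -scalerBr enormZ gtr0_norm ?invr_gt0//.
  by rewrite opprD addrACA subrr addr0.
rewrite exprVn lee_pdivlMl ?exprn_gt0//.
by rewrite muleC.
Qed.

(** Outer regularity reduces the bound to open sets. It is applied to [leb] restricted to a bounded
    open set containing [A], since it was proved for finite measures. *)
Lemma hausdorff_raw_leb_bounded A N : measurable A -> A `<=` centered_cube N ->
  H A <= kappa * leb n A.
Proof.
move=> mA AN.
pose B : set 'rV[R]_n := ball 0%R (2 ^+ N.+1 : R)%R.
have oB : open B by exact: ball_open.
have mB := open_measurable_rV oB.
have p0 : (0 < 2 ^+ N.+1 :> R)%R by rewrite exprn_gt0.
have pN : (0 < 2 ^+ N :> R)%R by rewrite exprn_gt0.
have AB : A `<=` B.
  move=> x /AN xN; split=> // i j; rewrite ord1 /ball/= mxE sub0r normrN.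
  have := xN j; rewrite /= in_itv/= ltr_norml exprS.
  move: (x 0%R j) (2 ^+ N : R)%R pN => a b b0 /andP[? ?].
  by apply/andP; split; lra.
have BQ : B `<=` centered_cube N.+1.
  move=> x [_ xB] j; have := xB 0%R j; rewrite /ball/= mxE sub0r normrN in_itv/=.
  by rewrite ltr_norml => /andP[/ltW -> ->].
have Boo : leb n B < +oo.
  apply: (@le_lt_trans _ _ (leb n (centered_cube N.+1))).
    by apply: le_measure => //; rewrite inE//; exact: measurable_centered_cube.
  by rewrite leb_centered_cube ltry.
pose nu : {finite_measure set 'rV[R]_n -> \bar R} := mfrestr mB Boo.
have [k k0 kE] := kappaE; rewrite kE.
apply/lee_addgt0Pr => e e0.
have ek : (0 < e / k)%R by rewrite divr_gt0.
have [_ /(_ _ ek)[C [U [cC oU CA AU UCe]]]] := borel_regular nu mA.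
have mU := open_measurable_rV oU; have mC := closed_measurable_rV cC.
apply: (@le_trans _ _ (H (U `&` B))).
  by apply: le_hausdorff_raw => x Ax; split; [exact: AU|exact: AB].
apply: le_trans (hausdorff_open_le (openI oU oB)) _; rewrite kE.
have -> : k%:E * leb n A + e%:E = k%:E * (leb n A + (e / k)%:E).
  rewrite ge0_muleDr ?measure_ge0 ?lee_fin ?ltW//.
  by rewrite -EFinM mulrC divfK// gt_eqF.
rewrite lee_pmul2l//; apply: (@le_trans _ _ (leb n A + leb n ((U `\` C) `&` B))).
  have mUCB : measurable ((U `\` C) `&` B) by apply: measurableI => //; exact: measurableD.
  apply: le_trans (measureU2 _ mA mUCB); apply: le_measure; rewrite ?inE.
  - exact: measurableI.
  - exact: measurableU.
  - by move=> x [Ux Bx]; have [Cx|Cx] := pselect (C x); [left; exact: CA|right].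
by apply: leeD => //; exact: ltW.
Qed.

Lemma hausdorff_raw_lebE A : measurable A -> H A = kappa * leb n A.
Proof.
move=> mA; have [k k0 kE] := kappaE; have kE0 : 0 <= k%:E by rewrite lee_fin ltW.
have mAQ N : measurable (A `&` centered_cube N).
  by apply: measurableI => //; exact: measurable_centered_cube.
apply/eqP; rewrite eq_le; apply/andP; split.
  pose F := seqDU (fun N => A `&` centered_cube N).
  have FA : \bigcup_N F N = A.
    by rewrite -seqDU_bigcup_eq -setI_bigcupr bigcup_centered_cube setIT.
  have mF N : measurable (F N).
    by apply: measurableD => //; exact: bigsetU_measurable.
  rewrite -[X in H X]FA; apply: le_trans (hausdorff_raw_subadd _ _) _.
  have -> : leb n A = \sum_(N <oo) leb n (F N).
    rewrite -[in LHS]FA measure_bigcup//; last exact: trivIset_seqDU.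
    by apply: eq_eseriesl => i; rewrite in_setT.
  rewrite kE -nneseriesZl; last by move=> *; exact: measure_ge0.
  apply: lee_nneseries => [*|N _]; first exact: hausdorff_raw_ge0.
  rewrite -kE; apply: (hausdorff_raw_leb_bounded (N := N)) => // x.
  by move=> /(@subset_seqDU _ (fun N => A `&` centered_cube N))[].
(* Lower bound without additivity of [H]: on a cube [Q], [kappa * leb Q <= H Q <= H (A & Q) + H (Q -
   A)], and the last term is at most [kappa * leb (Q - A)], which is finite and can be cancelled. *)
rewrite kE -lee_pdivlMl//.
have ndAQ : nondecreasing_seq (fun N => A `&` centered_cube N).
  by move=> i j ij; apply/subsetPset; apply: setIS; exact: le_centered_cube.
have : leb n \o (fun N => A `&` centered_cube N) @ \oo --> leb n A.
  rewrite -[X in _ --> leb n X](setIT A) -bigcup_centered_cube setI_bigcupr.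
  apply: nondecreasing_cvg_mu => //.
  by rewrite -setI_bigcupr bigcup_centered_cube setIT.
move=> /ereal_cvg_le; apply=> N /=.
rewrite lee_pdivlMl//; apply: le_trans (le_hausdorff_raw _ (@subIsetl _ A (centered_cube N))).
have mQ := measurable_centered_cube N.
have QAfin : leb n (centered_cube N `\` A) \is a fin_num.
  rewrite ge0_fin_numE ?measure_ge0//; apply: (@le_lt_trans _ _ (leb n (centered_cube N))).
    by apply: le_measure; rewrite ?inE//; exact: measurableD.
  by rewrite leb_centered_cube ltry.
have kQAfin : k%:E * leb n (centered_cube N `\` A) \is a fin_num by rewrite fin_numM.
rewrite -(leeD2rE _ _ kQAfin) -ge0_muleDr ?measure_ge0//.
rewrite setIC addeC -measureDI// -kE.
apply: le_trans (hausdorff_centered_cube_ge _) _.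
apply: (@le_trans _ _ (H (centered_cube N `&` A) + H (centered_cube N `\` A))).
  apply: hausdorff_rawU.
  by move=> x Qx; have [Ax|Ax] := pselect (A x); [left|right].
apply: leeD => //; apply: (@hausdorff_raw_leb_bounded _ N); last exact: subDsetl.
exact: measurableD.
Qed.

Lemma hausdorff_leb A : measurable A -> hausdorff n A = leb n A.
Proof.
move=> mA; have [k k0 kE] := kappaE.
have mC : measurable (@unit_cube R n).
  apply: (@measurable_box R n (fun=> `[0%R, 1%R]%classic)) => i.
  exact: measurable_itv.
have C1 : leb n (@unit_cube R n) = 1.
  rewrite -(expr1n _ n); apply: (@leb_cube R n (fun=> `[0%R, 1%R]%classic)) => i.
    exact: measurable_itv.
  by rewrite lebesgue_measure_itv/= lte_fin ltr01 -EFinB subr0.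
rewrite /hausdorff (hausdorff_raw_lebE mC) (hausdorff_raw_lebE mA) kE C1 mule1 [fine _]/= muleA -EFinM.
by rewrite mulVf ?mul1e// gt_eqF.
Qed.

End hausdorff_lebesgue.

(** * Invariance under isometries *)

Section isometries.
Context {R : realType} {n m : nat}.
Variable J : 'rV[R]_n -> 'rV[R]_m.
Hypothesis isoJ : forall x y, enorm (J x - J y) = enorm (x - y).

Lemma isometry_inj : injective J.
Proof.
move=> x y xy; apply/rowP => i; have := coord_le_enorm (x - y) i.
rewrite -isoJ xy subrr [enorm 0](_ : _ = 0); last first.
  by rewrite /enorm /dot big1 ?sqrtr0// => j _; rewrite mxE mul0r.
by rewrite normr_le0 !mxE subr_eq0 => /eqP.
Qed.

(** [J] may change the dimension and need not be onto. The Lipschitz bound with constant 1 is used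
    for [J], and for a left inverse on the image of [A]. *)
Lemma hausdorff_isometry k (A : set 'rV[R]_n) : hausdorff k (J @` A) = hausdorff k A.
Proof.
rewrite /hausdorff; congr (_ * _)%E; apply/eqP; rewrite eq_le; apply/andP; split.
  rewrite -[leRHS]mul1e -[X in (X%:E * _)%E](expr1n _ k).
  by apply: hausdorff_raw_lipschitz => // x y _ _; rewrite isoJ mul1r.
pose g y := xget 0 [set x | J x = y].
have gJ x : g (J x) = x.
  by apply: isometry_inj; apply: (@xgetPex _ 0 [set z | J z = J x]); exists x.
have AE : A = g @` (J @` A).
  apply/seteqP; split=> [x Ax|_ [_ [x Ax <-] <-]]; last by rewrite gJ.
  by exists (J x); [exists x|rewrite gJ].
rewrite {1}AE -[leRHS]mul1e -[X in (X%:E * _)%E](expr1n _ k).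
apply: hausdorff_raw_lipschitz => // _ _ [x Ax <-] [y Ay <-].
by rewrite !gJ isoJ mul1r.
Qed.

Lemma hausdorff_isometry_leb (A : set 'rV[R]_n) : measurable A ->
  hausdorff n (J @` A) = leb n A.
Proof. by move=> mA; rewrite hausdorff_isometry hausdorff_leb. Qed.

End isometries.

(** Isometry invariance of Lebesgue measure is read off the Hausdorff measure, whose definition only
    sees distances; no Jacobian is computed. *)
Lemma leb_isometry {R : realType} n (J : 'rV[R]_n -> 'rV[R]_n) (A : set 'rV[R]_n) :
  (forall x y, enorm (J x - J y) = enorm (x - y)) ->
  measurable A -> measurable (J @` A) -> leb n (J @` A) = leb n A.
Proof. by move=> isoJ mA mJA; rewrite -hausdorff_leb// hausdorff_isometry// hausdorff_leb. Qed.

(** * Hyperplanes and the sphere *)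

Section density.
Context d (T : measurableType d) (R : realType).
Variables (m : {measure set T -> \bar R}) (rho : T -> R).
Hypotheses (mrho : measurable_fun [set: T] rho) (rho0 : forall x, 0 <= rho x).
Local Open Scope ereal_scope.

Definition density_measure (A : set T) : \bar R := \int[m]_(x in A) (rho x)%:E.

Let density0 : density_measure set0 = 0.
Proof. exact: integral_set0. Qed.

Let density_ge0 A : 0 <= density_measure A.
Proof. by apply: integral_ge0 => x _; rewrite lee_fin. Qed.

Let density_sigma_additive : semi_sigma_additive density_measure.
Proof.
move=> F mF tF mUF; rewrite /density_measure ge0_integral_bigcup//.
- apply: is_cvg_ereal_nneg_natsum_cond => n _ _.
  by apply: integral_ge0 => x _; rewrite lee_fin.
- by apply: measurable_funTS; exact/measurable_EFinP.
- by move=> x _; rewrite lee_fin.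
Qed.

HB.instance Definition _ := isMeasure.Build _ _ _ density_measure
  density0 density_ge0 density_sigma_additive.

Definition densm : {measure set T -> \bar R} := density_measure.

Lemma densmE A : densm A = \int[m]_(x in A) (rho x)%:E. Proof. by []. Qed.

Import HBNNSimple.

Let integral_densm_nnsfun (h : {nnsfun T >-> R}) :
  \int[densm]_x (h x)%:E = \int[m]_x ((h x)%:E * (rho x)%:E).
Proof.
have mh r : measurable (h @^-1` [set r]) by exact: measurable_funPTI.
have mr : measurable_fun [set: T] (EFin \o rho) by exact/measurable_EFinP.
rewrite integralT_nnsfun sintegralE.
transitivity (\sum_(r \in range h) \int[m]_x (r%:E * ((\1_(h @^-1` [set r]) x)%:E * (rho x)%:E))).
  apply: eq_fsbigr => r /set_mem[x _ hx].
  rewrite ge0_integralZl//.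
  - rewrite densmE integral_mkcond; congr (_ * _).
    apply: eq_integral => y _; rewrite /patch indicE.
    by case: ifP => _; rewrite ?mul1e ?mul0e.
  - apply: emeasurable_funM => //; apply/measurable_EFinP; exact: measurable_indic.
  - by move=> y _; rewrite mule_ge0 ?lee_fin.
  - by rewrite -hx lee_fin fun_ge0.
rewrite -ge0_integral_fsum//.
- apply: eq_integral => x _; rewrite (fsbigD1 (h x))/=; last 2 first.
    exact: fimfunP.
    by exists x.
  rewrite indicE mem_set// mul1e fsbig1 ?adde0// => r [_ /= rh].
  by rewrite indicE memNset ?mul0e ?mule0// => /= hr; apply: rh.
- move=> r; apply: emeasurable_funM => //; apply: emeasurable_funM => //.
  by apply/measurable_EFinP; exact: measurable_indic.
- move=> r x _; rewrite indicE; have [/set_mem /= <-|_] := boolP (x \in _).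
    by rewrite mul1e mule_ge0 ?lee_fin// fun_ge0.
  by rewrite mul0e mule0.
Qed.

Lemma ge0_integral_densm (f : T -> \bar R) :
  measurable_fun [set: T] f -> (forall x, 0 <= f x) ->
  \int[densm]_x f x = \int[m]_x (f x * (rho x)%:E).
Proof.
move=> mf f0; pose g := nnsfun_approx measurableT mf.
have gf x : (g k x)%:E @[k --> \oo] --> f x by exact: cvg_nnsfun_approx.
have ndg x : nondecreasing_seq (fun k => (g k x)%:E).
  by move=> i j ij; rewrite lee_fin; apply/lefP; exact: nd_nnsfun_approx.
have mg k : measurable_fun [set: T] (fun x => (g k x)%:E) by exact/measurable_EFinP.
have mr : measurable_fun [set: T] (EFin \o rho) by exact/measurable_EFinP.
have fE : f = fun x => limn (fun k => (g k x)%:E).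
  by apply/funext => x; exact/esym/cvg_lim.
rewrite {1}fE monotone_convergence//; last by move=> k x _; rewrite lee_fin.
have frE x : f x * (rho x)%:E = limn (fun k => (g k x)%:E * (rho x)%:E).
  by apply/esym/cvg_lim => //; exact: cvgeZr.
under [RHS]eq_integral do rewrite frE.
rewrite monotone_convergence//.
- by congr (limn _); apply/funext => k; exact: integral_densm_nnsfun.
- by move=> k; exact: emeasurable_funM.
- by move=> k x _; rewrite mule_ge0 ?lee_fin.
- by move=> x _ i j ij; rewrite lee_wpmul2r ?lee_fin// -lee_fin ndg.
Qed.

End density.

Section householder.
Context {R : realType} {n : nat}.
Implicit Types v z : 'rV[R]_(1 + n).

Definition e0 : 'rV[R]_(1 + n) := row_mx 1%:M 0.

(* The reflection exchanging [e0] and a unit vector [v]; when [v = e0] the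
   convention [x / 0 = 0] makes it the identity, as it should be. *)
Definition refl v z : 'rV[R]_(1 + n) :=
  z - (2 * dot (e0 - v) z / dot (e0 - v) (e0 - v)) *: (e0 - v).

Lemma dot_eq0 z : dot z z = 0 -> z = 0.
Proof.
move=> zz; apply/rowP => i; apply/eqP; rewrite mxE -normr_le0.
by rewrite (le_trans (coord_le_enorm _ _))// /enorm zz sqrtr0.
Qed.

Lemma dot_refl v z z' : dot (refl v z) (refl v z') = dot z z'.
Proof.
rewrite /refl; move: (e0 - v) => w.
have [ww|ww] := eqVneq (dot w w) 0.
  by rewrite ww invr0 !mulr0 !scale0r !subr0.
rewrite !dotBl !dotBr !dotZl !dotZr (dotC z w); field.
by [].
Qed.

Lemma reflB v z z' : refl v z - refl v z' = refl v (z - z').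
Proof.
rewrite /refl; move: (e0 - v) => w.
by rewrite dotBr; apply/rowP => i; rewrite !mxE; ring.
Qed.

Lemma enorm_refl v z z' : enorm (refl v z - refl v z') = enorm (z - z').
Proof. by rewrite reflB /enorm dot_refl. Qed.

Lemma reflK v : involutive (refl v).
Proof.
move=> z; rewrite /refl; move: (e0 - v) => w.
have [ww|ww] := eqVneq (dot w w) 0.
  by rewrite ww invr0 !mulr0 !scale0r !subr0.
rewrite dotBr dotZr divfK// -addrA -opprD -scalerDl.
rewrite (_ : 2 * dot w z / dot w w + 2 * (dot w z - 2 * dot w z) / dot w w = 0).
  by rewrite scale0r subr0.
by field.
Qed.

Lemma refl_e0 v : dot v v = 1 -> refl v e0 = v.
Proof.
move=> vv; rewrite /refl.
have e00 : dot e0 e0 = 1.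
  by rewrite /dot big_ord_recl big1 => [|i _]; rewrite ?row_mx_ord0 ?row_mx_lift0 ?mxE ?mulr1 ?addr0 ?mulr0.
have wE : dot (e0 - v) (e0 - v) = 2 * dot (e0 - v) e0.
  by rewrite !dotBl !dotBr e00 vv (dotC v e0); ring.
have [ww|ww] := eqVneq (dot (e0 - v) (e0 - v)) 0.
  have /eqP := dot_eq0 ww; rewrite subr_eq0 => /eqP e0v.
  by rewrite ww invr0 mulr0 scale0r subr0 e0v.
by rewrite -wE divff// scale1r opprB addrC subrK.
Qed.

Lemma dot_row_mx (x x' : R) (y y' : 'rV[R]_n) :
  dot (row_mx x%:M y : 'rV[R]_(1 + n)) (row_mx x'%:M y') = x * x' + dot y y'.
Proof.
rewrite /dot big_ord_recl !row_mx_ord0; congr (_ + _).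
by apply: eq_bigr => i _; rewrite !row_mx_lift0.
Qed.

(** For a unit vector [v] the reflection sends [e0] to [v], hence maps the hyperplane of vanishing
    first coordinate isometrically onto the one orthogonal to [v]. The formula is jointly measurable
    in [v] and [y], as the outer integral over [v] requires. *)
Definition hyper_param v (y : 'rV[R]_n) : 'rV[R]_(1 + n) := refl v (row_mx 0%:M y).

Lemma enorm_hyper_param v y y' : enorm (hyper_param v y - hyper_param v y') = enorm (y - y').
Proof.
rewrite enorm_refl /enorm opp_row_mx add_row_mx -raddfB subr0.
by rewrite dot_row_mx mulr0 add0r.
Qed.

Lemma hyper_param_orth v y : dot v v = 1 -> dot v (hyper_param v y) = 0.
Proof.
move=> vv; rewrite -{1}(refl_e0 vv) dot_refl /e0 dot_row_mx mulr0 add0r.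
by rewrite /dot big1// => i _; rewrite mxE mul0r.
Qed.

Lemma orth_hyper_param v z : dot v v = 1 -> dot v z = 0 ->
  hyper_param v (rsubmx (refl v z)) = z.
Proof.
move=> vv vz; rewrite /hyper_param.
suff -> : row_mx 0%:M (rsubmx (refl v z)) = refl v z :> 'rV[R]_(1 + n) by rewrite reflK.
rewrite [RHS]rV_decomp; congr (row_mx _%:M _); apply/esym.
have <- : dot e0 (refl v z) = refl v z 0 0.
  by rewrite [in LHS](rV_decomp (refl v z)) /e0 dot_row_mx mul1r /dot big1 ?addr0// => i _; rewrite mxE mul0r.
by rewrite -(dot_refl v) reflK refl_e0.
Qed.

Lemma measurable_dot d (T : measurableType d) k (f g : T -> 'rV[R]_k) :
  measurable_fun [set: T] f -> measurable_fun [set: T] g ->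
  measurable_fun [set: T] (fun t => dot (f t) (g t)).
Proof.
move=> mf mg; apply: measurable_sum => i; apply: measurable_funM.
  exact: (measurableT_comp (measurable_rV_coord i) mf).
exact: (measurableT_comp (measurable_rV_coord i) mg).
Qed.

End householder.

Lemma measurable_invr (R : realType) : measurable_fun [set: R] (fun x : R => x^-1).
Proof.
rewrite (_ : [set: R] = ~` [set 0] `|` [set 0]); last by rewrite setUC setUv.
apply/measurable_funU => //; first exact: measurableC.
split.
  apply: open_continuous_measurable_fun; first by apply: closed_openC; exact: closed_eq.
  by move=> x /set_mem /= /eqP x0; apply: continuousV.
by apply: measurable_fun_set1.
Qed.

Section hyperplane_integral.
Context {R : realType} {n : nat}.

Lemma measurable_refl d (T : measurableType d) (f g : T -> 'rV[R]_(1 + n)) :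
  measurable_fun [set: T] f -> measurable_fun [set: T] g ->
  measurable_fun [set: T] (fun t => refl (f t) (g t)).
Proof.
move=> mf mg; have mw : measurable_fun [set: T] (fun t => e0 - f t).
  apply: measurable_fun_rV => i; under eq_fun do rewrite !mxE.
  apply: measurable_funB => //.
  exact: (measurableT_comp (measurable_rV_coord i) mf).
apply: measurable_fun_rV => i.
have E t : refl (f t) (g t) 0 i = g t 0 i -
    2 * dot (e0 - f t) (g t) / dot (e0 - f t) (e0 - f t) * (e0 - f t) 0 i.
  by rewrite /refl mxE [X in _ + X]mxE [X in - X]mxE.
under eq_fun do rewrite E.
apply: measurable_funB; first exact: (measurableT_comp (measurable_rV_coord i) mg).
apply: measurable_funM; last exact: (measurableT_comp (measurable_rV_coord i) mw).
apply: measurable_funM.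
  by apply: measurable_funM => //; exact: measurable_dot.
by apply: (measurableT_comp (@measurable_invr R)); exact: measurable_dot.
Qed.

Lemma measurable_hyper_param d (T : measurableType d) (f : T -> 'rV[R]_(1 + n))
    (g : T -> 'rV[R]_n) :
  measurable_fun [set: T] f -> measurable_fun [set: T] g ->
  measurable_fun [set: T] (fun t => hyper_param (f t) (g t)).
Proof.
move=> mf mg; apply: measurable_refl => //.
exact: (measurableT_comp (@measurable_row_mxr R n 0)).
Qed.

Lemma orth_hyperplaneE v : dot v v = 1 -> orth_hyperplane v = range (@hyper_param R n v).
Proof.
move=> vv; apply/seteqP; split=> [z /= vz|_ [y _ <-]]; last exact: hyper_param_orth.
by exists (rsubmx (refl v z)) => //; exact: orth_hyper_param.
Qed.

(** On Borel subsets of the hyperplane the Hausdorff measure is the image of [leb n] by the isometry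
    [hyper_param v], and the integral evaluates it on no other set. *)
Lemma integral_orth_hyperplane (v : 'rV[R]_(1 + n)) (f : 'rV[R]_(1 + n) -> \bar R) :
  dot v v = 1 -> measurable_fun [set: 'rV[R]_(1 + n)] f -> (forall y, (0 <= f y)%E) ->
  (\int[hausdorff n (n := n.+1)]_(y in orth_hyperplane v) f y =
   \int[leb n]_y f (hyper_param v y))%E.
Proof.
move=> vv mf f0.
have mh : measurable_fun [set: 'rV[R]_n] (hyper_param v).
  by apply: (@measurable_hyper_param _ _ (cst v) id).
have mo : measurable (@orth_hyperplane R n v).
  rewrite (_ : orth_hyperplane v = (fun y => dot v y) @^-1` [set 0]); last by [].
  rewrite -[X in measurable X]setTI.
  by have := @measurable_dot R _ _ (1 + n) (cst v) id (measurable_cst _) (@measurable_id _ _ _); apply.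
transitivity (\int[mpush (leb n) mh]_(y in @orth_hyperplane R n v) f y)%E.
  apply: eq_set_function_integral => B mB Bo; rewrite mpushE.
  have mPB : measurable (hyper_param v @^-1` B).
    by rewrite -[X in measurable X]setTI; exact: mh.
  transitivity (hausdorff n (hyper_param v @` (hyper_param v @^-1` B))); last first.
    by apply: hausdorff_isometry_leb => //; exact: enorm_hyper_param.
  congr (hausdorff n _); apply/seteqP; split=> [z Bz|_ [y By <-]//].
  have := Bo _ Bz; rewrite orth_hyperplaneE// => -[y _ yz].
  by exists y; rewrite /preimage/= ?yz.
rewrite (ge0_integral_pushforward mh)//; last exact: measurable_funTS.
rewrite (_ : _ @^-1` _ = setT)//; apply/seteqP; split=> // y _.
exact: hyper_param_orth.
Qed.

End hyperplane_integral.

(** * Riemannian measure of the sphere in the hemisphere charts *)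

Section sphere_integral.
Context {R : realType} {n : nat}.

(** Matrix determinant lemma: the block matrix [M] is factored in two ways, by eliminating one or
    the other of its diagonal blocks. *)
Lemma det_add_rank1 (c : R) (y : 'rV[R]_n) :
  \det (1%:M + c *: (y^T *m y)) = 1 + c * dot y y.
Proof.
pose M := block_mx (1%:M : 'M[R]_1) (- c *: y) y^T (1%:M : 'M[R]_n).
have -> : 1 + c * dot y y = \det M.
  have -> : M = block_mx (1 + c * dot y y)%:M (- c *: y) 0 1%:M *m block_mx 1%:M 0 y^T 1%:M.
    rewrite mulmx_block !mul0mx !mulmx0 !mulmx1 !mul1mx add0r /M.
    congr block_mx; last by rewrite add0r.
    - rewrite -scalemxAl; apply/matrixP => i j; rewrite !ord1 !mxE /=.
      under eq_bigr do rewrite mxE.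
      by rewrite -/(dot y y) mulNr addrK.
    - by rewrite add0r.
  by rewrite det_mulmx (@det_ublock _ 1) (@det_lblock _ 1) !det1 det_scalar1 !mulr1.
have -> : M = block_mx 1%:M 0 y^T 1%:M *m block_mx 1%:M (- c *: y) 0 (1%:M + c *: (y^T *m y)).
  rewrite mulmx_block !mul0mx !mulmx0 !mulmx1 !mul1mx !addr0 /M.
  congr block_mx; rewrite -scalemxAr addrA scaleNr addrC addrA.
  by rewrite subrK || by rewrite addrN add0r.
by rewrite det_mulmx (@det_ublock _ 1) (@det_lblock _ 1) !det1 !mul1r.
Qed.

Lemma chart_partialE (s : R) (y : 'rV[R]_n) i : dot y y < 1 ->
  chart_partial s y i =
    row_mx (- s * y 0 i / Num.sqrt (1 - dot y y))%:M (delta_mx 0 i) :> 'rV[R]_(1 + n).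
Proof.
move=> y1; have y10 : 0 < 1 - dot y y by rewrite subr_gt0.
apply/rowP => j; rewrite mxE.
case: (unliftP 0 j) => [k ->|->].
  rewrite row_mx_lift0 (_ : (fun _ => _) = (fun t => y 0 k + t * (delta_mx 0 i : 'rV[R]_n) 0 k)); last first.
    by apply/funext => t; rewrite /sphere_chart row_mx_lift0 !mxE.
  rewrite derive1E; apply: derive_val.
  apply: is_derive_eq.
  by rewrite add0r mul1r scaler0 add0r [_%:A]mulr1.
rewrite row_mx_ord0.
rewrite (_ : (fun _ => _) = (fun t => s * Num.sqrt (1 - dot y y - t * (2 * y 0 i) - t * t))); last first.
  apply/funext => t; rewrite /sphere_chart row_mx_ord0; congr (_ * Num.sqrt _).
  have dyi : dot y (delta_mx 0 i) = y 0 i.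
    rewrite /dot (bigD1 i)//= mxE !eqxx mulr1 big1 ?addr0// => k ki.
    by rewrite mxE (negbTE ki) andbF mulr0.
  have dii : dot (delta_mx 0 i) (delta_mx 0 i) = 1 :> R.
    rewrite /dot (bigD1 i)//= mxE !eqxx mulr1 big1 ?addr0// => k ki.
    by rewrite mxE (negbTE ki) andbF mulr0.
  by rewrite !dotDl !dotDr !dotZl !dotZr dii (dotC _ y) dyi; ring.
pose g (t : R) : R := 1 - dot y y - t * (2 * y 0 i) - t * t.
have dg : is_derive (0 : R) 1 g (- (2 * y 0 i)).
  apply: is_derive_eq.
  by rewrite !scale0r !add0r subr0 mul1r; congr (- _); exact: mulr1.
have g0 : g 0 = 1 - dot y y by rewrite /g !mul0r !subr0.
have ds : is_derive (g 0) 1 Num.sqrt (2 * Num.sqrt (g 0))^-1 by apply: is_derive1_sqrt; rewrite g0.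
have dsg := @is_derive1_comp _ _ _ _ _ _ ds dg.
have dd := is_deriveZ s dsg; rewrite derive1E.
transitivity ('D_1 (s *: (Num.sqrt \o g)) (0 : R)); first by [].
rewrite (@derive_val _ _ _ _ _ _ _ dd).
rewrite g0 /GRing.scale/=; field.
by rewrite sqrtr_eq0 -ltNge.
Qed.

(** The metric is the identity plus the rank one matrix [y^T *m y] divided by [1 - dot y y]. *)
Lemma det_chart_metric (s : R) (y : 'rV[R]_n) : s ^+ 2 = 1 -> dot y y < 1 ->
  \det (chart_metric s y) = (1 - dot y y)^-1.
Proof.
move=> s2 y1; have y10 : 0 < 1 - dot y y by rewrite subr_gt0.
have -> : chart_metric s y = 1%:M + (1 - dot y y)^-1 *: (y^T *m y).
  apply/matrixP => i j; rewrite mxE !chart_partialE// dot_row_mx.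
  rewrite !mxE big_ord1 !mxE [LHS]addrC; congr (_ + _).
    rewrite [LHS]/dot (bigD1 i)//= !mxE !eqxx mul1r big1 ?addr0 => [|k ki].
      by rewrite eq_sym.
    by rewrite mxE (negbTE ki) andbF mul0r.
  have y1s : (Num.sqrt (1 - dot y y)) ^+ 2 = 1 - dot y y by rewrite sqr_sqrtr// ltW.
  have sn0 : Num.sqrt (1 - dot y y) != 0 by rewrite sqrtr_eq0 -ltNge.
  rewrite -[in RHS]y1s.
  transitivity (s ^+ 2 * (y 0 i * y 0 j) / Num.sqrt (1 - dot y y) ^+ 2); first by field.
  by rewrite s2 mul1r mulrC.
rewrite det_add_rank1; field.
by rewrite gt_eqF.
Qed.

Definition sphere_density (y : 'rV[R]_n) : R :=
  if dot y y < 1 then (Num.sqrt (1 - dot y y))^-1 else 0.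

Lemma sphere_density_ge0 y : 0 <= sphere_density y.
Proof. by rewrite /sphere_density; case: ifP => // _; rewrite invr_ge0 sqrtr_ge0. Qed.

Lemma measurable_sqrt : measurable_fun [set: R] (@Num.sqrt R).
Proof. by apply: continuous_measurable_fun => x; exact: sqrt_continuous. Qed.

Lemma measurable_sphere_density : measurable_fun [set: 'rV[R]_n] sphere_density.
Proof.
have mdot : measurable_fun [set: 'rV[R]_n] (fun y => dot y y) by exact: measurable_dot.
apply: measurable_fun_ifT => //.
- exact: measurable_fun_ltr.
- apply: (measurableT_comp (@measurable_invr R)).
  apply: (measurableT_comp measurable_sqrt); exact: measurable_funB.
Qed.

Lemma measurable_sphere_chart s : measurable_fun [set: 'rV[R]_n] (@sphere_chart R n s).
Proof.
apply: (measurableT_comp (@measurable_row_mx R n)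
  (g := fun y : 'rV[R]_n => (s * Num.sqrt (1 - dot y y), y))).
apply/measurable_fun_pairP; split => /=.
  apply: measurable_funM => //; apply: (measurableT_comp measurable_sqrt).
  by apply: measurable_funB => //; exact: measurable_dot.
exact: measurable_id.
Qed.

Lemma dot_sphere_chart s (y : 'rV[R]_n) : s ^+ 2 = 1 -> dot y y <= 1 ->
  dot (sphere_chart s y) (sphere_chart s y) = 1.
Proof.
move=> s2 y1; rewrite /sphere_chart dot_row_mx mulrACA -!expr2 s2 mul1r sqr_sqrtr ?subr_ge0//.
by rewrite subrK.
Qed.

Lemma enorm_lt1 k (y : 'rV[R]_k) : (enorm y < 1) = (dot y y < 1).
Proof. by rewrite -{1}(sqrtr1 R) ltr_sqrt. Qed.

Lemma enorm_eq1 k (y : 'rV[R]_k) : (enorm y = 1) <-> (dot y y = 1).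
Proof.
split=> [y1|]; first by rewrite -sqr_enorm y1 expr1n.
by rewrite /enorm => ->; rewrite sqrtr1.
Qed.

Lemma measurable_sphere : measurable (@sphere R n).
Proof.
rewrite (_ : sphere = (fun v : 'rV[R]_(1 + n) => dot v v) @^-1` [set 1]).
  rewrite -[X in measurable X]setTI.
  by have := @measurable_dot R _ _ (1 + n) id id (@measurable_id _ _ _) (@measurable_id _ _ _); apply.
by apply/seteqP; split=> v /enorm_eq1.
Qed.

Definition chart_measure (s : R) : {measure set 'rV[R]_(1 + n) -> \bar R} :=
  mpush (densm (leb n) measurable_sphere_density sphere_density_ge0) (measurable_sphere_chart s).

Lemma sphere_measureE A : measurable A ->
  sphere_measure A = (chart_measure 1 A + chart_measure (-1) A)%E.
Proof.
move=> mA; rewrite /sphere_measure big_cons big_seq1.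
suff E s : s ^+ 2 = 1 ->
  (\int[lebesgue_rV n]_(y in [set y | (enorm y < 1)%R /\ A (sphere_chart s y)])
     (Num.sqrt (\det (chart_metric s y)))%:E = chart_measure s A)%E.
  by rewrite !E ?sqrrN ?expr1n.
move=> s2; rewrite integral_lebesgue_rV /chart_measure mpushE densmE.
rewrite [LHS]integral_mkcond [RHS]integral_mkcond; apply: eq_integral => y _.
rewrite /patch /sphere_density; case: (boolP (dot y y < 1)) => y1; last first.
  rewrite memNset; last by move=> /= [+ _]; rewrite enorm_lt1 (negbTE y1).
  by case: ifP.
case: (boolP (y \in _ @^-1` A)) => [|yA].
  rewrite inE => yA; rewrite mem_set//=; last by rewrite enorm_lt1.
  by rewrite det_chart_metric// sqrtrV// subr_ge0 ltW.
by rewrite memNset// => -[_ Ay]; move/negP: yA; apply; rewrite inE.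
Qed.

Lemma integral_sphere (f : 'rV[R]_(1 + n) -> \bar R) :
  measurable_fun [set: 'rV[R]_(1 + n)] f -> (forall v, (0 <= f v)%E) ->
  (\int[@sphere_measure R n]_(v in @sphere R n) f v =
   \int[leb n]_y (f (sphere_chart 1 y) * (sphere_density y)%:E) +
   \int[leb n]_y (f (sphere_chart (-1) y) * (sphere_density y)%:E))%E.
Proof.
move=> mf f0.
rewrite (eq_set_function_integral (m2 := measure_add (chart_measure 1) (chart_measure (-1)))); last first.
  by move=> A mA _; rewrite sphere_measureE// measure_addE.
rewrite ge0_integral_measure_add//; last exact: measurable_funTS.
  suff E s : s ^+ 2 = 1 -> (\int[chart_measure s]_(v in @sphere R n) f v =
     \int[leb n]_y (f (sphere_chart s y) * (sphere_density y)%:E))%E.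
    by rewrite !E ?sqrrN ?expr1n.
  move=> s2; rewrite integral_mkcond ge0_integral_mpush; last 2 first.
    by apply/(measurable_restrictT _ measurable_sphere); exact: measurable_funTS.
    by move=> v; rewrite /patch; case: ifP.
  rewrite ge0_integral_densm; last 2 first.
    apply: (measurableT_comp _ (measurable_sphere_chart s)).
    by apply/(measurable_restrictT _ measurable_sphere); exact: measurable_funTS.
    by move=> v; rewrite /patch; case: ifP.
  apply: eq_integral => y _; rewrite /patch /sphere_density.
  case: (boolP (dot y y < 1)) => [y1|_]; last by rewrite !mule0.
  by rewrite mem_set//; apply/enorm_eq1/dot_sphere_chart => //; exact: ltW.
exact: measurable_sphere.
Qed.

End sphere_integral.

(** * Polar coordinates *)

Section change_of_variables.
Context {R : realType}.
Local Notation mu := (@lebesgue_measure R).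
Variables (F f : R -> R) (a : R).
Hypotheses (incrF : forall x y, a <= x -> x < y -> F x < F y)
  (surjF : forall y, F a < y -> exists2 x, a < x & F x = y)
  (cf : continuous f) (dF : forall x : R, is_derive x (1 : R) F (f x))
  (f0 : forall x, a < x -> 0 <= f x).

Let cF : continuous F.
Proof. by move=> x; apply: differentiable_continuous; apply/derivable1_diffP; exact: ex_derive. Qed.

Let rho x := if a < x then f x else 0.

Let rho0 x : 0 <= rho x. Proof. by rewrite /rho; case: ifP => // /f0. Qed.

Let mrho : measurable_fun [set: R] rho.
Proof.
apply: measurable_fun_ifT => //; first exact: measurable_fun_ltr.
exact: continuous_measurable_fun.
Qed.

Let mF : measurable_fun [set: R] F. Proof. exact: continuous_measurable_fun. Qed.

Let nu := mpush (densm mu mrho rho0) (mF : measurable_fun [set: measurableTypeR R] (F : R -> measurableTypeR R)).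

Let mFa : measurable (`]-oo, F a]%classic : set R). Proof. exact: measurable_itv. Qed.

Let FTC p q : a <= p -> p < q ->
  (\int[mu]_(x in `]p, q]) (f x)%:E = (F q - F p)%:E)%E.
Proof.
move=> ap pq.
rewrite integral_itv_obnd_cbnd; last by apply: measurable_funTS; apply/measurable_EFinP; exact: continuous_measurable_fun.
rewrite (continuous_FTC2 (F := F))//.
- exact: continuous_subspaceT.
- split=> [x _||]; first exact: ex_derive.
  + by apply: cvg_at_right_filter; exact: cF.
  + by apply: cvg_at_left_filter; exact: cF.
- by move=> x _; rewrite derive1E; exact: derive_val.
Qed.

Let ltF x y : a <= x -> a <= y -> (F x < F y) = (x < y).
Proof.
move=> ax ay; apply/idP/idP => [|xy]; last exact: incrF.
by rewrite !ltNge; apply: contra; rewrite le_eqVlt => /predU1P[->//|/(incrF ay)/ltW].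
Qed.

Let leF x y : a <= x -> a <= y -> (F x <= F y) = (x <= y).
Proof. by move=> ax ay; rewrite !leNgt ltF. Qed.

Let nu_oc c d : nu `]c, d]%classic =
  if F a < d then (if F a < c then mu `]c, d]%classic else (d - F a)%:E) else 0%E.
Proof.
rewrite /nu mpushE densmE.
case: ifPn => [ad|]; last first.
  rewrite -leNgt => da; apply: integral0_eq => x /=; rewrite in_itv/= => /andP[_ Fxd].
  rewrite /rho; case: ifPn => // ax; have := incrF (lexx a) ax.
  by rewrite ltNge (le_trans Fxd da).
have [q aq qd] := surjF ad; have aq' := ltW aq.
suff main p : a <= p -> p < q -> (forall x, a < x -> (c < F x) = (p < x)) ->
    (\int[mu]_(x in F @^-1` `]c, d]) (rho x)%:E = (F q - F p)%:E)%E.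
  case: ifPn => [ac|].
    have [p ap pc] := surjF ac; have ap' := ltW ap.
    have [cd|dc] := ltP c d; last first.
      rewrite lebesgue_measure_oc ltNge dc/=.
      apply: integral0_eq => x /=; rewrite in_itv/= => /andP[cFx Fxd].
      by move: (lt_le_trans cFx Fxd); rewrite ltNge dc.
    rewrite lebesgue_measure_oc cd (main p) ?pc ?qd//; first by rewrite -ltF// pc qd.
    by move=> x /ltW ax; rewrite -pc ltF.
  rewrite -leNgt => ca; rewrite (main a) ?qd// => x ax.
  by rewrite ax (le_lt_trans ca)// incrF.
move=> ap pq cp; rewrite -(FTC ap pq).
rewrite [LHS]integral_mkcond [RHS]integral_mkcond; apply: eq_integral => x _.
rewrite /patch /rho; have [ax|xa] := ltP a x; last first.
  rewrite [in RHS]memNset; first by case: ifP.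
  by rewrite /= in_itv/= => /andP[px _]; move: (le_lt_trans ap px); rewrite ltNge xa.
have -> : (x \in F @^-1` `]c, d]%classic) = (x \in `]p, q]%classic).
  by apply/idP/idP; rewrite !inE /= !in_itv/= cp// -qd leF// ltW.
by [].
Qed.

(** The image under [F] of the measure of density [f] on []a, +oo[], completed by [mu] below [F a],
    gives half-open intervals their length by the fundamental theorem of calculus; hence it is
    [mu]. *)
Lemma ge0_integral_subst (h : R -> \bar R) : measurable_fun [set: R] h ->
  (forall x, (0 <= h x)%E) ->
  (\int[mu]_(y in `]F a, +oo[) h y = \int[mu]_(x in `]a, +oo[) (h (F x) * (f x)%:E))%E.
Proof.
move=> mh h0.
pose m : {measure set (measurableTypeR R) -> \bar R} := measure_add nu (mrestr mu mFa).
have mE A : measurable A -> mu A = m A.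
  apply: lebesgue_measure_unique => _ [[c d] _ <-].
  rewrite /m [RHS]measure_addE.
  have E : mrestr mu mFa `]c, d]%classic = mu (`]c, Num.min d (F a)]%classic).
    rewrite /mrestr /=; congr (_ _); apply/seteqP; split=> x /=; rewrite !in_itv/= le_min.
      by case=> /andP[-> ->] ->.
    by case/and3P => -> -> ->.
  transitivity (nu `]c, d]%classic + mu (`]c, Num.min d (F a)]%classic))%E; last by rewrite -E.
  rewrite nu_oc {E} !lebesgue_measure_oc lt_min minEle.
  have [ad|da] := ltP (F a) d; have [ac|ca] := leP (F a) c; have [ac'|ca'] := ltP (F a) c;
    have [cd|dc] := ltP c d => /=;
    rewrite ?adde0 ?add0e ?andbF ?ltNge ?ca' ?ca ?dc ?(ltW ad) ?(ltW ac') ?ac ?da /=; try by [];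
    try (exfalso; lra); try (by rewrite -?EFinD; congr EFin; lra).
have mnu A : measurable A -> A `<=` `]F a, +oo[%classic -> mu A = nu A.
  move=> mA AF; rewrite (mE _ mA) [LHS]measure_addE -[RHS]adde0; congr (_ + _)%E.
  change (mu (A `&` `]-oo, F a]%classic) = 0%E).
  suff -> : A `&` `]-oo, F a]%classic = set0 by rewrite measure0.
  apply/seteqP; split=> // x /= [/AF/=]; rewrite !in_itv/= andbT => ax.
  by rewrite leNgt ax.
have mG : measurable_fun [set: R] (fun y => (h \_ `]F a, +oo[%classic) y).
  apply/(measurable_restrictT _ _).1; first exact: measurable_itv.
  exact: measurable_funTS.
rewrite (eq_measure_integral nu); last exact: mnu.
have h0' y : (0 <= (h \_ `]F a, +oo[%classic) y)%E by rewrite /patch; case: ifP.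
rewrite integral_mkcond.
transitivity (\int[densm mu mrho rho0]_x (h \_ `]F a, +oo[%classic) (F x))%E.
  exact: ge0_integral_mpush.
rewrite ge0_integral_densm; [|exact: (measurableT_comp mG mF)|by []].
rewrite [RHS]integral_mkcond; apply: eq_integral => x _.
rewrite /rho /patch; have [ax|xa] := ltP a x.
  by rewrite !mem_set//= in_itv/= andbT ?incrF.
by rewrite [in RHS]memNset ?mule0//= in_itv/= andbT ltNge xa.
Qed.

End change_of_variables.

Section polar.
Context {R : realType}.
Local Notation mu := (@lebesgue_measure R).

Lemma ge0_integral_opp1 (f : R -> \bar R) : measurable_fun [set: R] f ->
  (forall x, (0 <= f x)%E) -> (\int[mu]_x f (- x)%R = \int[mu]_x f x)%E.
Proof.
move=> mf f0.
have mN : measurable_fun [set: R] ((fun x : measurableTypeR R => - x) : R -> measurableTypeR R).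
  exact: measurable_funN.
transitivity (\int[mpush mu mN]_x f x)%E; first by apply/esym; exact: ge0_integral_mpush.
apply: eq_measure_integral => A mA _; apply/esym.
apply: (lebesgue_measure_unique (mu := mpush mu mN)) => // _ [[c d] _ <-].
have -> : mpush mu mN `](c, d).1, (c, d).2]%classic = mu `[- d, - c[%classic.
  rewrite mpushE; congr (mu _).
  by apply/seteqP; split => x /=; rewrite !in_itv/= ltrNr lerNl andbC.
by rewrite !lebesgue_measure_itv/= !lte_fin ltrN2 !EFinN oppeK addeC.
Qed.

(** Substitution [r = sqrt (x ^ 2 + c)]. With [c] the squared norm of the other coordinates, it
    exchanges the radius [r] for the first coordinate [x]. *)
Lemma integral_subst_sqrt (c : R) (h : R -> \bar R) : 0 <= c ->
  measurable_fun [set: R] h -> (forall x, (0 <= h x)%E) ->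
  (\int[mu]_(r in `]0%R, +oo[) (if (c < r ^+ 2)%R then h r else 0)
   = \int[mu]_(x in `]0%R, +oo[) (h (Num.sqrt (x ^+ 2 + c)) * (x / Num.sqrt (x ^+ 2 + c))%:E))%E.
Proof.
(* For [c = 0] the substitution is the identity on positive [x], but the quotient [x / sqrt (x ^ 2)]
   jumps at 0, where the general argument asks for continuity. *)
move=> c0 mh h0; move: c0; rewrite le_eqVlt => /predU1P[<-|c0].
  apply: eq_integral => x /[!inE]/=; rewrite in_itv/= andbT => x0.
  by rewrite addr0 sqrtr_sqr gtr0_norm// exprn_gt0// divff ?mule1 ?gt_eqF.
pose F (x : R) := Num.sqrt (x ^+ 2 + c).
pose f (x : R) := x / Num.sqrt (x ^+ 2 + c).
have p0 x : 0 < x ^+ 2 + c by rewrite ltr_wpDl ?sqr_ge0.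
have F0 : F 0 = Num.sqrt c by rewrite /F expr0n/= add0r.
transitivity (\int[mu]_(r in `]F 0%R, +oo[) h r)%E.
  rewrite [LHS]integral_mkcond [RHS]integral_mkcond; apply: eq_integral => x _.
  rewrite /patch F0 !mem_setE !in_itv/= !andbT.
  have [x0|x0] := ltP 0 x; last by rewrite ltNge (le_trans x0)// sqrtr_ge0.
  suff -> : (Num.sqrt c < x) = (c < x ^+ 2) by [].
  by rewrite -[X in _ < X](gtr0_norm x0) -sqrtr_sqr ltr_sqrt ?exprn_gt0.
apply: (@ge0_integral_subst _ F f) => //.
- move=> x y x0 xy; rewrite /F ltr_sqrt ?p0// ltrD2r ltr_pXn2r// nnegrE//.
  by rewrite (le_trans x0)// ltW.
- move=> y; rewrite F0 => cy; have y0 : 0 < y by rewrite (le_lt_trans (sqrtr_ge0 _) cy).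
  have cy2 : c < y ^+ 2 by rewrite -(sqr_sqrtr (ltW c0)) ltr_pXn2r// nnegrE ?sqrtr_ge0// ltW.
  exists (Num.sqrt (y ^+ 2 - c)); first by rewrite sqrtr_gt0 subr_gt0.
  by rewrite /F sqr_sqrtr ?subr_ge0 ?(ltW cy2)// subrK sqrtr_sqr gtr0_norm.
- move=> x; apply: cvgM; first exact: cvg_id.
  apply: cvgV; first by rewrite gt_eqF// sqrtr_gt0.
  apply: continuous_comp; last exact: sqrt_continuous.
  by apply: cvgD; [exact: exprn_continuous|exact: cvg_cst].
- move=> x.
  have h1 : is_derive x 1 (fun x : R => x ^+ 2 + c) (2 * x).
    by apply: is_derive_eq; rewrite addr0 /GRing.scale/= !mulr1; ring.
  have h2 := is_derive1_sqrt (p0 x).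
  have := @is_derive1_comp R Num.sqrt (fun x : R => x ^+ 2 + c) x _ _ h2 h1.
  move/is_derive_eq; apply; rewrite /f /GRing.scale/=.
  have : Num.sqrt (x ^+ 2 + c) != 0 by rewrite gt_eqF// sqrtr_gt0.
  by move=> ?; field.
- by move=> x x0; rewrite divr_ge0// ?sqrtr_ge0// ltW.
Qed.

Variables (n : nat) (f : 'rV[R]_(1 + n) -> \bar R).
Hypotheses (mf : measurable_fun [set: 'rV[R]_(1 + n)] f) (f0 : forall z, (0 <= f z)%E)
  (homf : forall (r : R) z, 0 < r -> (f (r *: z) = r%:E * f z)%E).

Definition gauss_radial (r : R) := expR (- (r ^+ 2 / 2)).

Lemma measurable_gauss_radial : measurable_fun [set: R] gauss_radial.
Proof.
apply: continuous_measurable_fun => x; apply: continuous_comp; last exact: continuous_expR.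
by apply: cvgN; apply: cvgMl; exact: exprn_continuous.
Qed.

Let g s y := (f (sphere_chart s y) * (sphere_density y)%:E)%E.

Let mg s : measurable_fun [set: 'rV[R]_n] (g s).
Proof.
apply: emeasurable_funM; first exact: (measurableT_comp mf (measurable_sphere_chart s)).
by apply/measurable_EFinP; exact: measurable_sphere_density.
Qed.

Let g0 s y : (0 <= g s y)%E.
Proof. by apply: mule_ge0 => //; rewrite lee_fin sphere_density_ge0. Qed.

Let H s (r : R) y := ((r * gauss_radial r)%:E * g s (r^-1 *: y))%E.

Let mH s : measurable_fun [set: R * 'rV[R]_n] (fun p => H s p.1 p.2).
Proof.
apply: emeasurable_funM.
  apply/measurable_EFinP; apply: measurable_funM => //.
  exact: (measurableT_comp measurable_gauss_radial).
apply: (measurableT_comp (mg s)).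
apply: measurable_fun_rV => i; rewrite (_ : (fun _ => _) = (fun p : R * 'rV[R]_n => p.1^-1 * p.2 0 i)).
  apply: measurable_funM; first exact: (measurableT_comp (@measurable_invr R) measurable_fst).
  exact: (measurableT_comp (measurable_rV_coord i) measurable_snd).
by apply/funext => p; rewrite mxE.
Qed.

Let H0 s r y : 0 < r -> (0 <= H s r y)%E.
Proof. by move=> r0; apply: mule_ge0 => //; rewrite lee_fin mulr_ge0 ?expR_ge0// ltW. Qed.

Let fubini_pos (G : R * 'rV[R]_n -> \bar R) : measurable_fun [set: R * 'rV[R]_n] G ->
  (forall p, 0 < p.1 -> (0 <= G p)%E) ->
  (\int[mu]_(r in `]0%R, +oo[) \int[leb n]_y G (r, y) =
   \int[leb n]_y \int[mu]_(r in `]0%R, +oo[) G (r, y))%E.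
Proof.
move=> mG G0.
pose G' (p : R * 'rV[R]_n) : \bar R := if 0 < p.1 then G p else 0%E.
have mG' : measurable_fun [set: measurableTypeR R * 'rV[R]_n] G'.
  apply: measurable_fun_ifT => //.
  by apply: measurable_fun_ltr => //; exact: measurable_fst.
have G'0 p : (0 <= G' p)%E by rewrite /G'; case: ifPn => // /G0.
transitivity (\int[mu]_r \int[leb n]_y G' (r, y))%E.
  rewrite integral_mkcond; apply: eq_integral => r _; rewrite /patch mem_setE in_itv/= andbT /G'/=.
  by case: ifP => // _; rewrite integral0.
transitivity (\int[leb n]_y \int[mu]_r G' (r, y))%E; first exact: fubini_tonelli.
apply: eq_integral => y _.
rewrite [RHS]integral_mkcond; apply: eq_integral => r _.
by rewrite /patch mem_setE in_itv/= andbT /G'/=.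
Qed.

(** One hemisphere. For fixed [r] the chart variable is rescaled to [y / r], which absorbs [r ^ n].
    The integrals are exchanged and, for fixed [y], the radius is replaced by the first coordinate
    [x]: the Jacobian [x / rho] cancels the density of the sphere, and homogeneity cancels the
    remaining factor. *)
Lemma polar_half s :
  ((\int[mu]_(r in `]0%R, +oo[) (r ^+ n.+1 * gauss_radial r)%:E) *
    \int[leb n]_y (f (sphere_chart s y) * (sphere_density y)%:E) =
  \int[mu]_(x in `]0%R, +oo[) \int[leb n]_y
    ((gauss_radial (Num.sqrt (x ^+ 2 + dot y y)))%:E * f (row_mx (s * x)%:M y : 'rV[R]_(1 + n))))%E.
Proof.
pose J := (\int[leb n]_y g s y)%E.
transitivity (\int[mu]_(r in `]0%R, +oo[) \int[leb n]_y H s r y)%E.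
  have J0 : (0 <= J)%E by exact: integral_ge0.
  rewrite muleC -ge0_integralZl; last 1 first.
  exact: J0.
  - apply: eq_integral => r; rewrite inE/= in_itv/= andbT => r0.
    rewrite -/J /H ge0_integralZl; last 1 first.
    by rewrite lee_fin mulr_ge0 ?expR_ge0// ltW.
    + have ri0 : 0 < r^-1 by rewrite invr_gt0.
      rewrite (ge0_integral_scale ri0 (mg s) (g0 s)) exprVn invrK muleA -EFinM muleC.
      by rewrite exprS mulrAC.
    + exact: measurableT.
    + exact: (measurableT_comp (mg s) (measurable_scale _)).
    + by [].
  - exact: measurable_itv.
  - apply/measurable_EFinP; apply: measurable_funTS; apply: measurable_funM; last exact: measurable_gauss_radial.
    exact: measurable_funX.
  - move=> r; rewrite /= in_itv/= andbT => r0.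
    by rewrite lee_fin mulr_ge0 ?expR_ge0// exprn_ge0// ltW.
rewrite (fubini_pos (mH s)); last by move=> [r y] /=; exact: H0.
rewrite [RHS](fubini_pos (G := fun p => ((gauss_radial (Num.sqrt (p.1 ^+ 2 + dot p.2 p.2)))%:E * f (row_mx (s * p.1)%:M p.2 : 'rV[R]_(1 + n)))%E)); last 2 first.
- apply: emeasurable_funM.
    apply/measurable_EFinP; apply: (measurableT_comp measurable_gauss_radial).
    apply: (measurableT_comp measurable_sqrt); apply: measurable_funD; first exact: measurable_funX.
    exact: measurable_dot.
  apply: (measurableT_comp mf).
  apply: (measurableT_comp (@measurable_row_mx R n) (g := fun p : R * 'rV[R]_n => (s * p.1, p.2))).
  by apply: measurable_fun_pair => //; exact: measurable_funM.
- by move=> p _; apply: mule_ge0 => //; rewrite lee_fin expR_ge0.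
apply: eq_integral => y _.
have c0 : 0 <= dot y y by exact: dot_ge0.
pose h r := if 0 < r then H s r y else 0%E.
(* Inserting the condition changes nothing, since [sphere_density] vanishes when [y / r] is outside
   the open unit ball. *)
transitivity (\int[mu]_(r in `]0%R, +oo[) (if (dot y y < r ^+ 2)%R then h r else 0))%E.
  apply: eq_integral => r; rewrite inE/= in_itv/= andbT => r0.
  rewrite /h r0; case: ifPn => // yr; rewrite /H /g /sphere_density ifN ?mule0//.
  by rewrite dotZl dotZr mulrA -expr2 exprVn ltr_pdivrMl ?exprn_gt0// mulr1.
rewrite (integral_subst_sqrt c0); last 2 first.
- apply: measurable_fun_ifT => //; first exact: measurable_fun_ltr.
  apply: (measurableT_comp (mH s) (g := fun r => (r, y))).
  exact: measurable_pair2.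
- by move=> r; rewrite /h; case: ifP => // r0; exact: H0.
apply: eq_integral => x; rewrite inE/= in_itv/= andbT => x0.
set rho := Num.sqrt _.
have xc0 : 0 < x ^+ 2 + dot y y by rewrite ltr_pwDl// exprn_gt0.
have r0 : 0 < rho by rewrite sqrtr_gt0.
have r2 : rho ^+ 2 = x ^+ 2 + dot y y by rewrite sqr_sqrtr// ltW.
rewrite /h r0 /H /g /sphere_density.
have E : dot (rho^-1 *: y) (rho^-1 *: y) = dot y y / rho ^+ 2.
  by rewrite dotZl dotZr mulrA -expr2 exprVn mulrC.
have E2 : 1 - dot y y / rho ^+ 2 = (x / rho) ^+ 2.
  rewrite expr_div_n r2 -[1](@divff _ (x ^+ 2 + dot y y)) ?gt_eqF//.
  by rewrite -mulrBl addrK.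
have xr0 : 0 < x / rho by rewrite divr_gt0.
rewrite ifT; last by rewrite E -subr_gt0 E2 exprn_gt0.
rewrite /sphere_chart E E2 sqrtr_sqr gtr0_norm//.
have -> : row_mx (s * (x / rho))%:M (rho^-1 *: y) = rho^-1 *: (row_mx (s * x)%:M y : 'rV[R]_(1 + n)).
  by rewrite scale_row_mx scale_scalar_mx mulrA [_^-1 * _]mulrC.
rewrite homf ?invr_gt0//.
rewrite (muleC (rho^-1)%:E) -!muleA -!EFinM [X in (_ * X)%E]muleC muleA -EFinM.
by congr ((_)%:E * _)%E; field; rewrite !gt_eqF.
Qed.

(** The exponent [n.+1] is [n] from the volume element of R^(n+1) plus 1 from the homogeneity of
    [f]. The two hemispheres account for the two signs of the first coordinate. *)
Lemma polar :
  (\int[leb n.+1]_z ((gauss_radial (enorm z))%:E * f z) =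
   (\int[mu]_(r in `]0%R, +oo[) (r ^+ n.+1 * gauss_radial r)%:E) *
   \int[@sphere_measure R n]_(v in @sphere R n) f v)%E.
Proof.
rewrite (integral_sphere mf f0) ge0_muleDr; [|by apply: integral_ge0 => y _; exact: g0|by apply: integral_ge0 => y _; exact: g0].
rewrite !polar_half integral_lebS; last 2 first.
- apply: emeasurable_funM => //; apply/measurable_EFinP; apply: (measurableT_comp measurable_gauss_radial).
  by apply: (measurableT_comp measurable_sqrt); exact: measurable_dot.
- by move=> z; apply: mule_ge0 => //; rewrite lee_fin expR_ge0.
pose G (x : R) := (\int[leb n]_y ((gauss_radial (enorm (row_mx x%:M y : 'rV[R]_(1 + n))))%:E * f (row_mx x%:M y : 'rV[R]_(1 + n))))%E.
have G0 x : (0 <= G x)%E.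
  by apply: integral_ge0 => y _; apply: mule_ge0 => //; rewrite lee_fin expR_ge0.
have mG : measurable_fun [set: R] G.
  apply: (measurable_int_row (f := fun z => ((gauss_radial (enorm z))%:E * f z)%E)); last first.
    by move=> z; apply: mule_ge0 => //; rewrite lee_fin expR_ge0.
  apply: emeasurable_funM => //; apply/measurable_EFinP; apply: (measurableT_comp measurable_gauss_radial).
  by apply: (measurableT_comp measurable_sqrt); exact: measurable_dot.
have GE s x : s ^+ 2 = 1 -> G (s * x) = (\int[leb n]_y
    ((gauss_radial (Num.sqrt (x ^+ 2 + dot y y)))%:E * f (row_mx (s * x)%:M y : 'rV[R]_(1 + n))))%E.
  move=> s2; apply: eq_integral => y _; congr ((gauss_radial (Num.sqrt _))%:E * _)%E.
  by rewrite dot_row_mx mulrACA -!expr2 s2 mul1r.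
have EG s : s ^+ 2 = 1 -> (\int[mu]_(x in `]0%R, +oo[) \int[leb n]_y
    ((gauss_radial (Num.sqrt (x ^+ 2 + dot y y)))%:E * f (row_mx (s * x)%:M y : 'rV[R]_(1 + n))) =
    \int[mu]_(x in `]0%R, +oo[) G (s * x)%R)%E.
  by move=> s2; apply: eq_integral => x _; rewrite -(GE _ _ s2).
have e1 : (1 : R) ^+ 2 = 1 by rewrite expr1n.
have e2 : (-1 : R) ^+ 2 = 1 by rewrite sqrrN expr1n.
rewrite [X in (_ = X + _)%E](EG 1 e1).
rewrite [X in (_ = _ + X)%E](EG (-1) e2).
transitivity (\int[mu]_x G x)%E; first by [].
clearbody G => {GE EG}.
have mGN : measurable_fun [set: R] (fun x : R => G (- 1 * x)) by exact: (measurableT_comp mG).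
have setE : [set: R] = `]0, +oo[%classic `|` `]-oo, 0]%classic.
  by apply/seteqP; split=> // x _; have [|] := ltP 0 x; [left|right]; rewrite /= in_itv/= ?andbT.
rewrite {1}setE ge0_integral_setU; last 5 first.
- exact: measurable_itv.
- exact: measurable_itv.
- by rewrite -setE.
- by move=> x _.
- by apply/disj_set2P/seteqP; split=> // x /=; rewrite !in_itv/= andbT => -[x0]; rewrite leNgt x0.
congr (_ + _)%E; first by apply: eq_integral => x _; rewrite mul1r.
rewrite integral_mkcond -ge0_integral_opp1; last 2 first.
- by apply/(measurable_restrictT _ _).1; [exact: measurable_itv|exact: measurable_funTS].
- by move=> x; rewrite /patch; case: ifP.
rewrite integral_itv_obnd_cbnd; last exact: measurable_funTS.
rewrite [RHS]integral_mkcond; apply: eq_integral => x _.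
by rewrite /patch !mem_setE !in_itv/= andbT oppr_le0 mulN1r.
Qed.

End polar.

(** * Radial Gaussian moments and the Gamma function *)

Section radial_moment.
Context {R : realType}.
Local Notation mu := (@lebesgue_measure R).

Lemma subst_half_square (h : R -> \bar R) : measurable_fun [set: R] h ->
  (forall x, (0 <= h x)%E) ->
  (\int[mu]_(t in `]0%R, +oo[) h t = \int[mu]_(r in `]0%R, +oo[) (h (r ^+ 2 / 2)%R * r%:E))%E.
Proof.
move=> mh h0; pose F (r : R) := r ^+ 2 / 2.
have F0 : F 0 = 0 by rewrite /F expr0n mul0r.
transitivity (\int[mu]_(t in `]F 0%R, +oo[) h t)%E; first by rewrite F0.
apply: (@ge0_integral_subst R F id 0) => //.
- move=> x y x0 xy; rewrite /F ltr_pM2r ?invr_gt0// ltr_pXn2r// nnegrE//.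
  by rewrite (le_trans x0)// ltW.
- move=> y; rewrite F0 => y0; exists (Num.sqrt (2 * y)); first by rewrite sqrtr_gt0 mulr_gt0.
  by rewrite /F sqr_sqrtr ?mulr_ge0 ?ltW//; field.
- by move=> x; exact: cvg_id.
- by move=> x; apply: is_derive_eq; rewrite /GRing.scale/= !mulr1; field.
- by move=> x /ltW.
Qed.

(** Yields the positivity of [Gamma] at half integers, hence that of [igm_const]. *)
Lemma gauss_radial_moment_gt0 n :
  (0 < \int[mu]_(r in `]0%R, +oo[) (r ^+ n * gauss_radial r)%:E)%E.
Proof.
have m1 : measurable (`]1%R, 2%R]%classic : set R) by exact: measurable_itv.
have E : (\int[mu]_(r in `]1%R, 2%R]) (gauss_radial 2)%:E = (gauss_radial 2)%:E)%E.
  rewrite integral_cst// [X in (_ * X)%E](lebesgue_measure_oc 1 2) ltr1n -EFinM; congr EFin.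
  by rewrite (_ : 2 - 1 = 1) ?mulr1//; lra.
apply: (@lt_le_trans _ _ (gauss_radial 2)%:E); first by rewrite lte_fin expR_gt0.
rewrite -E [X in (X <= _)%E]integral_mkcond [X in (_ <= X)%E]integral_mkcond.
apply: ge0_le_integral.
- exact: measurableT.
- by move=> x _; rewrite /patch; case: ifP => // _; rewrite lee_fin expR_ge0.
- by apply/(measurable_restrictT _ _).1; [exact: measurable_itv|exact: measurable_cst].
- apply/(measurable_restrictT _ _).1; first exact: measurable_itv.
  apply: measurable_funTS; apply/measurable_EFinP; apply: measurable_funM; last exact: measurable_gauss_radial.
  exact: measurable_funX.
- move=> x _; rewrite /patch !mem_setE !in_itv/= andbT.
  case: (ltP 1 x) => [x1|x1] /=; last first.
    by case: ifP => // x0; rewrite lee_fin mulr_ge0 ?expR_ge0// exprn_ge0// ltW.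
  rewrite (lt_trans ltr01 x1); case: ifP => [x2|_]; last first.
    by rewrite lee_fin mulr_ge0 ?expR_ge0// exprn_ge0// ltW// (lt_trans ltr01 x1).
  rewrite lee_fin -[X in X <= _]mul1r; apply: ler_pM; rewrite ?expR_ge0//.
    by rewrite exprn_ege1// ltW.
  rewrite ler_expR lerN2 ler_pM2r ?invr_gt0// lerXn2r// nnegrE//.
  by rewrite ltW// (lt_trans ltr01 x1).
Qed.

Lemma gauss_radial_moment_fin n :
  (\int[mu]_(r in `]0%R, +oo[) (r ^+ n * gauss_radial r)%:E < +oo)%E.
Proof.
have expb (x : R) : 0 <= x -> x ^+ n <= n`!%:R * expR x.
  move=> x0; case: n => [|m]; first by rewrite expr0 fact0 mul1r -[X in X <= _]expR0 ler_expR.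
  rewrite -ler_pdivrMl ?ltr0n ?fact_gt0// mulrC; apply: le_trans (expR_ge1Dxn m x0).
  by rewrite lerDr.
(* From [r ^ n <= 1 + r ^ (2 n)] and [(r ^ 2 / 4) ^ n <= n! exp (r ^ 2 / 4)]: half of the Gaussian
   exponent absorbs the power, at the price of this constant. *)
pose C : R := 1 + 4 ^+ n * n`!%:R.
have C0 : 0 <= C by rewrite addr_ge0// mulr_ge0// exprn_ge0.
have mg : measurable_fun [set: R] (fun r : R => (gauss_fun (2^-1 * r))%:E).
  apply/measurable_EFinP; apply: (measurableT_comp (@measurable_gauss_fun R)).
  exact: measurable_funM.
apply: (@le_lt_trans _ _ (C%:E * \int[mu]_r (gauss_fun (2^-1 * r))%:E)%E); last first.
  rewrite (@ge0_integral_scale1 R 2^-1 (fun x => (gauss_fun x)%:E)); last 3 first.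
  - by rewrite invr_gt0.
  - by apply/measurable_EFinP; exact: measurable_gauss_fun.
  - by move=> x; rewrite lee_fin gauss_fun_ge0.
  by rewrite integralT_gauss -!EFinM ltry.
rewrite -ge0_integralZl//; last by move=> x _; rewrite lee_fin gauss_fun_ge0.
rewrite [X in (X <= _)%E]integral_mkcond.
apply: ge0_le_integral.
- exact: measurableT.
- move=> x _; rewrite /patch; case: ifPn => //; rewrite mem_setE in_itv/= andbT => x0.
  by rewrite lee_fin mulr_ge0 ?expR_ge0// exprn_ge0// ltW.
- apply/(measurable_restrictT _ _).1; first exact: measurable_itv.
  apply: measurable_funTS; apply/measurable_EFinP; apply: measurable_funM; last exact: measurable_gauss_radial.
  exact: measurable_funX.
- by apply: emeasurable_funM => //; exact: measurable_cst.
- move=> x _; rewrite /patch; case: ifPn => [|_]; last first.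
    by rewrite -EFinM lee_fin mulr_ge0// gauss_fun_ge0.
  rewrite mem_setE in_itv/= andbT => x0; rewrite -EFinM lee_fin.
  have x40 : 0 <= x ^+ 2 / 4 by rewrite divr_ge0// sqr_ge0.
  have -> : gauss_fun (2^-1 * x) = expR (- (x ^+ 2 / 4)).
    by rewrite /gauss_fun; congr expR; field.
  have -> : gauss_radial x = expR (- (x ^+ 2 / 4)) * expR (- (x ^+ 2 / 4)).
    by rewrite -expRD; congr expR; field.
  set e := expR _; have e0 : 0 < e by exact: expR_gt0.
  have e1 : e <= 1 by rewrite -expR0 ler_expR oppr_le0.
  rewrite mulrA ler_pM2r//.
  have xx : x ^+ n <= 1 + (x ^+ n) ^+ 2 by nra.
  apply: (le_trans (ler_wpM2r (ltW e0) xx)); rewrite mulrDl mul1r lerD//.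
  have -> : (x ^+ n) ^+ 2 = 4 ^+ n * (x ^+ 2 / 4) ^+ n.
    by rewrite -exprM mulnC exprM -exprMn; congr (_ ^+ n); field.
  rewrite -mulrA ler_pM2l ?exprn_gt0//.
  apply: (le_trans (ler_wpM2r (ltW e0) (expb _ x40))).
  by rewrite -mulrA -expRD subrr expR0 mulr1.
Qed.

Lemma gauss_radial_moment n :
  (\int[mu]_(r in `]0%R, +oo[) (r ^+ n.+1 * gauss_radial r)%:E =
   (2 `^ (n%:R / 2) * Gamma (n.+2%:R / 2))%:E)%E.
Proof.
have h0 (t : R) : 0 <= t `^ (n.+2%:R / 2 - 1) * expR (- t) by rewrite mulr_ge0 ?powR_ge0 ?expR_ge0.
have mh : measurable_fun [set: R] (fun t : R => (t `^ (n.+2%:R / 2 - 1) * expR (- t))%:E).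
  apply/measurable_EFinP; apply: measurable_funM; first exact: measurable_powR.
  by apply: (measurableT_comp (@measurable_expR R)); exact: measurable_funN.
have b0 : 0 <= 2 `^ (n%:R / 2) :> R by exact: powR_ge0.
have E : (\int[mu]_(r in `]0%R, +oo[) (r ^+ n.+1 * gauss_radial r)%:E =
   (2 `^ (n%:R / 2))%:E * \int[mu]_(t in `]0%R, +oo[) (t `^ (n.+2%:R / 2 - 1) * expR (- t))%:E)%E.
  rewrite (subst_half_square mh h0) -ge0_integralZl; last 1 first.
  by rewrite lee_fin.
  - apply: eq_integral => r; rewrite inE/= in_itv/= andbT => r0.
    rewrite -!EFinM; congr EFin; rewrite -/(gauss_radial r).
    have -> : n.+2%:R / 2 - 1 = n%:R / 2 :> R by rewrite -[n.+2]addn2 natrD; field.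
    have r20 : 0 <= r ^+ 2 / 2 by rewrite divr_ge0// sqr_ge0.
    have -> : 2 `^ (n%:R / 2) * ((r ^+ 2 / 2) `^ (n%:R / 2) * gauss_radial r * r) =
        (2 * (r ^+ 2 / 2)) `^ (n%:R / 2) * gauss_radial r * r.
      by rewrite (@powRM _ 2 (r ^+ 2 / 2) (n%:R / 2))//; ring.
    have -> : 2 * (r ^+ 2 / 2) = r `^ 2%:R by rewrite powR_mulrn ?ltW//; field.
    rewrite -powRrM (_ : 2%:R * (n%:R / 2) = n%:R); last by field.
    by rewrite powR_mulrn ?ltW// exprS; ring.
  - exact: measurable_itv.
  - apply: measurable_funTS; apply: emeasurable_funM; last by apply/measurable_EFinP.
    apply: (measurableT_comp mh (g := fun r : R => r ^+ 2 / 2)).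
    by apply: measurable_funM => //; exact: measurable_funX.
  - by move=> r; rewrite /= in_itv/= andbT => r0; rewrite -EFinM lee_fin mulr_ge0// ltW.
have G0 : (0 <= \int[mu]_(t in `]0%R, +oo[) (t `^ (n.+2%:R / 2 - 1) * expR (- t))%:E)%E.
  by apply: integral_ge0 => t _; rewrite lee_fin.
(* [Gamma] is a real-valued integral, which would be 0 by convention if it diverged; finiteness is
   what equates it with the extended one. *)
have := gauss_radial_moment_fin n.+1; rewrite E => fin.
rewrite EFinM /Gamma /Rintegral fineK// ge0_fin_numE// ltNge leye_eq.
apply/negP => /eqP I; move: fin; by rewrite I gt0_muley ?ltxx// lte_fin powR_gt0.
Qed.

End radial_moment.

(** * Gaussian integrals *)

Section normal.
Context {R : realType}.
Local Notation mu := (@lebesgue_measure R).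
Local Notation gam := (@normal_prob R 0 1).

Lemma ge0_integral_normal (m s : R) (f : R -> \bar R) : measurable_fun [set: R] f ->
  (forall x, (0 <= f x)%E) ->
  (\int[normal_prob m s]_x f x = \int[mu]_x (f x * (normal_pdf m s x)%:E))%E.
Proof.
move=> mf f0.
rewrite -(ge0_integral_densm mu (measurable_normal_pdf m s) (normal_pdf_ge0 m s) mf f0).
by apply: eq_measure_integral => A mA _.
Qed.

Lemma normal_pdfN (m s : R) : normal_pdf m (- s) = normal_pdf m s.
Proof.
apply/funext => x; rewrite /normal_pdf oppr_eq0; case: ifP => // _.
by rewrite /normal_peak /normal_fun sqrrN.
Qed.

Lemma normal_pdf_affine (m s x : R) : s != 0 ->
  normal_pdf m s (m + s * x) = `|s|^-1 * normal_pdf 0 1 x.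
Proof.
move=> s0; rewrite !normal_pdfE ?oner_neq0// mulrA; congr (_ * _).
  rewrite /normal_peak -[in LHS]mulrnAr sqrtrM ?sqr_ge0// sqrtr_sqr invfM.
  by rewrite expr1n mul1r.
rewrite /normal_fun subr0 expr1n; congr expR.
by rewrite [m + _]addrC addrK exprMn -[in LHS]mulr_natr -[in RHS]mulr_natr; field.
Qed.

Lemma ge0_integral_scaleN1 (s : R) (f : R -> \bar R) : s != 0 ->
  measurable_fun [set: R] f -> (forall x, (0 <= f x)%E) ->
  (\int[mu]_x f (s * x)%R = (`|s|^-1)%:E * \int[mu]_x f x)%E.
Proof.
rewrite neq_lt => /orP[s0|s0] mf f0; last by rewrite gtr0_norm// ge0_integral_scale1.
have Ns0 : 0 < - s by rewrite oppr_gt0.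
rewrite ltr0_norm// -(ge0_integral_scale1 Ns0 mf f0).
rewrite -(@ge0_integral_opp1 R (fun x => f (- s * x)%R))//; last exact: (measurableT_comp mf).
by apply: eq_integral => x _; rewrite mulrNN.
Qed.

(** A negative [s] is included because [gaussian_law] does not fix the sign of its parameter; the
    density depends on [s] only through its square. *)
Lemma ge0_integral_normal_affine (m s : R) (f : R -> \bar R) : s != 0 ->
  measurable_fun [set: R] f -> (forall x, (0 <= f x)%E) ->
  (\int[normal_prob m s]_x f x = \int[gam]_x f (m + s * x)%R)%E.
Proof.
move=> s0 mf f0.
have mfa : measurable_fun [set: R] (fun x => f (m + s * x)%R).
  by apply: (measurableT_comp mf); apply: measurable_funD => //; exact: measurable_funM.
rewrite (ge0_integral_normal m s mf f0) (ge0_integral_normal 0 1 mfa (fun x => f0 _)).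
have p0 y : (0 <= (normal_pdf m s y)%:E)%E by rewrite lee_fin normal_pdf_ge0.
have mp : measurable_fun [set: R] (fun y => (normal_pdf m s y)%:E).
  by apply/measurable_EFinP; exact: measurable_normal_pdf.
have mG : measurable_fun [set: R] (fun y => (f (y + m)%R * (normal_pdf m s (y + m))%:E)%E).
  apply: emeasurable_funM; [apply: (measurableT_comp mf)|apply: (measurableT_comp mp)];
    exact: measurable_funD.
rewrite -(@ge0_integral_shift1 R m _ (emeasurable_funM mf mp)); last by move=> y; apply: mule_ge0.
have s1 : (`|s|%:E * (`|s|^-1)%:E = 1)%E by rewrite -EFinM divff// normr_eq0.
rewrite -[LHS]mul1e -s1 -muleA -(ge0_integral_scaleN1 s0 mG); last by move=> y; apply: mule_ge0.
rewrite -(ge0_integralZl mu measurableT); last 3 first.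
- by apply: (measurableT_comp mG); exact: measurable_funM.
- by move=> y _; apply: mule_ge0.
- by rewrite lee_fin.
apply: eq_integral => x _; rewrite [(_ * _ + m)%R]addrC normal_pdf_affine// muleCA.
by rewrite -EFinM mulrA divff ?mul1r// normr_eq0.
Qed.

Lemma ge0_integral_normal_opp (f : R -> \bar R) :
  measurable_fun [set: R] f -> (forall x, (0 <= f x)%E) ->
  (\int[gam]_x f (- x)%R = \int[gam]_x f x)%E.
Proof.
move=> mf f0; transitivity (\int[normal_prob 0 (-1)]_x f x)%E.
  have s1 : (-1 : R) != 0 by rewrite oppr_eq0 oner_eq0.
  rewrite (ge0_integral_normal_affine 0 s1 mf f0).
  by apply: eq_integral => x _; rewrite add0r mulN1r.
rewrite (ge0_integral_normal _ _ mf f0) (ge0_integral_normal 0 1 mf f0).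
by apply: eq_integral => x _; rewrite normal_pdfN.
Qed.

Lemma normal_pdf01 (x : R) : normal_pdf 0 1 x = (Num.sqrt (2 * pi))^-1 * gauss_radial x.
Proof.
rewrite normal_pdfE ?oner_eq0// /normal_peak /normal_fun subr0 expr1n mul1r mulr_natl.
by congr (_ * expR _); rewrite -[1 *+ 2]/(2%:R) mulNr.
Qed.

Lemma normal_abs_moment n :
  (\int[gam]_x (`|x| ^+ n)%:E = (2 / Num.sqrt (2 * pi))%:E *
    \int[mu]_(r in `]0%R, +oo[) (r ^+ n * gauss_radial r)%:E)%E.
Proof.
have mn : measurable_fun [set: R] (fun x : R => (`|x| ^+ n)%:E).
  by apply/measurable_EFinP; apply: measurable_funX; exact: normr_measurable.
have n0 (x : R) : (0 <= (`|x| ^+ n)%:E)%E by rewrite lee_fin exprn_ge0.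
rewrite (ge0_integral_normal 0 1 mn n0).
pose G (x : R) := `|x| ^+ n * normal_pdf 0 1 x.
have G0 x : 0 <= G x by rewrite mulr_ge0 ?exprn_ge0// normal_pdf_ge0.
have cG : continuous G.
  move=> x; apply: cvgM; last exact/continuous_normal_pdf/oner_neq0.
  apply: (@continuous_comp _ _ _ (fun x : R => `|x|) (fun y : R => y ^+ n)).
    exact: norm_continuous.
  exact: exprn_continuous.
have GN : G =1 G \o -%R.
  by move=> x; rewrite /G /= normrN !normal_pdf01 /gauss_radial sqrrN.
transitivity (\int[mu]_x (G x)%:E)%E; first by apply: eq_integral => x _; rewrite -EFinM.
rewrite (ge0_symfun_integralT G0 cG GN).
rewrite -set_itvcy -integral_itv_obnd_cbnd; last first.
  by apply: measurable_funTS; apply/measurable_EFinP; exact: continuous_measurable_fun.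
have c0 : 0 <= (Num.sqrt (2 * pi))^-1 :> R by rewrite invr_ge0 sqrtr_ge0.
rewrite EFinM -muleA; congr (_ * _)%E; rewrite -(ge0_integralZl mu (measurable_itv _)); last 3 first.
- apply: measurable_funTS; apply/measurable_EFinP; apply: measurable_funM; last exact: measurable_gauss_radial.
  exact: measurable_funX.
- move=> x; rewrite /= in_itv/= andbT => x0.
  by rewrite lee_fin mulr_ge0 ?expR_ge0// exprn_ge0// ltW.
- by rewrite lee_fin.
apply: eq_integral => x; rewrite inE/= in_itv/= andbT => x0.
by rewrite -EFinM /G gtr0_norm// normal_pdf01; congr EFin; ring.
Qed.

Lemma normal_abs_moment_fin n : (\int[gam]_x (`|x| ^+ n)%:E < +oo)%E.
Proof.
rewrite normal_abs_moment lte_mul_pinfty ?lee_fin ?divr_ge0 ?sqrtr_ge0//.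
exact: gauss_radial_moment_fin.
Qed.

(** Stands in for integration by parts: the integral over [[- k.+1, k.+1]] is a difference of two
    values of [F], which is of order [1 / k] there, and dominated convergence passes to the whole
    line. *)
Lemma integral_derive_vanishing (F f : R -> R) (C : R) :
  (forall x : R, is_derive x (1 : R) F (f x)) -> continuous f ->
  mu.-integrable [set: R] (EFin \o f) -> (forall x, `|x| * `|F x| <= C) ->
  (\int[mu]_x (f x)%:E = 0)%E.
Proof.
move=> dF cf intf FC.
have F0 (s : R) : `|s| = 1 -> F (s * k.+1%:R) @[k --> \oo] --> (0 : R).
  move=> s1; apply: norm_cvg0.
  apply: (@squeeze_cvgr _ _ _ _ (fun=> 0) (fun k => C * harmonic k)).
  - apply: nearW => k; rewrite normr_ge0/= /harmonic -ler_pdivrMr ?invr_gt0// invrK mulrC.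
    by apply: le_trans (FC (s * k.+1%:R)); rewrite normrM s1 mul1r ger0_norm.
  - exact: cvg_cst.
  - by rewrite -[X in _ --> X](mulr0 C); apply: cvgMr; exact: cvg_harmonic.
have cF : continuous F.
  by move=> x; apply: differentiable_continuous; apply/derivable1_diffP; exact: ex_derive.
pose I (k : nat) : set R := `[- k.+1%:R, k.+1%:R]%classic.
have FTC k : (\int[mu]_x ((EFin \o f) \_ (I k)) x = (F k.+1%:R - F (- k.+1%:R))%:E)%E.
  rewrite -integral_mkcond (continuous_FTC2 (F := F)).
  - by [].
  - by rewrite -subr_gt0 opprK -natrD ltr0n.
  - exact: continuous_subspaceT.
  - split=> [x _||]; first exact: ex_derive.
    + by apply: cvg_at_right_filter; exact: cF.
    + by apply: cvg_at_left_filter; exact: cF.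
  - by move=> x _; rewrite derive1E; exact: derive_val.
have mI k : measurable (I k) by exact: measurable_itv.
have [|||||_ _ L] := @dominated_convergence _ _ R mu [set: R] measurableT
  (fun k => (EFin \o f) \_ (I k)) (EFin \o f) (abse \o (EFin \o f)).
- move=> k; apply/(measurable_restrictT _ (mI k)); apply: measurable_funTS.
  exact: (measurable_int _ intf).
- exact: (measurable_int _ intf).
- apply: aeW => x _; apply: cvg_near_cst; near=> k; rewrite /patch mem_set//.
  rewrite /I/= in_itv/= -ler_norml.
  near: k; exists (Num.bound `|x|) => // k /= bk.
  rewrite (le_trans (ltW (archi_boundP (normr_ge0 x))))//.
  by rewrite ler_nat leqW.
- exact: integrable_abse intf.
- apply: aeW => x k _; rewrite /patch; case: ifP => // _.
  by rewrite abse0 abse_ge0.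
rewrite (_ : (fun _ => _) = (fun k => (F k.+1%:R - F (- k.+1%:R))%:E)) in L; last exact/funext.
have L0 : (F k.+1%:R - F (- k.+1%:R))%:E @[k --> \oo] --> (0%R)%:E.
  apply: cvg_EFin; first by apply: nearW.
  rewrite /comp/= -[X in _ --> X](subr0 0); apply: cvgB.
    by have := F0 1 (normr1 R); under eq_fun do rewrite mul1r.
  by have := F0 (-1) (normrN1 R); under eq_fun do rewrite mulN1r.
by apply: (cvg_unique _ L L0).
Unshelve. all: by end_near. Qed.

Lemma integral_normal (m s : R) (f : R -> \bar R) : measurable_fun [set: R] f ->
  (\int[normal_prob m s]_x f x = \int[mu]_x (f x * (normal_pdf m s x)%:E))%E.
Proof.
move=> mf; rewrite [LHS]integralE [RHS]integralE.
have p0 x : (0 <= (normal_pdf m s x)%:E)%E by rewrite lee_fin normal_pdf_ge0.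
have E1 : (fun x => f x * (normal_pdf m s x)%:E)^\+%E = (fun x => f^\+ x * (normal_pdf m s x)%:E)%E.
  apply/funext => x; rewrite !funeposE; have [fx|fx] := leP 0%E (f x).
    by rewrite !max_l// mule_ge0.
  by rewrite !max_r ?mul0e ?(ltW fx)// mule_le0_ge0// ltW.
have E2 : (fun x => f x * (normal_pdf m s x)%:E)^\-%E = (fun x => f^\- x * (normal_pdf m s x)%:E)%E.
  apply/funext => x; rewrite !funenegE -mulNe; have [fx|fx] := leP 0%E (- f x)%E.
    by rewrite !max_l// mule_ge0.
  by rewrite !max_r ?mul0e ?(ltW fx)// mule_le0_ge0// ltW.
rewrite E1 E2 (ge0_integral_normal m s (measurable_funepos mf))//.
rewrite (ge0_integral_normal m s (measurable_funeneg mf))//.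
Qed.

Lemma integrable_normal n (f : R -> R) : measurable_fun [set: R] f ->
  (forall x, `|f x| <= `|x| ^+ n) -> gam.-integrable [set: R] (EFin \o f).
Proof.
move=> mf fn; apply/integrableP; split; first exact/measurable_EFinP.
apply: le_lt_trans (normal_abs_moment_fin n); apply: ge0_le_integral.
- exact: measurableT.
- by move=> x _; exact: abse_ge0.
- by apply: measurableT_comp => //; exact/measurable_EFinP.
- by apply/measurable_EFinP; apply: measurable_funX; exact: normr_measurable.
- by move=> x _; rewrite /= lee_fin.
Qed.

Lemma integrable_moment_pdf n :
  mu.-integrable [set: R] (fun x => (x ^+ n * normal_pdf 0 1 x)%:E).
Proof.
have mn : measurable_fun [set: R] (fun x : R => (`|x| ^+ n)%:E).
  by apply/measurable_EFinP; apply: measurable_funX; exact: normr_measurable.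
apply/integrableP; split.
  apply/measurable_EFinP; apply: measurable_funM; last exact: measurable_normal_pdf.
  exact: measurable_funX.
apply: le_lt_trans (normal_abs_moment_fin n).
have n0 (x : R) : (0 <= (`|x| ^+ n)%:E)%E by rewrite lee_fin exprn_ge0.
rewrite (ge0_integral_normal 0 1 mn n0) le_eqVlt; apply/orP; left; apply/eqP.
apply: eq_integral => x _; by rewrite -EFinM/= normrM normrX (ger0_norm (normal_pdf_ge0 _ _ _)).
Qed.

Lemma is_derive_normal_pdf (x : R) :
  is_derive x (1 : R) (normal_pdf 0 1) (- x * normal_pdf 0 1 x).
Proof.
have -> : normal_pdf 0 1 = (fun x : R => (Num.sqrt (2 * pi))^-1 * expR (- (x ^+ 2 / 2))).
  by apply/funext => y; rewrite normal_pdf01.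
apply: is_derive_eq; move: ((Num.sqrt (2 * pi))^-1) => c.
by rewrite /GRing.scale/=; field.
Qed.

Lemma sqr_normal_pdf_le (x : R) : x ^+ 2 * normal_pdf 0 1 x <= 2 * (Num.sqrt (2 * pi))^-1.
Proof.
have c0 : 0 <= (Num.sqrt (2 * pi))^-1 :> R by rewrite invr_ge0 sqrtr_ge0.
rewrite normal_pdf01 mulrCA mulrC ler_wpM2r//.
have -> : x ^+ 2 = 2 * (x ^+ 2 / 2) by field.
rewrite /gauss_radial; set y := x ^+ 2 / 2.
rewrite -mulrA ger_pMr// expRN ler_pdivrMr ?expR_gt0// mul1r.
by apply: le_trans (expR_ge1Dx y); rewrite lerDr.
Qed.

Lemma normr_normal_pdf_le (x : R) : `|x| * normal_pdf 0 1 x <= 2 * (Num.sqrt (2 * pi))^-1.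
Proof.
have p0 := normal_pdf_ge0 0 1 x; have [x1|x1] := leP 1 `|x|.
  apply: le_trans (sqr_normal_pdf_le x); rewrite ler_wpM2r// -real_normK ?num_real//.
  by rewrite expr2 ler_peMl.
have c0 : 0 <= (Num.sqrt (2 * pi))^-1 :> R by rewrite invr_ge0 sqrtr_ge0.
apply: (@le_trans _ _ (normal_pdf 0 1 x)); first by rewrite ler_piMl// ltW.
rewrite normal_pdf01 mulrC ler_wpM2r//.
apply: (@le_trans _ _ 1); last by lra.
by rewrite /gauss_radial -expR0 ler_expR oppr_le0 divr_ge0// sqr_ge0.
Qed.

Lemma normal_second_moment : (\int[gam]_x (x ^+ 2)%:E = 1)%E.
Proof.
have m2 : measurable_fun [set: R] (fun x : R => (x ^+ 2)%:E).
  by apply/measurable_EFinP; exact: measurable_funX.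
have n2 (x : R) : (0 <= (x ^+ 2)%:E)%E by rewrite lee_fin sqr_ge0.
rewrite (ge0_integral_normal 0 1 m2 n2).
have i0 := integrable_moment_pdf 0; have i2 := integrable_moment_pdf 2.
have E : (\int[mu]_x (((x : R) ^+ 0 * normal_pdf 0 1 x)%:E - (x ^+ 2 * normal_pdf 0 1 x)%:E) = 0)%E.
  (* The derivative of [x * normal_pdf 0 1 x], whose integral vanishes: moments 0 and 2 agree. *)
  pose f (x : R) := (1 - x ^+ 2) * normal_pdf 0 1 x.
  have fE : (fun x : R => (((x : R) ^+ 0 * normal_pdf 0 1 x)%:E - (x ^+ 2 * normal_pdf 0 1 x)%:E)%E) = EFin \o f.
    by apply/funext => x; rewrite -EFinB expr0 -mulrBl.
  rewrite fE; apply: (@integral_derive_vanishing (fun x => x * normal_pdf 0 1 x) _ (2 * (Num.sqrt (2 * pi))^-1)).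
  - move=> x; have d := is_derive_normal_pdf x.
    apply: is_derive_eq; rewrite /f /GRing.scale/= mulr1; ring.
  - move=> x; apply: cvgM; last exact/continuous_normal_pdf/oner_neq0.
    by apply: cvgB; [exact: cvg_cst|exact: exprn_continuous].
  - by rewrite -fE; exact: integrableB.
  - move=> x; rewrite normrM mulrA -expr2 real_normK ?num_real//.
    by rewrite (ger0_norm (normal_pdf_ge0 _ _ _)) sqr_normal_pdf_le.
rewrite integralB// in E.
have E1 : (\int[mu]_x ((x : R) ^+ 0 * normal_pdf 0 1 x)%:E = 1)%E.
  by rewrite -(integral_normal_pdf 0 1); apply: eq_integral => x _; rewrite expr0 mul1r.
rewrite E1 in E.
transitivity (\int[mu]_x ((x : R) ^+ 2 * normal_pdf 0 1 x)%:E)%E.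
  by apply: eq_integral => x _; rewrite EFinM.
have /integral_fune_fin_num := i2 => /(_ measurableT) fn.
by move/eqP: E; rewrite sube_eq ?fin_num_adde_defr// add0e => /eqP.
Qed.

Lemma integral_expRN : (\int[mu]_(t in `]0%R, +oo[) (expR (- t))%:E = 1)%E.
Proof.
have cN : continuous (fun x : R => expR (- x)).
  move=> x; apply: (continuous_comp (@oppr_continuous _ _ x)); exact: continuous_expR.
rewrite integral_itv_obnd_cbnd; last first.
  by apply: measurable_funTS; apply/measurable_EFinP; exact: continuous_measurable_fun.
rewrite (@ge0_continuous_FTC2y _ _ (fun x => - expR (- x)) 0 0).
- by rewrite oppr0 expR0 EFinN oppeK add0e.
- by move=> x _; exact: expR_ge0.
- exact: continuous_subspaceT.
- by rewrite -oppr0; apply: cvgN; exact: cvgr_expR.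
- by move=> x _; exact: ex_derive.
- by apply: cvg_at_right_filter; apply: cvgN; exact: cN.
- by move=> x _; rewrite derive1E; apply: derive_val; apply: is_derive_eq; rewrite /GRing.scale/=; ring.
Qed.

Lemma normal_first_abs_moment : (\int[gam]_x (`|x|)%:E = (2 / Num.sqrt (2 * pi))%:E)%E.
Proof.
transitivity (\int[gam]_x (`|x| ^+ 1)%:E)%E; first by apply: eq_integral => x _; rewrite expr1.
rewrite normal_abs_moment -[RHS]mule1; congr (_ * _)%E; rewrite -integral_expRN.
have mh : measurable_fun [set: R] (fun t : R => (expR (- t))%:E).
  by apply/measurable_EFinP; apply: (measurableT_comp (@measurable_expR R)); exact: measurable_funN.
have h0 (x : R) : (0 <= (expR (- x))%:E)%E by rewrite lee_fin expR_ge0.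
rewrite (subst_half_square mh h0); apply: eq_integral => x _.
by rewrite -EFinM expr1 mulrC.
Qed.

Lemma normal_setT : gam [set: R] = 1%E.
Proof. exact: probability_setT. Qed.

Definition normal_cos (a : R) : R := \int[gam]_x cos (a * x).

Lemma measurable_cosM (a c : R) : measurable_fun [set: R] (fun x : R => cos (a * x - c)).
Proof.
apply: continuous_measurable_fun => x; apply: continuous_comp; last exact: continuous_cos.
by apply: cvgB; [apply: cvgMr; exact: cvg_id|exact: cvg_cst].
Qed.

Lemma integrable_cosM (a c : R) : gam.-integrable [set: R] (EFin \o (fun x => cos (a * x - c))).
Proof.
apply: (@integrable_normal 0); first exact: measurable_cosM.
by move=> x; rewrite expr0 ler_norml cos_geN1 cos_le1.
Qed.

(** The characteristic function of the normal law, real by symmetry, is obtained from this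
    differential equation: differentiate under the integral, then integrate by parts against the
    density. *)
Lemma is_derive_normal_cos (a : R) : is_derive a (1 : R) normal_cos (- a * normal_cos a).
Proof.
pose f (a x : R) := cos (a * x).
have df (x y : R) : is_derive x (1 : R) (f ^~ y) (- y * sin (x * y)).
  by apply: is_derive_eq; rewrite /GRing.scale/=; ring.
have fE b : (EFin \o f b) = (EFin \o (fun x => cos (b * x - 0))).
  by apply/funext => x; rewrite /f/= subr0.
have intf b : gam.-integrable [set: R] (EFin \o f b) by rewrite fE; exact: integrable_cosM.
have iG : gam.-integrable [set: R] (EFin \o (fun y : R => `|y|)).
  by apply: (@integrable_normal 1) => [|x]; [exact: normr_measurable|rewrite expr1 normr_id].
have d1 x y : partial1of2 f x y = - y * sin (x * y).
  by rewrite partial1of2E; exact: derive_val.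
have Ia : `]a - 1, a + 1[%classic a by rewrite /= in_itv/= ltrBlDr ltrDl ltr01.
have dom x y : `]a - 1, a + 1[%classic x -> [set: R] y -> `|partial1of2 f x y| <= `|y|.
  by move=> _ _; rewrite d1 normrM normrN ler_piMr// ler_norml sin_geN1 sin_le1.
have der x y : `]a - 1, a + 1[%classic x -> [set: R] y -> derivable (f ^~ y) x 1.
  by move=> _ _; exact: ex_derive.
have C := derivable_under_integral measurableT Ia (fun x _ => intf x) der (fun y : R => normr_ge0 y) iG dom.
have D := differentiation_under_integral measurableT Ia (fun x _ => intf x) der (fun y : R => normr_ge0 y) iG dom.
apply: DeriveDef; first exact: C.
rewrite -derive1E D.
have i1 : gam.-integrable [set: R] (EFin \o (fun y => - y * sin (a * y))).
  apply: (@integrable_normal 1) => [|x].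
    apply: measurable_funM; first exact: measurable_funN.
    apply: continuous_measurable_fun => x; apply: continuous_comp; last exact: continuous_sin.
    by apply: cvgMr; exact: cvg_id.
  by rewrite normrM normrN expr1 ler_piMr// ler_norml sin_geN1 sin_le1.
have i2 : gam.-integrable [set: R] (EFin \o (fun y => a * f a y)).
  rewrite (_ : EFin \o _ = (fun y => a%:E * (EFin \o f a) y)%E); first exact: integrableZl.
  by apply/funext => y; rewrite /= EFinM.
under eq_Rintegral do rewrite d1.
apply/eqP; rewrite mulNr -addr_eq0 -[normal_cos a]/(\int[gam]_x f a x).
rewrite -(RintegralZl _ measurableT (intf a)) -(RintegralD measurableT i1 i2); apply/eqP.
(* The derivative of [sin (a * x) * normal_pdf 0 1 x]. *)
pose g (x : R) := (a * cos (a * x) - x * sin (a * x)) * normal_pdf 0 1 x.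
have mg : measurable_fun [set: R] (fun x : R => - x * sin (a * x) + a * f a x).
  by apply: measurable_funD; apply/measurable_EFinP; [exact: (measurable_int _ i1)|exact: (measurable_int _ i2)].
rewrite /Rintegral (integral_normal 0 1 (f := fun x => (- x * sin (a * x) + a * f a x)%:E)); last exact/measurable_EFinP.
rewrite [X in fine X](_ : _ = (\int[mu]_x (g x)%:E)%E); last first.
  by apply: eq_integral => x _; rewrite -EFinM /g /f; congr EFin; ring.
have cg : continuous g.
  have ca (h : R -> R) : continuous h -> continuous (fun x : R => h (a * x)).
    move=> ch x; apply: continuous_comp; last exact: ch.
    by apply: cvgMr; exact: cvg_id.
  move=> x; apply: cvgM; last exact/continuous_normal_pdf/oner_neq0.
  apply: cvgB; first by apply: cvgMr; apply: (ca _ (@continuous_cos R)).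
  by apply: cvgM; [exact: cvg_id|apply: (ca _ (@continuous_sin R))].
suff -> : (\int[mu]_x (g x)%:E = 0)%E by [].
apply: (@integral_derive_vanishing (fun x => sin (a * x) * normal_pdf 0 1 x) g (2 * (Num.sqrt (2 * pi))^-1)).
- move=> x; have d := is_derive_normal_pdf x.
  have ds : is_derive x (1 : R) (fun x : R => sin (a * x)) (a * cos (a * x)).
    by apply: is_derive_eq; rewrite /GRing.scale/=; ring.
  by apply: is_derive_eq; rewrite /g /GRing.scale/=; ring.
- exact: cg.
- have I1 := integrable_moment_pdf 0; have I2 := integrable_moment_pdf 1.
  pose gg (x : R) := (`|a|%:E * (x ^+ 0 * normal_pdf 0 1 x)%R%:E + `|(x ^+ 1 * normal_pdf 0 1 x)%R%:E|)%E.
  apply: (@le_integrable _ _ _ mu _ measurableT _ gg); rewrite /gg.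
  + by apply/measurable_EFinP; exact: continuous_measurable_fun.
  + move=> x _; rewrite /= lee_fin expr0 expr1 mul1r.
    have p0 := normal_pdf_ge0 0 1 x; rewrite [leRHS]ger0_norm ?addr_ge0// ?mulr_ge0//.
    rewrite /g normrM (ger0_norm p0) normrM (ger0_norm p0) -mulrDl ler_wpM2r//.
    apply: (le_trans (ler_normB _ _)); rewrite !normrM lerD// ler_piMr// ler_norml.
      by rewrite cos_geN1 cos_le1.
    by rewrite sin_geN1 sin_le1.
  + apply: integrableD => //; first exact: integrableZl.
    exact: integrable_abse I2.
- move=> x; rewrite normrM (ger0_norm (normal_pdf_ge0 _ _ _)).
  apply: le_trans (normr_normal_pdf_le x); rewrite ler_wpM2l//.
  by rewrite ler_piMl ?normal_pdf_ge0// ler_norml sin_geN1 sin_le1.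
Qed.

Lemma normal_cosE (a : R) : normal_cos a = expR (- (a ^+ 2 / 2)).
Proof.
pose h (a : R) := normal_cos a * expR (a ^+ 2 / 2).
have dh (x : R) : is_derive x (1 : R) h 0.
  have d := is_derive_normal_cos x.
  by apply: is_derive_eq; rewrite /GRing.scale/=; field.
have := is_derive_0_is_cst a 0 dh.
rewrite /h [in RHS]/normal_cos expr0n/= mul0r expR0 mulr1.
under eq_Rintegral do rewrite mul0r cos0.
have -> : \int[gam]_(_ in [set: R]) 1 = 1 :> R.
  by rewrite /Rintegral integral_cst// [X in (_ * X)%E]normal_setT mule1.
move=> H.
by rewrite expRN -[LHS](mulfK (lt0r_neq0 (expR_gt0 (a ^+ 2 / 2)))) H mul1r.
Qed.

(** The added 1 keeps integrands nonnegative, so that Tonelli's theorem applies throughout; letting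
    the phase [c] vary, [1 + cos] plays the part of the complex exponential. *)
Lemma integral_normal_cos (a c : R) :
  (\int[gam]_x (1 + cos (a * x - c))%:E = (1 + expR (- (a ^+ 2 / 2)) * cos c)%:E)%E.
Proof.
have I1 := integrable_cosM a c.
have cst1 : gam.-integrable [set: R] (EFin \o (fun=> 1 : R)).
  by apply: (@integrable_normal 0) => // x; rewrite normr1.
have E1 d : (\int[gam]_x (1 + cos (a * x - d))%:E)%E = (1 + \int[gam]_x cos (a * x - d))%:E.
  rewrite integralD_EFin//; last exact: integrable_cosM.
  rewrite EFinD; congr (_ + _)%E.
    by rewrite /comp integral_cst// [X in (_ * X)%E]normal_setT mule1.
  by rewrite /Rintegral fineK//; apply: integrable_fin_num => //; exact: integrable_cosM.
rewrite E1; congr (_ + _)%:E.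
have mc d : measurable_fun [set: R] (fun x : R => (1 + cos (a * x - d))%:E).
  by apply/measurable_EFinP; apply: measurable_funD => //; exact: measurable_cosM.
have c0 d (x : R) : (0 <= (1 + cos (a * x - d))%:E)%E.
  by rewrite lee_fin -lerBlDl sub0r cos_geN1.
(* Since the law is symmetric, the phases [c] and [- c] give the same integral; their sum is
   [2 * cos c] times the integral of [cos (a * x)], and no sine integral is computed. *)
have E2 : \int[gam]_x cos (a * x - c) = \int[gam]_x cos (a * x - - c).
  apply: (@addrI _ 1); apply: EFin_inj; rewrite -!E1 -(ge0_integral_normal_opp (mc (- c)) (c0 (- c))).
  by apply: eq_integral => x _; rewrite -cosN; congr (1 + cos _)%:E; ring.
suff : \int[gam]_x cos (a * x - c) + \int[gam]_x cos (a * x - - c) = 2 * (expR (- (a ^+ 2 / 2)) * cos c).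
  by rewrite -E2; lra.
rewrite -normal_cosE /normal_cos -(RintegralD measurableT I1 (integrable_cosM a (- c))).
have I0 : gam.-integrable [set: R] (EFin \o (fun x => cos (a * x))).
  by have := integrable_cosM a 0; under eq_fun do rewrite subr0.
rewrite (_ : 2 * (_ * cos c) = 2 * cos c * \int[gam]_x cos (a * x)); last by ring.
rewrite -(RintegralZl _ measurableT I0); apply: eq_Rintegral => x _.
by rewrite opprK cosB cosD; ring.
Qed.

(** Adding the integrals for [s] and [- s], equal by symmetry, removes the cross term. *)
Lemma normal_sqr_affine (A s : R) :
  (\int[gam]_x ((A + s * x) ^+ 2)%:E = (A ^+ 2 + s ^+ 2)%:E)%E.
Proof.
have mq (t : R) : measurable_fun [set: R] (fun x : R => ((A + t * x) ^+ 2)%:E).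
  apply/measurable_EFinP; apply: measurable_funX; apply: measurable_funD => //.
have q0 (t x : R) : (0 <= ((A + t * x) ^+ 2)%:E)%E by rewrite lee_fin sqr_ge0.
have sym : (\int[gam]_x ((A + (- s) * x) ^+ 2)%:E = \int[gam]_x ((A + s * x) ^+ 2)%:E)%E.
  rewrite -(ge0_integral_normal_opp (mq s) (q0 s)); apply: eq_integral => x _.
  by rewrite mulrN mulNr.
have m2 : measurable_fun [set: R] (fun x : R => (x ^+ 2)%:E).
  by apply/measurable_EFinP; exact: measurable_funX.
have n2 (x : R) : (0 <= (x ^+ 2)%:E)%E by rewrite lee_fin sqr_ge0.
have S : (\int[gam]_x ((A + s * x) ^+ 2)%:E + \int[gam]_x ((A + (- s) * x) ^+ 2)%:E =
    (2 * (A ^+ 2 + s ^+ 2))%:E)%E.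
  rewrite -(ge0_integralD gam measurableT (fun x _ => q0 s x) (mq s) (fun x _ => q0 (- s) x) (mq (- s))).
  transitivity (\int[gam]_x ((2 * A ^+ 2)%:E + (2 * s ^+ 2)%:E * (x ^+ 2)%:E))%E.
    by apply: eq_integral => x _; rewrite -EFinM -!EFinD; congr EFin; ring.
  rewrite ge0_integralD//.
  - rewrite integral_cst// [X in (_ * X)%E]normal_setT mule1.
    rewrite (ge0_integralZl gam measurableT m2) => [|x _|].
    + by rewrite normal_second_moment mule1 -EFinD; congr EFin; ring.
    + exact: n2.
    + by rewrite lee_fin mulr_ge0// sqr_ge0.
  - by move=> x _; rewrite lee_fin mulr_ge0// sqr_ge0.
  - by move=> x _; apply: mule_ge0; rewrite lee_fin; [apply: mulr_ge0 => //|]; exact: sqr_ge0.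
  - by apply: emeasurable_funM.
move: S; rewrite sym; case: (\int[gam]_x _)%E => //= r; rewrite -EFinD => -[E].
by congr EFin; lra.
Qed.

(** [gaussian_law] only asserts that some parameters exist. The second moments of [Z] and of [Z + 1]
    determine them: [m = 0] and [s = sigma] up to sign. *)
Lemma ge0_integral_gaussian_law d (T : measurableType d) (P : probability T R) (Z : T -> R)
    (mZ : measurable_fun [set: T] Z) (sigma : R) : 0 <= sigma ->
  gaussian_law (pushforward P Z) ->
  (\int[P]_w (Z w ^+ 2)%:E = (sigma ^+ 2)%:E)%E ->
  (\int[P]_w ((Z w + 1) ^+ 2)%:E = (sigma ^+ 2 + 1)%:E)%E ->
  forall f : R -> \bar R, measurable_fun [set: R] f -> (forall x, (0 <= f x)%E) ->
  (\int[P]_w f (Z w) = \int[gam]_x f (sigma * x)%R)%E.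
Proof.
move=> sigma0 [m [s law]] E2 E21.
have main (f : R -> \bar R) : measurable_fun [set: R] f -> (forall x, (0 <= f x)%E) ->
    (\int[P]_w f (Z w) = \int[gam]_x f (m + s * x)%R)%E.
  (* The degenerate law is the Dirac mass at [m], which the affine form [m + 0 * x] also
     describes. *)
  move=> mf f0; have [s0|s0] := eqVneq s 0.
    rewrite -(ge0_integral_mpush P mZ mf f0).
    rewrite (eq_measure_integral (dirac m)) => [|A mA _]; last first.
      by rewrite -[LHS]/(pushforward P Z A) law// s0 eqxx.
    rewrite integral_dirac// diracT mul1e.
    transitivity (\int[gam]_x (cst (f m) x))%E; last by apply: eq_integral => x _; rewrite s0 mul0r addr0.
    by rewrite integral_cst// [X in (_ * X)%E]normal_setT mule1.
  rewrite -(ge0_integral_mpush P (mZ : measurable_fun [set: T] (Z : T -> measurableTypeR R)) mf f0).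
  transitivity (\int[normal_prob m s]_x f x)%E.
    apply: eq_measure_integral => A mA _.
    by rewrite -[LHS]/(pushforward P Z A) law// (negbTE s0).
  exact: ge0_integral_normal_affine.
have ms (b : R) : (\int[P]_w ((Z w + b) ^+ 2)%:E = ((m + b) ^+ 2 + s ^+ 2)%:E)%E.
  rewrite (main (fun x => ((x + b) ^+ 2)%:E)).
  - rewrite -normal_sqr_affine; apply: eq_integral => x _; congr EFin; ring.
  - by apply/measurable_EFinP; apply: measurable_funX; exact: measurable_funD.
  - by move=> x; rewrite lee_fin sqr_ge0.
have e0 : m ^+ 2 + s ^+ 2 = sigma ^+ 2.
  apply: EFin_inj; rewrite -E2 -{1}[m]addr0 -ms; apply: eq_integral => w _.
  by rewrite addr0.
have e1 : (m + 1) ^+ 2 + s ^+ 2 = sigma ^+ 2 + 1 by apply: EFin_inj; rewrite -E21 -ms.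
have m0 : m = 0 by nra.
move: e0; rewrite m0 expr0n add0r => /eqP; rewrite eqf_sqr => es f mf f0.
rewrite (main _ mf f0) m0.
under eq_integral do rewrite add0r.
case/orP : es => /eqP -> //.
rewrite -(@ge0_integral_normal_opp (fun x => f (sigma * x)%R)); last 2 first.
- by apply: (measurableT_comp mf); exact: measurable_funM.
- by move=> x; exact: f0.
by apply: eq_integral => x _; rewrite mulNr mulrN.
Qed.

End normal.

(** * Pairs of random variables with the same Fourier integrals *)

Lemma bounded_cvg_integral d (T : measurableType d) (R : realType)
    (m : {measure set T -> \bar R}) (f_ : nat -> T -> R) (f : T -> R) :
  (m [set: T] < +oo)%E -> (forall k, measurable_fun [set: T] (f_ k)) ->
  measurable_fun [set: T] f -> (forall x, f_ ^~ x @ \oo --> f x) ->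
  (forall k x, 0 <= f_ k x <= 1) ->
  (\int[m]_x (f_ k x)%:E)%E @[k --> \oo] --> (\int[m]_x (f x)%:E)%E.
Proof.
move=> m1 mf_ mf cf f01.
have [|||||_ _ L] := @dominated_convergence _ _ R m [set: T] measurableT
  (fun k x => (f_ k x)%:E) (fun x => (f x)%:E) (cst 1%E).
- by move=> k; exact/measurable_EFinP.
- exact/measurable_EFinP.
- by apply: aeW => x _; apply: cvg_EFin; [exact: nearW|exact: cf].
- apply/integrableP; split; first exact: measurable_cst.
  under eq_integral do rewrite /= normr1.
  by rewrite (integral_cst _ measurableT) mul1e.
- by apply: aeW => x k _; have /andP[f0 f1] := f01 k x; rewrite /= ger0_norm// lee_fin.
exact: L.
Qed.

Lemma fubini_tonelli3 d d1 d2 (T : measurableType d) (T1 : measurableType d1)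
    (T2 : measurableType d2) (R : realType) (m : {sigma_finite_measure set T -> \bar R})
    (m1 : {sigma_finite_measure set T1 -> \bar R}) (m2 : {sigma_finite_measure set T2 -> \bar R})
    (F : T * T1 * T2 -> \bar R) : measurable_fun [set: T * T1 * T2] F ->
  (forall p, (0 <= F p)%E) ->
  (\int[m]_w \int[m1]_s \int[m2]_t F (w, s, t) = \int[m1]_s \int[m2]_t \int[m]_w F (w, s, t))%E.
Proof.
move=> mF F0.
rewrite (@fubini_tonelli _ _ _ _ R m m1 (fun p => \int[m2]_t F (p, t))%E); last 2 first.
- exact: measurable_fun_fubini_tonelli_F.
- by move=> p; exact: integral_ge0.
apply: eq_integral => s _.
have mFs : measurable_fun [set: T * T2] (fun p : T * T2 => F (p.1, s, p.2)).
  apply: (measurableT_comp mF (g := fun p : T * T2 => (p.1, s, p.2))).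
  apply: measurable_fun_pair => //; apply: measurable_fun_pair => //.
exact: (@fubini_tonelli _ _ _ _ R m m2 (fun p => F (p.1, s, p.2)) mFs (fun p => F0 _)).
Qed.

Section smoothing.
Context {R : realType}.
Local Notation mu := (@lebesgue_measure R).
Local Notation gam := (@normal_prob R 0 1).

Section one_pair.
Context d (T : measurableType d) (P : {sigma_finite_measure set T -> \bar R}) (U V : T -> R)
  (mU : measurable_fun [set: T] U) (mV : measurable_fun [set: T] V).

(** A Gaussian bump is a Gaussian average of cosines. Hence the mean of a bump centred at any point
    [(c, e)] is determined by the integrals of [1 + cos] of affine functions of [U] and [V]. *)
Lemma smoothing_fourier (k c e : R) :
  (\int[P]_w (1 + expR (- ((k * (U w - c)) ^+ 2 / 2)) * expR (- ((k * (V w - e)) ^+ 2 / 2)))%:E =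
   \int[gam]_s \int[gam]_t \int[P]_w (1 + cos (k * s * U w + k * t * V w - (k * s * c + k * t * e)))%:E)%E.
Proof.
pose F (w : T) (s t : R) : \bar R :=
  (1 + cos (k * s * U w + k * t * V w - (k * s * c + k * t * e)))%:E.
have F0 w s t : (0 <= F w s t)%E by rewrite lee_fin -lerBlDl sub0r cos_geN1.
have E w : (\int[gam]_s \int[gam]_t F w s t)%E =
    (1 + expR (- ((k * (U w - c)) ^+ 2 / 2)) * expR (- ((k * (V w - e)) ^+ 2 / 2)))%:E.
  set x := k * (U w - c); set y := k * (V w - e); set q := expR (- (y ^+ 2 / 2)).
  have q0 : 0 <= q by exact: expR_ge0.
  have q1 : q <= 1 by rewrite -expR0 ler_expR oppr_le0 divr_ge0// sqr_ge0.
  (* Written with the coefficients [1 - q] and [q], nonnegative because [q <= 1], so as to stay with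
     integrals of nonnegative functions. *)
  transitivity (\int[gam]_s ((1 - q)%:E + q%:E * (1 + cos (x * s - 0))%:E))%E.
    apply: eq_integral => s _.
    transitivity (\int[gam]_t (1 + cos (y * t - - (x * s)))%:E)%E.
      by apply: eq_integral => t _; rewrite /F /x /y; congr (1 + cos _)%:E; ring.
    by rewrite integral_normal_cos cosN subr0 -EFinM -EFinD; congr EFin; rewrite -/q; ring.
  have mc : measurable_fun [set: R] (fun s : R => (1 + cos (x * s - 0))%:E).
    by apply/measurable_EFinP; apply: measurable_funD => //; exact: measurable_cosM.
  have c0 (s : R) : (0 <= (1 + cos (x * s - 0))%:E)%E.
    by rewrite lee_fin -lerBlDl sub0r cos_geN1.
  have q0' : (0 <= q%:E)%E by rewrite lee_fin.
  rewrite ge0_integralD//; last 3 first.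
  - by move=> s _; rewrite lee_fin subr_ge0.
  - by move=> s _; exact: mule_ge0.
  - exact: emeasurable_funM.
  rewrite (ge0_integralZl gam measurableT mc (fun s _ => c0 s) q0').
  rewrite integral_normal_cos integral_cst// [X in (_ * X + _)%E]normal_setT mule1 cos0.
  by rewrite -EFinM -EFinD; congr EFin; ring.
transitivity (\int[P]_w \int[gam]_s \int[gam]_t F w s t)%E.
  by apply: eq_integral => w _; rewrite E.
apply: (@fubini_tonelli3 _ _ _ T (measurableTypeR R) (measurableTypeR R) R P gam gam (fun p => F p.1.1 p.1.2 p.2)) => //.
apply/measurable_EFinP; apply: measurable_funD => //.
have mcos : measurable_fun [set: R] (@cos R) by exact: continuous_measurable_fun (@continuous_cos R).
apply: (measurableT_comp mcos).
pose D := (T * measurableTypeR R * measurableTypeR R)%type.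
have m1 : measurable_fun [set: D] (fun x : D => x.1.1 : T) by exact: (measurableT_comp measurable_fst measurable_fst).
have m2 : measurable_fun [set: D] (fun x : D => x.1.2 : R) by exact: (measurableT_comp measurable_snd measurable_fst).
have m3 : measurable_fun [set: D] (fun x : D => x.2 : R) by exact: measurable_snd.
have mk (h : D -> R) : measurable_fun [set: D] h -> measurable_fun [set: D] (fun x => k * h x).
  by move=> mh; exact: measurable_funM.
have mc (h : D -> R) (a : R) : measurable_fun [set: D] h -> measurable_fun [set: D] (fun x => h x * a).
  by move=> mh; exact: measurable_funM.
apply: measurable_funB; apply: measurable_funD.
- by apply: measurable_funM; [exact: (mk _ m2)|exact: (measurableT_comp mU m1)].
- by apply: measurable_funM; [exact: (mk _ m3)|exact: (measurableT_comp mV m1)].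
- exact: (mc _ _ (mk _ m2)).
- exact: (mc _ _ (mk _ m3)).
Qed.

Lemma normal_pdf_smooth (k u c : R) : 0 < k ->
  normal_pdf u k^-1 c = normal_peak k^-1 * expR (- ((k * (u - c)) ^+ 2 / 2)).
Proof.
move=> k0; rewrite normal_pdfE ?invr_neq0 ?gt_eqF// /normal_fun; congr (_ * expR _).
by rewrite -[_ ^+ 2 *+ 2]mulr_natr; field; rewrite gt_eqF.
Qed.

(** After adding an independent normal noise of size [k^-1], the law of [(U, V)] enters only through
    its mean Gaussian bumps. *)
Lemma smoothing_convolution (k : R) (h : R * R -> \bar R) : 0 < k ->
  measurable_fun [set: R * R] h -> (forall p, (0 <= h p)%E) ->
  (\int[P]_w \int[gam]_x \int[gam]_y h (U w + k^-1 * x, V w + k^-1 * y)%R =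
   \int[mu]_c \int[mu]_e (h (c, e) *
     ((normal_peak k^-1) ^+ 2)%:E * \int[P]_w
       (expR (- ((k * (U w - c)) ^+ 2 / 2)) * expR (- ((k * (V w - e)) ^+ 2 / 2)))%:E))%E.
Proof.
move=> k0 mh h0.
have k1 : k^-1 != 0 by rewrite invr_neq0// gt_eqF.
have p0 (u c : R) : (0 <= (normal_pdf u k^-1 c)%:E)%E by rewrite lee_fin normal_pdf_ge0.
pose q := normal_peak k^-1 : R; have q0 : 0 <= q by exact: normal_peak_ge0.
pose g (W : T -> R) w (c : R) := q * expR (- ((k * (W w - c)) ^+ 2 / 2)).
have g0 W w c : (0 <= (g W w c)%:E)%E by rewrite lee_fin mulr_ge0// expR_ge0.
have gE W w c : g W w c = normal_pdf (W w) k^-1 c by rewrite normal_pdf_smooth.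
pose F w c e : \bar R := (h (c, e) * (g V w e)%:E * (g U w c)%:E)%E.
have F0 w c e : (0 <= F w c e)%E by rewrite /F !mule_ge0.
transitivity (\int[P]_w \int[mu]_c \int[mu]_e F w c e)%E.
  apply: eq_integral => w _.
  have mh2 c : measurable_fun [set: R] (fun e => h (c, e)).
    exact: (measurableT_comp mh (measurable_pair1 c)).
  transitivity (\int[gam]_x \int[normal_prob (V w) k^-1]_e h ((U w + k^-1 * x)%R, e))%E.
    apply: eq_integral => x _; rewrite (ge0_integral_normal_affine (V w) k1 (mh2 _))//.
  have mg : measurable_fun [set: R] (fun c => \int[normal_prob (V w) k^-1]_e h (c, e))%E.
    by apply: (@measurable_fun_fubini_tonelli_F _ _ _ (measurableTypeR R) R (normal_prob (V w) k^-1) h).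
  have g1 c : (0 <= \int[normal_prob (V w) k^-1]_e h (c, e))%E by exact: integral_ge0.
  rewrite -(ge0_integral_normal_affine (U w) k1 mg g1) (ge0_integral_normal _ _ mg g1).
  apply: eq_integral => c _.
  have mV2 : measurable_fun [set: R] (fun e => (normal_pdf (V w) k^-1 e)%:E).
    by apply/measurable_EFinP; exact: measurable_normal_pdf.
  rewrite (ge0_integral_normal _ _ (mh2 c))// -(ge0_integralZr mu measurableT); last 3 first.
  - by apply: emeasurable_funM; [exact: mh2|exact: mV2].
  - by move=> e _; rewrite mule_ge0.
  - by [].
  by apply: eq_integral => e _; rewrite /F !gE.
pose D := (T * measurableTypeR R * measurableTypeR R)%type.
have m1 : measurable_fun [set: D] (fun x : D => x.1.1 : T) by exact: (measurableT_comp measurable_fst measurable_fst).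
have m2 : measurable_fun [set: D] (fun x : D => x.1.2 : R) by exact: (measurableT_comp measurable_snd measurable_fst).
have m3 : measurable_fun [set: D] (fun x : D => x.2 : R) by exact: measurable_snd.
have mg (W : T -> R) (b : D -> R) : measurable_fun [set: T] W -> measurable_fun [set: D] b ->
    measurable_fun [set: D] (fun x : D => (g W x.1.1 (b x))%:E).
  move=> mW mb; apply/measurable_EFinP; apply: measurable_funM => //.
  apply: (measurableT_comp (@measurable_expR R)); apply: measurable_funN; apply: measurable_funM => //.
  apply: measurable_funX; apply: measurable_funM => //; apply: measurable_funB => //.
  exact: (measurableT_comp mW m1).
rewrite (@fubini_tonelli3 _ _ _ T (measurableTypeR R) (measurableTypeR R) R P mu mu (fun p => F p.1.1 p.1.2 p.2)) => [|| [[w c] e]]; last 2 first.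
- apply: emeasurable_funM; last exact: mg.
  apply: emeasurable_funM; last exact: mg.
  by apply: (measurableT_comp mh (g := fun x : D => (x.1.2, x.2))); exact: measurable_fun_pair.
- exact: F0.
apply: eq_integral => c _; apply: eq_integral => e _ /=.
transitivity (\int[P]_w ((h (c, e) * (q ^+ 2)%:E) * (expR (- ((k * (U w - c)) ^+ 2 / 2)) * expR (- ((k * (V w - e)) ^+ 2 / 2)))%:E))%E.
  by apply: eq_integral => w _; rewrite /F /g -!muleA -!EFinM; congr (_ * _%:E)%E; ring.
have me (W : T -> R) (b : R) : measurable_fun [set: T] W ->
    measurable_fun [set: T] (fun w => expR (- ((k * (W w - b)) ^+ 2 / 2))).
  move=> mW; apply: (measurableT_comp (@measurable_expR R)); apply: measurable_funN; apply: measurable_funM => //.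
  by apply: measurable_funX; apply: measurable_funM => //; exact: measurable_funB.
rewrite (ge0_integralZl P measurableT).
- by [].
- by apply/measurable_EFinP; apply: measurable_funM; exact: me.
- by move=> w _; rewrite lee_fin mulr_ge0 ?expR_ge0.
- by apply: mule_ge0 => //; rewrite lee_fin sqr_ge0.
Qed.

Lemma gauss_setT2 : prodm gam gam [set: R * R] = 1%E.
Proof.
rewrite -setXTT /prodm product_measure1E//.
by rewrite [X in (X * _)%E]normal_setT [X in (_ * X)%E]normal_setT mule1.
Qed.

Lemma integral_gauss2 (f : R * R -> \bar R) : measurable_fun [set: R * R] f ->
  (forall p, (0 <= f p)%E) ->
  (\int[prodm gam gam]_p f p = \int[gam]_x \int[gam]_y f (x, y))%E.
Proof. by move=> mf f0; exact: fubini_tonelli1. Qed.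

Hypothesis P1 : P [set: T] = 1%E.

(** Removes the noise: bounded convergence on the product of [P] with the laws of the two noise
    variables, as their size tends to 0. *)
Lemma smoothing_limit (h : R * R -> R) : measurable_fun [set: R * R] h ->
  continuous h -> (forall p, 0 <= h p <= 1) ->
  (\int[P]_w \int[gam]_x \int[gam]_y (h (U w + k.+1%:R^-1 * x, V w + k.+1%:R^-1 * y))%:E)%E
    @[k --> \oo] --> (\int[P]_w (h (U w, V w))%:E)%E.
Proof.
move=> mh ch h01.
pose M := prodm P (prodm gam gam).
pose f_ (k : nat) (p : T * (R * R)) := h (U p.1 + k.+1%:R^-1 * p.2.1, V p.1 + k.+1%:R^-1 * p.2.2).
pose f (p : T * (R * R)) := h (U p.1, V p.1).
pose D := (T * (measurableTypeR R * measurableTypeR R))%type.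
have m1 : measurable_fun [set: D] (fun p : D => p.2.1 : R) by exact: (measurableT_comp measurable_fst measurable_snd).
have m2 : measurable_fun [set: D] (fun p : D => p.2.2 : R) by exact: (measurableT_comp measurable_snd measurable_snd).
have mW (W : T -> R) : measurable_fun [set: T] W -> measurable_fun [set: D] (fun p : D => W p.1).
  by move=> mW; exact: (measurableT_comp mW measurable_fst).
have mf_ k : measurable_fun [set: D] (f_ k).
  apply: (measurableT_comp mh (g := fun p : D => (U p.1 + k.+1%:R^-1 * p.2.1, V p.1 + k.+1%:R^-1 * p.2.2))).
  apply: measurable_fun_pair; apply: measurable_funD; try exact: mW.
    exact: measurable_funM.
  exact: measurable_funM.
have mf : measurable_fun [set: D] f.
  apply: (measurableT_comp mh (g := fun p : D => (U p.1, V p.1))).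
  by apply: measurable_fun_pair; exact: mW.
have M1 : M [set: D] = 1%E.
  rewrite -setXTT /M /prodm product_measure1E//.
  by rewrite [X in (X * _)%E]P1 [X in (_ * X)%E]gauss_setT2 mule1.
have h0 p : 0 <= h p by have /andP[] := h01 p.
have IM (g : D -> R) : measurable_fun [set: D] g -> (forall p, 0 <= g p) ->
    (\int[M]_p (g p)%:E = \int[P]_w \int[gam]_x \int[gam]_y (g (w, (x, y)))%:E)%E.
  move=> mg g0; rewrite (@fubini_tonelli1 _ _ _ _ R P (prodm gam gam) (fun p => (g p)%:E)); last 2 first.
  - exact/measurable_EFinP.
  - by move=> p; rewrite lee_fin.
  apply: eq_integral => w _; rewrite /fubini_F (@integral_gauss2 (fun p => (g (w, p))%:E)) => [//||p].
    by apply/measurable_EFinP; exact: (measurableT_comp mg (measurable_pair1 w)).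
  by rewrite lee_fin.
have L : (\int[M]_p (f_ k p)%:E)%E @[k --> \oo] --> (\int[M]_p (f p)%:E)%E.
  apply: bounded_cvg_integral => //.
  - by rewrite [X in (X < _)%E]M1 ltry.
  - move=> p; rewrite /f_ /f.
    have c0 (a : R) : k.+1%:R^-1 * a @[k --> \oo] --> (0 : R).
      by rewrite -(mul0r a); apply: cvgMl; exact: cvg_harmonic.
    have cU (u a : R) : u + k.+1%:R^-1 * a @[k --> \oo] --> u.
      by rewrite -[X in _ --> X]addr0; apply: cvgD; [exact: cvg_cst|exact: c0].
    exact: (cvg_comp (fun k : nat => (U p.1 + k.+1%:R^-1 * p.2.1, V p.1 + k.+1%:R^-1 * p.2.2)) h (cvg_pair (cU _ _) (cU _ _)) (ch (U p.1, V p.1))).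
  - by move=> k p; exact: h01.
rewrite (IM f mf) in L; last by move=> p; exact: h0.
rewrite [X in X @ _ --> _](_ : _ = (fun k => \int[M]_p (f_ k p)%:E)%E); last first.
  by apply/funext => k; rewrite IM// => p; exact: h0.
rewrite [X in _ --> X](_ : _ = \int[P]_w \int[gam]_x \int[gam]_y (f (w, (x, y)))%:E)%E//.
apply: eq_integral => w _; rewrite /f/=.
have E : (\int[gam]__ (h (U w, V w))%:E = (h (U w, V w))%:E)%E.
  by rewrite integral_cst// [X in (_ * X)%E]normal_setT mule1.
by under [RHS]eq_integral do rewrite E.
Qed.

End one_pair.

Section two_pairs.
Context d (T : measurableType d) (P : {sigma_finite_measure set T -> \bar R}) (U V : T -> R)
  (mU : measurable_fun [set: T] U) (mV : measurable_fun [set: T] V) (P1 : P [set: T] = 1%E).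
Context d' (T' : measurableType d') (Q : {sigma_finite_measure set T' -> \bar R}) (U' V' : T' -> R)
  (mU' : measurable_fun [set: T'] U') (mV' : measurable_fun [set: T'] V') (Q1 : Q [set: T'] = 1%E).
Hypothesis same : forall s t c : R,
  (\int[P]_w (1 + cos (s * U w + t * V w - c))%:E =
   \int[Q]_w (1 + cos (s * U' w + t * V' w - c))%:E)%E.

Let add1 d1 (T1 : measurableType d1) (m : {sigma_finite_measure set T1 -> \bar R}) (f : T1 -> R) :
  m [set: T1] = 1%E -> measurable_fun [set: T1] f -> (forall w, 0 <= f w) ->
  (\int[m]_w (1 + f w)%:E = 1 + \int[m]_w (f w)%:E)%E.
Proof.
move=> m1 mf f0; under eq_integral do rewrite EFinD.
rewrite ge0_integralD//; last 2 first.
- by move=> w _; rewrite lee_fin.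
- exact/measurable_EFinP.
by congr (_ + _)%E; rewrite (integral_cst m measurableT) [X in (_ * X)%E]m1 mule1.
Qed.

Let me d1 (T1 : measurableType d1) (W : T1 -> R) (k b : R) : measurable_fun [set: T1] W ->
  measurable_fun [set: T1] (fun w => expR (- ((k * (W w - b)) ^+ 2 / 2))).
Proof.
move=> mW; apply: (measurableT_comp (@measurable_expR R)); apply: measurable_funN; apply: measurable_funM => //.
by apply: measurable_funX; apply: measurable_funM => //; exact: measurable_funB.
Qed.

Lemma eq_integral_of_fourier (h : R * R -> R) : measurable_fun [set: R * R] h ->
  continuous h -> (forall p, 0 <= h p <= 1) ->
  (\int[P]_w (h (U w, V w))%:E = \int[Q]_w (h (U' w, V' w))%:E)%E.
Proof.
move=> mh ch h01.
have h0 p : (0 <= (h p)%:E)%E by rewrite lee_fin; have /andP[] := h01 p.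
have A (k c e : R) :
  (\int[P]_w (expR (- ((k * (U w - c)) ^+ 2 / 2)) * expR (- ((k * (V w - e)) ^+ 2 / 2)))%:E =
   \int[Q]_w (expR (- ((k * (U' w - c)) ^+ 2 / 2)) * expR (- ((k * (V' w - e)) ^+ 2 / 2)))%:E)%E.
  suff : (forall a b : \bar R, 1 + a = 1 + b -> a = b)%E.
    apply.
  2: by move=> [a| |] [b| |]//= [] /addrI ->.
  rewrite -!add1//; try by move=> w; rewrite mulr_ge0 ?expR_ge0.
  - rewrite (smoothing_fourier P mU mV) (smoothing_fourier Q mU' mV').
    by apply: eq_integral => s _; apply: eq_integral => t _; exact: same.
  - by apply: measurable_funM; exact: me.
  - by apply: measurable_funM; exact: me.
have lP := smoothing_limit mU mV P1 mh ch h01.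
have lQ := smoothing_limit mU' mV' Q1 mh ch h01.
rewrite [X in X @ _ --> _](_ : _ = (fun k : nat => \int[Q]_w \int[gam]_x \int[gam]_y (h (U' w + k.+1%:R^-1 * x, V' w + k.+1%:R^-1 * y))%:E)%E) in lP.
  exact: (cvg_unique _ lP lQ).
apply/funext => k.
have k0 : (0 : R) < k.+1%:R by [].
have mhE : measurable_fun [set: R * R] (fun p => (h p)%:E) by exact/measurable_EFinP.
rewrite (smoothing_convolution P mU mV k0 mhE h0) (smoothing_convolution Q mU' mV' k0 mhE h0).
by apply: eq_integral => c _; apply: eq_integral => e _; rewrite A.
Qed.

(** The truncations [h j] of [j * g] to [[0, 1]] are continuous and tend to the indicator of the set
    where [g] is positive. *)
Lemma eq_measure_pos_of_fourier (g : R * R -> R) : measurable_fun [set: R * R] g ->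
  continuous g -> P [set w | 0 < g (U w, V w)] = Q [set w | 0 < g (U' w, V' w)].
Proof.
move=> mg cg.
pose h (j : nat) p := Num.min 1 (Num.max 0 (j%:R * g p)).
have h01 j p : 0 <= h j p <= 1.
  by rewrite /h le_min ler01 le_max lexx/= ge_min lexx.
have lim d1 (T1 : measurableType d1) (m : {sigma_finite_measure set T1 -> \bar R}) (W1 W2 : T1 -> R) :
   m [set: T1] = 1%E -> measurable_fun [set: T1] W1 -> measurable_fun [set: T1] W2 ->
   (\int[m]_w (h j (W1 w, W2 w))%:E)%E @[j --> \oo] --> m [set w | 0 < g (W1 w, W2 w)].
  move=> m1 mW1 mW2.
  have mgW : measurable_fun [set: T1] (fun w => g (W1 w, W2 w)).
    by apply: (measurableT_comp mg (g := fun w => (W1 w, W2 w))); exact: measurable_fun_pair.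
  have mA : measurable [set w | 0 < g (W1 w, W2 w)].
    rewrite (_ : [set w | _] = (fun w => 0 < g (W1 w, W2 w)) @^-1` [set true])//.
    by rewrite -[X in measurable X]setTI; apply: measurable_fun_ltr => //.
  rewrite -[X in m X]setIT -integral_indic//.
  apply: bounded_cvg_integral.
  - by rewrite [X in (X < _)%E]m1 ltry.
  - move=> j; apply: measurable_minr => //; apply: measurable_maxr => //.
    exact: measurable_funM.
  - exact: measurable_indic.
  - move=> w; rewrite indicE; have [gw|gw] := ltP 0 (g (W1 w, W2 w)); last first.
      rewrite memNset/=; last by rewrite ltNge gw.
      apply: cvg_near_cst; apply: nearW => j; rewrite /h max_l ?min_r//.
      by rewrite mulr_ge0_le0.
    rewrite mem_set//=; apply: cvg_near_cst; exists (Num.bound (g (W1 w, W2 w))^-1) => // j /= bj.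
    rewrite /h min_l// le_max; apply/orP; right.
    rewrite -ler_pdivrMr// mul1r; have gi : 0 <= (g (W1 w, W2 w))^-1 by rewrite invr_ge0 ltW.
    by apply: (le_trans (ltW (archi_boundP gi))); rewrite ler_nat.
  - by move=> j w; exact: h01.
have mh j : measurable_fun [set: R * R] (h j).
  apply: measurable_minr => //; apply: measurable_maxr => //.
  exact: measurable_funM.
have ch j : continuous (h j).
  have -> : h j = (fun=> 1) \min ((fun=> 0) \max (fun p => j%:R * g p)) by [].
  move=> p; apply: (@continuous_min R (R * R)%type (fun=> 1) _ p); first exact: cvg_cst.
  apply: (@continuous_max R (R * R)%type (fun=> 0) _ p); first exact: cvg_cst.
  by apply: cvgMr; exact: cg.
have lP := lim _ _ P U V P1 mU mV.
have lQ := lim _ _ Q U' V' Q1 mU' mV'.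
rewrite [X in X @ _ --> _](_ : _ = (fun j => \int[Q]_w (h j (U' w, V' w))%:E)%E) in lP.
  exact: (cvg_unique _ lP lQ).
by apply/funext => j; exact: eq_integral_of_fourier.
Qed.

End two_pairs.
End smoothing.

(** * Level crossings of a Gaussian field at two points *)

Lemma probability_integral_cst d (T : measurableType d) (R : realType) (P : probability T R) (k : R) :
  (\int[P]__ k%:E = k%:E)%E.
Proof. by rewrite (integral_cst _ measurableT) [X in (_ * X)%E]probability_setT mule1. Qed.

Lemma ltr_neq_of_mul_lt0 (R : realFieldType) (x y a : R) :
  (x - a) * (y - a) < 0 -> (x < a) != (y < a).
Proof. by move=> H; case: ltP => h1; case: ltP => h2 //; exfalso; nra. Qed.

Section gaussian_field_pair.
Context {R : realType} {n : nat} {dO : measure_display} {Omega : measurableType dO}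
  {P : probability Omega R} {X : 'rV[R]_n -> {RV P >-> R}} {F : probability 'rV[R]_n R}.
Hypotheses (hgauss : gaussian_field X) (hcent : centered_field X) (hF : spectral_measure X F).
Local Notation gam := (@normal_prob R 0 1).
Local Notation mu := (@lebesgue_measure R).

Lemma measurable_field t : measurable_fun [set: Omega] (X t : Omega -> R).
Proof. exact: measurable_funP. Qed.

Definition covf (h : 'rV[R]_n) : R := \int[F]_l cos (dot l h).

Lemma measurable_cos_dot (h : 'rV[R]_n) : measurable_fun [set: 'rV[R]_n] (fun l => cos (dot l h)).
Proof.
have mcos : measurable_fun [set: R] (@cos R) by exact: continuous_measurable_fun (@continuous_cos R).
by apply: (measurableT_comp mcos); exact: measurable_dot.
Qed.

Lemma integrable_cos_dot (h : 'rV[R]_n) : F.-integrable [set: 'rV[R]_n] (EFin \o (fun l => cos (dot l h))).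
Proof.
apply/integrableP; split; first by apply/measurable_EFinP; exact: measurable_cos_dot.
apply: (@le_lt_trans _ _ (\int[F]_l 1)%E).
  apply: ge0_le_integral => //.
  - by apply: measurableT_comp => //; apply/measurable_EFinP; exact: measurable_cos_dot.
  - by move=> l _; rewrite /= lee_fin ler_norml cos_geN1 cos_le1.
by rewrite (probability_integral_cst F 1) ltry.
Qed.

Lemma covfE (h : 'rV[R]_n) : (\int[F]_l (cos (dot l h))%:E = (covf h)%:E)%E.
Proof. by rewrite /covf /Rintegral fineK//; apply: integrable_fin_num => //; exact: integrable_cos_dot. Qed.

Lemma covf0 : covf 0 = 1.
Proof.
apply: EFin_inj; rewrite -covfE; transitivity (\int[F]_l 1)%E.
  by apply: eq_integral => l _; rewrite (_ : dot l 0 = 0) ?cos0// /dot big1// => i _; rewrite mxE mulr0.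
exact: probability_integral_cst.
Qed.

Lemma integral_field_mul s t : (\int[P]_w (X s w * X t w)%:E = (covf (s - t))%:E)%E.
Proof. by have := hF.2 s t; rewrite covfE unlock. Qed.

Lemma integral_field_sqr t : (\int[P]_w (X t w ^+ 2)%:E = 1)%E.
Proof. by have := integral_field_mul t t; rewrite subrr covf0. Qed.

Lemma integrable_field_sqr t : P.-integrable [set: Omega] (EFin \o (fun w => X t w ^+ 2)).
Proof.
apply/integrableP; split; first by apply/measurable_EFinP; apply: measurable_funX.
under eq_integral do rewrite /= ger0_norm ?sqr_ge0//.
by rewrite integral_field_sqr ltry.
Qed.

Lemma integrable_field_mul s t : P.-integrable [set: Omega] (EFin \o (fun w => X s w * X t w)).
Proof.
apply: (@le_integrable _ _ _ P _ measurableT _ (fun w => (X s w ^+ 2)%R%:E + (X t w ^+ 2)%R%:E)%E).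
- by apply/measurable_EFinP; apply: measurable_funM.
- move=> w _; rewrite /= lee_fin [leRHS]ger0_norm ?addr_ge0 ?sqr_ge0//.
  by rewrite ler_norml; apply/andP; split; nra.
- by apply: integrableD => //; exact: integrable_field_sqr.
Qed.

Lemma integrable_field t : P.-integrable [set: Omega] (EFin \o (X t : Omega -> R)).
Proof.
have i1 : P.-integrable [set: Omega] (fun=> 1%E : \bar R).
  by apply: finite_measure_integrable_cst.
apply: (@le_integrable _ _ _ P _ measurableT _ (fun w => 1%E + (X t w ^+ 2)%R%:E)%E).
- by apply/measurable_EFinP.
- move=> w _; rewrite /= lee_fin [leRHS]ger0_norm ?addr_ge0 ?sqr_ge0//.
  by rewrite ler_norml; apply/andP; split; nra.
- by apply: integrableD => //; exact: integrable_field_sqr.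
Qed.

Lemma integral_field t : (\int[P]_w (X t w)%:E = 0)%E.
Proof. by have := hcent t; rewrite unlock. Qed.

(** The shift by [k] supplies, for [k = 0] and [k = 1], the two moments from which a Gaussian law is
    identified. *)
Lemma integral_field_combination_sqr (p q : 'rV[R]_n) (a b k : R) :
  (\int[P]_w ((a * X p w + b * X q w + k) ^+ 2)%:E =
    (a ^+ 2 + b ^+ 2 + 2 * a * b * covf (p - q) + k ^+ 2)%:E)%E.
Proof.
pose Z w := a * X p w + b * X q w.
have I0 := integral_field.
transitivity (\int[P]_w ((a ^+ 2)%:E * (X p w ^+ 2)%:E + (b ^+ 2)%:E * (X q w ^+ 2)%:E +
   (2 * a * b)%:E * (X p w * X q w)%:E + (2 * a * k)%:E * (X p w)%:E + (2 * b * k)%:E * (X q w)%:E + (k ^+ 2)%:E))%E.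
  by apply: eq_integral => w _; rewrite -!EFinM -!EFinD /Z; congr EFin; ring.
have ip := integrable_field p; have iq := integrable_field q.
have ipp := integrable_field_sqr p; have iqq := integrable_field_sqr q.
have ipq := integrable_field_mul p q.
have ik : P.-integrable [set: Omega] (fun=> (k ^+ 2)%:E : \bar R).
  by apply: finite_measure_integrable_cst.
have iZ (c : R) (g : Omega -> R) : P.-integrable [set: Omega] (EFin \o g) ->
   P.-integrable [set: Omega] (fun w => c%:E * (g w)%:E)%E.
  by move=> ig; exact: (integrableZl measurableT c ig).
rewrite !integralD//; do ?[exact: iZ|apply: integrableD => //].
have E (c : R) (g : Omega -> R) : P.-integrable [set: Omega] (EFin \o g) ->
   (\int[P]_w (c%:E * (g w)%:E) = c%:E * \int[P]_w (g w)%:E)%E.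
  by move=> ig; exact: (integralZl measurableT ig c).
rewrite (E _ _ ipp) (E _ _ iqq) (E _ _ ipq) (E _ _ ip) (E _ _ iq) !I0 !mule0 !adde0.
rewrite !integral_field_sqr integral_field_mul probability_integral_cst !mule1.
by rewrite -!EFinM -!EFinD.
Qed.

Lemma field_combination_variance_ge0 (p q : 'rV[R]_n) (a b : R) :
  0 <= a ^+ 2 + b ^+ 2 + 2 * a * b * covf (p - q).
Proof.
have := integral_field_combination_sqr p q a b 0; rewrite expr0n addr0 => e.
by rewrite -lee_fin -e; apply: integral_ge0 => w _; rewrite lee_fin sqr_ge0.
Qed.

Lemma integral_field_combination (p q : 'rV[R]_n) (a b : R) (f : R -> \bar R) :
  measurable_fun [set: R] f -> (forall x, (0 <= f x)%E) ->
  (\int[P]_w f (a * X p w + b * X q w)%R =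
   \int[gam]_x f (Num.sqrt (a ^+ 2 + b ^+ 2 + 2 * a * b * covf (p - q)) * x)%R)%E.
Proof.
move=> mf f0; pose Z w := a * X p w + b * X q w.
have mZ : measurable_fun [set: Omega] Z.
  by apply: measurable_funD; apply: measurable_funM.
have mom := integral_field_combination_sqr p q a b.
have v0 := field_combination_variance_ge0 p q a b.
have law : gaussian_law (pushforward P Z).
  have := hgauss (fun i : 'I_2 => if i == ord0 then p else q) (fun i : 'I_2 => if i == ord0 then a else b).
  by congr (gaussian_law (pushforward P _)); apply/funext => w; rewrite !big_ord_recl big_ord0 addr0.
apply: (ge0_integral_gaussian_law mZ _ law) => //.
- rewrite sqr_sqrtr//; have := mom 0; rewrite expr0n addr0 => <-.
  by apply: eq_integral => w _; rewrite addr0.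
- by rewrite sqr_sqrtr// mom expr1n.
Qed.

Lemma integral_field1 (t : 'rV[R]_n) (f : R -> \bar R) :
  measurable_fun [set: R] f -> (forall x, (0 <= f x)%E) ->
  (\int[P]_w f (X t w) = \int[gam]_x f x)%E.
Proof.
move=> mf f0; have := integral_field_combination t t 1 0 mf f0.
rewrite expr1n expr0n !addr0 mulr0 mul0r addr0 sqrtr1.
under eq_integral do rewrite mul1r mul0r addr0.
by under [X in _ = X -> _]eq_integral do rewrite mul1r.
Qed.

Lemma field_level_null (t : 'rV[R]_n) (a : R) : P [set w | X t w = a] = 0%E.
Proof.
have mA : measurable [set w | X t w = a].
  by rewrite -[X in measurable X]setTI; exact: (measurable_funP (X t) measurableT _ (measurable_set1 a)).
have m1 : measurable_fun [set: R] (fun x : R => (\1_[set a] x)%:E : \bar R).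
  by apply/measurable_EFinP; exact: measurable_indic.
have n1 (x : R) : (0 <= (\1_[set a] x)%:E :> \bar R)%E by rewrite lee_fin.
transitivity (\int[P]_w (\1_[set a] (X t w))%:E)%E.
  by rewrite -[X in P X]setIT -integral_indic.
rewrite (integral_field1 t m1 n1) (ge0_integral_normal 0 1 m1 n1).
transitivity (\int[mu]_(x in [set a]) (normal_pdf 0 1 x)%:E)%E.
  rewrite [RHS]integral_mkcond; apply: eq_integral => x _.
  by rewrite indicE /patch; case: ifP => _; rewrite ?mul1e ?mul0e.
by rewrite integral_set1.
Qed.

Definition sdev_sum p q := Num.sqrt (2 + 2 * covf (p - q)).
Definition sdev_diff p q := Num.sqrt (2 - 2 * covf (p - q)).

(** The variances of [X p + X q] and [X p - X q] are nonnegative. *)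
Lemma covf_bounds p q : - 1 <= covf (p - q) <= 1.
Proof.
have h1 := field_combination_variance_ge0 p q 1 1.
have h2 := field_combination_variance_ge0 p q 1 (-1).
by apply/andP; split; nra.
Qed.

Lemma integral_affine_normal_cos (u v c : R) :
  (\int[prodm gam gam]_x (1 + cos (u * x.1 + v * x.2 - c))%:E =
   (1 + expR (- ((u ^+ 2 + v ^+ 2) / 2)) * cos c)%:E)%E.
Proof.
have mcos : measurable_fun [set: R] (@cos R) by exact: continuous_measurable_fun (@continuous_cos R).
pose D := (measurableTypeR R * measurableTypeR R)%type.
have m1 : measurable_fun [set: D] (fun p : D => p.1 : R) by exact: measurable_fst.
have m2 : measurable_fun [set: D] (fun p : D => p.2 : R) by exact: measurable_snd.
have mk (h : D -> R) (k : R) : measurable_fun [set: D] h -> measurable_fun [set: D] (fun x => k * h x).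
  by move=> mh; exact: measurable_funM.
rewrite (integral_gauss2 (f := fun x : R * R => (1 + cos (u * x.1 + v * x.2 - c))%:E)); last 2 first.
- apply/measurable_EFinP; apply: measurable_funD => //; apply: (measurableT_comp mcos).
  apply: measurable_funB => //; apply: measurable_funD; exact: mk.
- by move=> x; rewrite lee_fin -lerBlDl sub0r cos_geN1.
pose q := expR (- (v ^+ 2 / 2)).
have q0 : 0 <= q by exact: expR_ge0.
have q1 : q <= 1 by rewrite -expR0 ler_expR oppr_le0 divr_ge0// sqr_ge0.
transitivity (\int[gam]_s ((1 - q)%:E + q%:E * (1 + cos (u * s - c))%:E))%E.
  apply: eq_integral => s _.
  transitivity (\int[gam]_t (1 + cos (v * t - (c - u * s)))%:E)%E.
    by apply: eq_integral => t _; congr (1 + cos _)%:E => /=; ring.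
  rewrite integral_normal_cos -EFinM -EFinD -/q -[in RHS]cosN; congr EFin.
  by rewrite opprB; ring.
have mc : measurable_fun [set: R] (fun s : R => (1 + cos (u * s - c))%:E).
  by apply/measurable_EFinP; apply: measurable_funD => //; exact: measurable_cosM.
have c0 (s : R) : (0 <= (1 + cos (u * s - c))%:E)%E.
  by rewrite lee_fin -lerBlDl sub0r cos_geN1.
have q0' : (0 <= q%:E)%E by rewrite lee_fin.
rewrite ge0_integralD//; last 3 first.
- by move=> s _; rewrite lee_fin subr_ge0.
- by move=> s _; exact: mule_ge0.
- exact: emeasurable_funM.
rewrite (ge0_integralZl gam measurableT mc (fun s _ => c0 s) q0').
rewrite integral_normal_cos integral_cst// [X in (_ * X + _)%E]normal_setT mule1.
rewrite -EFinM -EFinD; congr EFin; rewrite mulrDl opprD expRD -/q; ring.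
Qed.

(* X p + X q and X q - X p are independent centered Gaussian variables. *)
Lemma field_crossing_prob (p q : 'rV[R]_n) (a : R) :
  P [set w | (X p w < a) != (X q w < a)] =
  prodm gam gam [set x | `|sdev_sum p q * x.1 - 2 * a| < `|sdev_diff p q * x.2|].
Proof.
have /andP[r1 r2] := covf_bounds p q.
set al := sdev_sum p q; set be := sdev_diff p q.
have al2 : al ^+ 2 = 2 + 2 * covf (p - q) by rewrite sqr_sqrtr//; lra.
have be2 : be ^+ 2 = 2 - 2 * covf (p - q) by rewrite sqr_sqrtr//; lra.
(* With [U = X p + X q] and [V = X q - X p], the product of [X p - a] and [X q - a] is a quarter of
   [(U - 2 a) ^ 2 - V ^ 2], so [0 < g (U, V)] says that they have opposite strict signs. *)
pose g (z : R * R) := `|z.2| - `|z.1 - 2 * a|.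
have mg : measurable_fun [set: R * R] g.
  apply: measurable_funB; apply: (measurableT_comp (@normr_measurable R setT)) => //.
  exact: measurable_funB.
have cg : continuous g.
  move=> z; apply: cvgB; apply: cvg_norm; first exact: cvg_snd.
  by apply: cvgB; [exact: cvg_fst|exact: cvg_cst].
have mU : measurable_fun [set: Omega] (fun w => X p w + X q w) by exact: measurable_funD.
have mV : measurable_fun [set: Omega] (fun w => X q w - X p w) by exact: measurable_funB.
pose D := (measurableTypeR R * measurableTypeR R)%type.
have m1 : measurable_fun [set: D] (fun p : D => al * p.1 : R).
  by apply: measurable_funM => //; exact: measurable_fst.
have m2 : measurable_fun [set: D] (fun p : D => be * p.2 : R).
  by apply: measurable_funM => //; exact: measurable_snd.
have same (s t c : R) :
  (\int[P]_w (1 + cos (s * (X p w + X q w) + t * (X q w - X p w) - c))%:E =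
   \int[prodm gam gam]_x (1 + cos (s * (al * x.1) + t * (be * x.2) - c))%:E)%E.
  transitivity (\int[P]_w (1 + cos ((s - t) * X p w + (s + t) * X q w - c))%:E)%E.
    by apply: eq_integral => w _; congr (1 + cos _)%:E; ring.
  rewrite (@integral_field_combination p q (s - t) (s + t) (fun z => (1 + cos (z - c))%:E)); last 2 first.
  - apply/measurable_EFinP; apply: measurable_funD => //.
    by have := measurable_cosM 1 c; under eq_fun do rewrite mul1r.
  - by move=> z; rewrite lee_fin -lerBlDl sub0r cos_geN1.
  rewrite integral_normal_cos sqr_sqrtr; last exact: field_combination_variance_ge0.
  transitivity (\int[prodm gam gam]_x (1 + cos (s * al * x.1 + t * be * x.2 - c))%:E)%E; last first.
    by apply: eq_integral => x _; congr (1 + cos _)%:E; ring.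
  rewrite integral_affine_normal_cos; congr (1 + expR _ * _)%:E.
  by rewrite !exprMn al2 be2; field.
have E := eq_measure_pos_of_fourier mU mV (@probability_setT _ _ _ P) m1 m2 gauss_setT2 same mg cg.
transitivity (prodm gam gam [set x | 0 < g (al * x.1, be * x.2)]); last first.
  by congr (_ _); apply/seteqP; split => x /=; rewrite /g/= subr_gt0.
apply: etrans E; pose B := [set w | 0 < g (X p w + X q w, X q w - X p w)].
have BE w : B w <-> (X p w - a) * (X q w - a) < 0.
  rewrite /B/= /g/= subr_gt0 -ltr_sqr ?nnegrE// !real_normK ?num_real//.
  by split => H; nra.
have mlt t : measurable_fun [set: Omega] (fun w => X t w < a).
  exact: measurable_fun_ltr.
have mA : measurable [set w | (X p w < a) != (X q w < a)].
  rewrite -[X in measurable X]setTI.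
  have -> : [set w | (X p w < a) != (X q w < a)] =
     (fun w => (X p w < a) && ~~ (X q w < a) || ~~ (X p w < a) && (X q w < a)) @^-1` [set true].
    by apply/seteqP; split => w /=; case: (X p w < a); case: (X q w < a).
  have mn t : measurable_fun [set: Omega] (fun w => ~~ (X t w < a)) by exact: measurable_neg.
  by apply: measurable_or => //; apply: measurable_and.
have mB : measurable B.
  rewrite -[X in measurable X]setTI (_ : B = (fun w => 0 < g (X p w + X q w, X q w - X p w)) @^-1` [set true])//.
  apply: measurable_fun_ltr => //.
  exact: (measurableT_comp mg (g := fun w => (X p w + X q w, X q w - X p w)) (measurable_fun_pair mU mV)).
have mN t : measurable [set w | X t w = a].
  by rewrite -[X in measurable X]setTI; exact: (measurable_funP (X t) measurableT _ (measurable_set1 a)).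
apply/eqP; rewrite eq_le; apply/andP; split.
(* The strict and the large comparison with [a] differ only when [X p] or [X q] equals [a], a null
   event. *)
- apply: (@le_trans _ _ (P (B `|` ([set w | X p w = a] `|` [set w | X q w = a])))).
    apply: le_measure; rewrite ?inE//; first by apply: measurableU => //; exact: measurableU.
    move=> w /= H; have [pe|pe] := eqVneq (X p w) a; first by right; left.
    have [qe|qe] := eqVneq (X q w) a; first by right; right.
    left; apply/BE; move: H pe qe; case: ltgtP => // h1 + _; case: ltgtP => // h2 _ _; nra.
  apply: (le_trans (measureU2 _ _ _)) => //; first exact: measurableU.
  rewrite -[leRHS]adde0; apply: leeD => //.
  apply: (le_trans (measureU2 P (mN p) (mN q))).
  by rewrite [X in (X + _)%E](field_level_null p a) [X in (_ + X)%E](field_level_null q a) adde0.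
- apply: le_measure; rewrite ?inE// => w /BE /=; move: (X p w) (X q w) => x y H.
  exact: ltr_neq_of_mul_lt0.
Qed.

End gaussian_field_pair.

(** * Short-distance asymptotics of the crossing probability *)

Section crossing_asymptotics.
Context {R : realType}.
Local Notation gam := (@normal_prob R 0 1).
Local Notation mu := (@lebesgue_measure R).

(** Obtained by the substitution [2 * a + be * p.2] for the first normal variable times [al], while
    [p.1] is the second normal variable. The Jacobian [be] is factored out of the probability, and
    what remains has a limit as [be] tends to 0. *)
Definition crossing_integrand (al be a : R) (p : R * R) : R :=
  if `|p.2| < `|p.1| then normal_pdf 0 al (2 * a + be * p.2) else 0.

Definition crossing_rate (al be a : R) : \bar R :=
  (\int[prodm gam mu]_p (crossing_integrand al be a p)%:E)%E.

Lemma crossing_integrand_ge0 al be a p : 0 <= crossing_integrand al be a p.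
Proof. by rewrite /crossing_integrand; case: ifP => // _; exact: normal_pdf_ge0. Qed.

Lemma measurable_crossing_integrand al be a :
  measurable_fun [set: measurableTypeR R * measurableTypeR R] (crossing_integrand al be a).
Proof.
pose D := (measurableTypeR R * measurableTypeR R)%type.
have m1 : measurable_fun [set: D] (fun p : D => p.1 : R) by exact: measurable_fst.
have m2 : measurable_fun [set: D] (fun p : D => p.2 : R) by exact: measurable_snd.
apply: measurable_fun_ifT => //.
  by apply: measurable_fun_ltr; apply: (measurableT_comp (@normr_measurable R setT)).
apply: (measurableT_comp (@measurable_normal_pdf R 0 al)).
by apply: measurable_funD => //; exact: measurable_funM.
Qed.

Lemma crossing_rateE (al be a : R) : 0 < al -> 0 <= be ->
  prodm gam gam [set x | `|al * x.1 - 2 * a| < `|be * x.2|] = (be%:E * crossing_rate al be a)%E.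
Proof.
move=> al0; rewrite le_eqVlt => /predU1P[<-|be0].
  rewrite mul0e (_ : [set x | _] = set0) ?measure0//.
  by apply/seteqP; split=> // x /=; rewrite mul0r normr0 ltNge normr_ge0.
pose D := (measurableTypeR R * measurableTypeR R)%type.
have m1 : measurable_fun [set: D] (fun p : D => al * p.1 - 2 * a : R).
  by apply: measurable_funB => //; apply: measurable_funM => //; exact: measurable_fst.
have m2 : measurable_fun [set: D] (fun p : D => be * p.2 : R).
  by apply: measurable_funM => //; exact: measurable_snd.
pose A := [set x : D | `|al * x.1 - 2 * a| < `|be * x.2|].
have mA : measurable A.
  rewrite -[X in measurable X]setTI (_ : A = (fun x : D => `|al * x.1 - 2 * a| < `|be * x.2|) @^-1` [set true])//.
  have ml : measurable_fun [set: D] (fun x : D => `|al * x.1 - 2 * a| < `|be * x.2|).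
    by apply: measurable_fun_ltr; apply: (measurableT_comp (@normr_measurable R setT)).
  exact: (ml measurableT [set true]).
have mi : measurable_fun [set: D] (fun x => (\1_A x)%:E : \bar R) by apply/measurable_EFinP; exact: measurable_indic.
have i0 (x : D) : (0 <= (\1_A x)%:E :> \bar R)%E by rewrite lee_fin.
transitivity (\int[prodm gam gam]_x (\1_A x)%:E)%E.
  by rewrite (@integral_indic _ _ R (prodm gam gam) _ measurableT A mA) setIT.
rewrite /prodm (fubini_tonelli1 _ mi i0) (fubini_tonelli (m1 := gam) (m2 := gam) _ mi i0).
have mci := measurable_crossing_integrand al be a.
have ci0 := crossing_integrand_ge0 al be a.
rewrite /crossing_rate /prodm (@fubini_tonelli1 _ _ _ _ R gam mu (fun p => (crossing_integrand al be a p)%:E)); last 2 first.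
- exact/measurable_EFinP.
- by move=> p; rewrite lee_fin.
have mcy y : measurable_fun [set: R] (fun u => (crossing_integrand al be a (y, u))%:E).
  apply/measurable_EFinP; apply: (measurableT_comp mci (g := fun u : measurableTypeR R => (y, u))).
  exact: measurable_pair1.
rewrite -(ge0_integralZl gam measurableT); last 3 first.
- apply: (@measurable_fun_fubini_tonelli_F _ _ _ _ R mu (fun p => (crossing_integrand al be a p)%:E)).
  + exact/measurable_EFinP.
  + by move=> p; rewrite lee_fin.
- by move=> y _; apply: integral_ge0 => u _; rewrite lee_fin.
- by rewrite lee_fin ltW.
apply: eq_integral => y _; rewrite /fubini_F.
pose f (z : R) : R := if `|z - 2 * a| < `|be * y| then 1 else 0.
have f0 z : (0 <= (f z)%:E)%E by rewrite lee_fin /f; case: ifP.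
have mf : measurable_fun [set: R] (fun z => (f z)%:E).
  apply/measurable_EFinP; apply: measurable_fun_ifT => //.
  apply: measurable_fun_ltr => //; apply: (measurableT_comp (@normr_measurable R setT)).
  exact: measurable_funB.
have al1 : al != 0 by rewrite gt_eqF.
transitivity (\int[gam]_x (f (0 + al * x))%:E)%E.
  apply: eq_integral => x _; rewrite add0r indicE /f /A.
  by case: ifPn => h; [rewrite mem_set|rewrite memNset//=; exact/negP].
rewrite -(ge0_integral_normal_affine 0 al1 mf f0) (ge0_integral_normal _ _ mf f0).
have mp : measurable_fun [set: R] (fun z => (normal_pdf 0 al z)%:E).
  by apply/measurable_EFinP; exact: measurable_normal_pdf.
have mG := emeasurable_funM mf mp.
have G0 z : (0 <= (f z)%:E * (normal_pdf 0 al z)%:E)%E.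
  by apply: mule_ge0 => //; rewrite lee_fin normal_pdf_ge0.
rewrite -(ge0_integral_shift1 (2 * a) mG G0).
have mG2 : measurable_fun [set: R] (fun z => ((f (z + 2 * a)%R)%:E * (normal_pdf 0 al (z + 2 * a)%R)%:E)%E).
  by apply: (measurableT_comp mG (g := fun z : R => z + 2 * a)); exact: measurable_funD.
have bb : (be%:E * (be^-1)%:E = 1)%E by rewrite -EFinM divff// gt_eqF.
rewrite -[LHS]mul1e -bb -muleA -(ge0_integral_scale1 be0 mG2) => [|z]; last exact: G0.
congr (_ * _)%E; apply: eq_integral => u _; rewrite /crossing_integrand/= -EFinM /f addrK !normrM.
rewrite ltr_pM2l ?normr_gt0 ?gt_eqF//; case: ifP => _; rewrite ?mul0r// mul1r.
by rewrite addrC.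
Qed.

Lemma normal_peak_small (al : R) : 1 <= al -> normal_peak al <= 1.
Proof.
move=> al1; rewrite /normal_peak invf_le1 ?sqrtr_gt0.
  rewrite -[X in X <= _]sqrtr1 ler_sqrt.
    have := pi_ge2 R; have : 1 <= al ^+ 2 by rewrite exprn_ege1.
    by rewrite -mulr_natr; nra.
  by rewrite mulrn_wge0// mulr_ge0 ?sqr_ge0 ?pi_ge0.
by rewrite pmulrn_lgt0// mulr_gt0 ?pi_gt0// exprn_gt0// (lt_le_trans ltr01).
Qed.

Let dominating (p : R * R) : R := if `|p.2| < `|p.1| then 1 else 0.

Let measurable_dominating : measurable_fun [set: measurableTypeR R * measurableTypeR R] dominating.
Proof.
apply: measurable_fun_ifT => //; apply: measurable_fun_ltr.
  by apply: (measurableT_comp (@normr_measurable R setT)); exact: measurable_snd.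
by apply: (measurableT_comp (@normr_measurable R setT)); exact: measurable_fst.
Qed.

Let dominating_ge0 p : 0 <= dominating p.
Proof. by rewrite /dominating; case: ifP. Qed.

Let integral_dominating :
  (\int[prodm gam mu]_p (dominating p)%:E = (4 / Num.sqrt (2 * pi))%:E)%E.
Proof.
rewrite /prodm (@fubini_tonelli1 _ _ _ _ R gam mu (fun p => (dominating p)%:E)); last 2 first.
- by apply/measurable_EFinP; exact: measurable_dominating.
- by move=> p; rewrite lee_fin.
transitivity (\int[gam]_y (2%:E * (`|y|)%:E))%E.
  apply: eq_integral => y _; rewrite /fubini_F.
  pose r : R := `|y|.
  transitivity (\int[mu]_(u in `](- r)%R, r%R[) 1)%E.
    rewrite [RHS]integral_mkcond; apply: eq_integral => u _.
    by rewrite /dominating /patch mem_setE in_itv/= -ltr_norml; case: ifP.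
  rewrite integral_cst; last exact: measurable_itv.
  rewrite mul1e [LHS]lebesgue_measure_itv/= lte_fin -EFinM /r.
  have [->|y0] := eqVneq y 0; first by rewrite normr0 oppr0 ltxx mulr0.
  by rewrite gtrN ?normr_gt0// -EFinD; congr EFin; rewrite opprK; ring.
rewrite (ge0_integralZl gam measurableT); last 3 first.
- by apply/measurable_EFinP; exact: normr_measurable.
- by move=> y _; rewrite lee_fin.
- by rewrite lee_fin.
by rewrite normal_first_abs_moment -EFinM; congr EFin; ring.
Qed.

(** Since the squares of [al] and [be] add up to 4, [al] tends to 2: the integrand tends to the
    density at [2 * a] of the normal law of variance 4, on a region of mean length
    [2 E|Y| = 4 / sqrt (2 pi)] for a standard normal [Y]. The bound [be <= 1] keeps [al >= 1], so
    that the densities are at most 1. *)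
Lemma crossing_rate_cvg (be_ : nat -> R) (a : R) : (forall k, 0 <= be_ k <= 1) ->
  be_ k @[k --> \oo] --> (0 : R) ->
  crossing_rate (Num.sqrt (4 - be_ k ^+ 2)) (be_ k) a @[k --> \oo] --> (pi^-1 * expR (- (a ^+ 2 / 2)))%:E.
Proof.
move=> b01 b0.
have al2 k : 3 <= 4 - be_ k ^+ 2.
  by have /andP[h0 h1] := b01 k; nra.
have al1 k : 1 <= Num.sqrt (4 - be_ k ^+ 2).
  rewrite -[X in X <= _]sqrtr1 ler_sqrt; have := al2 k; lra.
pose c1 : R := (Num.sqrt (4 * pi *+ 2))^-1 * expR (- (2 * a) ^+ 2 / (4 *+ 2)).
have c10 : 0 <= c1 by rewrite mulr_ge0 ?expR_ge0// invr_ge0 sqrtr_ge0.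
have L x : normal_pdf 0 (Num.sqrt (4 - be_ k ^+ 2)) (2 * a + be_ k * x) @[k --> \oo] --> c1.
  have E k : normal_pdf 0 (Num.sqrt (4 - be_ k ^+ 2)) (2 * a + be_ k * x) =
     (Num.sqrt ((4 - be_ k ^+ 2) * pi *+ 2))^-1 * expR (- (2 * a + be_ k * x) ^+ 2 / ((4 - be_ k ^+ 2) *+ 2)).
    rewrite normal_pdfE ?gt_eqF ?(lt_le_trans ltr01)// /normal_peak /normal_fun subr0 sqr_sqrtr//.
    by apply: le_trans (al2 k).
  under eq_fun do rewrite E.
  have bb : be_ k ^+ 2 @[k --> \oo] --> (0 : R).
    rewrite -[X in _ --> X](expr0n R 2); exact: (cvg_comp be_ (fun x => x ^+ 2) b0 (@exprn_continuous R 2 0)).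
  have b4 : 4 - be_ k ^+ 2 @[k --> \oo] --> (4 : R).
    by rewrite -[X in _ --> X]subr0; apply: cvgB => //; exact: cvg_cst.
  have sq : Num.sqrt ((4 - be_ k ^+ 2) * pi *+ 2) @[k --> \oo] --> Num.sqrt (4 * pi *+ 2 : R).
    apply: (cvg_comp (fun k => (4 - be_ k ^+ 2) * pi *+ 2) Num.sqrt); last exact: sqrt_continuous.
    by apply: cvgMn; apply: cvgMl.
  apply: cvgM.
    by apply: cvgV => //; rewrite gt_eqF// sqrtr_gt0 pmulrn_lgt0// mulr_gt0// pi_gt0.
  apply: (cvg_comp (fun k => - (2 * a + be_ k * x) ^+ 2 / ((4 - be_ k ^+ 2) *+ 2)) expR); last exact: continuous_expR.
  apply: cvgM.
    have lin : 2 * a + be_ k * x @[k --> \oo] --> 2 * a.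
      rewrite -[X in _ --> X]addr0 -(mul0r x); apply: cvgD; first exact: cvg_cst.
      exact: cvgMl.
    by apply: cvgN; exact: (cvg_comp (fun k => 2 * a + be_ k * x) (fun x => x ^+ 2) lin (@exprn_continuous R 2 (2 * a))).
  by apply: cvgV; [rewrite -mulr_natr mulf_neq0|apply: cvgMn].
have [|||||_ _ D] := @dominated_convergence _ _ R (prodm gam mu) setT measurableT
  (fun k p => (crossing_integrand (Num.sqrt (4 - be_ k ^+ 2)) (be_ k) a p)%:E)
  (fun p => (c1 * dominating p)%:E) (fun p => (dominating p)%:E).
- by move=> k; apply/measurable_EFinP; exact: measurable_crossing_integrand.
- by apply/measurable_EFinP; apply: measurable_funM => //; exact: measurable_dominating.
- apply: aeW => p _; apply: cvg_EFin; first exact: nearW.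
  rewrite /comp/= /crossing_integrand /dominating; case: ifP => _; last by rewrite mulr0; exact: cvg_cst.
  by rewrite mulr1; exact: L.
- apply/integrableP; split; first by apply/measurable_EFinP; exact: measurable_dominating.
  under eq_integral do rewrite /= ger0_norm//.
  by rewrite integral_dominating ltry.
- apply: aeW => p k _; rewrite /= ger0_norm ?crossing_integrand_ge0// lee_fin.
  rewrite /crossing_integrand /dominating; case: ifP => // _.
  apply: (le_trans (normal_pdf_ub _ _ _)); last exact: normal_peak_small.
  by rewrite gt_eqF// (lt_le_trans ltr01).
rewrite [X in _ --> X](_ : _ = (\int[prodm gam mu]_p (c1 * dominating p)%:E)%E); first exact: D.
under [RHS]eq_integral do rewrite EFinM.
rewrite (ge0_integralZl (prodm gam mu) measurableT); last 3 first.
- by apply/measurable_EFinP; exact: measurable_dominating.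
- by move=> p _; rewrite lee_fin.
- by rewrite lee_fin.
rewrite integral_dominating -EFinM; congr EFin; rewrite /c1.
have -> : - (2 * a) ^+ 2 / (4 *+ 2) = - (a ^+ 2 / 2) by rewrite -mulr_natr; field.
have -> : Num.sqrt (4 * pi *+ 2 : R) = 2 * Num.sqrt (2 * pi).
  rewrite (_ : 4 * pi *+ 2 = 2 ^+ 2 * (2 * pi)); last by rewrite -mulr_natr; ring.
  by rewrite sqrtrM ?sqr_ge0// sqrtr_sqr ger0_norm.
have s2 : Num.sqrt (2 * pi) ^+ 2 = 2 * pi :> R by rewrite sqr_sqrtr// mulr_ge0// pi_ge0.
have s0 : Num.sqrt (2 * pi) != 0 :> R by rewrite gt_eqF// sqrtr_gt0 mulr_gt0// pi_gt0.
rewrite [RHS]mulrAC; congr (_ * _); set r := Num.sqrt _ in s2 s0 *.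
have -> : (pi : R) = r ^+ 2 / 2 by rewrite s2; field.
by field.
Qed.

End crossing_asymptotics.

Section spectral_rate.
Context {R : realType} {n : nat} {F : probability 'rV[R]_n R}.
Local Notation gam := (@normal_prob R 0 1).
Local Notation covF := (@covf R n F).

Definition spectral_form (v : 'rV[R]_n) : \bar R := (\int[F]_l (dot l v ^+ 2)%:E)%E.

(** Its square is [4 ^ k * (2 - 2 * cos (x / 2 ^ k))], which integrates against [F] to the variance
    of an increment of [X] over [2 ^- k *: v], normalized by [4 ^ k]. *)
Definition dyadic_secant (k : nat) (x : R) : R := 2 ^+ k.+1 * sin (x / 2 ^+ k.+1).

(** Doubling formula for the sine. By this monotonicity the normalized variances converge to
    [spectral_form] even when it is infinite. *)
Lemma dyadic_secant_sqr_le k x : dyadic_secant k x ^+ 2 <= dyadic_secant k.+1 x ^+ 2.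
Proof.
pose y := x / 2 ^+ k.+2.
have -> : dyadic_secant k x = dyadic_secant k.+1 x * cos y.
  have E : 2 ^+ k.+2 = 2 * 2 ^+ k.+1 :> R by rewrite exprS.
  rewrite /dyadic_secant (_ : x / 2 ^+ k.+1 = y *+ 2); last first.
    by rewrite /y E -mulr_natr; field; rewrite expf_neq0.
  by rewrite sin_mulr2n -/y E -mulr_natr; ring.
by rewrite exprMn ler_piMr ?sqr_ge0//; have := cos2Dsin2 y; have := sqr_ge0 (sin y); lra.
Qed.

Lemma dyadic_secant_cvg (x : R) : dyadic_secant k x @[k --> \oo] --> x.
Proof.
have [->|x0] := eqVneq x 0.
  by apply: cvg_near_cst; apply: nearW => k; rewrite /dyadic_secant mul0r sin0 mulr0.
have d : is_derive (0 : R) 1 (@sin R) 1 by apply: is_derive_eq; rewrite cos0.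
pose t (k : nat) : R := x / 2 ^+ k.+1.
have t0 : (forall k, t k != 0) /\ t k @[k --> \oo] --> (0 : R).
  split=> [k|]; first by rewrite mulf_neq0// invr_neq0// expf_neq0.
  rewrite (_ : t = geometric (x / 2) (2^-1)); first by apply: cvg_geometric; rewrite ger0_norm// invf_lt1// ltr1n.
  by apply/funext => k; rewrite /t /= exprS exprVn; field; rewrite expf_neq0.
have /cvg_ex[/= l fl] := @ex_derive _ _ _ _ _ _ _ d.
have l1 : l = 1.
  by rewrite -[RHS](@derive_val _ _ _ _ _ _ _ d); apply/esym/cvg_lim.
move: fl; rewrite l1 => /cvgr_dnbhsP/(_ _ t0) C.
rewrite -[X in _ --> X]mulr1; rewrite (_ : (fun k => dyadic_secant k x) = (fun k => x * ((t k)^-1 *: (sin (t k *: 1 + 0) - sin 0)))).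
  by apply: cvgMr; exact: C.
apply/funext => k; rewrite /dyadic_secant sin0 subr0 addr0 /t /GRing.scale/= mulr1.
by field; rewrite x0 expf_neq0.
Qed.

Lemma integral_affine_cos_dot (a b : R) (h : 'rV[R]_n) :
  (\int[F]_l (a + b * cos (dot l h))%:E = (a + b * covF h)%:E)%E.
Proof.
have ic := @integrable_cos_dot R n F h.
have ia : F.-integrable [set: 'rV[R]_n] (EFin \o (fun=> a)).
  exact: finite_measure_integrable_cst.
have ib : F.-integrable [set: 'rV[R]_n] (fun l => b%:E * (cos (dot l h))%:E)%E.
  exact: (integrableZl measurableT b ic).
transitivity (\int[F]_l (a%:E + b%:E * (cos (dot l h))%:E))%E.
  by apply: eq_integral => l _; rewrite -EFinM -EFinD.
rewrite integralD// (integralZl measurableT ic b) probability_integral_cst.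
by rewrite [X in (_ + _ * X)%E]covfE -EFinM -EFinD.
Qed.

Lemma integral_dyadic_secant (v : 'rV[R]_n) k :
  (\int[F]_l (dyadic_secant k (dot l v) ^+ 2)%:E)%E =
  (4 ^+ k * (2 - 2 * covF (- (2 ^- k *: v))))%:E.
Proof.
transitivity (\int[F]_l (4 ^+ k * 2 + (- (4 ^+ k * 2)) * cos (dot l (- (2 ^- k *: v))))%:E)%E.
  apply: eq_integral => l _; congr EFin.
  pose y := dot l v / 2 ^+ k.+1.
  have -> : dot l (- (2 ^- k *: v)) = - (y *+ 2).
    by rewrite dotNr dotZr /y exprSr -mulr_natr; field; rewrite expf_neq0.
  rewrite cosN cos_mulr2n /dyadic_secant -/y exprMn.
  have -> : (2 ^+ k.+1 : R) ^+ 2 = 4 ^+ k * 4 by rewrite -exprM mulnC exprM exprSr; congr (_ ^+ _ * _); ring.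
  have c : cos y ^+ 2 = 1 - sin y ^+ 2 by have := cos2Dsin2 y; lra.
  by rewrite c -mulr_natr; ring.
by rewrite integral_affine_cos_dot; congr EFin; ring.
Qed.

Lemma measurable_dyadic_secant k : measurable_fun [set: R] (dyadic_secant k).
Proof.
apply: measurable_funM => //.
have ms : measurable_fun [set: R] (@sin R) by exact: continuous_measurable_fun (@continuous_sin R).
by apply: (measurableT_comp ms); exact: measurable_funM.
Qed.

Lemma spectral_form_cvg (v : 'rV[R]_n) :
  (4 ^+ k * (2 - 2 * covF (- (2 ^- k *: v))))%:E @[k --> \oo] --> spectral_form v.
Proof.
rewrite (_ : (fun k => _) = (fun k => \int[F]_l (dyadic_secant k (dot l v) ^+ 2)%:E)%E); last first.
  by apply/funext => k; rewrite integral_dyadic_secant.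
have L l : (dyadic_secant k (dot l v) ^+ 2)%:E @[k --> \oo] --> (dot l v ^+ 2)%:E.
  apply: cvg_EFin; first exact: nearW.
  have C : dyadic_secant k (dot l v) ^+ 2 @[k --> \oo] --> dot l v ^+ 2.
    by rewrite expr2; under eq_fun do rewrite expr2; apply: cvgM; exact: dyadic_secant_cvg.
  exact: C.
rewrite /spectral_form.
rewrite [X in _ --> X](_ : _ = (\int[F]_l limn (fun k => (dyadic_secant k (dot l v) ^+ 2)%:E))%E); last first.
  by apply: eq_integral => l _; apply/esym/cvg_lim => //; exact: L.
apply: cvg_monotone_convergence => //.
- move=> k; apply/measurable_EFinP; apply: measurable_funX.
  by apply: (measurableT_comp (measurable_dyadic_secant k)); exact: measurable_dot.
- by move=> k l _; rewrite lee_fin sqr_ge0.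
- move=> l _; apply/nondecreasing_seqP => k; rewrite lee_fin.
  exact: dyadic_secant_sqr_le.
Qed.

Lemma covf_cvg1 (v : 'rV[R]_n) : covF (- (2 ^- k *: v)) @[k --> \oo] --> (1 : R).
Proof.
have c0 (l : 'rV[R]_n) : cos (dot l (- (2 ^- k *: v))) @[k --> \oo] --> (1 : R).
  have t0 : - (dot l v * 2^-1 ^+ k) @[k --> \oo] --> (0 : R).
    rewrite -[X in _ --> X]oppr0; apply: cvgN.
    by apply: (@cvg_geometric R (dot l v) 2^-1); rewrite ger0_norm// invf_lt1// ltr1n.
  rewrite -[X in _ --> X]cos0; under eq_fun do rewrite dotNr dotZr -exprVn mulrC.
  exact: (cvg_comp (fun k => - (dot l v * 2^-1 ^+ k)) (@cos R) t0 (@continuous_cos R 0)).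
(* Half of [1 + cos] lies in [[0, 1]], as the bounded convergence lemma asks. *)
have L : (\int[F]_l (2^-1 + 2^-1 * cos (dot l (- (2 ^- k *: v))))%:E)%E @[k --> \oo] --> (\int[F]_l 1%:E)%E.
  apply: bounded_cvg_integral => //.
  - by rewrite [X in (X < _)%E]probability_setT ltry.
  - by move=> k; apply: measurable_funD => //; apply: measurable_funM => //; exact: measurable_cos_dot.
  - move=> l; rewrite [X in _ --> X](_ : 1 = 2^-1 + 2^-1 * 1); last by field.
    by apply: cvgD; [exact: cvg_cst|apply: cvgMr; exact: c0].
  - move=> k l; have := cos_geN1 (dot l (- (2 ^- k *: v))); have := cos_le1 (dot l (- (2 ^- k *: v))).
    by lra.
rewrite probability_integral_cst in L.
rewrite [X in X @ _ --> _](_ : _ = (fun k => (2^-1 + 2^-1 * covF (- (2 ^- k *: v)))%:E)) in L; last first.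
  by apply/funext => k; rewrite integral_affine_cos_dot.
move/fine_cvg : L => /= L.
rewrite (_ : (fun k => _) = (fun k => 2 * (2^-1 + 2^-1 * covF (- (2 ^- k *: v))) - 1)).
  rewrite [X in _ --> X](_ : 1 = 2 * 1 - 1); last by ring.
  by apply: cvgB; [apply: cvgMr|exact: cvg_cst].
by apply/funext => k; field.
Qed.

Definition crossing_prob (a : R) (h : 'rV[R]_n) : \bar R :=
  prodm gam gam [set x | `|Num.sqrt (2 + 2 * covF h) * x.1 - 2 * a| < `|Num.sqrt (2 - 2 * covF h) * x.2|].

Definition level_rate (a : R) (v : 'rV[R]_n) : \bar R :=
  (sqrte (spectral_form v) * (pi^-1 * expR (- (a ^+ 2 / 2)))%:E)%E.

Lemma cvg_sqrte (u : nat -> R) (l : \bar R) : (forall k, 0 <= u k) ->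
  (u k)%:E @[k --> \oo] --> l -> (Num.sqrt (u k))%:E @[k --> \oo] --> sqrte l.
Proof.
move=> u0; case: l => [r| |] L.
- have /fine_cvg/= {}L := L.
  apply: cvg_EFin; first exact: nearW.
  have C : Num.sqrt (u k) @[k --> \oo] --> Num.sqrt r by exact: (cvg_comp u Num.sqrt L (@sqrt_continuous R r)).
  exact: C.
- apply/cvgeryP; apply/cvgryPge => A; move/cvgeryP/cvgryPge : L => /(_ (A ^+ 2)).
  apply: filterS => k; rewrite -ler_sqrt//.
    by rewrite sqrtr_sqr; apply: le_trans; exact: ler_norm.
- exfalso; have c : cvgn (fun k => (u k)%:E) by apply/cvg_ex; exists -oo%E.
  have /(lime_ge c) : \forall k \near \oo, (0 <= (u k)%:E)%E by apply: nearW => k; rewrite lee_fin.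
  by rewrite (cvg_lim _ L).
Qed.

Hypothesis covF1 : forall h, - 1 <= covF h <= 1.

Lemma crossing_prob_rate (a : R) (v : 'rV[R]_n) :
  ((2 ^+ k)%:E * crossing_prob a (- (2 ^- k *: v)))%E @[k --> \oo] --> level_rate a v.
Proof.
pose be (k : nat) := Num.sqrt (2 - 2 * covF (- (2 ^- k *: v))).
have be2 k : be k ^+ 2 = 2 - 2 * covF (- (2 ^- k *: v)).
  by rewrite sqr_sqrtr//; have /andP[] := covF1 (- (2 ^- k *: v)); lra.
have be0 k : 0 <= be k by exact: sqrtr_ge0.
have cbe : be k @[k --> \oo] --> (0 : R).
  have C : 2 - 2 * covF (- (2 ^- k *: v)) @[k --> \oo] --> (0 : R).
    rewrite [X in _ --> X](_ : 0 = 2 - 2 * 1); last by ring.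
    by apply: cvgB; [exact: cvg_cst|apply: cvgMr; exact: covf_cvg1].
  rewrite -(@sqrtr0 R); exact: (cvg_comp (fun k => 2 - 2 * covF (- (2 ^- k *: v))) Num.sqrt C (@sqrt_continuous R 0)).
(* [crossing_rate_cvg] wants [be k <= 1] for every [k], which holds from a rank [K] on; the sequence
   is shifted accordingly. *)
have [K _ HK] : \forall k \near \oo, be k <= 1.
  have /cvgrPdist_le/(_ 1 ltr01) := cbe; apply: filterS => k.
  by rewrite sub0r normrN ger0_norm.
rewrite -(cvg_shiftn K).
have E k : ((2 ^+ (k + K))%:E * crossing_prob a (- (2 ^- (k + K) *: v)) =
   (2 ^+ (k + K) * be (k + K)%N)%:E * crossing_rate (Num.sqrt (4 - be (k + K)%N ^+ 2)) (be (k + K)%N) a)%E.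
  have al0 : 0 < Num.sqrt (4 - be (k + K)%N ^+ 2).
    rewrite sqrtr_gt0; have b1 := HK (k + K)%N (leq_addl _ _); have := be0 (k + K)%N; rewrite /= in b1.
    by nra.
  rewrite EFinM -muleA; congr (_ * _)%E; rewrite -(crossing_rateE a al0 (be0 _)).
  rewrite /crossing_prob -/(be _) (_ : 2 + 2 * _ = 4 - be (k + K)%N ^+ 2)//.
  by rewrite be2; ring.
under eq_fun do rewrite E.
have c0 : 0 < pi^-1 * expR (- (a ^+ 2 / 2)) by rewrite mulr_gt0 ?expR_gt0// invr_gt0 pi_gt0.
(* The limit of the first factor may be [+oo]; the product is defined because that of the second is
   positive. *)
apply: cvgeM.
- by rewrite mule_defE eqe (gt_eqF c0) /= andbF.
- rewrite (cvg_shiftn K (fun k => (2 ^+ k * be k)%:E)).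
  have S k : 2 ^+ k * be k = Num.sqrt (4 ^+ k * (2 - 2 * covF (- (2 ^- k *: v)))).
    rewrite sqrtrM ?exprn_ge0// -/(be k); congr (_ * _).
    by rewrite -[LHS]ger0_norm ?exprn_ge0// -sqrtr_sqr -exprM mulnC exprM; congr (Num.sqrt (_ ^+ _)); ring.
  under eq_fun do rewrite S.
  apply: cvg_sqrte; last exact: spectral_form_cvg.
  by move=> k; rewrite -be2 mulr_ge0// ?exprn_ge0// sqr_ge0.
- apply: (@crossing_rate_cvg R (fun k => be (k + K)%N) a).
  + by move=> k; rewrite be0/=; exact: (HK (k + K)%N (leq_addl _ _)).
  + by rewrite (cvg_shiftn K).
Qed.

End spectral_rate.

(** * Dyadic counts of zeros and crossings *)

Section counting_seq.
Context {R : realType} {T : choiceType}.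

Lemma le_counting_seq (s : seq T) (Z : set T) : uniq s -> {in s, forall x, Z x} ->
  ((size s)%:R%:E <= counting Z :> \bar R)%E.
Proof.
move=> us sZ; rewrite /counting; case: ifPn => [/asboolP fZ|_]; last exact: leey.
rewrite lee_fin ler_nat; apply: uniq_leq_size => // x xs.
by rewrite in_fset_set// inE; exact: sZ.
Qed.

(** Bounds on [counting] are thus transferred between sets by means of lists of points, finite and
    infinite sets being treated alike. *)
Lemma counting_seq_ge (p : nat) (Z : set T) : (p%:R%:E <= counting Z :> \bar R)%E ->
  exists s : seq T, [/\ uniq s, {in s, forall x, Z x} & (p <= size s)%N].
Proof.
rewrite /counting; case: ifPn => [/asboolP fZ|/asboolPn /(infinite_set_fset p)[B BZ pB] _].
  rewrite lee_fin ler_nat => pZ; exists (finmap.enum_fset (fset_set Z)); split => //.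
  by move=> x; rewrite in_fset_set// inE.
by exists (finmap.enum_fset B); split => // x xB; exact: BZ.
Qed.

End counting_seq.

Lemma near_seq (T : eqType) (I : Type) (F : set_system I) (FF : Filter F)
    (s : seq T) (Q : T -> I -> Prop) :
  (forall x, x \in s -> \forall m \near F, Q x m) ->
  \forall m \near F, forall x, x \in s -> Q x m.
Proof.
elim: s => [_|a s ih H]; first by apply: nearW.
have h1 := H a (mem_head _ _).
have h2 : \forall m \near F, forall x, x \in s -> Q x m.
  by apply: ih => x xs; apply: H; rewrite in_cons xs orbT.
near=> m => x; rewrite in_cons => /orP[/eqP->|xs]; first by near: m.
by move: x xs; near: m.
Unshelve. all: by end_near. Qed.

Section dyadic_cells.
Context {R : realType}.
Implicit Types (Z : set R) (m k : nat).

Definition dcell m k : set R := [set t | k%:R <= t * 2 ^+ m < k.+1%:R].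

Definition cell_hit m Z k : bool := `[< exists2 t, Z t & dcell m k t >].

Definition ncells m Z : nat := (\sum_(0 <= k < 2 ^ m) cell_hit m Z k)%N.

Lemma ncellsE m Z : ncells m Z = size [seq k <- iota 0 (2 ^ m) | cell_hit m Z k].
Proof. by rewrite size_filter /ncells /index_iota subn0 -sum1_count [RHS]big_mkcond/=; apply: eq_bigr => k _; case: cell_hit. Qed.

Lemma dcell_inj m k k' t : dcell m k t -> dcell m k' t -> k = k'.
Proof.
move=> /andP[a b] /andP[c d]; apply/eqP; rewrite eqn_leq.
have h1 : (k < k'.+1)%N by rewrite -(ltr_nat R) (le_lt_trans a d).
have h2 : (k' < k.+1)%N by rewrite -(ltr_nat R) (le_lt_trans c b).
by rewrite -ltnS h1 -ltnS h2.
Qed.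

Lemma ncells_le_counting m Z : ((ncells m Z)%:R%:E <= counting Z :> \bar R)%E.
Proof.
pose z k : R := xget 0 (Z `&` dcell m k).
have zP k : cell_hit m Z k -> (Z `&` dcell m k) (z k).
  by move=> /asboolP[t Zt ct]; apply: (xgetPex 0); exists t.
pose s := [seq k <- iota 0 (2 ^ m) | cell_hit m Z k].
rewrite ncellsE -/s -(size_map z s); apply: le_counting_seq.
  rewrite map_inj_in_uniq ?filter_uniq ?iota_uniq// => k k'.
  rewrite !mem_filter => /andP[/zP[_ ck] _] /andP[/zP[_ ck'] _] e.
  by apply: (dcell_inj ck); rewrite e.
by move=> _ /mapP[k + ->]; rewrite mem_filter => /andP[/zP[]].
Qed.

Lemma ncells_ge_size (s : seq R) Z : Z `<=` `[0, 1[%classic -> uniq s -> {in s, forall x, Z x} ->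
  \forall m \near \oo, (size s <= ncells m Z)%N.
Proof.
move=> Z01 us sZ.
have sep : \forall m \near \oo, forall x, x \in s -> forall y, y \in s -> x != y -> 1 <= 2 ^+ m * `|x - y|.
  apply: near_seq => x xs; apply: near_seq => y ys.
  have [->|xy] := eqVneq x y; first by apply: nearW.
  have d0 : 0 < `|x - y| by rewrite normr_gt0 subr_eq0.
  near=> m => _; rewrite -ler_pdivrMr// mul1r.
  have b0 : 0 <= `|x - y|^-1 by rewrite invr_ge0.
  rewrite (le_trans (ltW (archi_boundP b0)))// -natrX ler_nat.
  apply: (@leq_trans m); first by near: m; exact: nbhs_infty_ge.
  by rewrite ltnW// ltn_expl.
near=> m.
pose f (t : R) := Num.truncn (t * 2 ^+ m).
have fP t : t \in s -> dcell m (f t) t.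
  move=> /sZ/Z01/=; rewrite in_itv/= => /andP[t0 _].
  by apply: truncn_itv; rewrite mulr_ge0// exprn_ge0.
have fs : uniq (map f s).
  rewrite map_inj_in_uniq// => x y xs ys fxy; apply/eqP; apply: contraT => xy.
  have : 1 <= 2 ^+ m * `|x - y| by move: x xs y ys {fxy} xy; near: m.
  have /andP[a b] := fP _ xs; have /andP[] := fP _ ys; rewrite -fxy => c d.
  rewrite -[X in X * _]ger0_norm ?exprn_ge0// -normrM leNgt => /negP; case.
  rewrite ltr_norml; apply/andP; split; rewrite mulrC mulrBl.
    by move: a b c d; rewrite -natr1; lra.
  by move: a b c d; rewrite -natr1; lra.
rewrite ncellsE -(size_map f); apply: uniq_leq_size => // _ /mapP[t ts ->].
rewrite mem_filter mem_iota leq0n add0n/=; apply/andP; split.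
  by apply/asboolP; exists t; [exact: sZ|exact: fP].
rewrite -(ltr_nat R) natrX; have /andP[a _] := fP _ ts; apply: (le_lt_trans a).
have := Z01 _ (sZ _ ts); rewrite /= in_itv/= => /andP[_ t1].
by rewrite -[X in _ < X]mul1r ltr_pM2r// exprn_gt0.
Unshelve. all: by end_near. Qed.

(** Finitely many points are eventually in distinct cells; if [Z] is infinite, this is applied to
    finite subsets of any size. Measurability of zero counts rests on this limit. *)
Lemma ncells_cvg Z : Z `<=` `[0, 1[%classic ->
  (ncells m Z)%:R%:E @[m --> \oo] --> (counting Z : \bar R).
Proof.
move=> Z01; have [fZ|iZ] := pselect (finite_set Z).
  have cE : counting Z = (size (finmap.enum_fset (fset_set Z)))%:R%:E :> \bar R.
    by rewrite /counting asboolT.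
  rewrite cE; apply: cvg_near_cst.
  have sZ : {in finmap.enum_fset (fset_set Z), forall x, Z x}.
    by move=> x; rewrite in_fset_set// inE.
  have := ncells_ge_size Z01 (finmap.fset_uniq _) sZ; apply: filterS => m pm.
  apply/eqP; rewrite eq_le; apply/andP; split; last by rewrite lee_fin ler_nat.
  by rewrite -cE; exact: ncells_le_counting.
have -> : counting Z = +oo%E :> \bar R by rewrite /counting asboolF.
apply/cvgeryP; apply/cvgryPge => A.
have [B BZ pB] := infinite_set_fset (Num.bound `|A|) iZ.
have sB : {in finmap.enum_fset B, forall x, Z x} by move=> x xB; exact: BZ.
have := ncells_ge_size Z01 (finmap.fset_uniq _) sB; apply: filterS => m pm.
apply: (le_trans (ler_norm _)); apply: (le_trans (ltW (archi_boundP (normr_ge0 _)))).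
by rewrite ler_nat (leq_trans pB pm).
Qed.

End dyadic_cells.

(** * Sign changes along dyadic points *)

Section sign_changes.
Context {R : realType}.
Implicit Types (f : R -> R) (a : R).

Definition sgn_lt a f m l : bool := f (l%:R / 2 ^+ m) < a.

Definition crossings m a f : nat :=
  (\sum_(0 <= l < 2 ^ m) (sgn_lt a f m l != sgn_lt a f m l.+1))%N.

Lemma sign_changes_ge (b : nat -> bool) i j : (i <= j)%N ->
  ((b i != b j) <= \sum_(i <= l < j) (b l != b l.+1))%N.
Proof.
elim: j => [|j ih].
  by rewrite leqn0 => /eqP ->; rewrite eqxx.
rewrite leq_eqVlt => /predU1P[->|]; first by rewrite eqxx.
rewrite ltnS => ij; rewrite big_nat_recr//=; apply: leq_trans (leq_add (ih ij) (leqnn _)).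
by case: (b i); case: (b j); case: (b j.+1).
Qed.

Lemma sgn_lt_refine a f m d k : sgn_lt a f (m + d) (k * 2 ^ d) = sgn_lt a f m k.
Proof.
rewrite /sgn_lt natrM natrX exprD; congr (f _ < a).
by field; rewrite !expf_neq0.
Qed.

Lemma crossings_block m d a f : crossings (m + d) a f =
  (\sum_(0 <= k < 2 ^ m) \sum_(k * 2 ^ d <= l < k.+1 * 2 ^ d)
    (sgn_lt a f (m + d) l != sgn_lt a f (m + d) l.+1))%N.
Proof.
by rewrite /crossings expnD big_nat_mul; apply: eq_bigr => k _; rewrite mulSn [(2 ^ d + _)%N]addnC.
Qed.

Lemma crossings_nondecreasing a f m d : (crossings m a f <= crossings (m + d) a f)%N.
Proof.
rewrite crossings_block /crossings; apply: leq_sum => k _.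
rewrite -!(sgn_lt_refine a f m d); apply: sign_changes_ge.
by rewrite leq_mul2r leqnSn orbT.
Qed.

Variables (f : R -> R) (u : R).
Hypotheses (cf : continuous f) (nodyadic : forall m k, f (k%:R / 2 ^+ m) != u).

Let Z := [set t | `[0, 1[%classic t /\ f t = u].

Lemma crossings_le_ncells m : (crossings m u f <= ncells m Z)%N.
Proof.
rewrite /crossings /ncells big_nat [leqRHS]big_nat; apply: leq_sum => k /andP[_ km].
case: (boolP (_ != _)) => // sc; rewrite (_ : cell_hit m Z k)//; apply/asboolP.
have p0 : (0 : R) < 2 ^+ m by rewrite exprn_gt0.
pose p : R := k%:R / 2 ^+ m; pose q : R := k.+1%:R / 2 ^+ m.
have pq : p < q by rewrite /p /q ltr_pM2r ?invr_gt0// ltr_nat.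
have iv : Num.min (f p) (f q) <= u <= Num.max (f p) (f q).
  move: sc; rewrite /sgn_lt -/p -/q ge_min le_max.
  by case: (ltP (f p) u) => h1; case: (ltP (f q) u) => h2 // _; rewrite ?h1 ?h2 ?(ltW h1) ?(ltW h2) ?orbT.
have [t tpq ft] := IVT (ltW pq) (continuous_subspaceT cf) iv.
move: tpq; rewrite in_itv/= => /andP[pt tq].
(* The intermediate value theorem gives a zero of the closed cell; it is not an endpoint, both being
   dyadic, so it lies in the half-open cell and below 1. *)
have pt' : p < t.
  by rewrite lt_neqAle pt andbT; apply: contra (nodyadic m k) => /eqP e; rewrite -/p e ft.
have tq' : t < q.
  by rewrite lt_neqAle tq andbT; apply: contra (nodyadic m k.+1) => /eqP e; rewrite -/q -e ft.
exists t; last by rewrite /dcell/= -ler_pdivrMr// -ltr_pdivlMr// -/p -/q pt tq'.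
split=> //; rewrite /= in_itv/=; apply/andP; split.
  by apply: le_trans pt; rewrite divr_ge0// ltW.
by apply: (lt_le_trans tq'); rewrite ler_pdivrMr// mul1r -natrX ler_nat.
Qed.

(* A cell containing a zero of [f - u] has a dyadic point where [f] is in
   [(u - e, u + e)], while its endpoints are not: this makes two sign changes
   inside the cell, counting the levels [u - e] and [u + e] together. *)
Lemma crossings_two_sided (M : nat) :
  \forall e \near (0 : R)^'+, exists m, (2 * ncells M Z <= crossings m (u - e) f + crossings m (u + e) f)%N.
Proof.
(* Only the finitely many dyadic points of level [M] are involved, whence a common bound on [e]; the
   finer level [M + d] is chosen after [e]. *)
have gap : \forall e \near (0 : R)^'+, forall k, k \in iota 0 (2 ^ M).+1 -> e < `|f (k%:R / 2 ^+ M) - u|.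
  apply: near_seq => k _; apply: nbhs_right_lt.
  by rewrite normr_gt0 subr_eq0 nodyadic.
near=> e.
have e0 : 0 < e by near: e; exact: nbhs_right_gt.
have gape : forall k, k \in iota 0 (2 ^ M).+1 -> e < `|f (k%:R / 2 ^+ M) - u|.
  by near: e.
have {gape}gap' k : (k <= 2 ^ M)%N -> e < `|f (k%:R / 2 ^+ M) - u|.
  by move=> kM; apply: gape; rewrite mem_iota ltnS.
have hit : \forall d \near \oo, forall k, k \in iota 0 (2 ^ M) -> cell_hit M Z k ->
    exists j, (k * 2 ^ d <= j <= k.+1 * 2 ^ d)%N /\ `|f (j%:R / 2 ^+ (M + d)) - u| < e.
  apply: near_seq => k _; have [/asboolP[t [t01 ft] /andP[kt tk]]|] := boolP (cell_hit M Z k); last first.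
    by move=> _; apply: nearW.
  have /cvgrPdist_lt /(_ e e0) : f x @[x --> t] --> f t by exact: cf.
  move=> /nbhs_ballP[r /= r0 br].
  near=> d => _; pose j := Num.truncn (t * 2 ^+ (M + d)).
  have t0 : 0 <= t by move: t01; rewrite /= in_itv/= => /andP[].
  have /andP[j1 j2] : j%:R <= t * 2 ^+ (M + d) < j.+1%:R.
    by apply: truncn_itv; rewrite mulr_ge0// exprn_ge0.
  have d0 : (0 : R) < 2 ^+ d by rewrite exprn_gt0.
  have Md0 : (0 : R) < 2 ^+ (M + d) by rewrite exprn_gt0.
  exists j; split.
    apply/andP; split.
      rewrite -ltnS -(ltr_nat R); apply: le_lt_trans j2.
      by rewrite natrM natrX exprD mulrA ler_pM2r.
    rewrite ltnW// -(ltr_nat R); apply: (le_lt_trans j1).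
    by rewrite natrM natrX exprD mulrA ltr_pM2r.
  rewrite distrC -ft; apply: br; rewrite /ball/= ltr_norml; apply/andP; split.
    apply: (@lt_le_trans _ _ 0); first by rewrite oppr_lt0.
    by rewrite subr_ge0 ler_pdivrMr.
  rewrite -(ltr_pM2r Md0) mulrBl divfK ?gt_eqF//.
  apply: (@lt_trans _ _ 1); first by move: j2; rewrite -natr1; lra.
  rewrite exprD mulrA.
  have q : 1 < r * 2 ^+ d.
    rewrite mulrC -ltr_pdivrMr// mul1r.
    have b0 : 0 <= r^-1 by rewrite invr_ge0 ltW.
    rewrite (lt_le_trans (archi_boundP b0))// -natrX ler_nat.
    apply: (@leq_trans d); first by near: d; exact: nbhs_infty_ge.
    by rewrite ltnW// ltn_expl.
  rewrite mulrAC (lt_le_trans q)// ler_peMr//; last by rewrite exprn_ege1// ler1n.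
  by rewrite mulr_ge0 ?ltW.
have [d _ hd] := hit; exists (M + d)%N.
have {hit hd}hit k : (k < 2 ^ M)%N -> cell_hit M Z k ->
    exists j, (k * 2 ^ d <= j <= k.+1 * 2 ^ d)%N /\ `|f (j%:R / 2 ^+ (M + d)) - u| < e.
  by move=> kM; apply: (hd d (leqnn d)); rewrite mem_iota add0n.
rewrite !crossings_block -big_split/= /ncells big_distrr/= big_nat [leqRHS]big_nat.
apply: leq_sum => k /andP[_ kM].
have [kh|] := boolP (cell_hit M Z k); last by rewrite muln0.
have [j [/andP[kj jk] fj]] := hit _ kM kh.
rewrite !(big_cat_nat kj jk)/=.
apply: leq_trans (leq_add (leq_add (sign_changes_ge _ kj) (sign_changes_ge _ jk))
  (leq_add (sign_changes_ge _ kj) (sign_changes_ge _ jk))).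
rewrite !sgn_lt_refine /sgn_lt.
have g1 := gap' _ (ltnW kM); have g2 := gap' _ kM.
move: fj; rewrite ltr_norml => /andP[fj1 fj2].
have -> : (f (j%:R / 2 ^+ (M + d)) < u - e) = false by apply/negbTE; rewrite -leNgt; lra.
have -> : (f (j%:R / 2 ^+ (M + d)) < u + e) = true by lra.
have aux x : e < `|x - u| -> ((x < u - e) = (x < u)) * ((x < u + e) = (x < u)).
  case: (ltP x u) => xu.
    by rewrite ltr0_norm ?subr_lt0// => h; split; apply/idP; lra.
  rewrite ger0_norm ?subr_ge0// => h; split; apply/negbTE; rewrite -leNgt; lra.
(* The interior point is above [u - e] and below [u + e], while an endpoint is on the same side of
   both levels: so each of the two pieces of the cell has a sign change at exactly one of them. *)
rewrite !(aux _ g1) !(aux _ g2).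
by case: (_ < u); case: (_ < u).
Unshelve. all: by end_near. Qed.

End sign_changes.

(** * Measurability and law of the number of zeros *)

(* Turns a constraint [A x] into an equation, so that counting the zeros in [A] of
   a function reduces to counting the zeros of another function. *)
Lemma closed_zero_set {R : realType} {X : normedModType R} (A : set X) : closed A ->
  exists f : X -> R, [/\ continuous f, (forall x, 0 <= f x) & forall x, f x = 0 <-> A x].
Proof.
move=> cA; have [->|/set0P[a Aa]] := eqVneq A set0.
  exists (cst 1); split => //; first by move=> x; exact: cvg_cst.
  by move=> x; split => // /eqP; rewrite oner_eq0.
have hfin x : edist_inf A x \is a fin_num.
  rewrite ge0_fin_numE ?edist_inf_ge0//; apply: (@le_lt_trans _ _ (edist (x, a))).
    by apply: ereal_inf_lbound; exists a.
  rewrite -ge0_fin_numE ?edist_ge0//; apply/edist_finP; exists (`|x - a| + 1) => /=.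
    by rewrite ltr_wpDl.
  by rewrite -ball_normE /ball_/= ltrDl.
exists (fine \o edist_inf A); split.
- move=> x; apply: fine_cvg; rewrite fineK//.
  exact: edist_inf_continuous.
- by move=> x; rewrite fine_ge0// edist_inf_ge0.
- move=> x; split => [|Ax]; last by rewrite /= edist_inf0.
  move=> /= fx0; have hx0 : edist_inf A x = 0%E by rewrite -(fineK (hfin x)) fx0.
  apply: contrapT => nAx.
  have : nbhs x (~` A) by apply: open_nbhs_nbhs; split => //; exact: closed_openC.
  move=> /nbhs_ballP[r /= r0 br].
  have rx : (r%:E <= edist_inf A x)%E.
    apply: le_ereal_inf_tmp => _ [y Ay <-]; rewrite leNgt; apply/negP => /edist_lt_ball /= xy.
    exact: (br _ xy).
  have : (0%:E < edist_inf A x)%E by rewrite (lt_le_trans _ rx).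
  by rewrite hx0 ltxx.
Qed.

Section zero_count.
Context {R : realType} {d : measure_display} {T : measurableType d}.
Implicit Types (g : T -> R -> R).

Definition zeros g w : set R := [set t | `[0, 1[%classic t /\ g w t = 0].

(** The [i]-th rational clamped to [[a, b]]: a sequence that stays in the segment and is dense in
    it, including when it is a single point. *)
Definition dense_pt (a b : R) (i : nat) : R :=
  Num.max a (Num.min b (ratr (odflt 0 (unpickle i : option rat)))).

(** These events involve finitely many times only, so their probabilities are within reach of the
    finite-dimensional laws. *)
Definition near_zero g (q : nat -> R) (e : R) (I : nat) : set T :=
  [set w | exists2 i, (i < I)%N & g w (q i) < e].

Definition seg_hit g (a b : R) : set T := [set w | exists2 t, a <= t <= b & g w t = 0].

Variable g : T -> R -> R.
Hypotheses (mg : forall t, measurable_fun setT (g ^~ t)) (cg : forall w, continuous (g w))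
  (g0 : forall w t, 0 <= g w t).

Lemma measurable_near_zero q e I : measurable (near_zero g q e I).
Proof.
rewrite (_ : near_zero g q e I = \bigcup_(i in `I_I) [set w | g w (q i) < e]); last first.
  by apply/seteqP; split=> w [i]; exists i.
apply: bigcup_measurable => i _.
rewrite [X in measurable X](_ : _ = [set: T] `&` (g ^~ (q i)) @^-1` `]-oo, e[%classic).
  by apply: mg => //; exact: measurable_itv.
by rewrite setTI; apply/seteqP; split=> w /=; rewrite in_itv.
Qed.

Lemma near_zero_nondecreasing q e : nondecreasing_seq (near_zero g q e).
Proof. by move=> m k mk; apply/subsetPset => w [i im gi]; exists i => //; exact: leq_trans mk. Qed.

Lemma dense_pt_itv a b i : a <= b -> a <= dense_pt a b i <= b.
Proof.
by move=> ab; rewrite /dense_pt le_max lexx ge_max ab ge_min lexx.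
Qed.

Lemma dense_pt_dense (a b t e : R) : a <= t <= b -> 0 < e -> exists i, `|dense_pt a b i - t| < e.
Proof.
move=> /andP[at_ tb] e0.
have h : t - e < t + e by lra.
have [r] := rat_in_itvoo h; rewrite in_itv/= => /andP[r1 r2].
exists (pickle r); rewrite /dense_pt pickleK/= minEle maxEle.
set q : R := ratr r in r1 r2 *.
by case: (leP b q) => h1; case: (leP a) => h2; rewrite ltr_norml; apply/andP; split; lra.
Qed.

Let seg_event (a b : R) (j : nat) : set T :=
  \bigcup_I near_zero g (dense_pt a b) j.+1%:R^-1 I.

Lemma measurable_seg_event a b j : measurable (seg_event a b j).
Proof. by apply: bigcupT_measurable => I; exact: measurable_near_zero. Qed.

Lemma seg_event_nonincreasing a b : nonincreasing_seq (seg_event a b).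
Proof.
move=> m k mk; apply/subsetPset => w [I _ [i iI gi]]; exists I => //; exists i => //.
by apply: (lt_le_trans gi); rewrite lef_pV2 ?posrE// ler_nat ltnS.
Qed.

(** A continuous nonnegative function on a segment attains its minimum, which is 0 as soon as values
    at the dense points come arbitrarily close to 0. *)
Lemma seg_hitE a b : a <= b -> seg_hit g a b = \bigcap_j seg_event a b j.
Proof.
move=> ab; apply/seteqP; split => w.
  move=> [t abt gt] j _.
  have e0 : (0 : R) < j.+1%:R^-1 by rewrite invr_gt0.
  have /cvgrPdist_lt /(_ _ e0) : g w x @[x --> t] --> g w t by exact: cg.
  move=> /nbhs_ballP[r /= r0 br].
  have [i it] := dense_pt_dense abt r0.
  exists i.+1 => //; exists i => //.
  have : ball t r (dense_pt a b i) by rewrite /ball/= distrC.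
  by move=> /br/=; rewrite gt sub0r normrN; exact: le_lt_trans (ler_norm _).
move=> H; have cgw : {within `[a, b], continuous (g w)} by apply: continuous_subspaceT; exact: cg.
have [c] := EVT_min ab cgw; rewrite in_itv/= => cab minc.
exists c => //; apply/eqP; rewrite eq_le g0 andbT leNgt; apply/negP => gc.
have [j] := ltr_add_invr gc; rewrite add0r => jc.
have [I _ [i _ gi]] := H j Logic.I.
have : g w c <= g w (dense_pt a b i) by apply: minc; rewrite in_itv/=; exact: dense_pt_itv.
by rewrite leNgt (lt_trans gi jc).
Qed.

Lemma measurable_seg_hit a b : a <= b -> measurable (seg_hit g a b).
Proof. by move=> /seg_hitE ->; apply: bigcapT_measurable => j; exact: measurable_seg_event. Qed.

Let cl m k : R := k%:R / 2 ^+ m.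
(** Right ends increasing to the excluded end of cell [k]; for [j = 0] the segment is the single
    point [cl m k]. *)
Let cr m k j : R := cl m k.+1 - (2 ^+ m * j.+1%:R)^-1.

Lemma cell_bounds m k j : cl m k <= cr m k j.
Proof.
rewrite /cr /cl -(natr1 k) mulrDl mul1r -addrA lerDl subr_ge0 lef_pV2 ?posrE ?mulr_gt0 ?exprn_gt0//.
by rewrite ler_peMr ?exprn_ge0// ler1n.
Qed.

(* The cells are half open, hence increasing unions of compact segments, on
   which having a zero can be tested at countably many points. *)
Lemma cell_hit_segE m k : (k < 2 ^ m)%N ->
  [set w | cell_hit m (zeros g w) k] = \bigcup_j seg_hit g (cl m k) (cr m k j).
Proof.
move=> km; have p0 : (0 : R) < 2 ^+ m by rewrite exprn_gt0.
apply/seteqP; split => w /=.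
  move=> /asboolP[t [t01 gt] /andP[kt tk]].
  have tc : t < cl m k.+1 by rewrite /cl ltr_pdivlMr.
  have h0 : 0 < (cl m k.+1 - t) * 2 ^+ m by rewrite mulr_gt0// subr_gt0.
  have [j] := ltr_add_invr h0; rewrite add0r => jt; exists j => //; exists t => //.
  rewrite /cl ler_pdivrMr// kt /= /cr lerBrDr -lerBrDl invfM mulrC ler_pdivrMr//.
  exact: ltW.
move=> [j _ [t /andP[a b] gt]]; apply/asboolP.
have tc : t < cl m k.+1.
  by apply: (le_lt_trans b); rewrite /cr gtrDl oppr_lt0 invr_gt0 mulr_gt0.
exists t; last by apply/andP; split; [rewrite -ler_pdivrMr|rewrite -ltr_pdivlMr].
split => //; rewrite /= in_itv/=; apply/andP; split.
  by apply: le_trans a; rewrite divr_ge0// ltW.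
by apply: (lt_le_trans tc); rewrite ler_pdivrMr// mul1r -natrX ler_nat.
Qed.

Let seg_hit_nondecreasing m k : nondecreasing_seq (fun j => seg_hit g (cl m k) (cr m k j)).
Proof.
move=> i j ij; apply/subsetPset => w [t /andP[a b] gt]; exists t => //; rewrite a/=.
apply: (le_trans b); rewrite /cr lerD2l lerN2 lef_pV2 ?posrE ?mulr_gt0 ?exprn_gt0//.
by rewrite ler_pM2l ?exprn_gt0// ler_nat ltnS.
Qed.

Lemma measurable_cell_hit m k : (k < 2 ^ m)%N -> measurable [set w | cell_hit m (zeros g w) k].
Proof.
move=> km; rewrite cell_hit_segE//; apply: bigcupT_measurable => j.
by apply: measurable_seg_hit; exact: cell_bounds.
Qed.

Lemma ncells_sumE m w : (ncells m (zeros g w))%:R%:E =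
  (\sum_(k < 2 ^ m) (\1_[set w | cell_hit m (zeros g w) k] w)%:E)%E :> \bar R.
Proof.
rewrite sumEFin /ncells natr_sum big_mkord; congr (_%:E); apply: eq_bigr => k _.
rewrite indicE; case: (boolP (cell_hit _ _ _)) => h; first by rewrite mem_set.
by rewrite memNset//; exact/negP.
Qed.

Lemma measurable_ncells m : measurable_fun setT (fun w => (ncells m (zeros g w))%:R%:E : \bar R).
Proof.
rewrite (_ : (fun _ => _) = fun w => (\sum_(k < 2 ^ m) (\1_[set w | cell_hit m (zeros g w) k] w)%:E)%E); last first.
  by apply/funext => w; exact: ncells_sumE.
apply: emeasurable_sum.
move=> k; apply/measurable_EFinP; apply: measurable_indic; exact: measurable_cell_hit.
Qed.

Lemma measurable_counting_zeros : measurable_fun setT (fun w => counting (zeros g w) : \bar R).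
Proof.
apply: (emeasurable_fun_cvg (fun m w => (ncells m (zeros g w))%:R%:E)) => //.
  by move=> m; exact: measurable_ncells.
by move=> w _; apply: ncells_cvg => t [].
Qed.

Lemma integral_ncells (P : {measure set T -> \bar R}) m :
  (\int[P]_w (ncells m (zeros g w))%:R%:E =
   \sum_(k < 2 ^ m) P [set w | cell_hit m (zeros g w) k])%E.
Proof.
rewrite (_ : (fun _ => _) = fun w => (\sum_(k < 2 ^ m) (\1_[set w | cell_hit m (zeros g w) k] w)%:E)%E); last first.
  by apply/funext => w; exact: ncells_sumE.
rewrite ge0_integral_sum; last 3 first.
- exact: measurableT.
- move=> k; apply/measurable_EFinP; apply: measurable_indic; exact: measurable_cell_hit.
- by move=> k w _; rewrite lee_fin.
apply: eq_bigr => k _; rewrite integral_indic ?setIT//; exact: measurable_cell_hit.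
Qed.

Lemma seg_event_cvg (P : probability T R) a b j :
  P (near_zero g (dense_pt a b) j.+1%:R^-1 I) @[I --> \oo] --> P (seg_event a b j).
Proof.
apply: nondecreasing_cvg_mu; [by move=> I; exact: measurable_near_zero| |].
- exact: measurable_seg_event.
- exact: near_zero_nondecreasing.
Qed.

Lemma seg_hit_cvg (P : probability T R) a b : a <= b ->
  P (seg_event a b j) @[j --> \oo] --> P (seg_hit g a b).
Proof.
move=> ab; rewrite seg_hitE//; apply: nonincreasing_cvg_mu.
- by rewrite (le_lt_trans (probability_le1 _ _)) ?ltry//; exact: measurable_seg_event.
- by move=> j; exact: measurable_seg_event.
- by rewrite -seg_hitE//; exact: measurable_seg_hit.
- exact: seg_event_nonincreasing.
Qed.

Lemma cell_hit_cvg (P : probability T R) m k : (k < 2 ^ m)%N ->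
  P (seg_hit g (cl m k) (cr m k j)) @[j --> \oo] --> P [set w | cell_hit m (zeros g w) k].
Proof.
move=> km; rewrite cell_hit_segE//; apply: nondecreasing_cvg_mu.
- by move=> j; apply: measurable_seg_hit; exact: cell_bounds.
- by rewrite -cell_hit_segE//; exact: measurable_cell_hit.
- exact: seg_hit_nondecreasing.
Qed.

End zero_count.

Lemma eq_cvg_limit {R : realType} (u v : (\bar R)^nat) (a b : \bar R) :
  u @ \oo --> a -> v @ \oo --> b -> u =1 v -> a = b.
Proof. by move=> ua vb /funext uv; move: ua; rewrite uv => va; exact: (cvg_unique _ va vb). Qed.

Lemma fatou_le {R : realType} {d : measure_display} {T : measurableType d}
    (m : {measure set T -> \bar R}) (f : (T -> \bar R)^nat) (h : T -> \bar R) (c : \bar R) :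
  (forall k, measurable_fun setT (f k)) -> (forall k x, 0 <= f k x)%E ->
  (forall x, f k x @[k --> \oo] --> h x) -> (forall k, \int[m]_x f k x <= c)%E ->
  (\int[m]_x h x <= c)%E.
Proof.
move=> mf f0 fh fc.
rewrite (_ : h = fun x => limn_einf (f ^~ x)); last first.
  apply/funext => x; rewrite is_cvg_limn_einfE; last by apply/cvg_ex; exists (h x); exact: fh.
  by rewrite (cvg_lim _ (fh x)).
apply: (le_trans (fatou m measurableT mf (fun k x _ => f0 k x))).
rewrite limn_einf_lim; apply: lime_le; first exact: is_cvg_einfs.
apply: nearW => k; apply: le_trans (fc k).
by apply: ereal_inf_lbound; exists k => /=.
Qed.

Section zero_count_law.
Context {R : realType} {d : measure_display} {T : measurableType d} (P : probability T R).
Implicit Types g : T -> R -> R.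

(** Equal probabilities for [near_zero] pass through successive limits to [seg_hit] and [cell_hit],
    hence to the means of [ncells]. Fatou's lemma then leads to [counting], which gives one
    inequality; the other is its mirror image. *)
Let le_integral_counting_zeros g1 g2 :
  (forall t, measurable_fun setT (g1 ^~ t)) -> (forall w, continuous (g1 w)) -> (forall w t, 0 <= g1 w t) ->
  (forall t, measurable_fun setT (g2 ^~ t)) -> (forall w, continuous (g2 w)) -> (forall w t, 0 <= g2 w t) ->
  (forall q e I, P (near_zero g1 q e I) = P (near_zero g2 q e I)) ->
  (\int[P]_w counting (zeros g1 w) <= \int[P]_w counting (zeros g2 w))%E.
Proof.
move=> m1 c1 p1 m2 c2 p2 H.
have E m : (\int[P]_w (ncells m (zeros g1 w))%:R%:E = \int[P]_w (ncells m (zeros g2 w))%:R%:E)%E.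
  rewrite !integral_ncells//; apply: eq_bigr => k _.
  have L1 := cell_hit_cvg m1 c1 p1 (P := P) (ltn_ord k).
  apply: (eq_cvg_limit L1 (cell_hit_cvg m2 c2 p2 (P := P) (ltn_ord k))) => j.
  have ab := @cell_bounds R m k j.
  apply: (eq_cvg_limit (seg_hit_cvg m1 c1 p1 (P := P) ab) (seg_hit_cvg m2 c2 p2 (P := P) ab)) => i.
  by apply: (eq_cvg_limit (@seg_event_cvg _ _ _ _ m1 P _ _ i) (@seg_event_cvg _ _ _ _ m2 P _ _ i)) => l; exact: H.
have L1 w : (ncells m (zeros g1 w))%:R%:E @[m --> \oo] --> (counting (zeros g1 w) : \bar R).
  by apply: ncells_cvg => t [].
apply: (fatou_le (measurable_ncells m1 c1 p1) _ L1).
  by move=> m w; rewrite lee_fin.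
move=> m; rewrite E; apply: ge0_le_integral => //.
- exact: measurable_ncells.
- exact: measurable_counting_zeros.
- by move=> w _; exact: ncells_le_counting.
Qed.

Lemma eq_integral_counting_zeros g1 g2 :
  (forall t, measurable_fun setT (g1 ^~ t)) -> (forall w, continuous (g1 w)) -> (forall w t, 0 <= g1 w t) ->
  (forall t, measurable_fun setT (g2 ^~ t)) -> (forall w, continuous (g2 w)) -> (forall w t, 0 <= g2 w t) ->
  (forall q e I, P (near_zero g1 q e I) = P (near_zero g2 q e I)) ->
  (\int[P]_w counting (zeros g1 w) = \int[P]_w counting (zeros g2 w))%E.
Proof.
move=> m1 c1 p1 m2 c2 p2 H; apply/eqP; rewrite eq_le; apply/andP; split.
  exact: le_integral_counting_zeros.
by apply: le_integral_counting_zeros => // q e I; rewrite H.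
Qed.

End zero_count_law.

(** * Rice formula on a segment *)

Lemma limn_einf_ge {R : realType} (u : (\bar R)^nat) (c : \bar R) :
  (\forall j \near \oo, c <= u j)%E -> (c <= limn_einf u)%E.
Proof.
move=> [N _ cu]; rewrite limn_einf_lim; apply: lime_ge; first exact: is_cvg_einfs.
near=> m; apply: le_ereal_inf_tmp => _ [k /= mk <-]; apply: cu => /=.
by apply: leq_trans mk; near: m; exact: nbhs_infty_ge.
Unshelve. all: by end_near. Qed.

Section rice.
Context {R : realType} {n : nat} {dO : measure_display} {Omega : measurableType dO}
  {P : probability Omega R} {X : 'rV[R]_n -> {RV P >-> R}} {F : probability 'rV[R]_n R}.
Hypotheses (hgauss : gaussian_field X) (hcent : centered_field X) (hF : spectral_measure X F)
  (hcont : continuous_paths X).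
Variables (u : R) (y v : 'rV[R]_n).
Local Notation rho a := (@level_rate R n F a v).

Let path w : R -> R := fun t => X (y + t *: v) w.

Let mX t : measurable_fun [set: Omega] (X t : Omega -> R) := measurable_field t.

Lemma continuous_path w : continuous (path w).
Proof.
move=> t; apply: (@continuous_comp _ _ _ (fun t : R => y + t *: v) (fun x => X x w)); last exact: hcont.
by apply: cvgD; [exact: cvg_cst | apply: cvgZr_tmp; exact: cvg_id].
Qed.

Let cross_event a m l : set Omega := [set w | sgn_lt a (path w) m l != sgn_lt a (path w) m l.+1].

Let measurable_lt_event a t : measurable [set w | X t w < a].
Proof.
rewrite [X in measurable X](_ : _ = [set: Omega] `&` (X t) @^-1` `]-oo, a[%classic).
  by apply: mX => //; exact: measurable_itv.
by rewrite setTI; apply/seteqP; split=> w /=; rewrite in_itv.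
Qed.

Let measurable_cross_event a m l : measurable (cross_event a m l).
Proof.
rewrite [X in measurable X](_ : _ =
  ([set w | X (y + (l%:R / 2 ^+ m) *: v) w < a] `\` [set w | X (y + (l.+1%:R / 2 ^+ m) *: v) w < a]) `|`
  ([set w | X (y + (l.+1%:R / 2 ^+ m) *: v) w < a] `\` [set w | X (y + (l%:R / 2 ^+ m) *: v) w < a])).
  by apply: measurableU; apply: measurableD; exact: measurable_lt_event.
apply/seteqP; split=> w; rewrite /cross_event /sgn_lt /path /=; case: (X _ w < a); case: (X _ w < a) => //=.
- by left; split.
- by right; split.
- by case => -[].
- by case => -[].
Qed.

Let cross_sumE a m w : (crossings m a (path w))%:R%:E =
  (\sum_(l < 2 ^ m) (\1_(cross_event a m l) w)%:E)%E :> \bar R.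
Proof.
rewrite sumEFin /crossings natr_sum big_mkord; congr (_%:E); apply: eq_bigr => l _.
rewrite indicE; case: (boolP (_ != _)) => h; first by rewrite mem_set.
by rewrite memNset//; exact/negP.
Qed.

Let measurable_crossings a m : measurable_fun setT (fun w => (crossings m a (path w))%:R%:E : \bar R).
Proof.
rewrite (_ : (fun _ => _) = fun w => (\sum_(l < 2 ^ m) (\1_(cross_event a m l) w)%:E)%E); last first.
  by apply/funext => w; exact: cross_sumE.
apply: emeasurable_sum => l; apply/measurable_EFinP; apply: measurable_indic.
exact: measurable_cross_event.
Qed.

Lemma integral_crossings a m : (\int[P]_w (crossings m a (path w))%:R%:E =
  (2 ^+ m)%:E * @crossing_prob R n F a (- (2 ^- m *: v)))%E.
Proof.
rewrite (_ : (fun _ => _) = fun w => (\sum_(l < 2 ^ m) (\1_(cross_event a m l) w)%:E)%E); last first.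
  by apply/funext => w; exact: cross_sumE.
rewrite ge0_integral_sum; last 3 first.
- exact: measurableT.
- by move=> l; apply/measurable_EFinP; apply: measurable_indic; exact: measurable_cross_event.
- by move=> l w _; rewrite lee_fin.
transitivity (\sum_(l < 2 ^ m) @crossing_prob R n F a (- (2 ^- m *: v)))%E; last first.
  by rewrite sumr_const card_ord -natrX mule_natl.
apply: eq_bigr => l _; rewrite integral_indic//.
rewrite setIT.
have H := field_crossing_prob hgauss hcent hF (y + (l%:R / 2 ^+ m) *: v) (y + (l.+1%:R / 2 ^+ m) *: v) a.
have hd : y + (l%:R / 2 ^+ m) *: v - (y + (l.+1%:R / 2 ^+ m) *: v) = - (2 ^- m *: v).
  have hs : l%:R / 2 ^+ m - l.+1%:R / 2 ^+ m = - 2 ^- m :> R.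
    by rewrite -mulrBl -natr1 opprD addrA subrr sub0r mulN1r.
  by rewrite opprD addrACA subrr add0r -scalerBl hs scaleNr.
by move: H; rewrite /sdev_sum /sdev_diff hd => H; exact: H.
Qed.

Let covF1 h : - 1 <= @covf R n F h <= 1.
Proof. by have := covf_bounds hcent hF h 0; rewrite subr0. Qed.

Let ucross a w : \bar R := limn (fun m => (crossings m a (path w))%:R%:E).

Let crossings_homo a w : nondecreasing_seq (fun m => (crossings m a (path w))%:R%:E : \bar R).
Proof.
by move=> m k mk; rewrite lee_fin ler_nat -(subnKC mk) crossings_nondecreasing.
Qed.

Let cvg_crossings a w : (crossings m a (path w))%:R%:E @[m --> \oo] --> ucross a w.
Proof. by apply: ereal_nondecreasing_is_cvgn; exact: crossings_homo. Qed.

Let crossings_le a m w : ((crossings m a (path w))%:R%:E <= ucross a w)%E.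
Proof.
apply: lime_ge; first by apply/cvg_ex; exists (ucross a w); exact: cvg_crossings.
by near=> k; apply: crossings_homo; near: k; exact: nbhs_infty_ge.
Unshelve. all: by end_near. Qed.

Let measurable_ucross a : measurable_fun setT (ucross a).
Proof.
apply: (emeasurable_fun_cvg (fun m w => (crossings m a (path w))%:R%:E)).
  exact: measurable_crossings.
by move=> w _; exact: cvg_crossings.
Qed.

Let ucross_ge0 a w : (0 <= ucross a w)%E.
Proof. by apply: le_trans (crossings_le a 0 w); rewrite lee_fin. Qed.

Let crossings_ge0 a m w : (0 <= (crossings m a (path w))%:R%:E :> \bar R)%E.
Proof. by rewrite lee_fin. Qed.

Let rho_ge0 a : (0 <= rho a)%E.
Proof.
rewrite /level_rate mule_ge0//; first exact: sqrte_ge0.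
by rewrite lee_fin mulr_ge0 ?expR_ge0// invr_ge0 pi_ge0.
Qed.

Let integral_ucross a : (\int[P]_w ucross a w = rho a)%E.
Proof.
have L1 := cvg_monotone_convergence (mu := P) measurableT (measurable_crossings a)
  (fun m w _ => crossings_ge0 a m w) (fun w _ => crossings_homo a w).
have H := eq_cvg_limit L1 (crossing_prob_rate covF1 (a := a) (v := v)).
by apply: H => m; exact: integral_crossings.
Qed.

(** Off this null set no dyadic time is a zero, as the pathwise lemmas on sign changes require. *)
Let dyadic_null : set Omega := \bigcup_m \bigcup_k [set w | X (y + (k%:R / 2 ^+ m) *: v) w = u].

Let null_dyadic : P.-negligible dyadic_null.
Proof.
apply: negligible_bigcup => m; apply: negligible_bigcup => k.
have mA : measurable [set w | X (y + (k%:R / 2 ^+ m) *: v) w = u].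
  by rewrite -[X in measurable X]setTI; exact: (mX _ measurableT (measurable_set1 u)).
by apply/negligibleP => //; exact: (field_level_null hgauss hcent hF).
Qed.

Let nodyadicP w : ~ dyadic_null w -> forall m k, path w (k%:R / 2 ^+ m) != u.
Proof. by move=> nw m k; apply/eqP => e; apply: nw; exists m => //; exists k. Qed.

Definition level_times w : set R := [set t | X (y + t *: v) w = u].

Let I01 : set R := `[0, 1[%classic.

Let dist w (t : R) : R := `|X (y + t *: v) w - u|.

Let zerosE w : zeros dist w = I01 `&` level_times w.
Proof.
apply/seteqP; split => t [t01 h]; split => //.
  by apply/eqP; rewrite -subr_eq0 -normr_eq0; exact/eqP.
by rewrite /dist h subrr normr0.
Qed.

Let mdist t : measurable_fun setT (dist ^~ t).
Proof.
apply: measurableT_comp; first exact: normr_measurable.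
by apply: measurable_funB; [exact: mX|exact: measurable_cst].
Qed.

Let cdist w : continuous (dist w).
Proof.
move=> t; apply: cvg_norm; apply: cvgB; last exact: cvg_cst.
exact: continuous_path.
Qed.

Let dist_ge0 w t : 0 <= dist w t.
Proof. exact: normr_ge0. Qed.

Let level_zerosE w : [set t | `[0, 1[%classic t /\ path w t = u] = zeros dist w.
Proof. by rewrite zerosE. Qed.

Let rice_ge : (rho u <= \int[P]_w counting (I01 `&` level_times w))%E.
Proof.
under eq_integral do rewrite -zerosE.
have L : ((2 ^+ k)%:E * @crossing_prob R n F u (- (2 ^- k *: v)))%E @[k --> \oo] --> rho u.
  exact: crossing_prob_rate.
rewrite -(cvg_lim _ L)//; apply: lime_le; first by apply/cvg_ex; exists (rho u).
apply: nearW => m; rewrite -integral_crossings.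
apply: ae_ge0_le_integral => //.
- exact: (measurable_counting_zeros mdist cdist dist_ge0).
- apply: negligibleS null_dyadic => w; apply: contra_notP => nw _.
  apply: (@le_trans _ _ (ncells m (zeros dist w))%:R%:E); last exact: ncells_le_counting.
  by rewrite lee_fin ler_nat -level_zerosE crossings_le_ncells//; [exact: continuous_path|exact: nodyadicP].
Qed.

Let rice_le : (\int[P]_w counting (I01 `&` level_times w) <= rho u)%E.
Proof.
under eq_integral do rewrite -zerosE.
(* An infinite rate leaves nothing to prove; a finite one is continuous in the level, which the
   limit below needs. *)
have [sfin|] := boolP (sqrte (@spectral_form R n F v) \is a fin_num); last first.
  have s0 : (0 <= sqrte (@spectral_form R n F v))%E by exact: sqrte_ge0.
  rewrite ge0_fin_numE// -leNgt leye_eq => /eqP sy.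
  rewrite /level_rate sy gt0_mulye ?leey// lte_fin mulr_gt0 ?expR_gt0// invr_gt0; exact: pi_gt0.
pose e_ j : R := j.+1%:R^-1.
pose C j w := (ucross (u - e_ j) w + ucross (u + e_ j) w)%E.
have mC j : measurable_fun setT (C j) by apply: emeasurable_funD; exact: measurable_ucross.
have C0 j w : (0 <= C j w)%E by apply: adde_ge0; exact: ucross_ge0.
have iC j : (\int[P]_w C j w = rho (u - e_ j)%R + rho (u + e_ j)%R)%E.
  by rewrite ge0_integralD// ?integral_ucross//; exact: measurable_ucross.
have e_0 : e_ j @[j --> \oo] --> (0 : R) by exact: cvg_harmonic.
(* Used with [s = -1] and [s = 1], for the levels below and above [u]. *)
have cr s : rho (u + s * e_ j)%R @[j --> \oo] --> rho u.
  rewrite /level_rate; apply: cvgeZl => //; apply: cvg_EFin; first exact: nearW.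
  rewrite (_ : fine \o _ = fun j => pi^-1 * expR (- ((u + s * e_ j) ^+ 2 / 2)))//.
  have cf : continuous (fun x : R => pi^-1 * expR (- ((u + s * x) ^+ 2 / 2))).
    move=> x; apply: cvgMr; apply: (@continuous_comp _ _ _ (fun x : R => - ((u + s * x) ^+ 2 / 2)) expR); last exact: continuous_expR.
    apply: cvgN; apply: cvgMl; rewrite expr2; under eq_fun do rewrite expr2.
    by apply: cvgM; (apply: cvgD; [exact: cvg_cst|apply: cvgMr; exact: cvg_id]).
  have := cvg_comp e_ (fun x : R => pi^-1 * expR (- ((u + s * x) ^+ 2 / 2))) e_0 (cf 0).
  by rewrite mulr0 addr0.
have two : (\int[P]_w limn_einf (C ^~ w) <= rho u + rho u)%E.
  apply: (le_trans (fatou P measurableT mC (fun k w _ => C0 k w))).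
  have L : (\int[P]_w C j w)%E @[j --> \oo] --> (rho u + rho u)%E.
    rewrite (_ : (fun _ => _) = fun j => (rho (u + (-1) * e_ j)%R + rho (u + 1 * e_ j)%R)%E); last first.
      by apply/funext => j; rewrite iC mulN1r mul1r.
    by apply: cvgeD (cr _) (cr _); rewrite ge0_adde_def// inE rho_ge0.
  by rewrite is_cvg_limn_einfE ?(cvg_lim _ L)//; apply/cvg_ex; exists (rho u + rho u)%E.
apply: (fatou_le (measurable_ncells mdist cdist dist_ge0)).
- by move=> m w; rewrite lee_fin.
- by move=> w; apply: ncells_cvg => t [].
(* [M] is fixed first: how small [e] must be in [crossings_two_sided] depends on [M] and on the
   path, so the bound is on the pathwise lower limit over [e_ j], whose mean [two] controls. *)
move=> M; rewrite -(@lee_pmul2l _ 2%:E)//.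
rewrite -ge0_integralZl//; last exact: (measurable_ncells mdist cdist dist_ge0).
rewrite [leRHS](_ : _ = rho u + rho u)%E; last by rewrite mule_natl mule2n.
apply: le_trans two; apply: ae_ge0_le_integral => //.
- apply: emeasurable_funM => //; exact: (measurable_ncells mdist cdist dist_ge0).
- by move=> w _; apply: limn_einf_ge; exact: nearW.
- rewrite (_ : (fun _ => _) = \- (fun w => limn_esup (fun j => - C j w)))%E; last first.
    by apply/funext => w; rewrite [X in (- X)%E](limn_esupN (C ^~ w)) oppeK.
  apply: measurableT_comp; first exact: oppe_measurable.
  by apply: measurable_fun_limn_esup => j; apply: measurableT_comp; first exact: oppe_measurable.
apply: negligibleS null_dyadic => w; apply: contra_notP => nw _.
have cs := crossings_two_sided (@continuous_path w) (nodyadicP nw) M.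
apply: limn_einf_ge; move: cs => /nbhs_ballP[r /= r0 br].
have /cvgrPdist_lt /(_ _ r0) := e_0; apply: filterS => j ej.
have ej0 : 0 < e_ j by rewrite invr_gt0.
have [m hm] := br _ ej ej0.
apply: (@le_trans _ _ ((crossings m (u - e_ j) (path w))%:R%:E + (crossings m (u + e_ j) (path w))%:R%:E)).
  by rewrite -EFinM -EFinD lee_fin -natrM -natrD ler_nat -level_zerosE.
by apply: leeD; exact: crossings_le.
Qed.

Lemma rice : (\int[P]_w counting (`[0%R, 1%R[%classic `&` level_times w) = rho u)%E.
Proof. by apply/eqP; rewrite eq_le rice_ge rice_le. Qed.

End rice.

(** * Restriction to a closed set of times *)

(** Caratheodory functions are measurable: with the point replaced by the corner of its dyadic cube
    only countably many functions [g x] occur, and continuity gives the limit. *)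
Lemma measurable_jointly {R : realType} {n : nat} {d : measure_display} {T : measurableType d}
    (g : 'rV[R]_n -> T -> R) :
  (forall x, measurable_fun setT (g x)) -> (forall w, continuous (g ^~ w)) ->
  measurable_fun setT (fun p : 'rV[R]_n * T => g p.1 p.2).
Proof.
move=> mg cg.
pose q m (z : 'rV[int]_n) : 'rV[R]_n := \row_i ((z 0 i)%:~R / 2 ^+ m).
pose gm m (p : 'rV[R]_n * T) : R := g (q m (dyadic_floor m p.1)) p.2.
apply: (@measurable_fun_cvg _ _ _ _ gm) => //.
- move=> m _ A mA; rewrite setTI.
  rewrite (_ : gm m @^-1` A = \bigcup_z (dyadic_cube m z `*` (g (q m z) @^-1` A))); last first.
    apply/seteqP; split => [[x w] h|[x w] [z _ [/= xz h]]].
      by exists (dyadic_floor m x) => //; split => //; exact/dyadic_cubeP.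
    by rewrite /gm /=; move/dyadic_cubeP : xz => ->.
  apply: countable_bigcupT_measurable; first exact: countableP.
  move=> z; apply: measurableX; first exact: measurable_dyadic_cube.
  by rewrite -[X in measurable X]setTI; exact: mg.
- move=> [x w] _; rewrite /gm /=.
  apply: (@cvg_comp _ _ _ (fun m => q m (dyadic_floor m x)) (g ^~ w)); last exact: cg.
  apply/cvg_ballP => e e0; have [m0 hm0] := exists_exp2_lt e0.
  near=> m; split=> // i j; rewrite [i]ord1 /ball/= mxE.
  have m0m : (m0 <= m)%N by near: m; exact: nbhs_infty_ge.
  have p0 : 0 < 2 ^+ m :> R by rewrite exprn_gt0.
  have /dyadic_cubeP /(_ j) : dyadic_floor m x = dyadic_floor m x by [].
  rewrite /= in_itv/= => /andP[h1 h2].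
  have h3 : (2 ^+ m)^-1 <= (2 ^+ m0)^-1 :> R by rewrite lef_pV2 ?posrE ?exprn_gt0// ler_weXn2l// ler1n.
  by move: h2; rewrite mulrDl mul1r => h2; rewrite ltr_norml; apply/andP; split; lra.
Unshelve. all: by end_near. Qed.

Lemma counting_ge0 {R : realType} {T : choiceType} (A : set T) : (0 <= counting A :> \bar R)%E.
Proof. by apply: (@le_counting_seq R T [::]). Qed.

Lemma counting_superadditive {R : realType} {T : choiceType} (A B : set T) : A `&` B = set0 ->
  (counting A + counting B <= counting (A `|` B) :> \bar R)%E.
Proof.
move=> AB.
have [fA|iA] := pselect (finite_set A); last first.
  suff -> : counting (A `|` B) = +oo%E :> \bar R by exact: leey.
  by rewrite /counting asboolF// finite_setU => -[].
have [fB|iB] := pselect (finite_set B); last first.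
  suff -> : counting (A `|` B) = +oo%E :> \bar R by exact: leey.
  by rewrite /counting asboolF// finite_setU => -[].
have cE (C : set T) : finite_set C -> counting C = (size (finmap.enum_fset (fset_set C)))%:R%:E :> \bar R.
  by move=> fC; rewrite /counting asboolT.
rewrite (cE _ fA) (cE _ fB) -EFinD -natrD -size_cat; apply: le_counting_seq.
  rewrite cat_uniq !finmap.fset_uniq/= andbT; apply/hasPn => x.
  rewrite in_fset_set// => /set_mem Bx; rewrite /= in_fset_set//; apply/negP => /set_mem Ax.
  by have : set0 x by rewrite -AB.
move=> x; rewrite mem_cat => /orP[]; rewrite in_fset_set// => /set_mem; [by left|by right].
Qed.

Lemma le_counting {R : realType} {T : choiceType} (A B : set T) : A `<=` B ->
  (counting A <= counting B :> \bar R)%E.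
Proof.
move=> AB; have [fB|iB] := pselect (finite_set B); last by rewrite [leRHS]/counting asboolF// leey.
have fA := sub_finite_set AB fB; rewrite [leLHS]/counting asboolT//.
by apply: le_counting_seq => [|x]; [exact: finmap.fset_uniq|rewrite in_fset_set// => /set_mem/AB].
Qed.

(** * Averaging counts over shifts *)

Section counting_average.
Context {R : realType}.
Local Notation mu := (@lebesgue_measure R).

Lemma lebesgue_reflect (A : set R) (z : R) : measurable A ->
  (\int[mu]_s (\1_A (z - s))%:E = mu A)%E.
Proof.
move=> mA.
have m1 : measurable_fun [set: R] (fun x : R => (\1_A x)%:E : \bar R).
  by apply/measurable_EFinP; exact: measurable_indic.
have n1 (x : R) : (0 <= (\1_A x)%:E :> \bar R)%E by rewrite lee_fin.
have mN : measurable_fun [set: R] (fun s : R => (\1_A (- s))%:E : \bar R).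
  by apply: (measurableT_comp m1); exact: measurable_funN.
rewrite -[in RHS](setIT A) -(integral_indic mu measurableT mA) -(ge0_integral_opp1 m1 n1).
rewrite -(@ge0_integral_shift1 R (- z) _ mN (fun s => n1 (- s))).
by apply: eq_integral => s _; rewrite opprB.
Qed.

Variables (Z A : set R) (b : R).
Hypotheses (mA : measurable A) (A01 : A `<=` `[0, 1[%classic) (b0 : 0 < b).

Let hits s : \bar R := counting [set t | A t /\ Z (t + s)].
Let Zb : set R := [set t | `[0, 1[%classic t /\ Z (1 + t * b)].

Hypothesis mhits : measurable_fun [set: R] hits.

(** The shifts [s] bringing a point [1 + z * b] of [Z] into [A] form a reflected copy of [A], of
    measure [mu A]. They all lie in [[0, b + 1]], because the point is in [[1, b + 1[] and [A] in
    [[0, 1[]; this is why the points are taken from 1 on. *)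
Lemma counting_average_ge :
  (mu A * counting Zb <= \int[mu]_s ((\1_`[0, (b + 1)] s)%:E * hits s))%E.
Proof.
have Afin : mu A \is a fin_num.
  rewrite ge0_fin_numE//; apply: (@le_lt_trans _ _ (mu `[0%R, 1%R[%classic)).
    by apply: le_measure => //; rewrite inE//; exact: measurable_itv.
  by rewrite lebesgue_measure_itv/= lte_fin ltr01 -EFinB ltry.
(* Passing through [ncells] replaces a possibly infinite count by finite lists, over which integrals
   and sums commute. *)
have L : (mu A * (ncells m Zb)%:R%:E)%E @[m --> \oo] --> (mu A * counting Zb)%E.
  by apply: cvgeZl => //; apply: ncells_cvg => t [].
rewrite -(cvg_lim _ L)//; apply: lime_le; first by apply/cvg_ex; exists (mu A * counting Zb)%E.
apply: nearW => m.
have [s [us sZ ps]] := counting_seq_ge (ncells_le_counting m Zb).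
apply: (@le_trans _ _ (mu A * (size s)%:R%:E)%E).
  by rewrite lee_wpmul2l// lee_fin ler_nat.
have mi z : measurable_fun [set: R] (fun x : R => (\1_A (1 + z * b - x))%:E : \bar R).
  apply/measurable_EFinP; apply: (measurableT_comp (measurable_indic mA)).
  by apply: measurable_funB => //; exact: measurable_cst.
have -> : (mu A * (size s)%:R%:E = \int[mu]_x \sum_(z <- s) (\1_A (1 + z * b - x))%:E)%E.
  rewrite ge0_integral_sum//.
  under eq_bigr do rewrite lebesgue_reflect//.
  by rewrite big_const_seq count_predT iter_addr_0 muleC mule_natl.
apply: ge0_le_integral => //.
- by move=> x _; apply: sume_ge0 => z _; rewrite lee_fin.
- by apply: emeasurable_sum.
- apply: emeasurable_funM => //; apply/measurable_EFinP; apply: measurable_indic; exact: measurable_itv.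
move=> x _; rewrite sumEFin.
pose ph z : R := 1 + z * b - x.
pose s' := [seq ph z | z <- [seq z <- s | ph z \in A]].
have -> : \sum_(z <- s) \1_A (1 + z * b - x) = (size s')%:R :> R.
  rewrite size_map size_filter -sum1_count natr_sum [RHS]big_mkcond/=.
  by apply: eq_bigr => z _; rewrite indicE -/(ph z); case: (ph z \in A).
have us' : uniq s'.
  rewrite map_inj_uniq ?filter_uniq// => z z'.
  by move=> /addIr /addrI /(mulIf (lt0r_neq0 b0)).
have s'A : {in s', forall t, A t /\ Z (t + x)}.
  move=> _ /mapP[z + ->]; rewrite mem_filter => /andP[/set_mem Az zs]; split => //.
  by rewrite /ph subrK; have [] := sZ _ zs.
case: (boolP (x \in (`[0, (b + 1)] : interval R))) => xb.
  by rewrite indicE mem_set// mul1e; exact: le_counting_seq.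
rewrite indicE memNset//; last exact/negP.
suff -> : s' = [::] by rewrite mul0e.
rewrite -[s']filter_predT; apply/eqP; rewrite -size_eq0 size_filter -leqn0 leqNgt -has_count.
apply: contra xb => /hasP[_ /mapP[z + ->] _]; rewrite mem_filter => /andP[/set_mem/A01 + zs].
have [+ _] := sZ _ zs; rewrite /ph /= !in_itv/= => /andP[z0 z1] /andP[h1 h2].
have a0 := mulr_ge0 z0 (ltW b0); have a1 : z * b < b by rewrite gtr_pMl.
have aux (p q r : R) : 0 <= q -> q < r -> 0 <= 1 + q - p -> 1 + q - p < 1 -> 0 <= p <= r + 1.
  by move=> *; lra.
exact: (aux _ _ _ a0 a1 h1 h2).
Qed.

End counting_average.

Lemma measurable_level_dist {R : realType} {n : nat} {dO : measure_display} {Omega : measurableType dO}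
    {P : probability Omega R} {X : 'rV[R]_n -> {RV P >-> R}} (hcont : continuous_paths X)
    (u : R) d (T : measurableType d) (a : T -> 'rV[R]_n) (b : T -> Omega) :
  measurable_fun setT a -> measurable_fun setT b ->
  measurable_fun setT (fun p => `|X (a p) (b p) - u|).
Proof.
move=> ma mb; apply: measurableT_comp; first exact: normr_measurable.
apply: measurable_funB; last exact: measurable_cst.
have mX := measurable_jointly (g := fun x w => X x w) (fun x => measurable_funP (X x)) hcont.
exact: (measurableT_comp mX (measurable_fun_pair ma mb)).
Qed.

Definition level_count {R : realType} {n : nat} {dO : measure_display} {Omega : measurableType dO}
    {P : probability Omega R} (X : 'rV[R]_n -> {RV P >-> R}) (u : R) (v : 'rV[R]_n)
    (A : set R) (y : 'rV[R]_n) (w : Omega) : \bar R :=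
  counting ((`[0, 1[%classic `&` A) `&` @level_times R n dO Omega P X u y v w).

Lemma spectral_form_ge0 {R : realType} {n : nat} (F : probability 'rV[R]_n R) v :
  (0 <= @spectral_form R n F v)%E.
Proof. by apply: integral_ge0 => l _; rewrite lee_fin sqr_ge0. Qed.

Lemma spectral_form_scale {R : realType} {n : nat} (F : probability 'rV[R]_n R) (b : R) v :
  (@spectral_form R n F (b *: v) = (b ^+ 2)%:E * @spectral_form R n F v)%E.
Proof.
rewrite /spectral_form -ge0_integralZl//.
- by apply: eq_integral => l _; rewrite dotZr exprMn EFinM.
- apply/measurable_EFinP; apply: measurable_funX; apply: measurable_dot; last exact: measurable_cst.
  exact: measurable_id.
- by move=> l _; rewrite lee_fin sqr_ge0.
- by rewrite lee_fin sqr_ge0.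
Qed.

Lemma sqrteZ {R : realType} (b : R) (x : \bar R) : 0 < b -> (0 <= x)%E ->
  sqrte ((b ^+ 2)%:E * x)%E = (b%:E * sqrte x)%E.
Proof.
move=> b0; case: x => [r| |//] r0.
  by rewrite -EFinM /= sqrtrM ?sqr_ge0// sqrtr_sqr gtr0_norm.
by rewrite gt0_muley ?lte_fin ?exprn_gt0//= gt0_muley ?lte_fin.
Qed.

Lemma level_rate_scale {R : realType} {n : nat} (F : probability 'rV[R]_n R) (u b : R) v : 0 < b ->
  (@level_rate R n F u (b *: v) = b%:E * @level_rate R n F u v)%E.
Proof.
move=> b0; rewrite /level_rate spectral_form_scale sqrteZ//; last exact: spectral_form_ge0.
by rewrite muleA.
Qed.

Lemma level_rate_ge0 {R : realType} {n : nat} (F : probability 'rV[R]_n R) (u : R) v :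
  (0 <= @level_rate R n F u v)%E.
Proof.
rewrite /level_rate mule_ge0//; first exact: sqrte_ge0.
by rewrite lee_fin mulr_ge0 ?expR_ge0// invr_ge0 pi_ge0.
Qed.

(** The boundary effect of width 1 becomes negligible compared with [b] as [b] grows. *)
Lemma lee_of_scaled {R : realType} (x e : \bar R) : (0 <= x)%E ->
  (forall b : R, 0 < b -> (b%:E * e <= (b + 1)%:E * x)%E) -> (e <= x)%E.
Proof.
case: x => [x| |//] x0 H; last exact: leey.
move: e H => [e| |] H; last by rewrite leNye.
  rewrite lee_fin leNgt; apply/negP => xe.
  have d0 : 0 < e - x by rewrite subr_gt0.
  (* The value for which [b * (e - x)] is [x + 1], whereas the hypothesis bounds it by [x]. *)
  have b0 : 0 < (x + 1) / (e - x) by rewrite divr_gt0// ltr_wpDl.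
  have := H _ b0; rewrite -!EFinM lee_fin.
  have q : (x + 1) / (e - x) * (e - x) = x + 1 by rewrite divfK ?gt_eqF.
  rewrite leNgt => /negP; apply; move: x0; rewrite lee_fin => x0.
  set b := _ / _ in q *; rewrite mulrDl mul1r; lra.
by have := H 1 ltr01; rewrite mul1e -EFinM leye_eq.
Qed.

Section level_times_closed.
Context {R : realType} {n : nat} {dO : measure_display} {Omega : measurableType dO}
  {P : probability Omega R} {X : 'rV[R]_n -> {RV P >-> R}} {F : probability 'rV[R]_n R}.
Hypotheses (hgauss : gaussian_field X) (hcent : centered_field X) (hF : spectral_measure X F)
  (hcont : continuous_paths X) (hstat : stationary_field X).
Variable u : R.
Local Notation mu := (@lebesgue_measure R).

Let level_dist (f : R -> R) v y w (t : R) : R := `|X (y + t *: v) w - u| + f t.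

Lemma zeros_level_dist (f : R -> R) (A : set R) v y w :
  (forall x, 0 <= f x) -> (forall x, f x = 0 <-> A x) ->
  counting [set t | `[0, 1[%classic t /\ level_dist f v y w t = 0] = level_count X u v A y w.
Proof.
move=> f0 fA; congr counting; apply/seteqP; split => t /=.
  move=> [t01] /eqP; rewrite paddr_eq0// => /andP[/eqP h1 /eqP h2].
  split; first by split => //; exact/fA.
  by apply/eqP; rewrite -subr_eq0 -normr_eq0 h1.
move=> [[t01 At] h]; split => //; rewrite /level_times/= in h.
by rewrite /level_dist h subrr normr0 add0r; exact/fA.
Qed.

Let continuous_level_dist f v y w : continuous f -> continuous (level_dist f v y w).
Proof.
move=> cf t; apply: cvgD; last exact: cf.
apply: cvg_norm; apply: cvgB; last exact: cvg_cst.
exact: (continuous_path hcont).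
Qed.

Lemma measurable_line d (T : measurableType d) (y v : T -> 'rV[R]_n) (a : T -> R) :
  measurable_fun setT y -> measurable_fun setT v -> measurable_fun setT a ->
  measurable_fun setT (fun p => y p + a p *: v p).
Proof.
move=> my mv ma; apply: measurable_fun_rV => i.
rewrite (_ : (fun _ => _) = fun p => y p 0 i + a p * v p 0 i); last by apply/funext => p; rewrite !mxE.
apply: measurable_funD; first exact: (measurableT_comp (measurable_rV_coord i) my).
by apply: measurable_funM => //; exact: (measurableT_comp (measurable_rV_coord i) mv).
Qed.

(** The set of times depends on the parameter too, as the times at which a line meets [K] depend on
    the line; [f] expresses this dependence measurably. *)
Lemma measurable_level_count_param d (T : measurableType d) (y v : T -> 'rV[R]_n) (b : T -> Omega)
    (A : T -> set R) (f : T -> R -> R) :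
  measurable_fun setT y -> measurable_fun setT v -> measurable_fun setT b ->
  (forall t, measurable_fun setT (f ^~ t)) -> (forall p, continuous (f p)) ->
  (forall p t, 0 <= f p t) -> (forall p t, f p t = 0 <-> A p t) ->
  measurable_fun setT (fun p => level_count X u (v p) (A p) (y p) (b p)).
Proof.
move=> my mv mb mf cf f0 fA.
rewrite (_ : (fun _ => _) = fun p => counting (zeros (fun p => level_dist (f p) (v p) (y p) (b p)) p)); last first.
  by apply/funext => p; rewrite -(zeros_level_dist _ _ _ (f0 p) (fA p)).
apply: measurable_counting_zeros.
- move=> t; apply: measurable_funD => //.
  apply: measurable_level_dist => //; apply: measurable_line => //; exact: measurable_cst.
- by move=> p; exact: continuous_level_dist.
- by move=> p t; rewrite addr_ge0.
Qed.

Lemma measurable_level_count d (T : measurableType d) (y v : T -> 'rV[R]_n) (b : T -> Omega) (A : set R) :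
  closed A -> measurable_fun setT y -> measurable_fun setT v -> measurable_fun setT b ->
  measurable_fun setT (fun p => level_count X u (v p) A (y p) (b p)).
Proof.
move=> cA my mv mb; have [f [cf f0 fA]] := closed_zero_set cA.
apply: (measurable_level_count_param (f := fun _ => f)) => // t; exact: measurable_cst.
Qed.

Lemma level_count_setT v y w : level_count X u v setT y w =
  counting (`[0, 1[%classic `&` @level_times R n dO Omega P X u y v w).
Proof. by rewrite /level_count setIT. Qed.

Local Notation rho v := (@level_rate R n F u v).

Section closed_times.
Variables (v : 'rV[R]_n) (A : set R).
Hypothesis cA : closed A.
Local Notation rho := (@level_rate R n F u v).
Local Notation level_count := (level_count X u v).

(** The events [near_zero] depend on the field at finitely many points, all translated by [h], so
    stationarity applies to them; [eq_integral_counting_zeros] extends the equality to mean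
    counts. *)
Lemma level_count_shift y h :
  (\int[P]_w level_count A (y + h) w = \int[P]_w level_count A y w)%E.
Proof.
have [f [cf f0 fA]] := closed_zero_set cA.
pose g y := level_dist f v y.
have mg z t : measurable_fun setT (g z ^~ t).
  apply: measurable_funD; last exact: measurable_cst.
  by apply: measurable_level_dist => //; exact: measurable_cst.
under eq_integral do rewrite -(zeros_level_dist _ _ _ f0 fA).
under [RHS]eq_integral do rewrite -(zeros_level_dist _ _ _ f0 fA).
apply: (eq_integral_counting_zeros (g1 := g (y + h)) (g2 := g y)); rewrite /g.
- by move=> t; exact: mg.
- by move=> w; exact: continuous_level_dist.
- by move=> w t; rewrite addr_ge0.
- by move=> t; exact: mg.
- by move=> w; exact: continuous_level_dist.
- by move=> w t; rewrite addr_ge0.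
move=> q e I; pose B : set 'rV[R]_I := [set x | exists i : 'I_I, `|x 0 i - u| + f (q i) < e].
have mB : measurable B.
  rewrite (_ : B = \bigcup_(i in [set: 'I_I]) [set x : 'rV[R]_I | `|x 0 i - u| + f (q i) < e]); last first.
    by apply/seteqP; split => x [i]; exists i.
  apply: fin_bigcup_measurable; first exact: finite_finset.
  move=> i _; rewrite [X in measurable X](_ : _ = [set: 'rV[R]_I] `&` (fun x : 'rV[R]_I => `|x 0 i - u| + f (q i)) @^-1` `]-oo, e[%classic).
    have mh : measurable_fun [set: 'rV[R]_I] (fun x : 'rV[R]_I => `|x 0 i - u| + f (q i)).
      apply: measurable_funD; last exact: measurable_cst.
      apply: measurableT_comp; first exact: normr_measurable.
      by apply: measurable_funB; [exact: measurable_rV_coord|exact: measurable_cst].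
    by apply: (mh measurableT); exact: measurable_itv.
  by rewrite setTI; apply/seteqP; split=> x /=; rewrite in_itv.
have E z : near_zero (g z) q e I = [set w | B (\row_(i < I) X (z + q i *: v) w)].
  apply/seteqP; split => w /=.
    by move=> [i iI gi]; exists (Ordinal iI); rewrite mxE.
  by move=> [i]; rewrite mxE => gi; exists i.
rewrite -[level_dist f v (y + h)]/(g (y + h)) -[level_dist f v y]/(g y) (E (y + h)) (E y).
rewrite -[RHS](hstat (fun i : 'I_I => y + q i *: v) h mB); congr (P _).
apply/seteqP; split => w; rewrite /= (_ : \row_i X (y + h + q i *: v) w = \row_i X (y + q i *: v + h) w)//.
  by apply/rowP => i; rewrite !mxE addrAC.
by apply/rowP => i; rewrite !mxE addrAC.
Qed.

Lemma measurable_unit_part : measurable (`[0, 1[%classic `&` A).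
Proof. by apply: measurableI; [exact: measurable_itv|exact: closed_measurable]. Qed.

Lemma measurable_whole_count y' v' : measurable_fun setT
  (fun w => counting (`[0%R, 1%R[%classic `&` @level_times R n dO Omega P X u y' v' w) : \bar R).
Proof.
under eq_fun do rewrite -level_count_setT.
by apply: measurable_level_count; [exact: closedT|exact: measurable_cst..|exact: measurable_id].
Qed.

Let measurable_count1 z : measurable_fun setT (level_count A z).
Proof. by apply: measurable_level_count cA _ _ _; [exact: measurable_cst..|exact: measurable_id]. Qed.

(* By stationarity the mean is unchanged when the base point is moved by [s *: v];
   averaged over [0 <= s <= b + 1], each zero in [1, 1 + b[ has weight [mu A]. *)
Lemma level_count_ge y :
  (mu (`[0%R, 1%R[%classic `&` A) * rho <= \int[P]_w level_count A y w)%E.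
Proof.
apply: lee_of_scaled => [|b b0]; first by apply: integral_ge0 => w _; exact: counting_ge0.
pose Om := (measurableTypeR R * Omega)%type.
pose ind (s : R) : R := \1_(`[0, (b + 1)]%classic) s.
pose H (p : Om) : \bar R := ((ind p.1)%:E * level_count A (y + p.1 *: v) p.2)%E.
have H0 p : (0 <= H p)%E by rewrite mule_ge0 ?counting_ge0// lee_fin.
have mind : measurable_fun setT (fun s : measurableTypeR R => (ind s)%:E : \bar R).
  by apply/measurable_EFinP; apply: measurable_indic; exact: measurable_itv.
have mH : measurable_fun [set: Om] H.
  apply: emeasurable_funM; first exact: (measurableT_comp mind measurable_fst).
  apply: (measurable_level_count (y := fun p : Om => y + p.1 *: v) (v := fun=> v) (b := snd) cA); [|exact: measurable_cst|exact: measurable_snd].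
  by apply: measurable_line; [exact: measurable_cst..|exact: measurable_fst].
have E1 : (\int[mu]_s \int[P]_w H (s, w) = (b + 1)%:E * \int[P]_w level_count A y w)%E.
  transitivity (\int[mu]_s ((ind s)%:E * \int[P]_w level_count A y w))%E.
    apply: eq_integral => s _; rewrite -(level_count_shift y (s *: v)).
    have i0 : (0 <= (ind s)%:E)%E by rewrite lee_fin.
    exact: (ge0_integralZl P measurableT (measurable_count1 (y + s *: v)) (fun w _ => counting_ge0 _) i0).
  rewrite ge0_integralZr//; last 2 first.
  - by move=> s _; rewrite lee_fin.
  - by apply: integral_ge0 => w _; exact: counting_ge0.
  suff -> : (\int[mu]_s (ind s)%:E = (b + 1)%:E)%E by [].
  have mI : measurable (`[0, (b + 1)]%classic : set R) by exact: measurable_itv.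
  transitivity (mu (`[0%R, (b + 1)%R]%classic `&` setT)); first exact: (integral_indic mu measurableT mI).
  rewrite setIT lebesgue_measure_itv/= lte_fin; have -> : 0 < b + 1 by lra.
  by rewrite -EFinB subr0.
rewrite -E1 (@fubini_tonelli _ _ _ _ R mu P H mH H0).
(* Rice's formula on the times [[1, 1 + b[] is brought back to [[0, 1[] with base point [y + v] and
   direction [b *: v]; the rate is multiplied by [b]. *)
apply: (@le_trans _ _ (mu (`[0%R, 1%R[%classic `&` A) * \int[P]_w counting (`[0%R, 1%R[%classic `&` @level_times R n dO Omega P X u (y + v) (b *: v) w))%E).
  by rewrite (rice hgauss hcent hF hcont) level_rate_scale// muleCA.
rewrite -ge0_integralZl//; last exact: measurable_whole_count.
have mG := @measurable_fun_fubini_tonelli_G _ _ _ _ R mu H mH H0.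
apply: ge0_le_integral.
- exact: measurableT.
- by move=> w _; rewrite mule_ge0 ?counting_ge0.
- by apply: emeasurable_funM; [exact: measurable_cst|exact: measurable_whole_count].
- exact: mG.
move=> w _; set Z := @level_times R n dO Omega P X u y v w.
have hitsE s : level_count A (y + s *: v) w = counting [set t | (`[0%R, 1%R[%classic `&` A) t /\ Z (t + s)%R].
  have pE t : y + s *: v + t *: v = y + (t + s) *: v by rewrite scalerDl addrAC addrA.
  by congr counting; apply/seteqP; split => t [t01 h]; split => //; move: h; rewrite /Z /level_times/= pE.
have mh : measurable_fun [set: R] (fun s => counting [set t | (`[0, 1[%classic `&` A) t /\ Z (t + s)] : \bar R).
  rewrite (_ : (fun _ => _) = fun s : R => level_count A (y + s *: v) w); last by apply/funext => s; rewrite hitsE.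
  apply: (measurable_level_count (y := fun s : R => y + s *: v) (v := fun=> v) (b := fun=> w) cA); [|exact: measurable_cst..].
  by apply: measurable_line; [exact: measurable_cst..|exact: measurable_id].
have L := counting_average_ge measurable_unit_part (@subIsetl _ _ _) b0 mh.
rewrite (_ : [set t | `[0, 1[%classic t /\ Z (1 + t * b)] =
  `[0, 1[%classic `&` @level_times R n dO Omega P X u (y + v) (b *: v) w) in L; last first.
  have pE t : y + v + t *: (b *: v) = y + (1 + t * b) *: v by rewrite scalerDl scale1r scalerA addrA.
  by apply/seteqP; split => t [t01 h]; split => //; move: h; rewrite /Z /level_times/= pE.
apply: (le_trans L); rewrite le_eqVlt; apply/orP; left; apply/eqP.
by apply: eq_integral => s _; rewrite /H hitsE.
Qed.

End closed_times.

(* Compact subsets of the complement of [A] obey the lower bound, and the total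
   over [0, 1[ is known. *)
Lemma level_count_le v (A : set R) (cA : closed A) y : (rho v < +oo)%E ->
  (\int[P]_w level_count X u v A y w <= mu (`[0%R, 1%R[%classic `&` A) * rho v)%E.
Proof.
move=> rhoy.
have rfin : rho v \is a fin_num by rewrite ge0_fin_numE// level_rate_ge0.
have total : (\int[P]_w level_count X u v setT y w = rho v)%E.
  by under eq_integral do rewrite level_count_setT; exact: rice.
have e0 : (0 <= \int[P]_w level_count X u v A y w)%E by apply: integral_ge0 => w _; exact: counting_ge0.
have mA := measurable_unit_part cA.
have split_le C : compact C -> C `<=` `[0, 1[%classic `\` A ->
    (\int[P]_w level_count X u v A y w + mu C * rho v <= rho v)%E.
  move=> cC CD; have clC : closed C by apply: compact_closed => //; exact: norm_hausdorff.
  have CI : `[0, 1[%classic `&` C = C by apply/setIidPr => t /CD [].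
  have mC z : measurable_fun setT (level_count X u v C z).
    by apply: measurable_level_count clC _ _ _; [exact: measurable_cst..|exact: measurable_id].
  apply: (@le_trans _ _ (\int[P]_w level_count X u v A y w + \int[P]_w level_count X u v C y w)%E).
    by apply: (leeD (lexx _)); rewrite -{1}CI; exact: level_count_ge.
  have mcA : measurable_fun setT (level_count X u v A y).
    by apply: measurable_level_count cA _ _ _; [exact: measurable_cst..|exact: measurable_id].
  rewrite -total -ge0_integralD//.
  apply: ge0_le_integral => //.
  - by move=> w _; rewrite adde_ge0// counting_ge0.
  - exact: emeasurable_funD.
  - by apply: measurable_level_count closedT _ _ _; [exact: measurable_cst..|exact: measurable_id].
  move=> w _; apply: le_trans (counting_superadditive _) _.
    by apply/seteqP; split => t // -[[[_ At] _] [[_ /CD[_]]]].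
  by apply: le_counting => t [[[t01 _] h]|[[t01 _] h]]; split => //; split.
have efin : (\int[P]_w level_count X u v A y w)%E \is a fin_num.
  rewrite ge0_fin_numE//; apply: le_lt_trans rhoy.
  by have := split_le set0 compact0 (@sub0set _ _); rewrite measure0 mul0e adde0.
have mD : measurable (`[0, 1[%classic `\` A) by apply: measurableD; [exact: measurable_itv|exact: closed_measurable].
have muT : (mu (`[0%R, 1%R[%classic `&` A) + mu (`[0%R, 1%R[%classic `\` A) = 1)%E.
  have mI : measurable (`[0, 1[%classic : set R) by exact: measurable_itv.
  rewrite addeC -(measureDI mu mI (closed_measurable cA)).
  have m01 : (mu `[0%R, 1%R[%classic = 1)%E by rewrite lebesgue_measure_itv/= lte_fin ltr01 -EFinB subr0.
  exact: m01.
have Dsup : mu (`[0, 1[%classic `\` A) = ereal_sup [set mu C | C in [set C | compact C /\ C `<=` `[0, 1[%classic `\` A]].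
  exact: lebesgue_regularity_inner_sup.
have a0 : (0 <= mu (`[0%R, 1%R[%classic `&` A))%E by exact: measure_ge0.
have d0 : (0 <= mu (`[0%R, 1%R[%classic `\` A))%E by exact: measure_ge0.
move: (mu (`[0, 1[%classic `&` A)) (mu (`[0, 1[%classic `\` A)) Dsup muT a0 d0 => a dd Dsup muT a0 d0.
have := level_rate_ge0 F u v; rewrite -/(rho v).
move: split_le rhoy; rewrite -(fineK efin) -(fineK rfin).
move: (fine (\int[P]_w level_count X u v A y w)) (fine (rho v)) => e r split_le _; rewrite lee_fin => r0.
have er : e <= r.
  by have := split_le set0 compact0 (@sub0set _ _); rewrite measure0 mul0e adde0 lee_fin.
move: r0; rewrite le_eqVlt => /predU1P[r0|r0].
  by rewrite -r0 mule0 lee_fin; move: er; rewrite -r0.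
have dle : (dd <= ((r - e) / r)%:E)%E.
  rewrite Dsup; apply: ge_ereal_sup => _ [C [cC CD] <-].
  have := split_le C cC CD; have := measure_ge0 mu C; case: (mu C) => [c| |] c0; last by rewrite leNye.
    by rewrite -EFinM -EFinD !lee_fin ler_pdivlMr// lerBrDl.
  by rewrite gt0_mulye ?lte_fin// addey.
move: a dd a0 d0 muT dle {Dsup} => [a| |] [dd| |] //= a0 d0 [muT].
rewrite lee_fin -EFinM lee_fin => dle.
have : (1 - a) * r <= r - e by rewrite -ler_pdivlMr// -muT addrC addrK.
lra.
Qed.

End level_times_closed.

(** * Lines through a compact set *)

Lemma eq_integral_on d (T : measurableType d) (R : realType) (m : set T -> \bar R) (D : set T)
    (f g : T -> \bar R) : {in D, f =1 g} ->
  (\int[m]_(x in D) f x = \int[m]_(x in D) g x)%E.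
Proof.
move=> fg; rewrite /integral (_ : f \_ D = g \_ D)//; apply/funext => x.
by rewrite /patch; case: ifPn => // /fg.
Qed.

Lemma counting_le_inj {R : realType} {T U : choiceType} (A : set T) (B : set U) (phi : T -> U) :
  {in A &, injective phi} -> (forall x, A x -> B (phi x)) ->
  (counting A <= counting B :> \bar R)%E.
Proof.
move=> inj AB.
have H p : (p%:R%:E <= counting A :> \bar R)%E -> (p%:R%:E <= counting B :> \bar R)%E.
  move=> /counting_seq_ge[s [us sA ps]]; apply: (@le_trans _ _ (size (map phi s))%:R%:E).
    by rewrite size_map lee_fin ler_nat.
  apply: le_counting_seq; last by move=> _ /mapP[x xs ->]; apply: AB; exact: sA.
  by rewrite map_inj_in_uniq// => x y xs ys; apply: inj; rewrite inE; exact: sA.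
have [fA|iA] := pselect (finite_set A).
  have e : counting A = (size (finmap.enum_fset (fset_set A)))%:R%:E :> \bar R by rewrite /counting asboolT.
  by rewrite e; apply: H; rewrite e.
have e : counting A = +oo%E :> \bar R by rewrite /counting asboolF.
suff -> : counting B = +oo%E :> \bar R by exact: leey.
apply: eq_infty => r; apply: (@le_trans _ _ (Num.bound `|r|)%:R%:E); last by apply: H; rewrite e leey.
by rewrite lee_fin (le_trans (ler_norm _))// ltW// archi_boundP.
Qed.

Lemma dot_cauchy_schwarz {R : realType} {n : nat} (x z : 'rV[R]_n) :
  dot x z ^+ 2 <= dot x x * dot z z.
Proof.
have [zz|zz] := eqVneq (dot z z) 0.
  have -> : z = 0.
    apply/rowP => i; apply/eqP; rewrite mxE -normr_le0.
    by rewrite (le_trans (coord_le_enorm _ _))// /enorm zz sqrtr0.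
  have d0 y : dot y (0 : 'rV[R]_n) = 0 by rewrite /dot big1// => i _; rewrite mxE mulr0.
  by rewrite !d0 expr0n mulr0.
have zz0 : 0 < dot z z by rewrite lt0r zz dot_ge0.
have := dot_ge0 (dot z z *: x - dot x z *: z).
rewrite dotBl !dotBr !dotZl !dotZr (dotC z x) => h.
have : 0 <= dot z z * (dot x x * dot z z - dot x z ^+ 2) by rewrite (le_trans h)// le_eqVlt; apply/orP; left; apply/eqP; ring.
by rewrite pmulr_rge0// subr_ge0.
Qed.

Lemma compact_enorm_bounded {R : realType} {n : nat} (K : set 'rV[R]_n) : compact K ->
  exists L : R, 0 < L /\ forall x, K x -> enorm x < L.
Proof.
move=> /compact_bounded [M [_ HM]].
pose C := `|M| + 1.
have HC x : K x -> `|x| <= C.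
  by move=> Kx; apply: (HM C) => //; rewrite /C (le_lt_trans (ler_norm _))// ltrDl.
have C0 : 0 < C by rewrite /C ltr_wpDl.
exists (n%:R * (C + 1) + 1); split.
  by rewrite ltr_wpDl// mulr_ge0// ltW// addr_gt0.
move=> x /HC xC; apply: (@le_lt_trans _ _ (n%:R * (C + 1))); last by rewrite ltrDl.
apply: enorm_le_sum => i.
have : ball (0 : 'rV[R]_n) (C + 1) x by rewrite -ball_normE /ball_/= sub0r normrN (le_lt_trans xC)// ltrDl.
by move=> -[_ /(_ 0 i)]; rewrite /ball/= mxE sub0r normrN => /ltW.
Qed.

Section lines_through_compact.
Context {R : realType} {n : nat}.
Variables (K : set 'rV[R]_(1 + n)) (L : R).
Hypotheses (L0 : 0 < L) (KL : forall x, K x -> enorm x < L) (clK : closed K).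
Local Notation mu := (@lebesgue_measure R).
Implicit Types (v y : 'rV[R]_(1 + n)).

(* The part of the line [y + R v] close enough to the origin to meet [K] is
   parametrized by [0 <= t < 1] as [chord_base v y + t *: chord v]. *)
Definition chord v : 'rV[R]_(1 + n) := (2 * L) *: v.
Definition chord_base v y : 'rV[R]_(1 + n) := y - L *: v.
Definition chord_times v y : set R := [set t | K (chord_base v y + t *: chord v)].

Lemma chordE v y t : chord_base v y + t *: chord v = y + (t * (2 * L) - L) *: v.
Proof. by rewrite /chord_base /chord scalerA scalerBl addrA addrAC. Qed.

Lemma dot_unit_le v x : dot v v = 1 -> `|dot v x| <= enorm x.
Proof.
move=> vv; rewrite -sqrtr_sqr /enorm ler_sqrt ?dot_ge0//.
by have := dot_cauchy_schwarz v x; rewrite vv mul1r.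
Qed.

Lemma chord_times01 v y t : dot v v = 1 -> dot v y = 0 -> chord_times v y t -> `[0, 1[%classic t.
Proof.
move=> vv vy; rewrite /chord_times/= chordE => Kt.
have := le_lt_trans (dot_unit_le _ vv) (KL Kt).
rewrite dotDr vy add0r dotZr vv mulr1 ltr_norml => /andP[h1 h2].
rewrite in_itv/=; apply/andP; split; nra.
Qed.

Lemma closed_chord_times v y : closed (chord_times v y).
Proof.
apply: (@closed_comp _ _ (fun t : R => chord_base v y + t *: chord v)) => // t _.
by apply: cvgD; [exact: cvg_cst | apply: cvgZr_tmp; exact: cvg_id].
Qed.

Lemma counting_line {dO : measure_display} {Omega : measurableType dO} {P : probability Omega R}
    (X : 'rV[R]_(1 + n) -> {RV P >-> R}) (u : R) v y w : dot v v = 1 -> dot v y = 0 ->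
  counting (level_set X u K w `&` line v y) =
  level_count X u (chord v) (chord_times v y) (chord_base v y) w :> \bar R.
Proof.
move=> vv vy; have L20 : 2 * L != 0 by rewrite mulf_neq0 ?gt_eqF.
apply/eqP; rewrite eq_le; apply/andP; split.
(* Inverse of the parametrization of the chord: [dot v x] is the abscissa of [x] on the line, [y]
   being orthogonal to the unit vector [v]. *)
- apply: (counting_le_inj (phi := fun x => (dot v x + L) / (2 * L))).
    move=> _ _ /set_mem[_ [s _ <-]] /set_mem[_ [t _ <-]] /(divIf L20) /addIr.
    by rewrite !dotDr !dotZr vv !mulr1 => /addrI ->.
  move=> x [[Kx Xx] [s _ e]]; rewrite -e in Kx Xx *.
  have E : chord_base v y + ((dot v (y + s *: v) + L) / (2 * L)) *: chord v = y + s *: v.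
    by rewrite chordE divfK// addrK dotDr vy add0r dotZr vv mulr1.
  have ct : chord_times v y ((dot v (y + s *: v) + L) / (2 * L)) by rewrite /chord_times/= E.
  by split; [split; [exact: (chord_times01 vv vy ct)|]|rewrite /level_times/= E].
- apply: (counting_le_inj (phi := fun t => chord_base v y + t *: chord v)).
    move=> s t _ _; rewrite !chordE => /(congr1 (dot v)).
    by rewrite !dotDr !dotZr vv !mulr1 => /addrI /addIr /(mulIf L20).
  move=> t [[t01 ct] h]; split; first by split.
  by rewrite chordE; exists (t * (2 * L) - L).
Qed.

Lemma refl_row_mx v (t : R) (z : 'rV[R]_n) : dot v v = 1 ->
  refl v (row_mx t%:M z) = hyper_param v z + t *: v.
Proof.
move=> vv; rewrite /hyper_param.
have -> : row_mx t%:M z = row_mx 0%:M z + t *: e0 :> 'rV[R]_(1 + n).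
  rewrite /e0 scale_row_mx add_row_mx scaler0 addr0; congr row_mx.
  by apply/matrixP => i j; rewrite !mxE; case: eqP => _; rewrite ?mulr1n ?mulr0n ?mulr1 ?mulr0 ?add0r.
suff -> : refl v (row_mx 0%:M z + t *: e0) = refl v (row_mx 0%:M z) + t *: refl v e0 by rewrite refl_e0.
by rewrite /refl dotDr dotZr; apply/rowP => i; rewrite !mxE; ring.
Qed.

Lemma measurable_K : measurable K. Proof. exact: closed_measurable_rV. Qed.

(** Fubini's theorem in the orthonormal frame reflected onto [v], which [leb_isometry] allows. The
    factor [2 * L], the speed of the parametrization, turns chord times into lengths. *)
Lemma integral_chord_times v : dot v v = 1 ->
  measurable_fun [set: 'rV[R]_n]
    (fun z => mu (`[0%R, 1%R[%classic `&` chord_times v (hyper_param v z)) * (2 * L)%:E)%E /\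
  (\int[leb n]_z (mu (`[0%R, 1%R[%classic `&` chord_times v (hyper_param v z)) * (2 * L)%:E) =
   leb n.+1 K)%E.
Proof.
move=> vv; have mK := measurable_K.
have mr : measurable_fun [set: 'rV[R]_(1 + n)] (refl v).
  by apply: (measurable_refl (f := fun=> v) (g := id)); [exact: measurable_cst|exact: measurable_id].
have mrK : measurable (refl v @^-1` K) by rewrite -[X in measurable X]setTI; exact: mr.
have imE : refl v @` K = refl v @^-1` K.
  apply/seteqP; split=> [_ [x Kx <-]|x Kx]; first by rewrite /preimage/= reflK.
  by exists (refl v x) => //; rewrite reflK.
pose h (x : 'rV[R]_(1 + n)) : \bar R := (\1_K (refl v x))%:E.
have mh : measurable_fun [set: 'rV[R]_(1 + n)] h.
  by apply/measurable_EFinP; apply: (measurableT_comp (measurable_indic mK)).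
have h0 x : (0 <= h x)%E by rewrite lee_fin.
have lebKE : leb n.+1 K = (\int[leb n.+1]_x h x)%E.
  rewrite -(leb_isometry (enorm_refl v) mK) ?imE//; apply/esym.
  transitivity (leb n.+1 ((refl v @^-1` K) `&` setT)); first exact: (integral_indic (leb n.+1) measurableT mrK).
  by rewrite setIT.
pose h2 (p : measurableTypeR R * 'rV[R]_n) : \bar R := h (row_mx p.1%:M p.2).
have mh2 : measurable_fun setT h2 by exact: (measurableT_comp mh (@measurable_row_mx R n)).
suff E z : (mu (`[0%R, 1%R[%classic `&` chord_times v (hyper_param v z)) * (2 * L)%:E =
    \int[mu]_x h2 (x, z))%E.
  split.
    rewrite (_ : (fun _ => _) = fubini_G mu h2); last by apply/funext => z; rewrite E.
    exact: (@measurable_fun_fubini_tonelli_G _ _ _ _ R mu h2 mh2 (fun p => h0 _)).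
  rewrite lebKE (integral_lebS mh h0).
  rewrite (@fubini_tonelli _ _ _ _ R mu (leb n) h2 mh2 (fun p => h0 _)).
  by apply: eq_integral => z _; exact: E.
rewrite /h2 /h /=.
have vz : dot v (hyper_param v z) = 0 by exact: hyper_param_orth.
pose g (x : R) : \bar R := (\1_K (hyper_param v z + x *: v))%:E.
have mg : measurable_fun [set: R] g.
  apply/measurable_EFinP; apply: (measurableT_comp (measurable_indic mK)).
  by apply: measurable_line; [exact: measurable_cst..|exact: measurable_id].
have g0 x : (0 <= g x)%E by rewrite lee_fin.
transitivity (\int[mu]_x g x)%E; last by apply: eq_integral => x _; rewrite /g refl_row_mx.
have L20 : 0 < 2 * L by rewrite mulr_gt0.
have mgs : measurable_fun [set: R] (fun x : R => g (x - L)).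
  by apply: (measurableT_comp mg); apply: measurable_funB; [exact: measurable_id|exact: measurable_cst].
have E := ge0_integral_scale1 L20 mgs (fun x => g0 _).
have E2 := ge0_integral_shift1 (- L) mg g0.
rewrite E2 in E.
transitivity ((\int[mu]_s g (2 * L * s - L)%R) * (2 * L)%:E)%E; last first.
  by rewrite E muleC muleA -EFinM divff ?gt_eqF// mul1e.
congr (_ * _)%E.
have mct : measurable (`[0, 1[%classic `&` chord_times v (hyper_param v z)).
  apply: measurableI; first exact: measurable_itv.
  by apply: closed_measurable; exact: closed_chord_times.
transitivity (mu ((`[0%R, 1%R[%classic `&` chord_times v (hyper_param v z)) `&` setT)); first by rewrite setIT.
rewrite -(integral_indic mu measurableT mct).
apply: eq_integral => s _; rewrite /g !indicE.
suff -> : (s \in `[0, 1[%classic `&` chord_times v (hyper_param v z)) =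
  (hyper_param v z + (2 * L * s - L) *: v \in K) by [].
apply/idP/idP; rewrite !inE /chord_times/= chordE (mulrC _ s); first by case.
by move=> Ks; split => //; apply: (@chord_times01 v _ s vv vz); rewrite /chord_times/= chordE.
Qed.

End lines_through_compact.

(** * Mean integral geometric measure *)

Lemma Gamma_half_gt0 {R : realType} (n : nat) : 0 < @Gamma R (n.+2%:R / 2).
Proof.
have := @gauss_radial_moment_gt0 R n.+1.
by rewrite gauss_radial_moment lte_fin pmulr_rgt0// powR_gt0.
Qed.

Lemma igm_const_gt0 {R : realType} (n : nat) : 0 < @igm_const R n.+1.
Proof.
rewrite /igm_const divr_gt0//; first exact: Gamma_half_gt0.
by rewrite mulr_gt0// powR_gt0// pi_gt0.
Qed.

Section expected_measure.
Context {R : realType} {n : nat} {dO : measure_display} {Omega : measurableType dO}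
  {P : probability Omega R} {X : 'rV[R]_(1 + n) -> {RV P >-> R}} {F : probability 'rV[R]_(1 + n) R}.
Hypotheses (hgauss : gaussian_field X) (hcent : centered_field X) (hF : spectral_measure X F)
  (hcont : continuous_paths X) (hstat : stationary_field X).
Variables (u : R) (K : set 'rV[R]_(1 + n)) (L : R).
Hypotheses (L0 : 0 < L) (KL : forall x, K x -> enorm x < L) (clK : closed K).
Local Notation mu := (@lebesgue_measure R).
Local Notation rho v := (@level_rate R (1 + n) F u v).
Local Notation igm w := (integral_geometric_measure (n := n) (level_set X u K w)).
Local Notation c := (@igm_const R n.+1).

Definition chord_count (v y : 'rV[R]_(1 + n)) (w : Omega) : \bar R :=
  level_count X u (chord L v) (chord_times K L v y) (chord_base L v y) w.

Lemma chord_count_ge0 v y w : (0 <= chord_count v y w)%E.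
Proof. exact: counting_ge0. Qed.

Lemma measurable_chord_count d (T : measurableType d) (v y : T -> 'rV[R]_(1 + n)) (b : T -> Omega) :
  measurable_fun setT v -> measurable_fun setT y -> measurable_fun setT b ->
  measurable_fun setT (fun p => chord_count (v p) (y p) (b p)).
Proof.
move=> mv my mb; have [f [cf f0 fK]] := closed_zero_set clK.
have mch r (z : T -> 'rV[R]_(1 + n)) : measurable_fun setT z ->
    measurable_fun setT (fun p => z p + r *: v p).
  by move=> mz; apply: measurable_line => //; exact: measurable_cst.
have mbase : measurable_fun setT (fun p => chord_base L (v p) (y p)).
  by rewrite /chord_base; under eq_fun do rewrite -scaleNr; exact: mch.
apply: (measurable_level_count_param hcont u
  (f := fun p t => f (chord_base L (v p) (y p) + t *: chord L (v p)))) => //.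
- by apply: (measurableT_comp (measurable_scale _)).
- move=> t; apply: (measurableT_comp (continuous_measurable_M cf)).
  by rewrite /chord; under eq_fun do rewrite scalerA; exact: mch.
- move=> p t; apply: (@continuous_comp _ _ _ (fun t : R => chord_base L (v p) (y p) + t *: chord L (v p)) f); last exact: cf.
  by apply: cvgD; [exact: cvg_cst | apply: cvgZr_tmp; exact: cvg_id].
Qed.

Let J (p : Omega * 'rV[R]_(1 + n) * 'rV[R]_n) : \bar R :=
  chord_count p.1.2 (hyper_param p.1.2 p.2) p.1.1.

Let J0 p : (0 <= J p)%E. Proof. exact: chord_count_ge0. Qed.

Let measurable_J d (T : measurableType d) (b : T -> Omega) (v : T -> 'rV[R]_(1 + n)) (z : T -> 'rV[R]_n) :
  measurable_fun setT b -> measurable_fun setT v -> measurable_fun setT z ->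
  measurable_fun setT (fun p => J (b p, v p, z p)).
Proof.
move=> mb mv mz; apply: measurable_chord_count => //.
exact: measurable_hyper_param.
Qed.

Lemma igm_chord_count w : igm w =
  (c%:E * \int[@sphere_measure R n]_(v in @sphere R n) \int[leb n]_z J (w, v, z))%E.
Proof.
rewrite /integral_geometric_measure; congr (_ * _)%E.
apply: eq_integral_on => v /set_mem /enorm_eq1 vv.
rewrite (@eq_integral_on _ _ _ (hausdorff n (n := n.+1)) (orth_hyperplane v) _ (fun y => chord_count v y w)); last first.
  by move=> y /set_mem vy; exact: (counting_line L0 KL).
rewrite integral_orth_hyperplane//.
by apply: measurable_chord_count; [exact: measurable_cst|exact: measurable_id|exact: measurable_cst].
Qed.

Definition mean_chord_count v : \bar R := (\int[leb n]_z \int[P]_w J (w, v, z))%E.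

Lemma mean_chord_count_ge0 v : (0 <= mean_chord_count v)%E.
Proof. by apply: integral_ge0 => z _; apply: integral_ge0 => w _; exact: J0. Qed.

Let mJT : measurable_fun setT (fun p : 'rV[R]_(1 + n) * 'rV[R]_n * Omega => J (p.2, p.1.1, p.1.2)).
Proof.
by apply: measurable_J; [exact: measurable_snd|exact: (measurableT_comp measurable_fst measurable_fst)|exact: (measurableT_comp measurable_snd measurable_fst)].
Qed.

Lemma measurable_mean_chord_count : measurable_fun setT mean_chord_count.
Proof.
have m1 := @measurable_fun_fubini_tonelli_F _ _ _ _ R P _ mJT (fun p => J0 _).
exact: (@measurable_fun_fubini_tonelli_F _ _ _ _ R (leb n) _ m1
  (fun p => integral_ge0 _ (fun w _ => J0 _))).
Qed.

(** Tonelli's theorem is applied in each hemisphere chart, where [sphere_measure] becomes a density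
    against [leb n]. *)
Lemma integral_igm : (\int[P]_w igm w =
  c%:E * \int[@sphere_measure R n]_(v in @sphere R n) mean_chord_count v)%E.
Proof.
pose half s w : \bar R := (\int[leb n]_y (\int[leb n]_z J (w, sphere_chart s y, z) * (sphere_density y)%:E))%E.
have mJz w : measurable_fun setT (fun v => \int[leb n]_z J (w, v, z))%E.
  have mw : measurable_fun setT (fun p : 'rV[R]_(1 + n) * 'rV[R]_n => J (w, p.1, p.2)).
    by apply: measurable_J; [exact: measurable_cst|exact: measurable_fst|exact: measurable_snd].
  exact: (@measurable_fun_fubini_tonelli_F _ _ _ _ R (leb n) _ mw (fun p => J0 _)).
have Jz0 w v : (0 <= \int[leb n]_z J (w, v, z))%E by apply: integral_ge0 => z _; exact: J0.
have E w : igm w = (c%:E * (half 1%R w + half (-1)%R w))%E.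
  by rewrite igm_chord_count (integral_sphere (mJz w) (Jz0 w)).
pose G s (p : Omega * 'rV[R]_n * 'rV[R]_n) : \bar R :=
  (J (p.1.1, sphere_chart s p.1.2, p.2) * (sphere_density p.1.2)%:E)%E.
have sd0 (y : 'rV[R]_n) : (0 <= (sphere_density y)%:E :> \bar R)%E by rewrite lee_fin sphere_density_ge0.
have G0 s p : (0 <= G s p)%E by rewrite mule_ge0// J0.
have mG s : measurable_fun setT (G s).
  apply: emeasurable_funM.
    apply: measurable_J; [exact: (measurableT_comp measurable_fst measurable_fst)| |exact: measurable_snd].
    by apply: (measurableT_comp (measurable_sphere_chart s)); exact: (measurableT_comp measurable_snd measurable_fst).
  apply/measurable_EFinP; apply: (measurableT_comp measurable_sphere_density).
  exact: (measurableT_comp measurable_snd measurable_fst).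
have mJ1 w v : measurable_fun setT (fun z => J (w, v, z)).
  by apply: measurable_J; [exact: measurable_cst..|exact: measurable_id].
have halfE s w : half s w = (\int[leb n]_y \int[leb n]_z G s (w, y, z))%E.
  apply: eq_integral => y _; apply/esym.
  exact: (ge0_integralZr (leb n) measurableT (mJ1 w (sphere_chart s y)) (fun z _ => J0 _) (sd0 y)).
have half0 s w : (0 <= half s w)%E.
  by rewrite halfE; apply: integral_ge0 => y _; apply: integral_ge0 => z _.
have mhalf s : measurable_fun setT (half s).
  rewrite (_ : half s = fun w => (\int[leb n]_y \int[leb n]_z G s (w, y, z))%E); last first.
    by apply/funext => w; exact: halfE.
  have m1 := @measurable_fun_fubini_tonelli_F _ _ _ _ R (leb n) _ (mG s) (G0 s).
  exact: (@measurable_fun_fubini_tonelli_F _ _ _ _ R (leb n) _ m1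
    (fun p => integral_ge0 _ (fun w _ => G0 _ _))).
have int_half s : (\int[P]_w half s w =
    \int[leb n]_y (mean_chord_count (sphere_chart s y) * (sphere_density y)%:E))%E.
  transitivity (\int[P]_w \int[leb n]_y \int[leb n]_z G s (w, y, z))%E.
    by apply: eq_integral => w _; exact: halfE.
  rewrite (fubini_tonelli3 P (leb n) (leb n) (mG s) (G0 s)).
  apply: eq_integral => y _.
  have m2 : measurable_fun setT (fun p : 'rV[R]_n * Omega => J (p.2, sphere_chart s y, p.1)).
    by apply: measurable_J; [exact: measurable_snd|exact: measurable_cst|exact: measurable_fst].
  have m3 := @measurable_fun_fubini_tonelli_F _ _ _ _ R P _ m2 (fun p => J0 _).
  transitivity (\int[leb n]_z (\int[P]_w J (w, sphere_chart s y, z) * (sphere_density y)%:E))%E; last first.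
    exact: (ge0_integralZr (leb n) measurableT m3 (fun z _ => integral_ge0 _ (fun w _ => J0 _)) (sd0 y)).
  apply: eq_integral => z _.
  have m4 : measurable_fun setT (fun w => J (w, sphere_chart s y, z)).
    by apply: measurable_J; [exact: measurable_id|exact: measurable_cst..].
  exact: (ge0_integralZr P measurableT m4 (fun w _ => J0 _) (sd0 y)).
transitivity (\int[P]_w (c%:E * (half 1%R w + half (-1)%R w)))%E.
  by apply: eq_integral => w _; exact: E.
rewrite ge0_integralZl//; last 3 first.
- by apply: emeasurable_funD.
- by move=> w _; rewrite adde_ge0.
- by rewrite lee_fin ltW// igm_const_gt0.
congr (_ * _)%E; rewrite (integral_sphere measurable_mean_chord_count mean_chord_count_ge0).
transitivity (\int[P]_w half 1%R w + \int[P]_w half (-1)%R w)%E.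
  apply: ge0_integralD => //; exact: measurableT.
exact: (f_equal2 adde (int_half 1) (int_half (-1))).
Qed.

(** The rate along [chord L v] is [2 * L] times that along [v]; multiplied by the measure of the
    chord times it gives the rate times the length cut by [K], and these lengths add up to the
    volume. *)
Lemma mean_chord_count_ge v : dot v v = 1 -> (rho v * leb n.+1 K <= mean_chord_count v)%E.
Proof.
move=> vv; have [mc ic] := integral_chord_times L0 KL clK vv.
have m0 z : (0 <= mu (`[0%R, 1%R[%classic `&` chord_times K L v (hyper_param v z)) * (2 * L)%:E)%E.
  by rewrite mule_ge0// lee_fin mulr_ge0// ltW.
rewrite -ic muleC -(ge0_integralZr (leb n) measurableT mc (fun z _ => m0 z) (level_rate_ge0 F u v)).
apply: ge0_le_integral => //.
- by move=> z _; rewrite mule_ge0// level_rate_ge0.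
- by apply: emeasurable_funM => //; exact: measurable_cst.
- have m2 : measurable_fun setT (fun p : 'rV[R]_n * Omega => J (p.2, v, p.1)).
    by apply: measurable_J; [exact: measurable_snd|exact: measurable_cst|exact: measurable_fst].
  exact: (@measurable_fun_fubini_tonelli_F _ _ _ _ R P _ m2 (fun p => J0 _)).
move=> z _; rewrite -muleA -level_rate_scale ?mulr_gt0//.
have H := level_count_ge hgauss hcent hF hcont hstat u (chord L v)
  (@closed_chord_times R n K L clK v (hyper_param v z)) (chord_base L v (hyper_param v z)).
exact: H.
Qed.

Lemma mean_chord_count_fin v : dot v v = 1 -> (rho v < +oo)%E ->
  mean_chord_count v = (rho v * leb n.+1 K)%E.
Proof.
move=> vv rfin; apply/eqP; rewrite eq_le mean_chord_count_ge// andbT.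
have [mc ic] := integral_chord_times L0 KL clK vv.
have m0 z : (0 <= mu (`[0%R, 1%R[%classic `&` chord_times K L v (hyper_param v z)) * (2 * L)%:E)%E.
  by rewrite mule_ge0// lee_fin mulr_ge0// ltW.
rewrite -ic muleC -(ge0_integralZr (leb n) measurableT mc (fun z _ => m0 z) (level_rate_ge0 F u v)).
apply: ge0_le_integral => //.
- by move=> z _; apply: integral_ge0 => w _; exact: J0.
- have m2 : measurable_fun setT (fun p : 'rV[R]_n * Omega => J (p.2, v, p.1)).
    by apply: measurable_J; [exact: measurable_snd|exact: measurable_cst|exact: measurable_fst].
  exact: (@measurable_fun_fubini_tonelli_F _ _ _ _ R P _ m2 (fun p => J0 _)).
- by apply: emeasurable_funM => //; exact: measurable_cst.
move=> z _; rewrite -muleA -level_rate_scale ?mulr_gt0//.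
have H := level_count_le hgauss hcent hF hcont hstat (u := u) (v := chord L v)
  (@closed_chord_times R n K L clK v (hyper_param v z)) (chord_base L v (hyper_param v z)).
have rc : (rho (chord L v) < +oo)%E.
  rewrite level_rate_scale; last by rewrite mulr_gt0.
  by apply: lte_mul_pinfty rfin; rewrite ?lee_fin ?mulr_ge0// ltW.
exact: (H rc).
Qed.

End expected_measure.

(** * Second spectral moments *)

Section spectral_form_theory.
Context {R : realType} {n : nat} (F : probability 'rV[R]_n R).
Local Notation sform := (@spectral_form R n F).

Lemma measurable_spectral_form : measurable_fun setT sform.
Proof.
pose h (p : 'rV[R]_n * 'rV[R]_n) : \bar R := (dot p.2 p.1 ^+ 2)%:E.
have mh : measurable_fun setT h.
  apply/measurable_EFinP; apply: measurable_funX; apply: measurable_dot; [exact: measurable_snd|exact: measurable_fst].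
have h0 p : (0 <= h p)%E by rewrite lee_fin sqr_ge0.
exact: (@measurable_fun_fubini_tonelli_F _ _ _ _ R F h mh h0).
Qed.

Let mcoord2 i j : measurable_fun setT (fun l : 'rV[R]_n => l 0 i * l 0 j).
Proof. by apply: measurable_funM; exact: measurable_rV_coord. Qed.

Let sq_ge0 (i : 'I_n) (l : 'rV[R]_n) : (0 <= (l 0 i * l 0 i)%:E :> \bar R)%E.
Proof. by rewrite lee_fin -expr2 sqr_ge0. Qed.

Hypothesis fin : forall i, (\int[F]_l (l 0 i * l 0 i)%:E < +oo)%E.

Lemma integrable_spectral_entry i j : F.-integrable setT (fun l : 'rV[R]_n => (l 0 i * l 0 j)%:E).
Proof.
have mE k : measurable_fun setT (fun l : 'rV[R]_n => (l 0 k * l 0 k)%:E : \bar R) by exact/measurable_EFinP.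
apply: (@le_integrable _ _ _ F setT measurableT _ (fun l : 'rV[R]_n => (l 0 i * l 0 i)%:E + (l 0 j * l 0 j)%:E)%E).
- exact/measurable_EFinP.
- move=> l _; rewrite -EFinD !abse_EFin lee_fin normrM [leRHS]ger0_norm; last by rewrite addr_ge0// -expr2 sqr_ge0.
  rewrite -!expr2 -(real_normK (num_real (l 0 i))) -(real_normK (num_real (l 0 j))).
  by move: (normr_ge0 (l 0 i)) (normr_ge0 (l 0 j)); move: `|l 0 i| `|l 0 j| => a b a0 b0; nra.
- apply/integrableP; split; first by apply: emeasurable_funD.
  under eq_integral do rewrite gee0_abs ?adde_ge0//.
  by rewrite ge0_integralD// lte_add_pinfty.
Qed.

Lemma spectral_form_quadratic z :
  sform z = ((z *m map_mx fine (spectral_moment2 F) *m z^T) 0 0)%:E.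
Proof.
have E l : (dot l z ^+ 2)%:E = (\sum_(p : 'I_n * 'I_n) (z 0 p.1 * z 0 p.2)%:E * (l 0 p.1 * l 0 p.2)%:E)%E :> \bar R.
  under eq_bigr do rewrite -EFinM.
  rewrite sumEFin expr2 /dot big_distrlr/= pair_bigA; congr EFin.
  by apply: eq_bigr => p _ /=; ring.
rewrite /spectral_form; under eq_integral do rewrite E.
rewrite integral_sum//; last by move=> p; apply: integrableZl => //; exact: integrable_spectral_entry.
transitivity (\sum_(p : 'I_n * 'I_n) (z 0 p.1 * z 0 p.2 * fine (spectral_moment2 F p.1 p.2))%:E)%E.
  apply: eq_bigr => p _; rewrite integralZl//; last exact: integrable_spectral_entry.
  rewrite [in RHS]EFinM [spectral_moment2 F p.1 p.2]mxE fineK//.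
  exact: integrable_fin_num (integrable_spectral_entry _ _).
rewrite sumEFin; congr EFin.
rewrite -(pair_bigA _ (fun i j => z 0 i * z 0 j * fine (spectral_moment2 F i j)))/= exchange_big/= mxE.
apply: eq_bigr => j _; rewrite [X in _ = X * _]mxE [z^T j 0]mxE mulr_suml; apply: eq_bigr => i _.
by rewrite [map_mx _ _ _ _]mxE; ring.
Qed.

Lemma spectral_form_le z :
  (sform z <= (\sum_i \int[F]_l (l 0 i * l 0 i)%:E) * (dot z z)%:E)%E.
Proof.
have mE k : measurable_fun setT (fun l : 'rV[R]_n => (l 0 k * l 0 k)%:E : \bar R) by exact/measurable_EFinP.
rewrite -(ge0_integral_sum F measurableT mE) => [|k l _]; last exact: sq_ge0.
rewrite -ge0_integralZr//; last 3 first.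
- exact: emeasurable_sum.
- by move=> l _; apply: sume_ge0.
- by rewrite lee_fin dot_ge0.
apply: ge0_le_integral => //.
- by move=> l _; rewrite lee_fin sqr_ge0.
- apply/measurable_EFinP; apply: measurable_funX; apply: measurable_dot; [exact: measurable_id|exact: measurable_cst].
- apply: emeasurable_funM; [exact: emeasurable_sum|exact: measurable_cst].
move=> l _; rewrite sumEFin -EFinM lee_fin.
exact: (dot_cauchy_schwarz l z).
Qed.

End spectral_form_theory.

(** An off-diagonal entry is dominated by the sum of two diagonal ones. *)
Lemma finite_spectral_moment2 {R : realType} {n : nat} (F : probability 'rV[R]_n R) :
  finite_mx (spectral_moment2 F) <-> forall i, (\int[F]_l (l 0 i * l 0 i)%:E < +oo)%E.
Proof.
split=> [/forallP H i|H].
  by have /forallP/(_ i) := H i; rewrite mxE => /fin_numPlt/andP[].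
apply/forallP => i; apply/forallP => j; rewrite mxE.
exact: integrable_fin_num (integrable_spectral_entry H i j).
Qed.

(** Half of the Gaussian exponent is kept in reserve to absorb the linear growth of the square root
    of the spectral form. *)
Lemma integral_gauss_quarter_fin {R : realType} (n : nat) :
  (\int[@leb R n]_z (expR (- (dot z z / 4)))%:E < +oo)%E.
Proof.
have one : (\int[@lebesgue_measure R]_x (expR (- (x * x / 4)))%:E < +oo)%E.
  have s0 : Num.sqrt 2 != 0 :> R by rewrite gt_eqF// sqrtr_gt0.
  have p0 := @normal_peak_gt0 R (Num.sqrt 2) s0.
  have E x : (expR (- (x * x / 4)))%:E = ((normal_peak (Num.sqrt 2))^-1%:E * (normal_pdf 0 (Num.sqrt 2) x)%:E)%E :> \bar R.
    rewrite normal_pdfE// -EFinM mulKf ?gt_eqF// /normal_fun subr0 sqr_sqrtr//.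
    by congr (expR _)%:E; rewrite -expr2; field.
  under eq_integral do rewrite E.
  rewrite ge0_integralZl//; last 3 first.
  - by apply/measurable_EFinP; exact: measurable_normal_pdf.
  - by move=> x _; rewrite lee_fin normal_pdf_ge0.
  - by rewrite lee_fin invr_ge0 ltW.
  by rewrite integral_normal_pdf mule1 ltry.
elim: n => [|n ih]; first by rewrite integral_leb0 ltry.
have mg k : measurable_fun setT (fun z : 'rV[R]_k => (expR (- (dot z z / 4)))%:E : \bar R).
  apply/measurable_EFinP; apply: (measurableT_comp (@measurable_expR R)).
  apply: measurable_funN; apply: measurable_funM; last exact: measurable_cst.
  by apply: measurable_dot; exact: measurable_id.
rewrite (integral_lebS (mg (1 + n)%N)); last by move=> z; rewrite lee_fin expR_ge0.
have E x : (\int[leb n]_y (expR (- (dot (row_mx x%:M y : 'rV[R]_(1 + n)) (row_mx x%:M y) / 4)))%:E =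
    (expR (- (x * x / 4)))%:E * \int[leb n]_z (expR (- (dot z z / 4)))%:E)%E.
  rewrite -ge0_integralZl//.
    apply: eq_integral => y _; rewrite dot_row_mx -EFinM -expRD; congr (expR _)%:E.
    by rewrite mulrDl opprD.
under eq_integral do rewrite E.
rewrite ge0_integralZr//; last 2 first.
- apply/measurable_EFinP; apply: (measurableT_comp (@measurable_expR R)).
  by apply: measurable_funN; apply: measurable_funM; [apply: measurable_funM|exact: measurable_cst].
- by apply: integral_ge0 => z _; rewrite lee_fin expR_ge0.
apply: lte_mul_pinfty => //.
- by apply: integral_ge0 => x _; rewrite lee_fin expR_ge0.
- by rewrite ge0_fin_numE//; apply: integral_ge0 => x _; rewrite lee_fin expR_ge0.
Qed.

Section sphere_as_measure.
Context {R : realType} {n : nat}.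

(** Inside integrals the set function [sphere_measure] is exchanged for a genuine measure with the
    same values on Borel sets, to which linearity and monotonicity apply. *)
Lemma sphere_measure_is_measure : exists m : {measure set 'rV[R]_(1 + n) -> \bar R},
  forall f, (\int[@sphere_measure R n]_(v in @sphere R n) f v = \int[m]_(v in @sphere R n) f v)%E.
Proof.
exists (measure_add (chart_measure 1) (chart_measure (-1))) => f.
apply: eq_set_function_integral => A mA _; rewrite sphere_measureE//.
exact/esym/measure_addE.
Qed.

Lemma integral_sphereZr (f : 'rV[R]_(1 + n) -> \bar R) (k : \bar R) :
  measurable_fun setT f -> (forall v, (0 <= f v)%E) -> (0 <= k)%E ->
  (\int[@sphere_measure R n]_(v in @sphere R n) (f v * k) =
   \int[@sphere_measure R n]_(v in @sphere R n) f v * k)%E.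
Proof.
move=> mf f0 k0; have [m H] := sphere_measure_is_measure; rewrite !H.
rewrite ge0_integralZr//; first exact: measurable_sphere.
exact: measurable_funTS.
Qed.

Lemma le_integral_sphere (f g : 'rV[R]_(1 + n) -> \bar R) :
  measurable_fun setT f -> measurable_fun setT g ->
  (forall v, (0 <= f v)%E) -> (forall v, (0 <= g v)%E) ->
  (forall v, dot v v = 1 -> (f v <= g v)%E) ->
  (\int[@sphere_measure R n]_(v in @sphere R n) f v <=
   \int[@sphere_measure R n]_(v in @sphere R n) g v)%E.
Proof.
move=> mf mg f0 g0 fg; have [m H] := sphere_measure_is_measure; rewrite !H.
apply: ge0_le_integral => //.
- exact: measurable_sphere.
- exact: measurable_funTS.
- exact: measurable_funTS.
- by move=> v /enorm_eq1; exact: fg.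
Qed.

End sphere_as_measure.

Lemma measurable_sqrte {R : realType} d (T : measurableType d) (f : T -> \bar R) :
  measurable_fun setT f -> (forall x, (0 <= f x)%E) -> measurable_fun setT (fun x => sqrte (f x)).
Proof.
move=> mf f0; rewrite (_ : (fun _ => _) = (fun x => (f x `^ 2^-1)%E)); last first.
  by apply/funext => x; rewrite poweR12_sqrt.
exact: (measurableT_comp (measurable_poweR _) mf).
Qed.

Lemma eq_lee {R : realType} (x y : \bar R) : x = y -> (x <= y)%E.
Proof. by move=> ->. Qed.

Section infinite_spectral_moment.
Context {R : realType} {n : nat} (F : probability 'rV[R]_(1 + n) R).
Local Notation sform := (@spectral_form R (1 + n) F).

Definition spectral_sphere : \bar R :=
  (\int[@sphere_measure R n]_(v in @sphere R n) sqrte (sform v))%E.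

Lemma measurable_sqrte_form : measurable_fun setT (fun v => sqrte (sform v)).
Proof. by apply: measurable_sqrte; [exact: measurable_spectral_form|exact: spectral_form_ge0]. Qed.

Lemma spectral_sphere_polar :
  (\int[leb n.+1]_z ((gauss_radial (enorm z))%:E * sqrte (sform z)) =
   (2 `^ (n%:R / 2) * Gamma (n.+2%:R / 2))%:E * spectral_sphere)%E.
Proof.
rewrite -gauss_radial_moment; apply: polar.
- exact: measurable_sqrte_form.
- by move=> z; exact: sqrte_ge0.
- by move=> r z r0; rewrite spectral_form_scale sqrteZ// spectral_form_ge0.
Qed.

Let G z : \bar R := ((gauss_radial (enorm z))%:E * sqrte (sform z))%E.

Let G0 z : (0 <= G z)%E.
Proof. by rewrite mule_ge0 ?sqrte_ge0// lee_fin expR_ge0. Qed.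

Let mG : measurable_fun setT G.
Proof.
apply: emeasurable_funM; last exact: measurable_sqrte_form.
apply/measurable_EFinP; apply: (measurableT_comp (@measurable_expR R)).
apply: measurable_funN; apply: measurable_funM; last exact: measurable_cst.
by under eq_fun do rewrite sqr_enorm; apply: measurable_dot; exact: measurable_id.
Qed.

Lemma gauss_spectral_form_fin : (forall i, (\int[F]_l (l 0 i * l 0 i)%:E < +oo)%E) ->
  (\int[leb n.+1]_z G z < +oo)%E.
Proof.
move=> fin; pose tr := (\sum_i \int[F]_l (l 0%R i * l 0%R i)%:E)%E.
have tr0 : (0 <= tr)%E.
  by apply: sume_ge0 => i _; apply: integral_ge0 => l _; rewrite lee_fin -expr2 sqr_ge0.
have trf : tr \is a fin_num.
  rewrite ge0_fin_numE//; apply: lte_sum_pinfty => i _; exact: fin.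
apply: (@le_lt_trans _ _ (\int[leb n.+1]_z ((Num.sqrt (fine tr))%:E * (expR (- (dot z z / 4)))%:E))%E).
  have me : measurable_fun setT (fun z : 'rV[R]_(1 + n) => (expR (- (dot z z / 4)))%:E : \bar R).
    apply/measurable_EFinP; apply: (measurableT_comp (@measurable_expR R)).
    apply: measurable_funN; apply: measurable_funM; last exact: measurable_cst.
    by apply: measurable_dot; exact: measurable_id.
  apply: ge0_le_integral => //.
  - by apply: emeasurable_funM; first exact: measurable_cst.
  move=> z _; rewrite /G.
  have : (sqrte (sform z) <= (Num.sqrt (fine tr) * enorm z)%:E)%E.
    rewrite /enorm -sqrtrM ?fine_ge0//.
    have -> : (Num.sqrt (fine tr * dot z z))%:E = sqrte (fine tr * dot z z)%:E by [].
    rewrite lee_sqrt ?lee_fin ?mulr_ge0 ?fine_ge0 ?dot_ge0// EFinM fineK//.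
    exact: spectral_form_le.
  move=> h; apply: (@le_trans _ _ ((gauss_radial (enorm z))%:E * (Num.sqrt (fine tr) * enorm z)%:E)%E).
    by rewrite lee_wpmul2l// lee_fin expR_ge0.
  rewrite -!EFinM lee_fin mulrCA ler_wpM2l ?sqrtr_ge0//.
  rewrite /gauss_radial -sqr_enorm; set r := enorm z.
  have -> : - (r ^+ 2 / 2) = - (r ^+ 2 / 4) - r ^+ 2 / 4 by field.
  rewrite expRD -mulrA ler_piMr ?expR_ge0// expRN mulrC ler_pdivrMr ?expR_gt0// mul1r.
  (* [r <= 1 + r ^ 2 / 4 <= exp (r ^ 2 / 4)], the first inequality being that [(r - 2) ^ 2] is
     nonnegative. *)
  apply: (le_trans _ (expR_ge1Dx _)); have := sqr_ge0 (r - 2); lra.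
rewrite ge0_integralZl//; last first.
- apply/measurable_EFinP; apply: (measurableT_comp (@measurable_expR R)).
  apply: measurable_funN; apply: measurable_funM; last exact: measurable_cst.
  by apply: measurable_dot; exact: measurable_id.
by rewrite lte_mul_pinfty// ?lee_fin ?sqrtr_ge0// integral_gauss_quarter_fin.
Qed.

Lemma spectral_form_delta i : sform (delta_mx 0 i) = (\int[F]_l (l 0%R i * l 0%R i)%:E)%E.
Proof.
apply: eq_integral => l _; rewrite expr2 (_ : dot l (delta_mx 0 i) = l 0 i)//.
by rewrite /dot (bigD1 i)//= big1 => [|j ji]; rewrite mxE ?eqxx ?(negbTE ji) ?andbF ?mulr1 ?mulr0 ?addr0.
Qed.

Lemma spectral_form_diff_fin z e : (sform z < +oo)%E -> (sform (z + e) < +oo)%E -> (sform e < +oo)%E.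
Proof.
move=> hz hze.
have mf x : measurable_fun setT (fun l : 'rV[R]_(1 + n) => (dot l x ^+ 2)%:E : \bar R).
  by apply/measurable_EFinP; apply: measurable_funX; apply: measurable_dot; [exact: measurable_id|exact: measurable_cst].
have p0 x (l : 'rV[R]_(1 + n)) : (0 <= (dot l x ^+ 2)%:E :> \bar R)%E by rewrite lee_fin sqr_ge0.
apply: (@le_lt_trans _ _ (\int[F]_l (2%:E * ((dot l z ^+ 2)%:E + (dot l (z + e) ^+ 2)%:E)))%E).
  apply: ge0_le_integral => //.
  - by apply: emeasurable_funM; [exact: measurable_cst|exact: emeasurable_funD].
  move=> l _; rewrite -EFinD -EFinM lee_fin dotDr.
  (* With [a = dot l z] and [b = dot l e], the difference of the two sides is [(2 a + b) ^ 2]. *)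
  have := sqr_ge0 (2 * dot l z + dot l e); move: (dot l z) (dot l e) => a b; nra.
rewrite ge0_integralZl//; last 2 first.
- exact: emeasurable_funD.
- by move=> l _; rewrite adde_ge0.
by rewrite ge0_integralD// lte_mul_pinfty// lte_add_pinfty.
Qed.

(** A finite integral would make the set [D] of infinite values null. But [z] and [z + delta_mx 0 i]
    cannot both have a finite form, their difference having an infinite one; so [D] and a translate
    of it cover a space of positive measure. *)
Lemma gauss_spectral_form_infinite i : (\int[F]_l (l 0%R i * l 0%R i)%:E = +oo)%E ->
  (\int[leb n.+1]_z G z = +oo)%E.
Proof.
move=> Di; apply/eqP; rewrite eq_le leey leNgt; apply/negP => Gfin.
have Gint : (leb n.+1).-integrable setT G.
  apply/integrableP; split => //.
  by under eq_integral do rewrite gee0_abs//.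
have := integrable_ae measurableT Gint.
pose D := [set z | sform z = +oo%E].
have mD : measurable D.
  by rewrite -[X in measurable X]setTI; exact: (measurable_spectral_form F measurableT (emeasurable_set1 +oo)).
move=> aeG.
have D0 : leb n.+1 D = 0%E.
  have [N [mN N0 DN]] := aeG.
  apply/eqP; rewrite eq_le measure_ge0 andbT -N0; apply: le_measure; rewrite ?inE//.
  by move=> z Dz; apply: DN => /(_ Logic.I); rewrite /G Dz /= gt0_muley ?lte_fin ?expR_gt0.
have cover : setT `<=` D `|` (fun z => z + delta_mx 0 i) @^-1` D.
  move=> z _; apply: contrapT => /not_orP[nz nze].
  have lt x : ~ D x -> (sform x < +oo)%E by move=> Dx; rewrite ltey; apply/eqP.
  have := spectral_form_diff_fin (lt _ nz) (lt _ nze).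
  by rewrite spectral_form_delta Di.
have mD' : measurable ((fun z => z + delta_mx 0 i) @^-1` D).
  by rewrite -[X in measurable X]setTI; exact: measurable_shift.
have T0 : leb n.+1 [set: 'rV[R]_(1 + n)] = 0%E.
  apply/eqP; rewrite eq_le measure_ge0 andbT.
  apply: (le_trans (le_measure (leb n.+1) _ _ cover)); rewrite ?inE//; first exact: measurableU.
  apply: (le_trans (measureU2 _ mD mD')).
  have D1 : leb n.+1 ((fun z => z + delta_mx 0 i) @^-1` D) = 0%E.
    by rewrite -[RHS]D0; exact: (leb_shift (delta_mx 0 i) mD).
  have h0 : (leb n.+1 D <= 0)%E by rewrite D0.
  by apply: (le_trans (leeD h0 (eq_lee D1))); rewrite adde0.
have : (leb n.+1 (@centered_cube R (1 + n) 0) <= leb n.+1 [set: 'rV[R]_(1 + n)])%E.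
  by apply: le_measure => //; rewrite inE//; exact: measurable_centered_cube.
by rewrite T0 leb_centered_cube lee_fin leNgt exprn_gt0// exprn_gt0.
Qed.

End infinite_spectral_moment.

(** * The formula *)

Lemma leb_bounded_fin {R : realType} {n : nat} (K : set 'rV[R]_n) (L : R) :
  measurable K -> (forall x, K x -> enorm x < L) -> (leb n K < +oo)%E.
Proof.
move=> mK KL; pose N := Num.bound `|L|.
have KN : K `<=` centered_cube N.
  move=> x Kx i; have h1 := le_lt_trans (coord_le_enorm x i) (KL _ Kx).
  have h2 : L < 2 ^+ N.
    rewrite (le_lt_trans (ler_norm _))// (lt_le_trans (archi_boundP (normr_ge0 _)))//.
    by rewrite -natrX ler_nat ltnW// ltn_expl.
  have := lt_trans h1 h2; rewrite /= in_itv/= ltr_norml => /andP[/ltW -> ->//].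
apply: (@le_lt_trans _ _ (leb n (@centered_cube R n N))).
  by apply: le_measure => //; rewrite inE//; exact: measurable_centered_cube.
by rewrite leb_centered_cube ltry.
Qed.

(* c_n / pi = (2 pi)^(-(n+2)/2) 2^(n/2) Gamma((n+2)/2): the last two factors
   come from the radial integral in polar coordinates. *)
Lemma igm_constE {R : realType} (n : nat) :
  @igm_const R n.+1 * pi^-1 =
  (2 * pi) `^ (- (n.+2%:R / 2)) * (2 `^ (n%:R / 2) * Gamma (n.+2%:R / 2)).
Proof.
have p0 := @pi_gt0 R.
rewrite /igm_const /= powRN powRM ?ltW//.
have -> : n.+2%:R / 2 = n%:R / 2 + 1 :> R by rewrite -addn2 natrD mulrDl divff.
rewrite !powRD; [|by rewrite gt_eqF ?implybT..].
rewrite !powRr1 ?ltW//.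
have a0 : 2 `^ (n%:R / 2) != 0 :> R by rewrite gt_eqF// powR_gt0.
have b0 : pi `^ (n%:R / 2) != 0 :> R by rewrite gt_eqF// powR_gt0.
have c0 : pi != 0 :> R by rewrite gt_eqF.
move: (2 `^ (n%:R / 2)) (pi `^ (n%:R / 2)) (Gamma _) a0 b0 => a b G a0 b0.
by move: pi {p0} c0 => p c0; field; rewrite ?a0 ?b0 ?c0.
Qed.

Section kac_rice.
Context {R : realType} {n : nat} {dO : measure_display} {Omega : measurableType dO}
  {P : probability Omega R} {X : 'rV[R]_(1 + n) -> {RV P >-> R}} {F : probability 'rV[R]_(1 + n) R}.
Hypotheses (hgauss : gaussian_field X) (hcent : centered_field X) (hF : spectral_measure X F)
  (hcont : continuous_paths X) (hstat : stationary_field X).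
Variables (u : R) (K : set 'rV[R]_(1 + n)).
Hypothesis hK : compact K.
Local Notation c := (@igm_const R n.+1).
Local Notation k := (pi^-1 * expR (- (u ^+ 2 / 2))).
Local Notation S := (@spectral_sphere R n F).
Local Notation EI := (\int[P]_w integral_geometric_measure (n := n) (level_set X u K w))%E.
Local Notation rho v := (@level_rate R (1 + n) F u v).

Let k_gt0 : 0 < k. Proof. by rewrite mulr_gt0 ?expR_gt0// invr_gt0 pi_gt0. Qed.

Let clK : closed K.
Proof. by apply: compact_closed => //; exact: norm_hausdorff. Qed.

Let mK : measurable K. Proof. exact: closed_measurable_rV. Qed.

Let lebK0 : (0 <= leb n.+1 K)%E. Proof. exact: measure_ge0. Qed.

Lemma leb_compact_fin : (leb n.+1 K < +oo)%E.
Proof. by have [L [_ KL]] := compact_enorm_bounded hK; exact: leb_bounded_fin mK KL. Qed.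

Let mrho : measurable_fun setT (fun v => rho v).
Proof. by apply: emeasurable_funM; [exact: measurable_sqrte_form|exact: measurable_cst]. Qed.

Let integral_rho : (\int[@sphere_measure R n]_(v in @sphere R n) (rho v * leb n.+1 K) =
  S * k%:E * leb n.+1 K)%E.
Proof.
rewrite integral_sphereZr//; last by move=> v; exact: level_rate_ge0.
rewrite /level_rate integral_sphereZr//; first exact: measurable_sqrte_form.
- by move=> v; exact: sqrte_ge0.
- by rewrite lee_fin ltW.
Qed.

Lemma mean_igm_ge : (c%:E * (S * k%:E * leb n.+1 K) <= EI)%E.
Proof.
have [L [L0 KL]] := compact_enorm_bounded hK.
rewrite (integral_igm hcont u L0 KL clK) -integral_rho.
rewrite lee_wpmul2l//; first by rewrite lee_fin ltW// igm_const_gt0.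
apply: le_integral_sphere.
- by apply: emeasurable_funM => //; exact: measurable_cst.
- exact: measurable_mean_chord_count.
- by move=> v; rewrite mule_ge0// level_rate_ge0.
- by move=> v; exact: mean_chord_count_ge0.
- by move=> v; exact: mean_chord_count_ge.
Qed.

Lemma mean_igm_fin : (forall v, (rho v < +oo)%E) -> EI = (c%:E * (S * k%:E * leb n.+1 K))%E.
Proof.
move=> rfin; have [L [L0 KL]] := compact_enorm_bounded hK.
rewrite (integral_igm hcont u L0 KL clK) -integral_rho; congr (_ * _)%E.
apply: eq_integral_on => v /set_mem /enorm_eq1 vv.
exact: mean_chord_count_fin.
Qed.

End kac_rice.

Theorem theorem1 (R : realType) (n : nat) (dO : measure_display)
    (Omega : measurableType dO) (P : probability Omega R)
    (X : 'rV[R]_n.+1 -> {RV P >-> R}) (F : probability 'rV[R]_n.+1 R)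
    (u : R) (K : set 'rV[R]_n.+1)
    (hgauss : gaussian_field X)
    (hcent : centered_field X)
    (hstat : stationary_field X)
    (hvar : unit_variance X)
    (hcont : continuous_paths X)
    (hF : spectral_measure X F)
    (hK : compact K) :
  ((0 < lebesgue_rV n.+1 K)%E ->
     ((\int[P]_w integral_geometric_measure (level_set X u K w) < +oo)%E <->
      finite_mx (spectral_moment2 F))) /\
  (finite_mx (spectral_moment2 F) ->
     (\int[P]_w integral_geometric_measure (level_set X u K w) < +oo)%E /\
     (\int[P]_w integral_geometric_measure (level_set X u K w) =
      lebesgue_rV n.+1 K * calF (spectral_moment2 F)
        * (expR (- (u ^+ 2 / 2)))%:E)%E).
Proof.
have mK : measurable K by apply: closed_measurable_rV; apply: compact_closed => //; exact: norm_hausdorff.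
rewrite (lebesgue_rVE mK).
pose S := @spectral_sphere R n F.
have S0 : (0 <= S)%E.
  have [m H] := @sphere_measure_is_measure R n.
  by rewrite /S /spectral_sphere H; apply: integral_ge0 => v _; exact: sqrte_ge0.
pose M : R := 2 `^ (n%:R / 2) * Gamma (n.+2%:R / 2).
have M0 : 0 < M by rewrite mulr_gt0 ?powR_gt0// Gamma_half_gt0.
pose k : R := pi^-1 * expR (- (u ^+ 2 / 2)).
have k0 : 0 < k by rewrite mulr_gt0 ?expR_gt0// invr_gt0 pi_gt0.
have polS := @spectral_sphere_polar R n F.
have finite_case : finite_mx (spectral_moment2 F) ->
    (\int[P]_w integral_geometric_measure (level_set X u K w) < +oo)%E /\
    (\int[P]_w integral_geometric_measure (level_set X u K w) =
      leb n.+1 K * calF (spectral_moment2 F) * (expR (- (u ^+ 2 / 2)))%:E)%E.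
  move=> finL; have fin := (finite_spectral_moment2 F).1 finL.
  have sfE z := spectral_form_quadratic fin z.
  have rfin v : (@level_rate R n.+1 F u v < +oo)%E by rewrite /level_rate sfE -EFinM ltry.
  have Sfin : S \is a fin_num.
    have := @gauss_spectral_form_fin R n F fin; rewrite polS -/S -/M.
    by rewrite ge0_fin_numE// => h; rewrite ltNge leye_eq; apply/eqP => Sy; move: h; rewrite Sy gt0_muley.
  have EI := mean_igm_fin hgauss hcent hF hcont hstat hK rfin.
  have Kfin : leb n.+1 K \is a fin_num by rewrite ge0_fin_numE// leb_compact_fin.
  split; first by rewrite EI -/S -(fineK Sfin) -(fineK Kfin) -!EFinM ltry.
  (* In polar coordinates the integral in [calF] is the spherical integral [S] times the radial
     factor [M]; [igm_constE] then matches the constants. *)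
  have -> : calF (spectral_moment2 F) = (((2 * pi) `^ (- (n.+2%:R / 2)) * M)%:E * S)%E.
    rewrite /calF finL integral_lebesgue_rV EFinM -muleA -polS; congr (_ * _)%E.
    by apply: eq_integral => z _; rewrite sfE /= -EFinM mulrC.
  rewrite EI -/S -(fineK Sfin) -(fineK Kfin) -igm_constE -!EFinM; congr EFin; ring.
split; last exact: finite_case.
move=> K0; split=> [EIfin|/finite_case[]//].
apply/finite_spectral_moment2 => i; rewrite ltey; apply/eqP => Di.
have Sy : S = +oo%E.
  have := @gauss_spectral_form_infinite R n F i Di; rewrite polS -/S -/M => MS.
  apply: contrapT => /eqP; rewrite -ltey => Slt.
  have Sfin : S \is a fin_num by rewrite ge0_fin_numE.
  by move: MS; rewrite -(fineK Sfin) -EFinM.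
have := mean_igm_ge hgauss hcent hF hcont hstat u hK; rewrite -/S Sy.
(* The positivity of the measure of [K] enters here: the product of [+oo] with 0 would be 0. *)
rewrite gt0_mulye ?lte_fin// gt0_mulye// gt0_muley ?lte_fin ?igm_const_gt0//.
by rewrite leye_eq => /eqP EIy; move: EIfin; rewrite EIy.
Qed.
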